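(* Let $i \in \mathbb{N}$ be fixed. Uniformly for real $x\ge y \ge 2$, $$ D_i(x,y) \asymp_i D_i^*(x,y) \asymp_i x \left(\frac{\log y }{\log x}\right)^{\lambda_{1/i}}, $$ where the exponent $\lambda_{1/i}$ is $\lambda_a$ with $a=1/i$ ($\lambda_a$ is defined in the context). The truncated numerical values of $\lambda_{1/i}$ for $i=1,\dots,20$ are: $1$ (exactly, $i=1$); $2.46206...$ ($i=2$); $4.20605...$ ($3$); $6.15900...$ ($4$); $8.27925...$ ($5$); $10.5395...$ ($6$); $12.9203...$ ($7$); $15.4074...$ ($8$); $17.9892...$ ($9$); $20.6568...$ ($10$); $23.4026...$ ($11$); $26.2206...$ ($12$); $29.1054...$ ($13$); $32.0524...$ ($14$); $35.0578...$ ($15$); $38.1180...$ ($16$); $41.2300...$ ($17$); $44.3909...$ ($18$); $47.5985...$ ($19$); $50.8504...$ ($20$). These estimates remain valid if only squarefree integers in $\mathcal{D}_{i,y}$ (resp. $\mathcal{D}^*_{i,y}$) are counted, provided $x\ge y \ge y_0(i)$, for some constant $y_0(i)$ depending only on $i$. As $i\to \infty$, we have $$\lambda_{1/i}= i \bigl(\log (i) -1 +o(1)\bigr).$$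
   Context: A finite increasing sequence of natural numbers is called $y$-dense if the ratios of consecutive terms are all $\le y$. Define $\mathcal{D}_{0,y}=\mathbb{N}=\{1,2,\ldots\}$. For $i\ge 1$, $n\in \mathcal{D}_{i,y}$ if and only if the increasing sequence $\{d: d|n,\ d\in \mathcal{D}_{i-1,y}\}$ is a $y$-dense sequence containing $1$ and $n$. Define $\mathcal{D}^*_{0,y}=\mathbb{N}$. For $i\ge 1$, $n\in \mathcal{D}^*_{i,y}$ if and only if for each $j$ with $0\le j \le i-1$, the increasing sequence $\{d: d|n,\ d\in \mathcal{D}^*_{j,y} \text{ and } n/d \in \mathcal{D}^*_{i-1-j,y} \}$ is a $y$-dense sequence containing $1$ and $n$. Counting functions: $D_i(x,y) = | [1,x] \cap \mathcal{D}_{i,y} |$ and $D^*_i(x,y) = | [1,x] \cap \mathcal{D}^*_{i,y} |$. Buchstab's function $\omega$: $\omega(u)=0$ for $u<1$, $\omega(u)=1/u$ for $1\le u\le 2$, $\omega$ is continuous on $[1,\infty)$ and $(u\,\omega(u))'=\omega(u-1)$ for $u>2$. $\gamma$ is Euler's constant. For $a>0$ let $$g_a(s)=s + \frac{e^{-\gamma}}{a (1+a)^s} +s \int_1^\infty \bigl( \omega(u) - e^{-\gamma}\bigr) \frac{du}{(1+au)^{s+1}},$$ an entire function of $s$. The number $-\lambda_a$ is defined to be the largest real zero of $g_a$. $f\asymp_i g$ means $c_1 g\le f\le c_2 g$ for positive constants $c_1,c_2$ depending only on $i$. *)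

(* Defs.v *)
From HB Require Import structures.
From mathcomp Require Import all_boot all_order all_algebra.
From mathcomp Require Import all_classical all_reals all_analysis.

Set Implicit Arguments.
Unset Strict Implicit.
Unset Printing Implicit Defensive.

Import Order.TTheory GRing.Theory Num.Theory.
Import numFieldNormedType.Exports.

Local Open Scope classical_set_scope.
Local Open Scope ring_scope.

Section DenseDivisors.
Variables (R : realType) (y : R).

(** The quotient is a genuine ratio only between positive terms; below, all
    sequences consist of divisors of a positive integer. *)
Definition ydense (s : seq nat) : bool :=
  sorted [rel a b | (a < b)%N && (b%:R / a%:R <= y)] s.

(** [divisors n] is increasing, hence so are its filtered subsequences; for
    [n = 0] it is empty, so that [0] satisfies none of the predicates below. *)
Definition dense_from_1_to (n : nat) (s : seq nat) : bool :=
  [&& 1%N \in s, n \in s & ydense s].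

Fixpoint Dset (i : nat) : pred nat :=
  if i is j.+1 then
    fun n => dense_from_1_to n [seq d <- divisors n | Dset j d]
  else fun n => (0 < n)%N.

Definition Dstar_step (i : nat) (prev : nat -> pred nat) : pred nat := fun n =>
  if i is k.+1 then
    [forall j : 'I_k.+1,
      dense_from_1_to n
        [seq d <- divisors n | prev j d && prev (k - j)%N (n %/ d)%N]]
  else (0 < n)%N.

(** The definition of the i-th starred set refers to all smaller indices:
    [Dstar_upto k j] is the j-th set for [j < k] (and junk for [j >= k]).
    The intended recursion is [Dstar0], [DstarS] below. *)
Fixpoint Dstar_upto (k : nat) : nat -> pred nat :=
  if k is k'.+1 then
    fun j => if j == k' then Dstar_step k' (Dstar_upto k') else Dstar_upto k' j
  else fun _ => pred0.

Definition Dstar (i : nat) : pred nat := Dstar_upto i.+1 i.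

Lemma Dstar_unfold i : Dstar i = Dstar_step i (Dstar_upto i).
Proof. by rewrite /Dstar /= eqxx. Qed.

Lemma Dstar_uptoE k j : (j < k)%N -> Dstar_upto k j = Dstar j.
Proof.
elim: k => [//|k IHk]; rewrite ltnS leq_eqVlt => /orP[/eqP->//|jk].
by rewrite /= (ltn_eqF jk) IHk.
Qed.

Lemma Dstar0 n : Dstar 0 n = (0 < n)%N.
Proof. by []. Qed.

Lemma DstarS i n : Dstar i.+1 n =
  [forall j : 'I_i.+1,
    dense_from_1_to n
      [seq d <- divisors n | Dstar j d && Dstar (i - j)%N (n %/ d)%N]].
Proof.
rewrite Dstar_unfold; apply: eq_forallb => j.
congr dense_from_1_to; apply: eq_filter => d.
by rewrite !Dstar_uptoE // ltnS leq_subr.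
Qed.

End DenseDivisors.

Definition squarefree (n : nat) : bool :=
  (0 < n)%N && all (fun p => ~~ (p ^ 2 %| n)%N) (primes n).

Section Exponent.
Variable R : realType.
Implicit Types (a s u x : R) (w : R -> R).

Definition count_upto (A : pred nat) x : R :=
  (count A (iota 1 (Num.truncn x)))%:R.

Definition euler_gamma : R :=
  lim ((fun n : nat => \sum_(1 <= k < n.+1) k%:R^-1 - ln n%:R : R) @ \oo).

Definition is_buchstab w : Prop :=
  [/\ forall u, u < 1 -> w u = 0,
      forall u, 1 <= u <= 2 -> w u = u^-1,
      {within `[1, +oo[, continuous w}
    & forall u, 2 < u -> is_derive u 1 (fun v => v * w v) (w (u - 1))].

(** The conditions determine [w] uniquely; [fun=> 0] is an irrelevant default. *)
Definition buchstab : R -> R := xget (fun=> 0) [set w | is_buchstab w].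

(** Only the real zeros of this entire function are needed, so it is restricted
    to the real line. *)
Definition gfun a s : R :=
  s + expR (- euler_gamma) / (a * (1 + a) `^ s)
    + s * \int[@lebesgue_measure R]_(u in `[1, +oo[)
            ((buchstab u - expR (- euler_gamma)) / (1 + a * u) `^ (s + 1)).

Definition is_largest_zero (f : R -> R) s : Prop :=
  f s = 0 /\ forall t, f t = 0 -> t <= s.

Definition lambda a : R := - xget 0 [set s | is_largest_zero (gfun a) s].

(** [f x y] and [g x y] have the same order of magnitude, uniformly for
    [x >= y >= y0]. *)
Definition asymp_from (y0 : R) (f g : R -> R -> R) : Prop :=
  exists c1 c2 : R, [/\ 0 < c1, 0 < c2 &
    forall x y, y0 <= y -> y <= x -> c1 * g x y <= f x y <= c2 * g x y].

Definition decimal (m : nat) (ds : seq nat) : R :=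
  m%:R + \sum_(k < size ds) (nth 0%N ds k)%:R / 10 ^+ k.+1.

Definition truncates_to (l : R) (m : nat) (ds : seq nat) : Prop :=
  decimal m ds <= l < decimal m ds + 10 ^- size ds.

End Exponent.

(** Triples (i, integer part, leading decimals) of the exponent at [1 / i]. *)
Definition lambda_table : seq (nat * nat * seq nat) :=
  [:: ( 2,  2, [:: 4; 6; 2; 0; 6]);
      ( 3,  4, [:: 2; 0; 6; 0; 5]);
      ( 4,  6, [:: 1; 5; 9; 0; 0]);
      ( 5,  8, [:: 2; 7; 9; 2; 5]);
      ( 6, 10, [:: 5; 3; 9; 5]);
      ( 7, 12, [:: 9; 2; 0; 3]);
      ( 8, 15, [:: 4; 0; 7; 4]);
      ( 9, 17, [:: 9; 8; 9; 2]);
      (10, 20, [:: 6; 5; 6; 8]);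
      (11, 23, [:: 4; 0; 2; 6]);
      (12, 26, [:: 2; 2; 0; 6]);
      (13, 29, [:: 1; 0; 5; 4]);
      (14, 32, [:: 0; 5; 2; 4]);
      (15, 35, [:: 0; 5; 7; 8]);
      (16, 38, [:: 1; 1; 8; 0]);
      (17, 41, [:: 2; 3; 0; 0]);
      (18, 44, [:: 3; 9; 0; 9]);
      (19, 47, [:: 5; 9; 8; 5]);
      (20, 50, [:: 8; 5; 0; 4])]%N.

(* Main.v *)
(* For real mu and v > 0 put G mu v := v ^ (mu - 1) * g_(1/v)(- mu), where g is the
   entire function defining the exponent. Buchstab's equation gives
   d/dv G mu = mu G (mu - 1) and the delay equation
   v d/dv G mu v = G mu (v + 1) + (mu - 1) G mu v, for which a maximum principle
   holds on [a, oo). Hence lambda_(1/a) is the threshold below which G mu is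
   positive on [a, oo); explicit sub- and supersolutions bound it from both sides,
   which yields its asymptotics and, evaluated in integer arithmetic, its decimals.

   Put a = i. The prime factors p of n in D_i satisfy
   p ^ i <= y ^ i * (product of the prime factors of n below p), up to the square
   part of n, while adjoining a prime p with (p y) ^ i <= n to n in D*_i stays in
   D*_i. So both counts compare with a tree in which a number b, with
   l = ln b, is multiplied by increasing primes p such that a ln p <= l. With L the
   sum of ln q / q over the primes q < p, which is ln p + O(1) by Mertens, the
   delay equation says that L ^ (lambda - 1) G lambda (l / L) is almost invariant
   along this tree; adding terms of smaller order turns it into a weight that is
   super- or subinvariant. The number of n <= x is thus governed by the value of
   the weight at the root divided by (ln x) ^ lambda. *)

(* Complex zeros of g never enter: lambda is a threshold for signs, and signs are compared by one
   maximum principle. On the arithmetic side the obstacle is the boundary l = a L, where [G lambda]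
   vanishes: Mertens' estimate fixes L only up to O(1), so the sign of the main term is unknown
   nearby. The weight therefore has a second term, smaller by L ^ (-1/2), built on [G mu] with mu =
   lambda - 1/4. It is positive at the boundary, beats the O(1/L) uncertainty there, and its own
   drift has a definite sign; a factor 1 + K/L supplies such a drift elsewhere. Changing the sign of
   both corrections exchanges super- and subinvariance. For the upper bound, numbers stopped inside
   the boundary zone are confined to a short logarithmic window and summed separately. For the lower
   bound, the weight is nonpositive near the boundary, and beyond it inserting 2 i + 1 primes
   directly yields a count vanishing to the same order. For the decimals, [G] is up to a factor a
   Mellin transform; cutting its integral at a finite T changes the delay equation by a boundary
   term of known sign, so that truncations are the explicit sub- and supersolutions. *)
From Stdlib Require Import ZArith.
From HB Require Import structures.
Require Import Defs.
From mathcomp Require Import all_boot all_order all_algebra.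
From mathcomp Require Import all_classical all_reals all_analysis.
From mathcomp Require Import measurable_realfun.
From mathcomp Require Import ring lra zify ssrZ.

Set Implicit Arguments.
Unset Strict Implicit.
Unset Printing Implicit Defensive.

Import Order.TTheory GRing.Theory Num.Theory.
Import numFieldNormedType.Exports.

Local Open Scope classical_set_scope.
Local Open Scope ring_scope.

(* [lra] is slow on large contexts, so first hide the inequalities that mention a
   variable foreign to the goal. *)
Definition hidden (P : Prop) : Prop := P.

Ltac foreign G T := match goal with v : _ |- _ => match T with context [v] =>
  lazymatch G with context [v] => fail | _ => idtac end end end.

Ltac nlra := first [solve [match goal with |- ?G =>
  repeat match goal with H : is_true ?T |- _ => foreign G T; change (hidden T) in H end end; lra] | lra].

(** * One-variable calculus: derivative rules, mean values, monotonicity *)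

Section Calculus.
Variable R : realType.
Implicit Types (f g Q : R -> R) (x a b d : R).

Lemma is_deriveD' f g x a b : is_derive x 1 f a -> is_derive x 1 g b ->
  is_derive x 1 (fun t => f t + g t) (a + b).
Proof. by move=> fa gb; exact: is_deriveD. Qed.

Lemma is_deriveB' f g x a b : is_derive x 1 f a -> is_derive x 1 g b ->
  is_derive x 1 (fun t => f t - g t) (a - b).
Proof. by move=> fa gb; exact: is_deriveB. Qed.

Lemma is_deriveZ' k f x a : is_derive x 1 f a ->
  is_derive x 1 (fun t => k * f t) (k * a).
Proof. by move=> fa; exact: is_deriveZ. Qed.

Lemma is_deriveM' f g x a b : is_derive x 1 f a -> is_derive x 1 g b ->
  is_derive x 1 (fun t => f t * g t) (a * g x + f x * b).
Proof.
move=> fa gb; apply: (@is_derive_eq _ _ _ _ _ _ _ _ (is_deriveM fa gb)).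
by rewrite /GRing.scale /=; ring.
Qed.

Lemma is_derive_comp' f g x a b : is_derive (g x) 1 f a -> is_derive x 1 g b ->
  is_derive x 1 (fun t => f (g t)) (a * b).
Proof. by move=> fa gb; exact: (@is_derive1_comp _ f g x a b fa gb). Qed.

Lemma is_derive_affine (k c x : R) : is_derive x 1 (fun t => k * t + c) k.
Proof.
rewrite -[X in is_derive _ _ _ X]addr0 -[X in X + 0]mulr1.
exact: (is_deriveD' (is_deriveZ' k (is_derive_id x 1)) (is_derive_cst c x 1)).
Qed.

Lemma is_derive_shift' f c x a : is_derive (x + c) 1 f a ->
  is_derive x 1 (fun t => f (t + c)) a.
Proof.
move=> fa; rewrite -[a]mulr1; apply: is_derive_comp' => //.
by rewrite -[X in is_derive _ _ _ X]addr0; exact: (is_deriveD' (is_derive_id x 1) (is_derive_cst c x 1)).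
Qed.

Lemma is_derive_powR m c x : 0 < x + c ->
  is_derive x 1 (fun t => (t + c) `^ m) (m * (x + c) `^ (m - 1)).
Proof. by move=> xc; exact: (is_derive_shift' (is_derive1_powR m xc)). Qed.

Lemma is_derive_invr x : x != 0 -> is_derive x 1 (fun t => t^-1) (- (x ^- 2)).
Proof.
move=> x0; have := @is_deriveV _ id x 1 1 x0 (is_derive_id _ _).
by move=> H; apply: is_derive_eq H _; rewrite /GRing.scale /= mulr1.
Qed.

Lemma is_deriveX' f x a m : is_derive x 1 f a ->
  is_derive x 1 (fun t => f t ^+ m.+1) (m.+1%:R * f x ^+ m * a).
Proof.
move=> fa; elim: m => [|m IH].
  have -> : (fun t => f t ^+ 1) = f by apply/funext => t; rewrite expr1.
  by rewrite expr0 mulr1 mul1r.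
have -> : (fun t => f t ^+ m.+2) = (fun t => f t * f t ^+ m.+1).
  by apply/funext => t; rewrite exprS.
apply: (@is_derive_eq _ _ _ _ _ _ _ _ (is_deriveM' fa IH)).
by rewrite exprS -[m.+2%:R]natr1; ring.
Qed.

Lemma is_derive_continuous f x a : is_derive x 1 f a -> {for x, continuous f}.
Proof.
by case=> df _; apply: differentiable_continuous; apply/derivable1_diffP.
Qed.

Lemma is_derive_within f df a b :
  (forall x, a <= x <= b -> is_derive x 1 f (df x)) ->
  {within `[a, b], continuous f}.
Proof.
move=> H; apply: continuous_in_subspaceT => x; rewrite inE/= in_itv/= => /H.
exact: is_derive_continuous.
Qed.

Lemma mean_value f df a b : a < b ->
  (forall x, a < x < b -> is_derive x 1 f (df x)) ->
  {within `[a, b], continuous f} ->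
  exists2 c, a < c < b & f b - f a = df c * (b - a).
Proof.
move=> ab H cf; have H' x : x \in `]a, b[%R -> is_derive x 1 f (df x) by rewrite in_itv/=; exact: H.
by have [c] := MVT ab H' cf; rewrite in_itv/=; exists c.
Qed.

Lemma mean_value_cc f df a b : a < b ->
  (forall x, a <= x <= b -> is_derive x 1 f (df x)) ->
  exists2 c, a < c < b & f b - f a = df c * (b - a).
Proof.
move=> ab H; apply: mean_value (is_derive_within H) => // x /andP[ax xb].
by apply: H; rewrite !ltW.
Qed.

Lemma derive_ge0_le f df a b : a <= b ->
  (forall x, a < x < b -> is_derive x 1 f (df x)) ->
  (forall x, a < x < b -> 0 <= df x) ->
  {within `[a, b], continuous f} -> f a <= f b.
Proof.
rewrite le_eqVlt => /predU1P[-> //|ab] H d0 cf.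
have [c cab E] := mean_value ab H cf.
by rewrite -subr_ge0 E mulr_ge0 ?d0// subr_ge0 ltW.
Qed.

Lemma derive_ge0_le_cc f df a b : a <= b ->
  (forall x, a <= x <= b -> is_derive x 1 f (df x)) ->
  (forall x, a < x < b -> 0 <= df x) -> f a <= f b.
Proof.
move=> ab H d0; apply: (derive_ge0_le ab _ d0 (is_derive_within H)).
by move=> x /andP[ax xb]; apply: H; rewrite !ltW.
Qed.

Lemma derive_gt0_lt_cc f df a b : a < b ->
  (forall x, a <= x <= b -> is_derive x 1 f (df x)) ->
  (forall x, a < x < b -> 0 < df x) -> f a < f b.
Proof.
move=> ab H d0; have [c cab E] := mean_value_cc ab H.
by rewrite -subr_gt0 E mulr_gt0 ?d0// subr_gt0.
Qed.

(** A quadratic remainder is the form in which differentiation under an integral or a series sign is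
    proved below: such a bound can itself be integrated or summed. *)
Lemma is_derive_quad f x d (M r : R) : 0 < r -> 0 <= M ->
  (forall h, `|h| < r -> `|f (x + h) - f x - d * h| <= M * h ^+ 2) ->
  is_derive x 1 f d.
Proof.
move=> r0 M0 H.
have K : h^-1 *: (f (h *: 1 + x) - f x) @[h --> 0^'] --> d.
  apply/cvgrPdist_le => /= e e0; near=> h.
  have h0 : h != 0 by near: h; exact: nbhs_dnbhs_neq.
  have hr : `|h| < r by near: h; apply: dnbhs0_lt.
  have hM : `|h| < e / (M + 1) by near: h; apply: dnbhs0_lt; rewrite divr_gt0// ltr_wpDl.
  rewrite /GRing.scale /= mulr1 (addrC h x).
  have -> : d - h^-1 * (f (x + h) - f x) = - (f (x + h) - f x - d * h) / h.
    by rewrite !mulNr !mulrBl mulfK// mulrC; ring.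
  rewrite normrM normrN normfV ler_pdivrMr ?normr_gt0//.
  apply: le_trans (H _ hr) _; rewrite -(real_normK (num_real h)) expr2 mulrA ler_pM2r ?normr_gt0//.
  move: hM; rewrite ltr_pdivlMr ?ltr_wpDl// mulrDr mulr1 mulrC => /ltW; apply: le_trans.
  by rewrite lerDl normr_ge0.
by split; [apply/cvg_ex; exists d | exact: cvg_lim K].
Unshelve. all: by end_near. Qed.

Lemma is_derive_uniq f x a b : is_derive x 1 f a -> is_derive x 1 f b -> a = b.
Proof. by move=> [_ <-] [_ <-]. Qed.

Lemma is_derive_near f g x a (r : R) : 0 < r ->
  (forall t, `|t - x| < r -> f t = g t) -> is_derive x 1 f a -> is_derive x 1 g a.
Proof.
move=> r0 fg; have H : {near x, f =1 g}.
  by exists r => //= t; rewrite /ball_/= distrC => /fg.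
by move=> fa; apply: near_eq_is_derive H _.
Qed.

End Calculus.

(** * Integrals over [1, oo) of continuous functions that decay like u^-2 *)

Section Improper.
Variable R : realType.
Implicit Types (f g Q : R -> R) (C l u a b : R).

Definition cont1 f := {within `[1, +oo[, continuous f}.

Definition J f : R := \int[@lebesgue_measure R]_(u in `[1, +oo[) f u.

Definition primitive1 f Q :=
  [/\ forall u, 1 < u -> is_derive u 1 Q (f u), cont1 Q
    & Q x @[x --> +oo] --> (0 : R)].

(** A class closed under linear combinations, in which integrals are bounded by C and tails by C /
    u, the explicit integral of the majorant. *)
Definition decay2 C f := forall u, 1 <= u -> `|f u| <= C * u ^- 2.

Lemma cont1T f : continuous f -> cont1 f.
Proof. exact: continuous_subspaceT. Qed.

Lemma cont1_pos f : (forall u, 0 < u -> {for u, continuous f}) -> cont1 f.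
Proof.
move=> H; apply: continuous_in_subspaceT => u; rewrite inE/= in_itv/= andbT => u1.
by apply: H; exact: lt_le_trans u1.
Qed.

Lemma cont1D f g : cont1 f -> cont1 g -> cont1 (fun u => f u + g u).
Proof. by move=> cf cg u; apply: cvgD; [exact: cf|exact: cg]. Qed.

Lemma cont1M f g : cont1 f -> cont1 g -> cont1 (fun u => f u * g u).
Proof. by move=> cf cg u; apply: cvgM; [exact: cf|exact: cg]. Qed.

Lemma cont1_derive f df : (forall u, 0 < u -> is_derive u 1 f (df u)) -> cont1 f.
Proof.
by move=> H; apply: cont1_pos => u u0; exact: is_derive_continuous (H u u0).
Qed.

Lemma cont1_within f a b : 1 <= a -> cont1 f -> {within `[a, b], continuous f}.
Proof.
move=> a1; apply: continuous_subspaceW => x /=; rewrite !in_itv/= andbT.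
by move=> /andP[ax _]; exact: le_trans ax.
Qed.

Lemma cont1_at f u : cont1 f -> 1 < u -> {for u, continuous f}.
Proof.
move=> /continuous_within_itvcyP[cf _] u1.
by apply: cf; rewrite in_itv/= u1.
Qed.

Lemma is_derive_Ninv C u : u != 0 -> is_derive u 1 (fun t => - C * t^-1) (C * u ^- 2).
Proof.
move=> u0; rewrite (_ : C * _ = - C * - (u ^- 2)); last by ring.
by apply: is_deriveZ'; exact: is_derive_invr.
Qed.

Let mu := @lebesgue_measure R.

Lemma cvg_inv_pinfty : x^-1 @[x --> +oo] --> (0 : R).
Proof.
apply/cvgrPdist_lt => e e0; near=> x.
have x0 : e^-1 < x by near: x; apply: nbhs_pinfty_gt; rewrite num_real.
have xp : 0 < x by apply: lt_trans x0; rewrite invr_gt0.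
by rewrite sub0r normrN gtr0_norm ?invr_gt0// -[e]invrK ltf_pV2 ?posrE ?invr_gt0.
Unshelve. all: by end_near. Qed.

Lemma inv2_cont1 C : cont1 (fun u : R => C * u ^- 2).
Proof.
apply: cont1_pos => u u0; apply: cvgM; first exact: cvg_cst.
apply: cvgV; first by rewrite expf_neq0// gt_eqF.
exact: exprn_continuous.
Qed.

Lemma FTC_nonneg f Q l : (forall u, 1 <= u -> 0 <= f u) -> cont1 f ->
  (forall u, 1 < u -> is_derive u 1 Q (f u)) -> cont1 Q ->
  Q x @[x --> +oo] --> l ->
  mu.-integrable `[1, +oo[ (EFin \o f) /\ J f = l - Q 1.
Proof.
move=> f0 cf dQ cQ lQ.
have drv u : 1 < u -> derivable Q u 1 by move=> /dQ [].
have d1 : {in `]1, +oo[, (derive1 Q : R -> R) =1 f}.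
  by move=> u; rewrite in_itv/= andbT => /dQ [_]; rewrite derive1E.
have [_ rQ] := (continuous_within_itvcyP _ _).1 cQ.
have E := ge0_continuous_FTC2y f0 cf lQ drv rQ d1.
split; last by rewrite /J /Rintegral E.
apply/integrableP; split.
  by apply/measurable_EFinP; apply: subspace_continuous_measurable_fun.
have -> : (\int[mu]_(x in `[1%R, +oo[) `|(EFin \o f) x| =
           \int[mu]_(x in `[1%R, +oo[) (f x)%:E)%E.
  apply: eq_integral => u; rewrite inE/= in_itv/= andbT => u1.
  by rewrite ger0_norm// f0.
by rewrite E ltry.
Qed.

Lemma decay2_shift C f : decay2 C f ->
  forall u, 1 <= u -> 0 <= f u + C * u ^- 2.
Proof. by move=> d u /d; rewrite ler_norml => /andP[+ _]; rewrite -subr_ge0 opprK. Qed.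

(** Adding [C * u ^- 2] makes the integrand nonnegative, so [FTC_nonneg] applies to it; the same
    theorem for [C * u ^- 2] alone is then subtracted. *)
Lemma J_primitive_lim f Q l C : cont1 f -> decay2 C f ->
  (forall u, 1 < u -> is_derive u 1 Q (f u)) -> cont1 Q ->
  Q x @[x --> +oo] --> l -> J f = l - Q 1.
Proof.
move=> cf df dQ cQ lQ.
have C0 : 0 <= C by have := df 1 (lexx _); rewrite expr1n invr1 mulr1; exact: le_trans.
have cN : cont1 (fun t => - C * t^-1).
  apply: (@cont1_derive _ (fun u => C * u ^- 2)) => u u0.
  exact: (is_derive_Ninv C (lt0r_neq0 u0)).
have lN : - C * x^-1 @[x --> +oo] --> (0 : R).
  rewrite -[X in _ --> X](mulr0 (- C)); apply: cvgM; first exact: cvg_cst.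
  exact: cvg_inv_pinfty.
have dN u : 1 < u -> is_derive u 1 (fun t => - C * t^-1) (C * u ^- 2).
  by move=> u1; apply: is_derive_Ninv; rewrite gt_eqF// (lt_trans _ u1).
have p2 u : 1 <= u -> 0 <= C * u ^- 2.
  by move=> u1; rewrite mulr_ge0// invr_ge0 exprn_ge0// (le_trans ler01).
have [i2 J2] := FTC_nonneg p2 (inv2_cont1 (C := C)) dN cN lN.
have [i1 J1] := FTC_nonneg (@decay2_shift C f df) (cont1D cf (inv2_cont1 (C := C)))
  (fun u h => is_deriveD' (dQ u h) (dN u h)) (cont1D cQ cN) (cvgD lQ lN).
have -> : J f = J (fun u => f u + C * u ^- 2) - J (fun u => C * u ^- 2).
  by rewrite /J -RintegralB//; apply: eq_Rintegral => u _; rewrite addrK.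
by rewrite J1 J2; ring.
Qed.

Lemma J_primitive f Q C : cont1 f -> decay2 C f -> primitive1 f Q -> J f = - Q 1.
Proof. by move=> cf df [dQ cQ lQ]; rewrite (J_primitive_lim cf df dQ cQ lQ) sub0r. Qed.

Lemma primitive_exists f : cont1 f ->
  exists Q, [/\ Q 1 = 0, forall u, 1 < u -> is_derive u 1 Q (f u) & cont1 Q].
Proof.
move=> cf; pose Q x : R := \int[mu]_(t in `[1, x]) f t.
have I b : mu.-integrable `[1, b] (EFin \o f).
  apply: continuous_compact_integrable; first exact: segment_compact.
  exact: cont1_within cf.
have dQ u : 1 < u -> is_derive u 1 Q (f u).
  move=> u1; have [||d1 d2] := @continuous_FTC1_closed _ f 1 u (u + 1) _ (I _) u1.
  - by rewrite ltrDl.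
  - exact: cont1_at.
  by split; [exact: d1 | rewrite -derive1E; exact: d2].
exists Q; split=> //; first by rewrite /Q set_itv1 Rintegral_set1.
apply/continuous_within_itvcyP; split.
  move=> u; rewrite in_itv/= andbT => u1; exact: is_derive_continuous (dQ u u1).
have ab : (1 : R) < 2 by rewrite ltr1n.
have := parameterized_integral_continuous (ltW ab) (I 2).
by move=> /(continuous_within_itvP _ ab)[_ + _].
Qed.

Lemma cvg_Ninv C : - C * x^-1 @[x --> +oo] --> (0 : R).
Proof.
rewrite -[X in _ --> X](mulr0 (- C)); apply: cvgM; first exact: cvg_cst.
exact: cvg_inv_pinfty.
Qed.

Lemma cont1Z C f : cont1 f -> cont1 (fun u => C * f u).
Proof. by move=> cf u; apply: cvgM; [exact: cvg_cst|exact: cf]. Qed.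

Lemma decay2_ge0 C f : decay2 C f -> 0 <= C.
Proof.
by move=> df; have := df 1 (lexx _); rewrite expr1n invr1 mulr1; exact: le_trans.
Qed.

Lemma decay2D C C' f g : decay2 C f -> decay2 C' g -> decay2 (C + C') (fun u => f u + g u).
Proof.
move=> df dg u u1; rewrite mulrDl.
by apply: le_trans (ler_normD _ _) _; apply: lerD; [exact: df|exact: dg].
Qed.

Lemma decay2Z k C f : decay2 C f -> decay2 (`|k| * C) (fun u => k * f u).
Proof. by move=> df u u1; rewrite normrM -mulrA ler_wpM2l// df. Qed.

Lemma derive_le_decay2 f F C a b : 0 < a -> a <= b ->
  (forall u, a < u < b -> is_derive u 1 F (f u)) ->
  (forall u, a < u < b -> `|f u| <= C * u ^- 2) -> {within `[a, b], continuous F} ->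
  `|F b - F a| <= C * a^-1 - C * b^-1.
Proof.
move=> a0 ab dF df cF.
have gt0 u : a < u < b -> u != 0 by case/andP => au _; rewrite gt_eqF// (lt_trans a0).
have cN : {within `[a, b], continuous (fun u => - C * u^-1)}.
  apply: (@is_derive_within _ _ (fun u => C * u ^- 2)) => u /andP[h _].
  by apply: is_derive_Ninv; rewrite gt_eqF// (lt_le_trans a0).
have M1 : F a + - C * a^-1 <= F b + - C * b^-1.
  apply: (@derive_ge0_le _ (fun t => F t + - C * t^-1) (fun u => f u + C * u ^- 2)); first exact: ab.
  - by move=> u h; exact: (is_deriveD' (dF u h) (is_derive_Ninv C (gt0 u h))).
  - by move=> u /df; rewrite ler_norml => /andP[+ _]; rewrite -subr_ge0 opprK.
  - by move=> u; apply: cvgD; [exact: cF|exact: cN].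
have M2 : - C * a^-1 - F a <= - C * b^-1 - F b.
  apply: (@derive_ge0_le _ (fun t => - C * t^-1 - F t) (fun u => C * u ^- 2 - f u)); first exact: ab.
  - by move=> u h; exact: (is_deriveB' (is_derive_Ninv C (gt0 u h)) (dF u h)).
  - by move=> u /df; rewrite ler_norml subr_ge0 => /andP[].
  - by move=> u; apply: cvgB; [exact: cN|exact: cF].
rewrite ler_norml; apply/andP; split; nlra.
Qed.

Lemma primitive_bound f F C : decay2 C f ->
  (forall u, 1 < u -> is_derive u 1 F (f u)) -> cont1 F ->
  forall a b, 1 <= a -> a <= b -> `|F b - F a| <= C * a^-1 - C * b^-1.
Proof.
move=> df dF cF a b a1 ab; apply: (derive_le_decay2 (f := f)) => //.
- by apply: lt_le_trans a1.
- by move=> u /andP[au _]; apply: dF; exact: le_lt_trans au.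
- by move=> u /andP[au _]; apply: df; apply: le_trans a1 (ltW au).
- exact: cont1_within.
Qed.

(** The bound makes F u - C / u nondecreasing and at most F 1 + C, so the limit comes from monotone
    convergence. Freezing the argument at 1 by [Num.max] makes [g] monotone on the whole line. *)
Lemma cvg_of_bound F C : 0 <= C ->
  (forall a b, 1 <= a -> a <= b -> `|F b - F a| <= C * a^-1 - C * b^-1) ->
  exists2 l : R, F x @[x --> +oo] --> l & forall u, 1 <= u -> `|F u - l| <= C * u^-1.
Proof.
move=> C0 bF.
pose g x := F (Num.max x 1) - C * (Num.max x 1)^-1.
have m1 x : (1 : R) <= Num.max x 1 by rewrite le_max lexx orbT.
have mg : nondecreasing_fun g.
  move=> x y xy; have mxy : Num.max x 1 <= Num.max y 1.
    by rewrite ge_max !le_max xy lexx orbT.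
  by have := bF _ _ (m1 x) mxy; rewrite ler_norml => /andP[+ _]; rewrite /g; nlra.
have ub : has_ubound (range g).
  exists (F 1 + C) => _ [x _ <-]; have := bF _ _ (lexx 1) (m1 x).
  rewrite invr1 mulr1 ler_norml => /andP[_ +]; rewrite /g.
  have : 0 <= C * (Num.max x 1)^-1 by rewrite mulr_ge0// invr_ge0 (le_trans ler01).
  by nlra.
have lF : F x @[x --> +oo] --> sup (range g).
  have L : (g x - (- C * x^-1)) @[x --> +oo] --> sup (range g).
    rewrite -[X in _ --> X]subr0; apply: cvgB; last exact: cvg_Ninv.
    exact: nondecreasing_cvgr.
  apply: cvg_trans L; apply: near_eq_cvg; near=> x.
  have x1 : 1 <= x by near: x; apply: nbhs_pinfty_ge; rewrite num_real.
  by rewrite /g max_l//; ring.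
exists (sup (range g)) => // u u1; rewrite distrC.
have : `|F x - F u| @[x --> +oo] --> `|sup (range g) - F u|.
  by apply: cvg_norm; apply: cvgB lF _; exact: cvg_cst.
move=> L; apply: (cvgr_to_le L); near=> x.
have ux : u <= x by near: x; apply: nbhs_pinfty_ge; rewrite num_real.
apply: le_trans (bF _ _ u1 ux) _; rewrite lerBlDr lerDl mulr_ge0// invr_ge0.
by rewrite (le_trans _ ux)// (le_trans ler01).
Unshelve. all: by end_near. Qed.

(** From here on [J f] is handled through the primitive vanishing at infinity, so that linearity,
    bounds and integration by parts become statements about derivatives. *)
Lemma primitive_lim f C : cont1 f -> decay2 C f ->
  exists2 Q, primitive1 f Q & J f = - Q 1.
Proof.
move=> cf df; have [F [_ dF cF]] := primitive_exists cf.
have [l lF _] := cvg_of_bound (decay2_ge0 df) (primitive_bound df dF cF).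
have P : primitive1 f (fun u => F u - l).
  split=> [u h||].
  - rewrite -[f u]subr0; exact: (is_deriveB' (dF u h) (is_derive_cst _ u 1)).
  - by apply: cont1D cF _; apply: cont1T => u; exact: cvg_cst.
  - by rewrite -[X in _ --> X](subrr l); apply: cvgB lF _; exact: cvg_cst.
exists (fun u => F u - l) => //; exact: (J_primitive cf df P).
Qed.

Lemma primitive_le f Q C : decay2 C f -> primitive1 f Q ->
  forall u, 1 <= u -> `|Q u| <= C * u^-1.
Proof.
move=> df [dQ cQ lQ] u u1.
have [l lQ' H] := cvg_of_bound (decay2_ge0 df) (primitive_bound df dQ cQ).
by have := H _ u1; rewrite (cvg_unique _ lQ' lQ) ?subr0.
Qed.

Lemma J_le f C : cont1 f -> decay2 C f -> `|J f| <= C.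
Proof.
move=> cf df; have [Q PQ ->] := primitive_lim cf df.
by have := primitive_le df PQ (lexx 1); rewrite normrN invr1 mulr1.
Qed.

Lemma J_lin f g k C C' : cont1 f -> cont1 g -> decay2 C f -> decay2 C' g ->
  J (fun u => f u + k * g u) = J f + k * J g.
Proof.
move=> cf cg df dg.
have [Q PQ ->] := primitive_lim cf df; have [Q' PQ' ->] := primitive_lim cg dg.
have := J_primitive (cont1D cf (cont1Z (C := k) cg)) (decay2D df (decay2Z k dg)).
case: PQ PQ' => [dQ cQ lQ] [dQ' cQ' lQ'] /(_ (fun u => Q u + k * Q' u)) ->; first by ring.
split=> [u h||].
- exact: (is_deriveD' (dQ u h) (is_deriveZ' k (dQ' u h))).
- exact: cont1D cQ (cont1Z (C := k) cQ').
rewrite -[X in _ --> X](addr0 0) -[X in 0 + X](mulr0 k).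
by apply: cvgD lQ _; apply: cvgM lQ'; exact: cvg_cst.
Qed.

(** Differentiation under the integral sign: the integrand of the remainder decays like u^-2 with
    constant [M * h ^+ 2], hence so small is its integral. *)
Lemma J_derive (K : R -> R -> R) K' (t M r : R) C C' : 0 < r -> 0 <= M ->
  (forall s, `|s - t| < r -> cont1 (K s)) ->
  (forall s, `|s - t| < r -> decay2 C (K s)) ->
  cont1 K' -> decay2 C' K' ->
  (forall h u, `|h| < r -> 1 <= u ->
     `|K (t + h) u - K t u - h * K' u| <= M * h ^+ 2 * u ^- 2) ->
  is_derive t 1 (fun s => J (K s)) (J K').
Proof.
move=> r0 M0 cK dK cK' dK' HM; apply: (is_derive_quad r0 M0) => h hr.
have tt : `|t - t| < r by rewrite subrr normr0.
have th : `|t + h - t| < r by rewrite addrC addKr.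
have E1 := J_lin (-1) (cK _ th) (cK _ tt) (dK _ th) (dK _ tt).
have c1 := cont1D (cK _ th) (cont1Z (C := -1) (cK _ tt)).
have d1 := decay2D (dK _ th) (decay2Z (-1) (dK _ tt)).
have E2 := J_lin (- h) c1 cK' d1 dK'.
have -> : J (K (t + h)) - J (K t) - J K' * h =
  J (fun u => K (t + h) u + -1 * K t u + - h * K' u) by rewrite E2 E1; ring.
apply: J_le; first exact: cont1D c1 (cont1Z (C := - h) cK').
by move=> u h1; rewrite mulN1r mulNr; exact: HM.
Qed.

Lemma taylor2 f (df ddf : R -> R) (x r M : R) :
  (forall t, `|t - x| < r -> is_derive t 1 f (df t)) ->
  (forall t, `|t - x| < r -> is_derive t 1 df (ddf t)) ->
  (forall t, `|t - x| < r -> `|ddf t| <= M) ->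
  forall h, `|h| < r -> `|f (x + h) - f x - h * df x| <= M * h ^+ 2.
Proof.
move=> f1 f2 b h hr.
have lip t : `|t - x| < r -> `|df t - df x| <= M * `|t - x|.
  move=> tr; have [tx|xt|->] := ltgtP t x; last by rewrite !subrr normr0 mulr0.
  - have H s : t <= s <= x -> is_derive s 1 df (ddf s).
      move=> /andP[ts sx]; apply: f2; apply: le_lt_trans tr.
      by rewrite !ler0_norm ?subr_le0 ?(ltW tx)//; nlra.
    have [c /andP[c1 c2] E] := mean_value_cc tx H.
    rewrite distrC E normrM (distrC t) ler_wpM2r//; apply: b; apply: le_lt_trans tr.
    by rewrite !ler0_norm ?subr_le0 ?ltW//; nlra.
  - have H s : x <= s <= t -> is_derive s 1 df (ddf s).
      move=> /andP[ts sx]; apply: f2; apply: le_lt_trans tr.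
      by rewrite !ger0_norm ?subr_ge0 ?(ltW xt)//; nlra.
    have [c /andP[c1 c2] E] := mean_value_cc xt H.
    rewrite E normrM ler_wpM2r//; apply: b; apply: le_lt_trans tr.
    by rewrite !ger0_norm ?subr_ge0 ?ltW//; nlra.
have fin c : `|c - x| <= `|h| -> `|h * df c - h * df x| <= M * h ^+ 2.
  move=> ch; rewrite -mulrBr normrM -(real_normK (num_real h)) expr2 mulrCA ler_wpM2l//.
  apply: le_trans (lip _ (le_lt_trans ch hr)) _; rewrite ler_wpM2l//.
  have x0 : `|x - x| < r by rewrite subrr normr0 (le_lt_trans _ hr).
  exact: le_trans (normr_ge0 _) (b _ x0).
have [h0|h0|->] := ltgtP h 0; last by rewrite addr0 subrr mul0r subr0 normr0 expr0n mulr0.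
- have H s : x + h <= s <= x -> is_derive s 1 f (df s).
    move=> /andP[ts sx]; apply: f1; apply: le_lt_trans hr.
    by rewrite !ler0_norm ?subr_le0 ?(ltW h0)//; nlra.
  have xh : x + h < x by nlra.
  have [c /andP[c1 c2] E] := mean_value_cc xh H.
  have -> : f (x + h) - f x = h * df c by rewrite -opprB E; ring.
  by apply: fin; rewrite !ler0_norm ?subr_le0 ?ltW//; nlra.
- have H s : x <= s <= x + h -> is_derive s 1 f (df s).
    move=> /andP[ts sx]; apply: f1; apply: le_lt_trans hr.
    by rewrite !ger0_norm ?subr_ge0 ?(ltW h0)//; nlra.
  have xh : x < x + h by nlra.
  have [c /andP[c1 c2] E] := mean_value_cc xh H.
  have -> : f (x + h) - f x = h * df c by rewrite E; ring.
  by apply: fin; rewrite !ger0_norm ?subr_ge0 ?ltW//; nlra.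
Qed.

End Improper.

(** * Buchstab's function *)

Section BuchstabExistence.
Variable R : realType.
Implicit Types (f g Q w : R -> R) (C l u v a b x : R).

Lemma derive0_eq f a b : a <= b ->
  (forall x, a < x < b -> is_derive x 1 f 0) -> {within `[a, b], continuous f} ->
  f a = f b.
Proof.
rewrite le_eqVlt => /predU1P[-> //|ab] H cf.
have [c cab E] := mean_value (df := fun=> 0) ab H cf.
by apply/eqP; rewrite eq_sym -subr_eq0 E mul0r.
Qed.

Lemma continuous_max1 Q : cont1 Q -> continuous (fun x => Q (Num.max x 1)).
Proof.
move=> cQ x; have m1 y : (1 : R) <= Num.max y 1 by rewrite le_max lexx orbT.
have := cQ (Num.max x 1).
rewrite /continuous_at /nbhs /= /nbhs_subspace /=.
case: ifPn => [_|]; last by rewrite notin_setE/= in_itv/= andbT m1.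
move=> cQx A /cQx/=; rewrite /nbhs/= => -[e/= e0 He]; exists e => //= y.
rewrite /ball_/= => xy; apply: He => /=; last by rewrite in_itv/= andbT m1.
apply: le_lt_trans xy; have := ler_norm (x - y); have := ler_norm (y - x); rewrite (distrC y).
rewrite /Num.max => h1 h2.
by case: (ltP x 1) => h3; case: (ltP y 1) => h4; rewrite ler_norml; apply/andP; split; nlra.
Qed.

Let prim f : R -> R := xget (fun=> 0) [set Q : R -> R |
  [/\ Q 1 = 0, forall u, 1 < u -> is_derive u 1 Q (f u) & cont1 Q]].

Let primP f : cont1 f -> [/\ prim f 1 = 0,
  forall u, 1 < u -> is_derive u 1 (prim f) (f u) & cont1 (prim f)].
Proof.
move=> /primitive_exists[Q HQ]; rewrite /prim.
by case: xgetP => [Q' _ //|/(_ Q)]; case.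
Qed.

Lemma cont1_inv : cont1 (fun u : R => u^-1).
Proof.
by apply: cont1_pos => u u0; apply: cvgV; [rewrite gt_eqF|exact: cvg_id].
Qed.

(** Method of steps for A(u) = u w(u), which has derivative A(u - 1) / (u - 1) beyond 2. Each
    iteration is exact one unit further: [A n u] is the true value for u <= n + 2. The [Num.max]
    keeps it equal to 1 for u <= 2. *)
Let A := fix A n : R -> R := if n is m.+1
  then fun u => 1 + prim (fun x => A m x / x) (Num.max (u - 1) 1) else fun=> 1.

Let A_S n u : A n.+1 u = 1 + prim (fun x => A n x / x) (Num.max (u - 1) 1).
Proof. by []. Qed.

Let A_cont n : continuous (A n) /\ cont1 (fun x => A n x / x).
Proof.
elim: n => [|n [IH1 IH2]].
  by split; [move=> x; exact: cvg_cst|apply: cont1M (cont1T _) cont1_inv; move=> x; exact: cvg_cst].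
have cA : continuous (A n.+1).
  have [_ _ cp] := primP IH2.
  move=> x; apply: cvgD; first exact: cvg_cst.
  apply: (@continuous_comp _ _ _ (fun x => x - 1) (fun x => prim (fun x => A n x / x) (Num.max x 1))).
    by apply: cvgB; [exact: cvg_id|exact: cvg_cst].
  exact: continuous_max1.
by split=> //; apply: cont1M (cont1T cA) cont1_inv.
Qed.

Let prim_ext f g b : 1 <= b -> cont1 f -> cont1 g -> (forall u, 1 < u < b -> f u = g u) ->
  prim f b = prim g b.
Proof.
move=> b1 /primP[f0 df cf] /primP[g0 dg cg] fg.
suff : prim f 1 - prim g 1 = prim f b - prim g b by rewrite f0 g0 => H; nlra.
apply: (@derive0_eq (fun u => prim f u - prim g u)) => //.
  move=> u /[dup] hu /andP[h _]; rewrite -[X in is_derive _ _ _ X](subrr (f u)) {2}fg//.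
  exact: (is_deriveB' (df u h) (dg u h)).
by apply: cont1_within => //; move=> u; apply: cvgB; [exact: cf|exact: cg].
Qed.

Let A_stable n u : u <= n%:R + 2 -> A n.+1 u = A n u.
Proof.
elim: n u => [|n IH] u hu.
  have [p0 _ _] := primP (A_cont 0).2.
  by rewrite /= max_r ?p0 ?addr0//; nlra.
rewrite A_S [RHS]A_S; congr (1 + _).
apply: prim_ext; [by rewrite le_max lexx orbT|exact: (A_cont n.+1).2|exact: (A_cont n).2|].
move=> x /andP[x1 xb]; rewrite IH//.
move: xb; rewrite lt_max => /orP[|]; last by nlra.
by move: hu; rewrite -natr1 => ? ?; nlra.
Qed.

Let A_ge n m u : u <= n%:R + 2 -> (n <= m)%N -> A m u = A n u.
Proof.
move=> hu; elim: m => [|m IH]; first by rewrite leqn0 => /eqP->.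
rewrite leq_eqVlt => /predU1P[-> //|]; rewrite ltnS => nm.
rewrite A_stable ?IH//; apply: le_trans hu _.
by rewrite lerD2r ler_nat.
Qed.

Let Ainf u := A (Num.truncn u) u.

Let AinfE n u : u < n%:R + 1 -> 0 <= u -> Ainf u = A n u.
Proof.
move=> un u0; rewrite /Ainf; apply/esym; apply: A_ge.
  by rewrite ltW// (lt_trans (truncnS_gt _))// -natr1; nlra.
rewrite -ltnS -(ltr_nat R); apply: le_lt_trans (_ : _ <= u) _; first by rewrite truncn_le.
by rewrite -natr1.
Qed.

Let Ainf_le2 u : 0 <= u <= 2 -> Ainf u = 1.
Proof.
move=> /andP[u0 u2]; rewrite (@AinfE 2)//; last by nlra.
by rewrite (@A_ge 0) //; nlra.
Qed.

Let Ainf_near u : 0 < u -> exists n (r : R), [/\ 0 < r, u < n%:R &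
  forall v, `|v - u| < r -> 0 <= v /\ Ainf v = A n v].
Proof.
move=> u0; exists (Num.truncn u).+2, (Num.min u 1); split.
- by rewrite lt_min u0 ltr01.
- by apply: lt_trans (truncnS_gt u) _; rewrite ltr_nat.
move=> v; rewrite lt_min ltr_norml => /andP[/andP[vu _]]; rewrite ltr_norml => /andP[_ v1].
have v0 : 0 <= v by nlra.
split=> //; apply: AinfE => //; have := truncnS_gt u; rewrite -!natr1.
by move=> H; nlra.
Qed.

Lemma buchstab_exists : exists w, is_buchstab w.
Proof.
have cA u : 0 < u -> {for u, continuous Ainf}.
  move=> u0; have [n [r [r0 _ H]]] := Ainf_near u0.
  have E : {near u, A n =1 Ainf}.
    by exists r => //= t; rewrite /ball_/= distrC => /H[_ ->].
  have EE : A n u = Ainf u := nbhs_singleton E.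
  change (Ainf x @[x --> u] --> Ainf u); rewrite -EE.
  exact: cvg_trans (near_eq_cvg E) ((A_cont n).1 u).
exists (fun u => if u < 1 then 0 else Ainf u / u); split.
- by move=> u ->.
- move=> u /andP[u1 u2]; rewrite ltNge u1/= Ainf_le2 ?div1r// u2 andbT; nlra.
- apply: (@subspace_eq_continuous _ _ _ (fun u => Ainf u / u)).
    by move=> u; rewrite inE/= in_itv/= andbT /from_subspace => h; rewrite ltNge h.
  by apply: cont1M (cont1_pos cA) cont1_inv.
- move=> u u2; have u0 : 0 < u by nlra.
  have [[|n] [r [r0 un H]]] := Ainf_near u0; first by nlra.
  have [_ dp _] := primP (A_cont n).2.
  have u11 : 1 < u - 1 by nlra.
  (* Within distance u - 2 of u, v - 1 stays above 1, so the [Num.max] disappears. *)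
  have r'0 : 0 < Num.min r (u - 2) by rewrite lt_min r0 subr_gt0.
  have -> : (if u - 1 < 1 then 0 else Ainf (u - 1) / (u - 1)) = A n (u - 1) / (u - 1).
    rewrite ltNge ltW//=; congr (_ / _).
    by apply: AinfE; move: un; rewrite -?natr1 => ?; nlra.
  apply: (@is_derive_near _ (fun v => 1 + prim (fun x => A n x / x) (v + (- 1))) _ u _ _ r'0).
    move=> v; rewrite lt_min => /andP[/H[v0 E] ]; rewrite ltr_norml => /andP[v1 _].
    rewrite ltNge (_ : 1 <= v)/=; last by nlra.
    rewrite mulrCA divff ?mulr1 ?E /=; first by rewrite max_l//; nlra.
    by rewrite gt_eqF//; nlra.
  rewrite -[X in is_derive _ _ _ X]add0r.
  exact: (is_deriveD' (is_derive_cst _ u 1) (is_derive_shift' (dp _ u11))).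
Qed.

End BuchstabExistence.

Section BuchstabProperties.
Variable R : realType.
Implicit Types (f g Q w : R -> R) (C l u v a b x c : R).
Variable w : R -> R.
Hypothesis Hw : is_buchstab w.

Lemma buchstab_12 u : 1 <= u <= 2 -> w u = u^-1.
Proof. by have [_ H _ _] := Hw; exact: H. Qed.

Lemma buchstab_cont : cont1 w. Proof. by case: Hw. Qed.

Definition dbuchstab u := (w (u - 1) - w u) / u.

Lemma buchstab_is_derive u : 2 < u -> is_derive u 1 w (dbuchstab u).
Proof.
move=> u2; have [_ _ _ /(_ u u2) H] := Hw.
have u0 : u != 0 by rewrite gt_eqF//; nlra.
have := is_deriveM' H (is_derive_invr u0).
have -> : w (u - 1) * u^-1 + u * w u * - u ^- 2 = dbuchstab u.
  by rewrite /dbuchstab; field.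
have r0 : 0 < u - 2 by nlra.
apply: (is_derive_near r0) => t; rewrite ltr_norml => /andP[t1 _].
by rewrite mulrAC divff ?mul1r// gt_eqF//; nlra.
Qed.

(** Induction over unit intervals: the derivative w(v - 1) of v w(v) lies in [1/2, 1] by the
    previous interval, so v w(v), which is 1 at v = 2, is caught between two lines. *)
Lemma buchstab_bounds u : 1 <= u -> 2^-1 <= w u <= 1.
Proof.
suff H n : forall u, 1 <= u -> u < n%:R + 2 -> 2^-1 <= w u <= 1.
  by move=> u1; apply: (H (Num.truncn u)) => //; have := truncnS_gt u; rewrite -natr1; nlra.
elim: n => [|n IH] {}u u1 un.
  rewrite buchstab_12 ?u1/=; last by nlra.
  by rewrite invf_le1 ?lef_pV2 ?posrE//; nlra.
have [u2|u2] := leP u 2.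
  rewrite buchstab_12 ?u1//= invf_le1 ?lef_pV2 ?posrE//; nlra.
have ab : 2 <= u by exact: ltW.
have [_ _ _ D] := Hw.
have d t : 2 < t < u -> is_derive t 1 (fun v => v * w v) (w (t - 1)).
  by move=> /andP[t2 _]; exact: D.
have ct : {within `[2, u], continuous (fun v => v * w v)}.
  have c : cont1 (fun v => v * w v).
    by apply: cont1M buchstab_cont; apply: cont1T => v; exact: cvg_id.
  by apply: cont1_within c; nlra.
have b t : 2 < t < u -> 2^-1 <= w (t - 1) <= 1.
  move=> /andP[t2 tu]; apply: IH; first nlra.
  by move: un; rewrite -natr1; nlra.
have idc k : {within `[2, u], continuous (fun v => k * v)}.
  by apply: (@is_derive_within _ _ (fun=> k)) => v _; apply: (is_derive_eq (is_deriveZ' k (is_derive_id v 1))); rewrite mulr1.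
have w2 : w 2 = 2^-1 by apply: buchstab_12; apply/andP; split; nlra.
have L : 2 * w 2 - 2^-1 * 2 <= u * w u - 2^-1 * u.
  apply: (@derive_ge0_le _ (fun v => v * w v - 2^-1 * v) (fun t => w (t - 1) - 2^-1 * 1) _ _ ab).
  - by move=> t h; exact: (is_deriveB' (d t h) (is_deriveZ' _ (is_derive_id t 1))).
  - by move=> t /b; nlra.
  - by move=> t; apply: cvgB; [exact: ct|exact: idc].
have U : 1 * 2 - 2 * w 2 <= 1 * u - u * w u.
  apply: (@derive_ge0_le _ (fun v => 1 * v - v * w v) (fun t => 1 * 1 - w (t - 1)) _ _ ab).
  - by move=> t h; exact: (is_deriveB' (is_deriveZ' _ (is_derive_id t 1)) (d t h)).
  - by move=> t /b; nlra.
  - by move=> t; apply: cvgB; [exact: idc|exact: ct].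
rewrite w2 in L U; apply/andP; split; nra.
Qed.

(** By the mean value theorem w(u - 1) - w(u) is minus a value of w' on (u - 1, u), and w'(u)
    divides it by u, so every pass gains one power. For u <= 3, where u - 1 may fall below 2, the
    constant [3 ^+ n.+1] pays. *)
Lemma dbuchstab_decay n :
  exists2 C, 0 <= C & forall u, 2 < u -> `|dbuchstab u| <= C * u ^- n.
Proof.
have B u : 2 < u -> `|dbuchstab u| <= 1.
  move=> u2; rewrite normrM normfV (gtr0_norm (_ : 0 < u)); last by nlra.
  have B1 : 2^-1 <= w u <= 1 by apply: buchstab_bounds; nlra.
  have B2 : 2^-1 <= w (u - 1) <= 1 by apply: buchstab_bounds; nlra.
  by rewrite ler_pdivrMr ?ler_norml; [apply/andP; split|]; nlra.
elim: n => [|n [C C0 IH]]; first by exists 1 => // u /B; rewrite expr0 invr1 mulr1.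
exists (C * 2 ^+ n + 3 ^+ n.+1) => [|u u2].
  by rewrite addr_ge0 ?mulr_ge0 ?exprn_ge0.
have u0 : 0 < u by nlra.
have [u3|u3] := leP u 3.
  apply: le_trans (B _ u2) _; rewrite ler_pdivlMr ?exprn_gt0// mul1r.
  apply: le_trans (_ : 3 ^+ n.+1 <= _); last by rewrite lerDr mulr_ge0 ?exprn_ge0.
  by apply: lerXn2r => //; rewrite nnegrE// ltW.
have H t : u - 1 <= t <= u -> is_derive t 1 w (dbuchstab t).
  by move=> /andP[t1 _]; apply: buchstab_is_derive; nlra.
have uu : u - 1 < u by nlra.
have [t /andP[t1 t2] E] := mean_value_cc uu H.
have bt : `|w (u - 1) - w u| <= C * 2 ^+ n * u ^- n.
  have -> : w (u - 1) - w u = - dbuchstab t.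
    by rewrite -[LHS]opprB E; ring.
  rewrite normrN; apply: le_trans (IH t _) _; first by nlra.
  rewrite -mulrA ler_wpM2l// ler_pdivlMr ?exprn_gt0// mulrC.
  rewrite ler_pdivrMr ?exprn_gt0//; last by nlra.
  by rewrite -exprMn; apply: lerXn2r; rewrite ?nnegrE; nlra.
rewrite /dbuchstab normrM normfV (gtr0_norm u0) [u ^+ n.+1]exprSr invfM.
apply: le_trans (ler_wpM2r _ bt) _; first by rewrite invr_ge0 ltW.
rewrite mulrA; apply: ler_wpM2r; first by rewrite invr_ge0 ltW.
by apply: ler_wpM2r; [rewrite invr_ge0 exprn_ge0// ltW | rewrite lerDl exprn_ge0].
Qed.

Lemma buchstab_limit : exists2 c : R, w x @[x --> +oo] --> c & 2^-1 <= c <= 1 /\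
  forall n, exists2 C, 0 <= C & forall u, 1 <= u -> `|w u - c| <= C * u ^- n.
Proof.
have bd n C : (forall u, 2 < u -> `|dbuchstab u| <= C * u ^- n.+2) -> 0 <= C ->
  forall a b, 2 <= a -> a <= b -> `|w b - w a| <= C * a ^- n * (a^-1 - b^-1).
  move=> HC C0 a b a2 ab; rewrite mulrBr; have a0 : 0 < a by nlra.
  apply: (derive_le_decay2 (f := dbuchstab)) => //.
  - by move=> u /andP[au _]; apply: buchstab_is_derive; nlra.
  - move=> u /andP[au _]; have u2 : 2 < u by nlra.
    apply: le_trans (HC _ u2) _; rewrite -mulrA ler_wpM2l//.
    have -> : n.+2 = (n + 2)%N by rewrite addn2.
    rewrite exprD invfM ler_wpM2r ?invr_ge0 ?exprn_ge0//; [nlra|].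
    by rewrite lef_pV2 ?posrE ?exprn_gt0 ?lerXn2r ?nnegrE//; nlra.
  - by apply: cont1_within buchstab_cont; nlra.
(* The derivative formula holds beyond 2 while [cvg_of_bound] starts at 1; the shift reconciles
   them. *)
pose F x := w (x + 1).
have cvF n C : (forall u, 2 < u -> `|dbuchstab u| <= C * u ^- n.+2) -> 0 <= C ->
  forall b, 1 <= b -> forall k, forall x, b <= x -> x <= k ->  `|F k - F x| <= C * (b+1) ^- n * (x^-1 - k^-1).
  move=> HC C0 b b1 k x bx xk; rewrite /F.
  have h1 : 2 <= x + 1 by nlra.
  have h2 : x + 1 <= k + 1 by nlra.
  apply: le_trans (bd n C HC C0 _ _ h1 h2) _.
  have p0 : 0 <= (x + 1)^-1 - (k + 1)^-1 by rewrite subr_ge0 lef_pV2 ?posrE; nlra.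
  apply: ler_pM => //.
  - by rewrite mulr_ge0// invr_ge0 exprn_ge0//; nlra.
  - rewrite ler_wpM2l// lef_pV2 ?posrE ?exprn_gt0; try nlra.
    by apply: lerXn2r; rewrite ?nnegrE; nlra.
  - have e (t : R) : 0 < t -> t^-1 - (t + 1)^-1 = (t * (t + 1))^-1.
      by move=> t0; field; rewrite !gt_eqF; nlra.
    have x0 : 0 < x by nlra.
    have k0 : 0 < k by nlra.
    have m : x * (x + 1) <= k * (k + 1) by nra.
    have p1 : 0 < x * (x + 1) by nra.
    have p2 : 0 < k * (k + 1) by nra.
    have : (k * (k + 1))^-1 <= (x * (x + 1))^-1 by rewrite lef_pV2 ?posrE.
    by rewrite -!e//; nlra.
have [C0 C00 HC0] := dbuchstab_decay 2.
have [c cF _] : exists2 l : R, F x @[x --> +oo] --> l & forall u, 1 <= u -> `|F u - l| <= C0 * u^-1.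
  apply: cvg_of_bound => // a b a1 ab; rewrite -mulrBr.
  by have := cvF 0 C0 HC0 C00 a a1 b a (lexx _) ab; rewrite expr0 invr1 mulr1.
have cw : w x @[x --> +oo] --> c.
  have : F (x - 1) @[x --> +oo] --> c.
    apply: (@cvg_comp _ _ _ (fun x => x - 1) F _ _ _ _ cF).
    exact: cvg_addrr.
  by apply: cvg_trans; apply: near_eq_cvg; near=> x; rewrite /F subrK.
exists c => //; split.
  apply/andP; split.
    apply: (cvgr_to_ge cw); near=> x.
    have x1 : 1 <= x by near: x; apply: nbhs_pinfty_ge; rewrite num_real.
    by have /andP[] := buchstab_bounds x1.
  apply: (cvgr_to_le cw); near=> x.
  have x1 : 1 <= x by near: x; apply: nbhs_pinfty_ge; rewrite num_real.
  by have /andP[] := buchstab_bounds x1.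
move=> n; have [C C0' HC] := dbuchstab_decay n.+2.
have two u : 2 <= u -> `|w u - c| <= C * u ^- n.
  move=> u2; rewrite distrC.
  have : `|w x - w u| @[x --> +oo] --> `|c - w u|.
    by apply: cvg_norm; apply: cvgB cw _; exact: cvg_cst.
  move=> L; apply: (cvgr_to_le L); near=> x.
  have ux : u <= x by near: x; apply: nbhs_pinfty_ge; rewrite num_real.
  apply: le_trans (bd n C HC C0' u x u2 ux) _.
  rewrite -[leRHS]mulr1 ler_wpM2l ?mulr_ge0 ?invr_ge0 ?exprn_ge0//; first nlra.
  have : u^-1 <= 1 by rewrite invf_le1; nlra.
  have : 0 <= x^-1 by rewrite invr_ge0; nlra.
  by nlra.
have cb : 2^-1 <= c <= 1.
  apply/andP; split.
    apply: (cvgr_to_ge cw); near=> x.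
    have x1 : 1 <= x by near: x; apply: nbhs_pinfty_ge; rewrite num_real.
    by have /andP[] := buchstab_bounds x1.
  apply: (cvgr_to_le cw); near=> x.
  have x1 : 1 <= x by near: x; apply: nbhs_pinfty_ge; rewrite num_real.
  by have /andP[] := buchstab_bounds x1.
exists (C + 2 ^+ n) => [|u u1]; first by rewrite addr_ge0 ?exprn_ge0.
have [u2|u2] := leP 2 u.
  apply: le_trans (two _ u2) _; apply: ler_wpM2r; last by rewrite lerDl exprn_ge0.
  by rewrite invr_ge0; apply: exprn_ge0; exact: le_trans ler01 u1.
have /andP[h1 h2] := buchstab_bounds u1; move: cb => /andP[h3 h4].
apply: (@le_trans _ _ 1); first by rewrite ler_norml; apply/andP; split; nlra.
rewrite ler_pdivlMr ?exprn_gt0 ?mul1r; last nlra.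
apply: le_trans (_ : 2 ^+ n <= _); last by rewrite lerDr.
by apply: lerXn2r; rewrite ?nnegrE; nlra.
Unshelve. all: by end_near. Qed.

End BuchstabProperties.

(** * Buchstab's equation tested against a kernel; the limit of w is e^(-gamma) *)

Section Kernel.
Variable R : realType.
Implicit Types (f g Q w : R -> R) (C l u v a b x t : R).
Variables (w : R -> R) (c : R).
Hypothesis Hw : is_buchstab w.
Hypothesis Hdec : forall n, exists2 C : R, 0 <= C &
  forall u, 1 <= u -> `|w u - c| <= C * u ^- n.

Definition phi u := w u - c.

Lemma phi_cont : cont1 phi.
Proof. by apply: cont1D (buchstab_cont Hw) _; apply: cont1T => v; exact: cvg_cst. Qed.

Lemma phi_decay n (B : R) k : 0 <= B -> (forall u, 1 <= u -> `|k u| <= B * u ^+ n) ->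
  exists C, decay2 C (fun u => phi u * k u).
Proof.
move=> B0 Hk; have [C C0 HC] := Hdec n.+2.
exists (C * B) => u u1; rewrite normrM.
have u0 : 0 < u by nlra.
apply: le_trans (ler_pM (normr_ge0 _) (normr_ge0 _) (HC u u1) (Hk u u1)) _.
have -> : u ^+ n.+2 = u ^+ n * u ^+ 2 by rewrite -exprD addn2.
rewrite le_eqVlt; apply/orP; left; apply/eqP; field.
by rewrite ?expf_neq0 ?gt_eqF.
Qed.

Lemma J_scale k f C : cont1 f -> decay2 C f -> J (fun u => k * f u) = k * J f.
Proof.
move=> cf df; have := J_lin (k - 1) cf cf df df.
have -> : (fun u => f u + (k - 1) * f u) = (fun u => k * f u) by apply/funext => u; ring.
by move=> ->; ring.
Qed.

Lemma eq0_small x C : (forall b, 2 <= b -> `|x| <= C * b^-1) -> x = 0.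
Proof.
move=> H; apply/eqP; rewrite -normr_le0 leNgt; apply/negP => x0.
have C0 : 0 <= C by have := H 2 (lexx _); nlra.
have := H (2 + 2 * C / `|x|); rewrite lerDl.
have q : 0 <= 2 * C / `|x| by rewrite mulr_ge0 ?invr_ge0 ?mulr_ge0.
move=> /(_ q); rewrite ler_pdivlMr; last by nlra.
rewrite mulrDr mulrCA divff ?gt_eqF//; nlra.
Qed.

(** Buchstab's equation in adjoint form. Beyond 2 the derivative of u phi(u) is phi(u - 1), so
    integrating (u phi k)' over [2, oo) gives both integrals up to boundary terms; on [1, 2] one has
    u phi = 1 - c u explicitly, which brings in [K]. Exponentials and powers as k give the
    functional equations of [laplace1] and [G]. *)
Lemma kernel_identity (k dk K : R -> R) n (B : R) : 0 <= B ->
  (forall u, 0 < u -> is_derive u 1 k (dk u)) -> cont1 dk ->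
  (forall u, 0 < u -> is_derive u 1 K (k u)) ->
  (forall u, 1 <= u -> `|k u| <= B * u ^+ n) ->
  (forall u, 1 <= u -> `|k (u + 1)| <= B * u ^+ n) ->
  (forall u, 1 <= u -> `|dk u| <= B * u ^+ n) ->
  J (fun u => phi u * (u * dk u)) + J (fun u => phi u * k (u + 1)) =
  - (1 - c) * k 1 + c * (K 2 - K 1).
Proof.
move=> B0 Dk cdk DK bk bk1 bdk.
have cid : cont1 (fun u : R => u) by apply: cont1T => v; exact: cvg_id.
have ck : cont1 k by exact: cont1_derive Dk.
have cK : cont1 K by exact: cont1_derive DK.
have ck1 : cont1 (fun u => k (u + 1)).
  apply: (@cont1_derive _ _ (fun u => dk (u + 1))) => u u0.
  by apply: is_derive_shift'; apply: Dk; rewrite addr_gt0.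
have bu g u : 1 <= u -> `|g u| <= B * u ^+ n -> `|u * g u| <= B * u ^+ n.+1.
  move=> u1 h; rewrite normrM ger0_norm ?exprS; last nlra.
  by rewrite mulrCA ler_wpM2l//; nlra.
have [C1 d1] := phi_decay B0 (fun u h => bu dk u h (bdk u h)).
have [C2 d2] := phi_decay B0 bk1.
have [C3 d3] := phi_decay B0 (fun u h => bu k u h (bk u h)).
have c1 : cont1 (fun u => phi u * (u * dk u)).
  exact: cont1M phi_cont (cont1M cid cdk).
have c2 : cont1 (fun u => phi u * k (u + 1)) by exact: cont1M phi_cont ck1.
have c3 : cont1 (fun u => phi u * (u * k u)) by exact: cont1M phi_cont (cont1M cid ck).
have [Q1 P1 ->] := primitive_lim c1 d1.
have [Q2 P2 ->] := primitive_lim c2 d2.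
have b1 := primitive_le d1 P1; have b2 := primitive_le d2 P2.
have [dQ1 cQ1 _] := P1; have [dQ2 cQ2 _] := P2.
have E2 : Q1 2 - (phi 2 * (2 * k 2) - Q2 1) = 0.
  (* This combination is constant on [2, oo) by the delay equation and is O(1/b), hence zero. *)
  pose H u := Q1 u - (phi u * (u * k u) - Q2 (Num.max (u - 1) 1)).
  have H2 b : 2 <= b -> H 2 = H b.
    move=> hb; apply: derive0_eq => // [u /andP[u2 ub]|].
    - have u0 : u != 0 by rewrite gt_eqF//; nlra.
      have u1 : 1 < u - 1 by nlra.
      have u11 : 1 < u by nlra.
      have u00 : 0 < u by nlra.
      have r0 : 0 < u - 2 by nlra.
      apply: (@is_derive_near _ (fun u => Q1 u - (phi u * (u * k u) - Q2 (u + (-1)))) _ u _ _ r0).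
        move=> t; rewrite ltr_norml => /andP[t1 _].
        by rewrite /H max_l//; nlra.
      have dphi : is_derive u 1 phi (dbuchstab w u).
        rewrite -[dbuchstab w u]subr0.
        exact: (is_deriveB' (buchstab_is_derive Hw u2) (is_derive_cst c u 1)).
      have D := is_deriveB' (dQ1 u u11) (is_deriveB' (is_deriveM' dphi
         (is_deriveM' (is_derive_id u 1) (Dk u u00))) (is_derive_shift' (dQ2 _ u1))).
      apply: (is_derive_eq D).
      rewrite /dbuchstab /phi subrK; field.
      by [].
    - have cc : cont1 (fun u => Q1 u - (phi u * (u * k u) - Q2 (Num.max (u - 1) 1))).
        move=> u; apply: cvgB; first exact: cQ1.
        apply: cvgB; first exact: c3.
        apply: cont1T => {}u.
        apply: (@continuous_comp _ _ _ (fun x => x - 1) (fun x => Q2 (Num.max x 1))).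
          by apply: cvgB; [exact: cvg_id|exact: cvg_cst].
        exact: continuous_max1.
      by apply: cont1_within cc; nlra.
  have -> : Q1 2 - (phi 2 * (2 * k 2) - Q2 1) = H 2.
    by rewrite /H max_r//; nlra.
  apply: (@eq0_small _ (C1 + C3 + 2 * C2)) => b hb; rewrite (H2 b hb).
  have h1 : 1 <= b by nlra.
  have h2 : 1 <= b - 1 by nlra.
  have := b1 b h1; have := d3 b h1; have := b2 _ h2.
  rewrite /H max_l//.
  have C20 := decay2_ge0 d2; have C30 := decay2_ge0 d3.
  have i0 : 0 < b^-1 by rewrite invr_gt0; nlra.
  have i1 : b^-1 <= 1 by rewrite invf_le1; nlra.
  have i2 : (b - 1)^-1 <= 2 * b^-1.
    rewrite -div1r ler_pdivrMr; last by nlra.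
    by rewrite mulrAC ler_pdivlMr; nlra.
  rewrite -exprVn => q1 q2 q3.
  have q1' : `|Q2 (b - 1)| <= C2 * (2 * b^-1) by apply: le_trans q1 _; apply: ler_wpM2l.
  have q2' : `|phi b * (b * k b)| <= C3 * b^-1.
    apply: le_trans q2 _; apply: ler_wpM2l => //; rewrite expr2; nra.
  move: q1' q2' q3; rewrite !ler_norml => /andP[? ?] /andP[? ?] /andP[? ?].
  by apply/andP; split; nlra.
have E1 : Q1 1 - (phi 1 * (1 * k 1) + c * K 1) = Q1 2 - (phi 2 * (2 * k 2) + c * K 2).
  have ab : (1 : R) <= 2 by nlra.
  apply: (@derive0_eq _ (fun u => Q1 u - (phi u * (u * k u) + c * K u)) _ _ ab) => [u /andP[h1 h2]|].
  - have u0 : u != 0 by rewrite gt_eqF//; nlra.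
    have u00 : 0 < u by nlra.
    have r0 : 0 < Num.min (u - 1) (2 - u) by rewrite lt_min; apply/andP; split; nlra.
    apply: (@is_derive_near _ (fun u => Q1 u - ((- c * u + 1) * k u + c * K u)) _ u _ _ r0).
      move=> t; rewrite lt_min !ltr_norml => /andP[/andP[t1 _] /andP[_ t2]].
      rewrite /phi (buchstab_12 Hw); last by apply/andP; split; nlra.
      by congr (_ - (_ + _)); field; rewrite gt_eqF//; nlra.
    have D := is_deriveB' (dQ1 u h1) (is_deriveD' (is_deriveM' (is_derive_affine (- c) 1 u) (Dk u u00)) (is_deriveZ' c (DK u u00))).
    apply: (is_derive_eq D).
    rewrite /phi (buchstab_12 Hw); last by apply/andP; split; nlra.
    by field.
  - have cc : cont1 (fun u => Q1 u - (phi u * (u * k u) + c * K u)).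
      move=> u; apply: cvgB; first exact: cQ1.
      by apply: cvgD; [exact: c3|exact: (cont1Z (C := c) cK)].
    by apply: cont1_within cc.
have p1 : phi 1 = 1 - c by rewrite /phi (buchstab_12 Hw) ?invr1//; apply/andP; split; nlra.
by rewrite p1 in E1; nlra.
Qed.

Lemma expR_quad (t h u : R) : 0 < t -> 0 <= u -> `|h| < t ->
  `|expR (- (t + h) * u) - expR (- t * u) - h * (- u * expR (- t * u))| <= u ^+ 2 * h ^+ 2.
Proof.
move=> t0 u0 ht.
have D (s : R) : is_derive s 1 (fun s => expR (- s * u)) (- u * expR (- s * u)).
  have -> : (fun s => expR (- s * u)) = (fun s => expR (- u * s + 0)).
    by apply/funext => z; congr expR; ring.
  rewrite (_ : - s * u = - u * s + 0); last by ring.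
  rewrite [- u * _]mulrC.
  exact: (is_derive_comp' (is_derive_expR _) (is_derive_affine (- u) 0 s)).
have B s : `|s - t| < t -> `|- u * (- u * expR (- s * u))| <= u ^+ 2; last first.
  exact: (@taylor2 _ (fun s => expR (- s * u)) (fun s => - u * expR (- s * u)) _ t t _
    (fun s _ => D s) (fun s _ => is_deriveZ' (- u) (D s)) B h ht).
move=> st.
rewrite mulrA mulrNN -expr2 normrM (ger0_norm (exprn_ge0 _ u0)) ger0_norm ?expR_ge0//.
rewrite -[leRHS]mulr1 ler_wpM2l ?exprn_ge0// expR_le1 mulNr oppr_le0 mulr_ge0//.
by move: st; rewrite ltr_norml => /andP[]; nlra.
Qed.

Lemma expR_decay (t u : R) : 0 <= t -> 1 <= u -> `|expR (- t * u)| <= expR (- t) * u ^+ 0.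
Proof.
move=> t0 u1; rewrite ger0_norm ?expR_ge0// expr0 mulr1 ler_expR; nra.
Qed.

Lemma cont1_expR (t : R) : cont1 (fun u => expR (- t * u)).
Proof.
apply: cont1T => u; apply: (@continuous_comp _ _ _ (fun u => - t * u) expR).
  by apply: cvgM; [exact: cvg_cst|exact: cvg_id].
exact: continuous_expR.
Qed.

Lemma cont1_id : cont1 (fun u : R => u).
Proof. by apply: cont1T => v; exact: cvg_id. Qed.

(** One plus the Laplace transform of w over [1, oo). The limit c of w is integrated separately,
    which leaves an integrand whose decay is uniform down to t = 0. *)
Definition laplace1 t := 1 + c * (expR (- t) / t) + J (fun u => phi u * expR (- t * u)).

(** [kernel_identity] for k(u) = e^(-t u) turns the derivative, an integral of -u phi(u) e^(-t u),
    back into the transform itself. *)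
Lemma laplace1_is_derive t : 0 < t ->
  is_derive t 1 laplace1 (- (expR (- t) / t) * laplace1 t).
Proof.
move=> t0.
have ce (s : R) : cont1 (fun u => phi u * expR (- s * u)) by exact: cont1M phi_cont (@cont1_expR s).
have B0 : (0 : R) <= 1 by [].
have be (s u : R) : 0 <= s -> 1 <= u -> `|expR (- s * u)| <= 1 * u ^+ 0.
  by move=> s0 u1; apply: le_trans (expR_decay s0 u1) _; rewrite ler_pM2r ?exprn_gt0 ?expR_le1 ?oppr_le0//; nlra.
have [C HC] : exists C, forall s, 0 <= s -> decay2 C (fun u => phi u * expR (- s * u)).
  have [C C0 H] := Hdec 2; exists C => s s0 u u1; rewrite normrM.
  rewrite -[leRHS]mulr1; apply: ler_pM => //; first exact: H.
  by apply: le_trans (be s u s0 u1) _; rewrite expr0 mulr1.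
have bu u : 1 <= u -> `|- u * expR (- t * u)| <= 1 * u ^+ 1.
  move=> u1; rewrite normrM normrN mulrC; apply: ler_pM => //.
    by have := be t u (ltW t0) u1; rewrite expr0 mulr1.
  by rewrite ger0_norm; nlra.
have [C' d'] := phi_decay B0 bu.
have c' : cont1 (fun u => phi u * (- u * expR (- t * u))).
  apply: cont1M phi_cont (cont1M _ (@cont1_expR t)).
  by move=> u; apply: cvgN; exact: cont1_id.
have [M M0 HM] := Hdec 4.
have DJ : is_derive t 1 (fun s => J (fun u => phi u * expR (- s * u)))
  (J (fun u => phi u * (- u * expR (- t * u)))).
  apply: (@J_derive _ (fun s u => phi u * expR (- s * u)) _ t M t C C' t0 M0 _ _ c' d').
  - by move=> s _; exact: ce.
  - by move=> s; rewrite ltr_norml => /andP[h _]; apply: HC; nlra.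
  move=> h u ht u1.
  have -> : phi u * expR (- (t + h) * u) - phi u * expR (- t * u) - h * (phi u * (- u * expR (- t * u)))
    = phi u * (expR (- (t + h) * u) - expR (- t * u) - h * (- u * expR (- t * u))) by ring.
  have u0 : 0 <= u by nlra.
  rewrite normrM; apply: le_trans (ler_pM (normr_ge0 _) (normr_ge0 _) (HM u u1) (expR_quad t0 u0 ht)) _.
  rewrite le_eqVlt; apply/orP; left; apply/eqP; field.
  by rewrite gt_eqF//; nlra.
have K : J (fun u => phi u * (u * (- t * expR (- t * u)))) + J (fun u => phi u * expR (- t * (u + 1))) =
  - (1 - c) * expR (- t * 1) + c * (- t^-1 * expR (- t * 2) - - t^-1 * expR (- t * 1)).
  have De u : is_derive u 1 (fun u => expR (- t * u)) (- t * expR (- t * u)).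
    have -> : (fun u => expR (- t * u)) = (fun u => expR (- t * u + 0)).
      by apply/funext => z; rewrite addr0.
    rewrite -[X in expR X]addr0 [- t * _]mulrC.
    exact: (is_derive_comp' (is_derive_expR _) (is_derive_affine (- t) 0 u)).
  have DK u : 0 < u -> is_derive u 1 (fun u => - t^-1 * expR (- t * u)) (expR (- t * u)).
    move=> _; apply: (is_derive_eq (is_deriveZ' (- t^-1) (De u))).
    by field; rewrite gt_eqF.
  have B1 : 0 <= 1 + t by nlra.
  have k1 u : 1 <= u -> `|expR (- t * u)| <= (1 + t) * u ^+ 0.
    by move=> u1; apply: le_trans (be _ _ (ltW t0) u1) _; rewrite expr0; nlra.
  have k2 u : 1 <= u -> `|expR (- t * (u + 1))| <= (1 + t) * u ^+ 0.
    move=> u1; have u2 : 1 <= u + 1 by nlra.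
    by apply: le_trans (be _ _ (ltW t0) u2) _; rewrite !expr0; nlra.
  have k3 u : 1 <= u -> `|- t * expR (- t * u)| <= (1 + t) * u ^+ 0.
    move=> u1; rewrite normrM normrN (gtr0_norm t0).
    have := be _ _ (ltW t0) u1; rewrite !expr0 !mulr1 => h.
    by apply: le_trans (ler_wpM2l (ltW t0) h) _; nlra.
  exact: (@kernel_identity _ _ _ 0 _ B1 (fun u _ => De u) (cont1Z (C := - t) (@cont1_expR t)) DK k1 k2 k3).
have K1 : J (fun u => phi u * (u * (- t * expR (- t * u)))) = t * J (fun u => phi u * (- u * expR (- t * u))).
  by rewrite -(J_scale t c' d'); congr J; apply/funext => u; ring.
have K2 : J (fun u => phi u * expR (- t * (u + 1))) = expR (- t) * J (fun u => phi u * expR (- t * u)).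
  rewrite -(J_scale (expR (- t)) (ce t) (HC t (ltW t0))); congr J; apply/funext => u.
  by rewrite mulrDr mulr1 expRD; ring.
have D0 : is_derive t 1 (fun s => expR (- s) / s) ((- expR (- t)) * t^-1 + expR (- t) * - t ^- 2).
  apply: is_deriveM'; last by apply: is_derive_invr; rewrite gt_eqF.
  have := is_derive_comp' (is_derive_expR _) (is_derive_affine (-1) 0 t).
  have -> : (fun t => expR (-1 * t + 0)) = (fun s => expR (- s)).
    by apply/funext => z; rewrite addr0 mulN1r.
  by rewrite addr0 mulN1r mulrN1.
have D := is_deriveD' (is_deriveD' (is_derive_cst (1 : R) t 1) (is_deriveZ' c D0)) DJ.
apply: (is_derive_eq D).
move: K; rewrite K1 K2 mulr1 (_ : - t * 2 = - t + - t) ?expRD; last by ring.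
rewrite /laplace1; move: (J _) (J _) => j2 j1 K.
have -> : j1 = t^-1 * (t * j1) by field; rewrite gt_eqF.
rewrite (_ : t * j1 = - (1 - c) * expR (- t) + c * (- t^-1 * (expR (- t) * expR (- t)) - - t^-1 * expR (- t)) - expR (- t) * j2); last by nlra.
by field; rewrite gt_eqF.
Qed.

Hypothesis Hc : 2^-1 <= c <= 1.

Lemma cvg0_bound f C : (forall u, 1 <= u -> `|f u| <= C * u^-1) -> f x @[x --> +oo] --> (0 : R).
Proof.
move=> H; apply/cvgrPdist_le => e e0; near=> x.
have x1 : 1 <= x by near: x; apply: nbhs_pinfty_ge; rewrite num_real.
have xC : C / e <= x by near: x; apply: nbhs_pinfty_ge; rewrite num_real.
rewrite sub0r normrN; apply: le_trans (H _ x1) _.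
by rewrite ler_pdivrMr; [move: xC; rewrite ler_pdivrMr// mulrC|nlra].
Unshelve. all: by end_near. Qed.

Lemma expR_le_inv x : 0 < x -> expR (- x) <= x^-1.
Proof.
move=> x0; rewrite expRN lef_pV2 ?posrE ?expR_gt0//.
by apply: le_trans (expR_ge1Dx x); nlra.
Qed.

Lemma is_derive_expRM t x : is_derive x 1 (fun u => expR (- t * u)) (- t * expR (- t * x)).
Proof.
have -> : (fun u => expR (- t * u)) = (fun u => expR (- t * u + 0)).
  by apply/funext => z; rewrite addr0.
rewrite -[X in expR X]addr0 [- t * _]mulrC.
exact: (is_derive_comp' (is_derive_expR _) (is_derive_affine (- t) 0 x)).
Qed.

Lemma J_expR t : 0 < t -> exists2 C, decay2 C (fun u => expR (- t * u)) &
  J (fun u => expR (- t * u)) = expR (- t) / t.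
Proof.
move=> t0.
have dec : decay2 (4 / t ^+ 2) (fun u => expR (- t * u)).
  move=> u u1; rewrite ger0_norm ?expR_ge0//.
  have -> : - t * u = - (t * u / 2) + - (t * u / 2) by field.
  have h : 0 < t * u / 2 by rewrite divr_gt0// mulr_gt0//; nlra.
  rewrite expRD; apply: le_trans (ler_pM (expR_ge0 _) (expR_ge0 _) (expR_le_inv h) (expR_le_inv h)) _.
  rewrite le_eqVlt; apply/orP; left; apply/eqP; field.
  by rewrite !gt_eqF//; nlra.
exists (4 / t ^+ 2); first exact: dec.
have P : primitive1 (fun u => expR (- t * u)) (fun u => - t^-1 * expR (- t * u)).
  split=> [u u1||].
  - apply: (is_derive_eq (is_deriveZ' (- t^-1) (is_derive_expRM t u))).
    by field; rewrite gt_eqF.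
  - by apply: cont1Z; exact: cont1_expR.
  - apply: (@cvg0_bound _ (t^-1 * (4 / t ^+ 2))) => u u1.
    rewrite normrM normrN (gtr0_norm (_ : 0 < t^-1)) ?invr_gt0// -mulrA.
    apply: ler_wpM2l; first by rewrite invr_ge0 ltW.
    apply: le_trans (dec u u1) _; apply: ler_wpM2l; first by rewrite divr_ge0 ?exprn_ge0// ltW.
    have v0 : 0 <= u^-1 by rewrite invr_ge0; nlra.
    have v1 : u^-1 <= 1 by rewrite invf_le1; nlra.
    rewrite -exprVn expr2; nra.
by rewrite (J_primitive (@cont1_expR t) dec P) mulr1; ring.
Qed.

Lemma laplace1_bound : exists2 K : R, 0 <= K & forall t, 0 < t ->
  [/\ 1 <= laplace1 t, laplace1 t <= 1 + K / t & `|t * laplace1 t - c| <= K * t].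
Proof.
have ce (s : R) : cont1 (fun u => phi u * expR (- s * u)) by exact: cont1M phi_cont (@cont1_expR s).
have [C C0 HC] := Hdec 2.
have dC t : 0 < t -> decay2 (C * expR (- t)) (fun u => phi u * expR (- t * u)).
  move=> t0 u u1; have := expR_decay (ltW t0) u1; rewrite expr0 mulr1 => e.
  rewrite normrM; apply: le_trans (ler_pM (normr_ge0 _) (normr_ge0 _) (HC u u1) e) _.
  by rewrite mulrAC.
have /andP[c1 c2] := Hc.
exists (2 + c + C) => [|t t0]; first by nlra.
have b := J_le (ce t) (dC t t0).
have [C1 d1 E1] := J_expR t0.
have i1 : expR (- t) <= t^-1 by exact: expR_le_inv.
have i2 : expR (- t) <= 1 by rewrite expR_le1; nlra.
have i3 : 1 - t <= expR (- t) by apply: le_trans (expR_ge1Dx (- t)).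
have i4 := expR_gt0 (- t).
have t1 : 0 < t^-1 by rewrite invr_gt0.
have tE : t * t^-1 = 1 by rewrite divff// gt_eqF.
split.
- have E := J_lin c (ce t) (@cont1_expR t) (dC t t0) d1.
  have -> : laplace1 t = 1 + J (fun u => w u * expR (- t * u)).
    rewrite /laplace1 -E1 -addrA [c * _ + _]addrC -E; congr (1 + J _); apply/funext => u.
    by rewrite /phi; ring.
  rewrite lerDl; apply: Rintegral_ge0 => u /=; rewrite in_itv/= andbT => u1.
  have /andP[h _] := buchstab_bounds Hw u1.
  by rewrite mulr_ge0 ?expR_ge0//; nlra.
- rewrite /laplace1; have : c * (expR (- t) / t) <= 1 * (1 * t^-1).
    by rewrite mulrA !mul1r; apply: ler_piMl; [exact: ltW|nra].
  have : C * expR (- t) <= C * t^-1 by rewrite ler_wpM2l.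
  move: b; rewrite ler_norml => /andP[_ b] h1 h2.
  rewrite -[t^-1]mul1r in h1 *; nra.
- rewrite /laplace1.
  have -> : t * (1 + c * (expR (- t) / t) + J (fun u => phi u * expR (- t * u))) - c =
    t + c * (expR (- t) - 1) + t * J (fun u => phi u * expR (- t * u)) by field; rewrite gt_eqF.
  move: b; rewrite ler_norml; move: (J _) => j /andP[b1 b2].
  have : C * expR (- t) <= C by rewrite -[leRHS]mulr1 ler_wpM2l.
  rewrite ler_norml; move=> h; apply/andP; split; nra.
Qed.

Let y t := ln (t * laplace1 t).

(** The equation is now integrable: t [laplace1 t] tends to c at 0 and [laplace1 t] to 1 at
    infinity, so c is determined by the integral of (1 - e^(-s)) / s, that is, by gamma. *)
Lemma ln_laplace1_is_derive t : 0 < t -> is_derive t 1 y ((1 - expR (- t)) / t).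
Proof.
move=> t0; have [K _ /(_ t t0)[L1 _ _]] := laplace1_bound.
have p : 0 < t * laplace1 t by rewrite mulr_gt0//; nlra.
have D := @is_derive_comp' _ (@ln R) (fun t => t * laplace1 t) _ _ _ (is_derive1_ln p) (is_deriveM' (is_derive_id t 1) (laplace1_is_derive t0)).
apply: (is_derive_eq D); field.
by rewrite !gt_eqF//; nlra.
Qed.

(** The primitive vanishing at 0 of (1 - (1 - x/n)^m) / x, the finite counterpart of (1 - e^(-x)) /
    x; at x = n = m it is the harmonic number. *)
Let hsum (n : R) m x := \sum_(k < m) (1 - (1 - x / n) ^+ k.+1) / k.+1%:R.

Lemma hsum_is_derive (n : R) m x : n != 0 -> x != 0 ->
  is_derive x 1 (hsum n m) ((1 - (1 - x / n) ^+ m) / x).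
Proof.
move=> n0 x0; elim: m => [|m IH].
  rewrite expr0 subrr mul0r.
  have -> : hsum n 0 = fun=> 0 by apply/funext => z; rewrite /hsum big_ord0.
  exact: is_derive_cst.
have -> : hsum n m.+1 = fun z => hsum n m z + (1 - (- n^-1 * z + 1) ^+ m.+1) * m.+1%:R^-1.
  by apply/funext => z; rewrite /hsum big_ord_recr/= [- n^-1 * z + 1]addrC mulNr [n^-1 * z]mulrC.
have D1 := is_derive_affine (- n^-1) 1 x.
have D2 := is_deriveX' m D1.
have D3 := is_deriveM' (is_deriveB' (is_derive_cst (1 : R) x 1) D2) (is_derive_cst (m.+1%:R^-1 : R) x 1).
apply: (@is_derive_eq _ _ _ _ _ _ _ _ (is_deriveD' IH D3)).
rewrite [- n^-1 * x + 1]addrC mulNr [n^-1 * x]mulrC /cst.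
rewrite [in RHS]exprS; set X := (_ ^+ m); field.
by rewrite n0 x0 nat1r pnatr_eq0.
Qed.

Lemma hsum_continuous (n : R) m : continuous (hsum n m).
Proof.
elim: m => [|m IH] x.
  have -> : hsum n 0 = fun=> 0 by apply/funext => z; rewrite /hsum big_ord0.
  exact: cvg_cst.
have -> : hsum n m.+1 = fun z => hsum n m z + (1 - (- n^-1 * z + 1) ^+ m.+1) * m.+1%:R^-1.
  by apply/funext => z; rewrite /hsum big_ord_recr/= [- n^-1 * z + 1]addrC mulNr [n^-1 * z]mulrC.
have D2 := is_deriveX' m (is_derive_affine (- n^-1) 1 x).
have D3 := is_deriveM' (is_deriveB' (is_derive_cst (1 : R) x 1) D2) (is_derive_cst (m.+1%:R^-1 : R) x 1).
exact: cvgD (IH x) (is_derive_continuous D3).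
Qed.

Lemma bernoulli_le (s : R) m : 0 <= s <= 1 -> 1 - m%:R * s <= (1 - s) ^+ m.
Proof.
move=> /andP[s0 s1]; elim: m => [|m IH]; first by rewrite mul0r subr0 expr0.
rewrite exprS; apply: le_trans (ler_wpM2l (_ : 0 <= 1 - s) IH); last by nlra.
rewrite -natr1; have : 0 <= m%:R * s * s by rewrite !mulr_ge0.
by nlra.
Qed.

Lemma expR_approx (m : nat) x : (0 < m)%N -> 0 < x <= m%:R ->
  (1 - x / m%:R) ^+ m <= expR (- x) /\ expR (- x) - (1 - x / m%:R) ^+ m <= x ^+ 2 * expR (- x) / m%:R.
Proof.
move=> m0 /andP[x0 xm]; have n0 : (0 : R) < m%:R by rewrite ltr0n.
have q0 : 0 <= x / m%:R by rewrite divr_ge0 ?ltW.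
have q1 : x / m%:R <= 1 by rewrite ler_pdivrMr// mul1r.
have e1 : (1 - x / m%:R) ^+ m <= expR (- x).
  have -> : - x = m%:R * (- (x / m%:R)) by field; rewrite gt_eqF.
  rewrite expRM_natl; apply: lerXn2r; rewrite ?nnegrE ?expR_ge0//; first nlra.
  exact: expR_ge1Dx.
have e2 : (1 + x / m%:R) ^+ m <= expR x.
  rewrite {2}(_ : x = m%:R * (x / m%:R)); last by field; rewrite gt_eqF.
  rewrite expRM_natl; apply: lerXn2r; rewrite ?nnegrE ?expR_ge0//; first nlra.
  exact: expR_ge1Dx.
split=> //.
have b : 1 - m%:R * (x / m%:R) ^+ 2 <= (1 - x / m%:R) ^+ m * expR x.
  apply: le_trans (bernoulli_le m (_ : 0 <= (x / m%:R) ^+ 2 <= 1)) _; first by apply/andP; split; nra.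
  have -> : 1 - (x / m%:R) ^+ 2 = (1 - x / m%:R) * (1 + x / m%:R) by ring.
  by rewrite exprMn; apply: ler_wpM2l => //; rewrite exprn_ge0; nlra.
have E : m%:R * (x / m%:R) ^+ 2 = x ^+ 2 / m%:R by field; rewrite gt_eqF.
have ee : expR (- x) * expR x = 1 by rewrite mulrC expRxMexpNx_1.
have := ler_wpM2l (expR_ge0 (- x)) b; rewrite E mulrCA ee mulr1.
by rewrite mulrBr mulr1 [expR (- x) * _]mulrC mulrAC => ?; nlra.
Qed.

(** The two integrands differ by at most x e^(-x) / m, with a fixed sign, and the integral of this
    over (0, oo) is 1 / m. *)
Lemma ln_laplace1_harmonic (m : nat) : (0 < m)%N ->
  ln c - m%:R^-1 <= y m%:R - \sum_(k < m) k.+1%:R^-1 <= ln c.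
Proof.
move=> m0; have n0 : (0 : R) < m%:R by rewrite ltr0n.
have nn : m%:R != 0 :> R by rewrite gt_eqF.
pose z x := y x - hsum m%:R m x.
pose dz x := (1 - expR (- x)) / x - (1 - (1 - x / m%:R) ^+ m) / x.
have Dz x : 0 < x -> is_derive x 1 z (dz x).
  move=> x0; exact: (is_deriveB' (ln_laplace1_is_derive x0) (hsum_is_derive m nn (lt0r_neq0 x0))).
have dzE x : 0 < x -> dz x = - (expR (- x) - (1 - x / m%:R) ^+ m) / x.
  by move=> x0; rewrite /dz; field; rewrite gt_eqF.
(* A primitive of -x e^(-x) / m, with value 1 / m at 0: it turns the upper estimate into
   monotonicity of [z - P]. *)
pose P x := (x + 1) * expR (- x) / m%:R.
have DP x : is_derive x 1 P (- (x * expR (- x) / m%:R)).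
  have De := is_derive_comp' (is_derive_expR _) (is_derive_affine (-1) 0 x).
  have E : (fun t => expR (-1 * t + 0)) = (fun t => expR (- t)).
    by apply/funext => t; congr expR; ring.
  rewrite E in De.
  have D := is_deriveM' (is_deriveM' (is_derive_affine 1 1 x) De) (is_derive_cst (m%:R^-1 : R) x 1).
  have EP : (fun t => (1 * t + 1) * expR (- t) * cst m%:R^-1 t) = P.
    by apply/funext => t; rewrite /P mul1r.
  rewrite EP in D; apply: (is_derive_eq D).
  by rewrite (_ : -1 * x + 0 = - x); [rewrite /cst; ring|ring].
have bounds e : 0 < e -> e < m%:R -> z m%:R <= z e /\ z e - m%:R^-1 <= z m%:R.
  move=> e0 em; have ab : e <= m%:R by exact: ltW.
  have xx x : e < x < m%:R -> 0 < x <= m%:R by move=> /andP[h1 h2]; apply/andP; split; nlra.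
  split.
    rewrite -lerN2.
    apply: (@derive_ge0_le_cc _ (fun t => - z t) (fun t => - dz t)) => //.
      move=> x /andP[h1 h2]; apply: is_deriveN; apply: Dz; nlra.
    move=> x /xx /[dup] h /andP[x0 _]; rewrite dzE// mulNr opprK; apply: divr_ge0 (ltW x0).
    by rewrite subr_ge0; have [] := expR_approx m0 h.
  have := @derive_ge0_le_cc _ (fun t => z t - P t) (fun t => dz t - - (t * expR (- t) / m%:R)) _ _ ab.
  have : 0 <= P m%:R by rewrite /P divr_ge0 ?mulr_ge0 ?expR_ge0 ?addr_ge0.
  have : P e <= m%:R^-1.
    rewrite /P -[leRHS]mul1r; apply: ler_wpM2r; first by rewrite invr_ge0.
    have h := expR_ge1Dx e; have h2 : expR e * expR (- e) = 1 by exact: expRxMexpNx_1.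
    by have h3 := expR_gt0 (- e); nra.
  move=> p1 p2 H; suff : z e - P e <= z m%:R - P m%:R by nlra.
  apply: H.
    move=> x /andP[h1 h2]; have x0 : 0 < x by nlra.
    exact: (is_deriveB' (Dz x x0) (DP x)).
  move=> x /xx /[dup] h /andP[x0 _]; rewrite dzE//.
  have [_ h2] := expR_approx m0 h.
  suff : (expR (- x) - (1 - x / m%:R) ^+ m) / x <= x * expR (- x) / m%:R by nlra.
  rewrite ler_pdivrMr//; apply: le_trans h2 _.
  by rewrite le_eqVlt; apply/orP; left; apply/eqP; field; rewrite gt_eqF.
have zm : z m%:R = y m%:R - \sum_(k < m) k.+1%:R^-1.
  congr (_ - _); apply: eq_bigr => k _; rewrite divff// subrr expr0n subr0 mul1r//.
have [K K0 HK] := laplace1_bound.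
have /andP[c1 c2] := Hc; have c0 : 0 < c by nlra.
have ly : y e @[e --> 0^'+] --> ln c.
  apply: (@cvg_comp _ _ _ (fun t => t * laplace1 t) (@ln R) _ (nbhs c)); last exact: continuous_ln.
  apply/cvgrPdist_le => e e0; near=> t.
  have t0 : 0 < t by near: t; exact: nbhs_right_gt.
  have t1 : t <= e / (K + 1) by near: t; apply: nbhs_right_le; rewrite divr_gt0//; nlra.
  have [_ _] := HK t t0; rewrite distrC => h; apply: le_trans h _.
  move: t1; rewrite ler_pdivlMr; last by nlra.
  by nra.
have lh : hsum m%:R m e @[e --> 0^'+] --> (0 : R).
  have h0 : hsum m%:R m 0 = 0.
    by rewrite /hsum big1// => k _; rewrite mul0r subr0 expr1n subrr mul0r.
  rewrite -[X in _ --> X]h0; apply: cvg_at_right_filter.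
  exact: hsum_continuous.
have lz : z e @[e --> 0^'+] --> ln c.
  by rewrite -[ln c]subr0; exact: cvgB ly lh.
rewrite -zm; apply/andP; split.
  suff : ln c <= z m%:R + m%:R^-1 by nlra.
  apply: (cvgr_to_le lz); near=> e.
  have e0 : 0 < e by near: e; exact: nbhs_right_gt.
  have em : e < m%:R by near: e; exact: nbhs_right_lt.
  by have [_ ?] := bounds e e0 em; nlra.
apply: (cvgr_to_ge lz); near=> e.
have e0 : 0 < e by near: e; exact: nbhs_right_gt.
have em : e < m%:R by near: e; exact: nbhs_right_lt.
by have [? _] := bounds e e0 em.
Unshelve. all: by end_near. Qed.

(** At t = n the logarithm of t [laplace1 t] is ln n + O(1/n), and it is also ln c plus the harmonic
    number up to 1 / n; hence gamma = - ln c. *)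
Lemma buchstab_limit_gamma : c = expR (- euler_gamma R).
Proof.
have /andP[c1 c2] := Hc; have c0 : 0 < c by nlra.
suff : euler_gamma R = - ln c by move=> ->; rewrite opprK lnK.
apply/cvg_lim => //; have [K K0 HK] := laplace1_bound.
apply/cvgrPdist_le => e e0; near=> n.
have n0 : (0 < n)%N by near: n; exact: nbhs_infty_gt.
have nb : (K + 1) / e <= n%:R by near: n; exact: nbhs_infty_ger.
have nR : (0 : R) < n%:R by rewrite ltr0n.
have ih : 0 < n%:R^-1 :> R by rewrite invr_gt0.
have [L1 L2 _] := HK n%:R nR.
have l0 : 0 <= ln (laplace1 n%:R) by exact: ln_ge0.
have l1 : ln (laplace1 n%:R) <= K / n%:R.
  have h := @le_ln1Dx _ (laplace1 n%:R - 1); rewrite (addrC 1) subrK in h.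
  by apply: le_trans (h _) _; nlra.
have := ln_laplace1_harmonic n0; rewrite /y lnM ?posrE; [|by []|by nlra].
rewrite big_add1 /= big_mkord => /andP[h1 h2].
move: nb; rewrite ler_pdivrMr// mulrC -ler_pdivrMr// mulrDl mul1r => nb.
rewrite ler_norml; apply/andP; split; nlra.
Unshelve. all: by end_near. Qed.

End Kernel.

HB.lock Definition egam (R : realType) : R := expR (- euler_gamma R).
HB.lock Definition osc (R : realType) : R -> R := phi (@buchstab R) (egam R).
HB.lock Definition Imom (R : realType) (m v : R) : R := J (fun u => osc u * (v + u) `^ m).
(** For mu < 0 this is -mu times the sum of v^(mu - 1) and the integral over u >= 1 of w(u) (v +
    u)^(mu - 1), a manifestly positive quantity. Taking the limit e^(-gamma) of w out of the
    integral and integrating it exactly continues the formula to all real mu. *)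
HB.lock Definition G (R : realType) (mu v : R) : R :=
  - mu * v `^ (mu - 1) + egam R * (v + 1) `^ mu - mu * Imom (mu - 1) v.

(** * The functions G and the exponent *)

Section GFamily.
Variable R : realType.
Implicit Types (f g Q w : R -> R) (C l u v a b x t m mu s : R).

Notation bst := (@buchstab R).
Notation c := (egam R).
Notation ph := (@osc R).

Lemma powR_exp_is_derive a x : 0 < a -> is_derive x 1 (fun t => a `^ t) (ln a * a `^ x).
Proof.
move=> a0; have E : (fun t => a `^ t) = (fun t => expR (ln a * t + 0)).
  by apply/funext => t; rewrite /powR gt_eqF// addr0 mulrC.
have := is_derive_comp' (is_derive_expR _) (is_derive_affine (ln a) 0 x).
by rewrite -E addr0 /powR gt_eqF// mulrC (mulrC x).
Qed.

#[local] Opaque powR expR ln J.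

Lemma is_buchstab_buchstab : is_buchstab (@buchstab R).
Proof.
have [w Hw] := buchstab_exists R.
by rewrite /buchstab; case: xgetP => // /(_ w).
Qed.

Lemma buchstab_facts : 2^-1 <= c <= 1 /\
  forall n, exists2 C : R, 0 <= C & forall u, 1 <= u -> `|bst u - c| <= C * u ^- n.
Proof.
have [c' _ [Hc Hd]] := buchstab_limit is_buchstab_buchstab.
by have E := buchstab_limit_gamma is_buchstab_buchstab Hd Hc; rewrite egam.unlock -E.
Qed.

Let Hc := buchstab_facts.1.
Let Hdec := buchstab_facts.2.
Let phE : ph = phi bst c. Proof. by rewrite osc.unlock. Qed.
Lemma osc_cont : cont1 ph.
Proof. rewrite phE; exact: (phi_cont is_buchstab_buchstab). Qed.
Lemma osc_decay n : exists2 C : R, 0 <= C & forall u, 1 <= u -> `|ph u| <= C * u ^- n.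
Proof. by rewrite phE; exact: Hdec. Qed.
Let HImom m v : Imom m v = J (fun u => ph u * (v + u) `^ m).
Proof. by rewrite Imom.unlock. Qed.
Let GE mu v : G mu v = - mu * v `^ (mu - 1) + c * (v + 1) `^ mu - mu * Imom (mu - 1) v.
Proof. by rewrite G.unlock. Qed.

Lemma powR_le_exprn x m n : 1 <= x -> m <= n%:R -> x `^ m <= x ^+ n.
Proof.
move=> x1 mn; rewrite -powR_mulrn; last by nlra.
exact: ler_powR.
Qed.

Lemma natr_ge_norm m : exists n : nat, `|m| <= n%:R.
Proof. by exists (Num.truncn `|m|).+1; apply: ltW; exact: truncnS_gt. Qed.

Lemma powR_shift_le v m n u : 0 <= v -> m <= n%:R -> 1 <= u ->
  `|(v + u) `^ m| <= (v + 1) ^+ n * u ^+ n.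
Proof.
move=> v0 mn u1; rewrite ger0_norm ?powR_ge0//.
apply: le_trans (powR_le_exprn (_ : 1 <= v + u) mn) _; first nlra.
rewrite -exprMn; apply: lerXn2r; rewrite ?nnegrE; nra.
Qed.

Lemma cont1_powR v m : 0 <= v -> cont1 (fun u => (v + u) `^ m).
Proof.
move=> v0; apply: (@cont1_derive _ _ (fun u => m * (u + v) `^ (m - 1))) => u u0.
have -> : (fun u => (v + u) `^ m) = (fun u => (u + v) `^ m).
  by apply/funext => z; rewrite addrC.
by apply: is_derive_powR; nlra.
Qed.

Lemma phi_powR v m : 0 <= v -> cont1 (fun u => ph u * (v + u) `^ m) /\
  exists C, decay2 C (fun u => ph u * (v + u) `^ m).
Proof.
move=> v0; split; first exact: cont1M osc_cont (@cont1_powR v m v0).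
have [n mn] := natr_ge_norm m.
have mn' : m <= n%:R by exact: le_trans (ler_norm _) mn.
rewrite phE; apply: (phi_decay Hdec (n := n) (B := (v + 1) ^+ n)).
  by rewrite exprn_ge0//; nlra.
by move=> u u1; exact: powR_shift_le.
Qed.

Lemma Imom_is_derive m v : 0 < v -> is_derive v 1 (Imom m) (m * Imom (m - 1) v).
Proof.
move=> v0; have [n mn] := natr_ge_norm m.
have mn' : m <= n%:R by exact: le_trans (ler_norm _) mn.
have [C0 C00 H0] := osc_decay n.+2.
have vv : 0 <= v by exact: ltW.
have [c1 [C1 d1]] := @phi_powR v (m - 1) vv.
have V1 : 0 <= 2 * v + 1 by nlra.
pose B := (2 * v + 1) ^+ n.
have B0 : 0 <= B by exact: exprn_ge0.
have bnd s k u : 0 <= s -> s <= 2 * v -> k <= m -> 1 <= u -> `|(s + u) `^ k| <= B * u ^+ n.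
  move=> s0 sv km u1; apply: le_trans (powR_shift_le s0 (le_trans km mn') u1) _.
  apply: ler_wpM2r; first by rewrite exprn_ge0//; nlra.
  by apply: lerXn2r; rewrite ?nnegrE; nlra.
have dec k : (forall u, 1 <= u -> `|k u| <= B * u ^+ n) -> decay2 (C0 * B) (fun u => ph u * k u).
  move=> Hk u u1; rewrite normrM.
  have u0 : 0 < u by nlra.
  apply: le_trans (ler_pM (normr_ge0 _) (normr_ge0 _) (H0 u u1) (Hk u u1)) _.
  have -> : u ^+ n.+2 = u ^+ n * u ^+ 2 by rewrite -exprD addn2.
  rewrite le_eqVlt; apply/orP; left; apply/eqP; field.
  by rewrite ?expf_neq0 ?gt_eqF.
have E : m * Imom (m - 1) v = J (fun u => m * (ph u * (v + u) `^ (m - 1))).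
  by rewrite (J_scale m c1 d1) HImom.
rewrite E (_ : Imom m = fun s => J (fun u => ph u * (s + u) `^ m)); last first.
  by apply/funext => s; rewrite HImom.
pose M := C0 * (`|m * (m - 1)| * B).
have M0 : 0 <= M by rewrite !mulr_ge0.
have cK (s : R) : `|s - v| < v -> cont1 (fun u => ph u * (s + u) `^ m).
  by rewrite ltr_norml => /andP[h _]; have [|] := @phi_powR s m; first by nlra.
have dK (s : R) : `|s - v| < v -> decay2 (C0 * B) (fun u => ph u * (s + u) `^ m).
  rewrite ltr_norml => /andP[h1 h2]; apply: dec => u u1; apply: bnd => //; nlra.
apply: (@J_derive _ (fun s u => ph u * (s + u) `^ m) _ v M v _ _ v0 M0 cK dK
  (cont1Z (C := m) c1) (decay2Z m d1)).
move=> h u hv u1.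
have -> : ph u * (v + h + u) `^ m - ph u * (v + u) `^ m - h * (m * (ph u * (v + u) `^ (m - 1))) =
  ph u * ((v + h + u) `^ m - (v + u) `^ m - h * (m * (v + u) `^ (m - 1))) by ring.
rewrite normrM.
have T : `|(v + h + u) `^ m - (v + u) `^ m - h * (m * (v + u) `^ (m - 1))| <= `|m * (m - 1)| * (B * u ^+ n) * h ^+ 2.
  have p t : `|t - v| < v -> 0 < t + u by rewrite ltr_norml => /andP[? _]; nlra.
  apply: (@taylor2 _ (fun t => (t + u) `^ m) (fun t => m * (t + u) `^ (m - 1))
    (fun t => m * ((m - 1) * (t + u) `^ (m - 1 - 1))) v v _ _ _ _ h hv).
  - by move=> t /p; exact: is_derive_powR.
  - by move=> t /p /(is_derive_powR (m - 1)); exact: is_deriveZ'.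
  - move=> t; rewrite ltr_norml => /andP[h1 h2]; rewrite mulrA normrM ler_wpM2l//.
    by apply: bnd => //; nlra.
apply: le_trans (ler_pM (normr_ge0 _) (normr_ge0 _) (H0 u u1) T) _.
have u0 : 0 < u by nlra.
have -> : u ^+ n.+2 = u ^+ n * u ^+ 2 by rewrite -exprD addn2.
rewrite le_eqVlt; apply/orP; left; apply/eqP; rewrite /M; field.
by rewrite ?expf_neq0 ?gt_eqF.
Qed.

Lemma G_is_derive mu v : 0 < v -> is_derive v 1 (G mu) (mu * G (mu - 1) v).
Proof.
move=> v0; have v1 : 0 < v + 1 by nlra.
have v00 : 0 < v + 0 by nlra.
have D1 := is_derive_powR (mu - 1) v00; rewrite addr0 in D1.
have E1 : (fun t => (t + 0) `^ (mu - 1)) = (fun t => t `^ (mu - 1)).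
  by apply/funext => t; rewrite addr0.
rewrite E1 in D1.
have D := is_deriveB' (is_deriveD' (is_deriveZ' (- mu) D1) (is_deriveZ' c (is_derive_powR mu v1)))
  (is_deriveZ' mu (Imom_is_derive (mu - 1) v0)).
rewrite (_ : G mu = fun t => - mu * t `^ (mu - 1) + c * (t + 1) `^ mu - mu * Imom (mu - 1) t); last first.
  by apply/funext => t; rewrite GE.
by apply: (is_derive_eq D); rewrite GE; ring.
Qed.

Lemma powRS x m : 0 < x -> x `^ m = x * x `^ (m - 1).
Proof.
move=> x0; rewrite -{2}[x](powRr1 (ltW x0)) -powRD; first by congr (_ `^ _); ring.
by rewrite (gt_eqF x0) implybT.
Qed.

Lemma G0 v : G 0 v = c.
Proof. by rewrite GE powRr0 oppr0 !mul0r add0r subr0 mulr1. Qed.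

(** [kernel_identity] for k(u) = (v + u)^(mu - 1). Writing u = (v + u) - v gives the change of
    index, and v + (u + 1) = (v + 1) + u the change of argument. The primitive of k divides by mu;
    at mu = 0 both sides are zero. *)
Lemma G_shift mu v : 0 < v -> v * (mu * G (mu - 1) v) = G mu (v + 1) + (mu - 1) * G mu v.
Proof.
move=> v0; have [mu0|mu0] := eqVneq mu 0.
  by rewrite mu0 !G0; ring.
set k := mu - 1; have vv : 0 <= v by exact: ltW.
have [n mn] := natr_ge_norm k; have kn : k <= n%:R by exact: le_trans (ler_norm _) mn.
have kn1 : k - 1 <= n%:R by nlra.
pose B := (1 + `|k|) * (v + 2) ^+ n.
have B0 : 0 <= B by rewrite mulr_ge0 ?exprn_ge0 ?addr_ge0//.
have le12 : (v + 1) ^+ n <= (v + 2) ^+ n by apply: lerXn2r; rewrite ?nnegrE; nlra.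
have Bb s m : 0 <= s -> s <= v + 1 -> m <= n%:R -> forall u, 1 <= u -> `|(s + u) `^ m| <= (v + 2) ^+ n * u ^+ n.
  move=> s0 sv mn' u u1; apply: le_trans (powR_shift_le s0 mn' u1) _.
  apply: ler_wpM2r; first by rewrite exprn_ge0//; nlra.
  by apply: lerXn2r; rewrite ?nnegrE; nlra.
have P0 u : 1 <= u -> 0 <= (v + 2) ^+ n * u ^+ n by move=> u1; rewrite mulr_ge0 ?exprn_ge0//; nlra.
have nk : 0 <= `|k| by [].
have Dk u : 0 < u -> is_derive u 1 (fun u => (v + u) `^ k) (k * (v + u) `^ (k - 1)).
  move=> u0; have -> : (fun u => (v + u) `^ k) = (fun u => (u + v) `^ k).
    by apply/funext => z; rewrite addrC.
  by rewrite (addrC v); apply: is_derive_powR; nlra.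
have DK u : 0 < u -> is_derive u 1 (fun u => mu^-1 * (v + u) `^ mu) ((v + u) `^ k).
  move=> u0; have -> : (fun u => mu^-1 * (v + u) `^ mu) = (fun u => mu^-1 * (u + v) `^ mu).
    by apply/funext => z; rewrite addrC.
  have uv : 0 < u + v by nlra.
  apply: (is_derive_eq (is_deriveZ' mu^-1 (is_derive_powR mu uv))).
  by rewrite mulrA mulVf// mul1r addrC.
have KI := @kernel_identity R bst c is_buchstab_buchstab Hdec _ _ _ n B B0 Dk
  (cont1Z (C := k) (@cont1_powR v (k - 1) vv)) DK.
have h1 u : 1 <= u -> `|(v + u) `^ k| <= B * u ^+ n.
  move=> u1; have h : v <= v + 1 by nlra.
  have := Bb _ _ vv h kn u u1; have := P0 u u1; rewrite /B; nra.
have h2 u : 1 <= u -> `|(v + (u + 1)) `^ k| <= B * u ^+ n.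
  move=> u1; rewrite (_ : v + (u + 1) = (v + 1) + u); last by ring.
  have v10 : 0 <= v + 1 by nlra.
  have := Bb _ _ v10 (lexx _) kn u u1; have := P0 u u1; rewrite /B; nra.
have h3 u : 1 <= u -> `|k * (v + u) `^ (k - 1)| <= B * u ^+ n.
  move=> u1; have h : v <= v + 1 by nlra.
  rewrite normrM; have := Bb _ _ vv h kn1 u u1; have := P0 u u1; rewrite /B; nra.
have {KI} := KI h1 h2 h3; rewrite -phE.
have [c0 [C0 d0]] := @phi_powR v k vv; have [c1 [C1 d1]] := @phi_powR v (k - 1) vv.
have -> : J (fun u => ph u * (u * (k * (v + u) `^ (k - 1)))) = k * (Imom k v - v * Imom (k - 1) v).
  have c2 := cont1D c0 (cont1Z (C := - v) c1).
  have d2 := decay2D d0 (decay2Z (- v) d1).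
  rewrite !HImom -mulNr -(J_lin (- v) c0 c1 d0 d1) -(J_scale k c2 d2).
  apply: eq_Rintegral => u; rewrite inE/= in_itv/= andbT => u1.
  by rewrite (powRS k (_ : 0 < v + u)); [ring|nlra].
have -> : J (fun u => ph u * (v + (u + 1)) `^ k) = Imom k (v + 1).
  by rewrite HImom; congr J; apply/funext => u; congr (_ * _ `^ _); ring.
move=> KI.
have {}KI : mu * (k * (Imom k v - v * Imom (k - 1) v) + Imom k (v + 1)) =
  - mu * (1 - c) * (v + 1) `^ k + c * ((v + 2) `^ mu - (v + 1) `^ mu).
  by rewrite KI; field.
have e1 : (v + 1) `^ mu = (v + 1) * (v + 1) `^ k by apply: powRS; rewrite addr_gt0.
have e2 : v `^ k = v * v `^ (k - 1) by exact: powRS.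
rewrite !GE -/k e2; rewrite e1 in KI *.
rewrite (_ : v + 1 + 1 = v + 2); last by ring.
have -> : mu = k + 1 by rewrite /k; ring.
rewrite (_ : mu = k + 1) in KI; last by rewrite /k; ring.
have c0' : c * (v + 2) `^ (k + 1) = (k + 1) * (k * (Imom k v - v * Imom (k - 1) v) + Imom k (v + 1)) + (k + 1) * (1 - c) * (v + 1) `^ k + c * ((v + 1) * (v + 1) `^ k) by rewrite KI; ring.
by rewrite c0'; ring.
Qed.

Lemma powR_ratio_le v x m n : 0 < v -> v <= x -> x <= v * n%:R -> `|m| <= n%:R -> (0 < n)%N ->
  x `^ m <= n%:R ^+ n * v `^ m.
Proof.
move=> v0 vx xn mn n0; have n1 : (1 : R) <= n%:R by rewrite ler1n.
have q1 : 1 <= x / v by rewrite ler_pdivlMr// mul1r.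
have -> : x = v * (x / v) by field; rewrite gt_eqF.
rewrite powRM; [|exact: ltW|nlra].
rewrite mulrC; apply: ler_wpM2r; first exact: powR_ge0.
apply: le_trans (powR_le_exprn q1 (le_trans (ler_norm m) mn)) _.
by apply: lerXn2r; rewrite ?nnegrE ?ler_pdivrMr//; nlra.
Qed.

Lemma Imom_le m : exists2 C, 0 <= C & forall v, 2^-1 <= v -> `|Imom m v| <= C * v `^ m.
Proof.
have [n mn] := natr_ge_norm m; have [C C0 HC] := osc_decay n.+2.
exists (C * 3 ^+ n); first by rewrite mulr_ge0 ?exprn_ge0.
move=> v v2; have v0 : 0 < v by nlra.
have vv : 0 <= v by exact: ltW.
have [c0 _] := @phi_powR v m vv.
rewrite HImom; apply: J_le => // u u1; rewrite normrM.
have u0 : 0 < u by nlra.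
have q : (v + u) `^ m <= (3 * u) ^+ n * v `^ m.
  have q1 : 1 <= 1 + u / v by rewrite lerDl divr_ge0// ltW.
  have -> : v + u = v * (1 + u / v) by field; rewrite gt_eqF.
  rewrite powRM; [|exact: ltW|nlra].
  rewrite mulrC; apply: ler_wpM2r; first exact: powR_ge0.
  apply: le_trans (powR_le_exprn q1 (le_trans (ler_norm m) mn)) _.
  have q2 : u / v <= 2 * u.
    by rewrite ler_pdivrMr//; nra.
  by apply: lerXn2r; rewrite ?nnegrE; nlra.
rewrite [`|_ `^ _|]ger0_norm ?powR_ge0//.
apply: le_trans (ler_pM (normr_ge0 _) (powR_ge0 _ _) (HC u u1) q) _.
have -> : u ^+ n.+2 = u ^+ n * u ^+ 2 by rewrite -exprD addn2.
rewrite exprMn le_eqVlt; apply/orP; left; apply/eqP; field.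
by rewrite ?expf_neq0 ?gt_eqF.
Qed.

Lemma powRB1_le v m : 2^-1 <= v -> v `^ (m - 1) <= 2 * v `^ m.
Proof.
move=> v2; have v0 : 0 < v by nlra.
by rewrite (powRS m v0); have := powR_ge0 v (m - 1); nra.
Qed.

Lemma G_le mu : exists2 C, 0 <= C & forall v, 2^-1 <= v -> `|G mu v| <= C * v `^ mu.
Proof.
have [C C0 HC] := Imom_le (mu - 1); have [n mn] := natr_ge_norm mu.
have /andP[c1 c2] := Hc.
have N0 : (0 : R) <= n.+3%:R ^+ n.+3 by rewrite exprn_ge0.
have M0 : 0 <= `|mu| by [].
exists (2 * `|mu| + n.+3%:R ^+ n.+3 + 2 * `|mu| * C) => [|v v2].
  have : 0 <= `|mu| * C by rewrite mulr_ge0.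
  nlra.
have v0 : 0 < v by nlra.
have p1 := powRB1_le mu v2; have p0 := powR_ge0 v (mu - 1); have p0' := powR_ge0 v mu.
have p2 : (v + 1) `^ mu <= n.+3%:R ^+ n.+3 * v `^ mu.
  apply: powR_ratio_le => //; first nlra.
    by rewrite -!natr1; have := ler0n R n; nra.
  by apply: le_trans mn _; rewrite ler_nat; lia.
have := HC v v2; set I := Imom _ _ => HI.
have h1 : `|- mu * v `^ (mu - 1)| <= `|mu| * (2 * v `^ mu).
  by rewrite normrM normrN (ger0_norm p0); apply: ler_wpM2l.
have h2 : `|c * (v + 1) `^ mu| <= n.+3%:R ^+ n.+3 * v `^ mu.
  rewrite ger0_norm ?mulr_ge0 ?powR_ge0//; [|nlra].
  by apply: le_trans p2; have := powR_ge0 (v + 1) mu; nra.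
have h3 : `|mu * I| <= `|mu| * (C * (2 * v `^ mu)).
  by rewrite normrM; apply: ler_wpM2l => //; apply: le_trans HI _; apply: ler_wpM2l.
rewrite GE; apply: le_trans (ler_normB _ _) _.
apply: le_trans (lerD (ler_normD _ _) (lexx _)) _.
by nlra.
Qed.

Lemma G_ge mu : 0 <= mu -> exists2 V, 1 <= V & forall v, V <= v -> c / 2 * v `^ mu <= G mu v.
Proof.
move=> mu0; have [C C0 HC] := Imom_le (mu - 1).
have /andP[c1 c2] := Hc; have c0 : 0 < c by nlra.
have pp : 0 <= mu * (1 + C) by rewrite mulr_ge0//; nlra.
exists (1 + 4 * mu * (1 + C)) => [|v hv]; first nlra.
have v1 : 1 <= v by nlra.
have v0 : 0 < v by nlra.
have v2 : 2^-1 <= v by nlra.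
have := HC v v2; rewrite GE; set I := Imom _ _; rewrite ler_norml => /andP[_ HI].
have p0 := powR_ge0 v (mu - 1).
have p1 : v `^ mu <= (v + 1) `^ mu by apply: ge0_ler_powR; rewrite ?nnegrE; nlra.
have e := powRS mu v0.
have h3 : mu * I <= mu * (C * v `^ (mu - 1)) by exact: ler_wpM2l.
have h4 : c * v `^ mu <= c * (v + 1) `^ mu by rewrite ler_wpM2l; nlra.
suff : mu * (1 + C) * v `^ (mu - 1) <= c / 2 * v `^ mu by nlra.
rewrite e mulrA; apply: ler_wpM2r => //; nra.
Qed.

Lemma powR_neg_small s e : 0 < s -> 0 < e -> exists2 x, 1 <= x & x `^ (- s) <= e.
Proof.
move=> s0 e0; exists (1 + (e^-1) `^ (s^-1)); first by rewrite lerDl powR_ge0.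
rewrite powRN -[leRHS]invrK lef_pV2 ?posrE ?invr_gt0//; last first.
  by rewrite powR_gt0// ltr_pwDl// powR_ge0.
have E : ((e^-1) `^ (s^-1)) `^ s = e^-1.
  by rewrite -powRrM mulVf ?gt_eqF// powRr1// invr_ge0 ltW.
rewrite -[leLHS]E; apply: ge0_ler_powR; rewrite ?nnegrE ?powR_ge0 ?(ltW s0)//.
  by rewrite addr_ge0 ?powR_ge0.
by rewrite lerDr.
Qed.

(** Here e^(-gamma) can be put back under the integral, which becomes one of w >= 0; s >= 1 makes (v
    + u)^(-s - 1) fall off like u^-2. *)
Lemma G_neg_large s v : 1 <= s -> 0 < v -> 0 < G (- s) v.
Proof.
move=> s1 v0; have s0 : 0 < s by nlra.
have vv : 0 <= v by exact: ltW.
have cw : cont1 bst by exact: buchstab_cont is_buchstab_buchstab.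
set k := - s - 1; have [c0 [C0 d0]] := @phi_powR v k vv.
have ck := @cont1_powR v k vv.
have le_inv u m : 1 <= u -> m <= 0 -> (v + u) `^ m <= u `^ m.
  move=> u1 m0; rewrite -[m]opprK !(powRN _ (- m)) lef_pV2 ?posrE ?powR_gt0; try nlra.
  by apply: ge0_ler_powR; rewrite ?nnegrE; nlra.
have dk : decay2 1 (fun u => (v + u) `^ k).
  move=> u u1; rewrite ger0_norm ?powR_ge0// mul1r.
  apply: le_trans (le_inv u k u1 _) _; first by rewrite /k; nlra.
  have -> : u ^- 2 = u `^ (- 2%:R) by rewrite powR_invn//; nlra.
  by apply: ler_powR => //; rewrite /k; nlra.
have P : primitive1 (fun u => (v + u) `^ k) (fun u => - s^-1 * (v + u) `^ (- s)).
  have D u : 0 < u -> is_derive u 1 (fun u => - s^-1 * (v + u) `^ (- s)) ((v + u) `^ k).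
    move=> u0; have -> : (fun u => - s^-1 * (v + u) `^ (- s)) = (fun u => - s^-1 * (u + v) `^ (- s)).
      by apply/funext => z; rewrite addrC.
    have uv : 0 < u + v by nlra.
    apply: (is_derive_eq (is_deriveZ' (- s^-1) (is_derive_powR (- s) uv))).
    by rewrite mulrA mulrNN mulVf ?gt_eqF// mul1r addrC.
  split=> [u u1||]; first by apply: D; nlra.
    exact: cont1_derive D.
  apply: (@cvg0_bound _ _ 1) => u u1.
  have si : 0 <= s^-1 by rewrite invr_ge0 ltW.
  rewrite mulNr normrN ger0_norm ?mulr_ge0 ?powR_ge0//.
  apply: ler_pM => //; rewrite ?powR_ge0 ?invr_ge0 ?(ltW s0)//; first by rewrite invf_le1.
  apply: le_trans (le_inv u (- s) u1 _) _; first nlra.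
  by rewrite -powR_inv1; [apply: ler_powR => //; nlra|nlra].
have E := J_primitive ck dk P.
have E2 := J_lin c c0 ck d0 dk.
have Jw : 0 <= J (fun u => ph u * (v + u) `^ k + c * (v + u) `^ k).
  apply: Rintegral_ge0 => u /=; rewrite in_itv/= andbT => u1.
  rewrite -mulrDl phE /phi subrK mulr_ge0 ?powR_ge0//.
  by have := buchstab_bounds is_buchstab_buchstab u1; nlra.
rewrite E2 E in Jw.
rewrite GE HImom -/k opprK; have -> : c * (v + 1) `^ (- s) = s * (c * (- (- s^-1 * (v + 1) `^ (- s)))).
  by field; rewrite gt_eqF.
have p : 0 < s * v `^ k by rewrite mulr_gt0// powR_gt0.
rewrite mulNr opprK; set j := J _ in Jw *; set q := c * _ in Jw *.
have h : 0 <= s * (j + q) by rewrite mulr_ge0// ltW.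
rewrite (_ : s * (c * _) = s * q); last by rewrite /q; ring.
by rewrite mulrDr in h; nlra.
Qed.

(** For -1 < mu < 0 the derivative is mu times a function already known to be positive, so [G mu]
    decreases strictly; being O(v^mu), it could not return from a negative value. *)
Lemma G_neg mu v : mu < 0 -> 0 < v -> 0 < G mu v.
Proof.
move=> mu0 v0; have [m1|m1] := leP 1 (- mu).
  by have := G_neg_large m1 v0; rewrite opprK.
have dec a b : 0 < a -> a < b -> G mu b < G mu a.
  move=> a0 ab; rewrite -ltrN2.
  apply: (@derive_gt0_lt_cc _ (fun t => - G mu t) (fun t => - (mu * G (mu - 1) t))) => //.
    by move=> x /andP[h _]; apply: is_deriveN; apply: G_is_derive; exact: lt_le_trans h.
  move=> x /andP[h _]; have x0 : 0 < x by exact: lt_trans h.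
  have h2 : 1 <= 1 - mu by nlra.
  have := G_neg_large h2 x0; rewrite opprB => h3; nra.
have ge0 a : 0 < a -> 0 <= G mu a.
  move=> a0; rewrite leNgt; apply/negP => neg.
  have [C C0 HC] := G_le mu.
  have e0 : 0 < - G mu a / (C + 1) by rewrite divr_gt0; nlra.
  have mm : 0 < - mu by nlra.
  have [x x1] := powR_neg_small mm e0; rewrite opprK => hx.
  pose b := Num.max x (a + 1).
  have xb : x <= b by rewrite le_max lexx.
  have ab : a < b by rewrite lt_max; apply/orP; right; nlra.
  have b1 : 1 <= b by exact: le_trans xb.
  have b2 : 2^-1 <= b by nlra.
  have := dec a b a0 ab; have := HC b b2; rewrite ler_norml => /andP[h1 _] h2.
  have h3 : b `^ mu <= x `^ mu.
    rewrite -[mu]opprK !(powRN _ (- mu)) lef_pV2 ?posrE ?powR_gt0//; [|nlra|nlra].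
    by apply: ge0_ler_powR; rewrite ?nnegrE; nlra.
  have h4 : b `^ mu <= - G mu a / (C + 1) by exact: le_trans hx.
  move: h4; rewrite ler_pdivlMr; last nlra.
  by have := powR_ge0 b mu; nra.
have v1 : v < v + 1 by nlra.
apply: le_lt_trans (dec _ _ v0 v1); apply: ge0; nlra.
Qed.

(** The derivative is the constant [G 0], and the delay equation at v = 1 fixes the additive
    constant. The zero at v = 1 is the origin of the value 1 of the exponent for i = 1. *)
Lemma G1 v : 1 <= v -> G 1 v = c * (v - 1).
Proof.
move=> v1; have D x : 0 < x -> is_derive x 1 (fun t => G 1 t - c * t) 0.
  move=> x0; have := is_deriveB' (G_is_derive 1 x0) (is_deriveZ' c (is_derive_id x 1)).
  by rewrite subrr G0 mulr1 mul1r subrr.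
have E x : 1 <= x -> G 1 1 - c * 1 = G 1 x - c * x.
  move=> x1; apply: (@derive0_eq _ (fun t => G 1 t - c * t)) => //.
    by move=> y /andP[h _]; apply: D; nlra.
  apply: (@is_derive_within _ _ (fun=> 0)) => y /andP[h _]; apply: D; nlra.
have S := G_shift 1 (ltr01 : 0 < (1 : R)).
rewrite subrr G0 mul0r addr0 !mul1r in S.
have h11 : (1 : R) <= 1 + 1 by nlra.
have := E v v1; have := E (1 + 1) h11; rewrite -S; nlra.
Qed.

Lemma gfunE v s : 0 < v -> gfun v^-1 s = v `^ (s + 1) * G (- s) v.
Proof.
move=> v0; have vv : 0 <= v by exact: ltW.
have [c0 [C0 d0]] := @phi_powR v (- s - 1) vv.
have e1 : (1 + v^-1) `^ s = (v + 1) `^ s / v `^ s.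
  have -> : 1 + v^-1 = (v + 1) * v^-1 by field; rewrite gt_eqF.
  by rewrite powRM ?invr_ge0//; [rewrite -powR_inv1// -powRrM mulN1r powRN|nlra].
rewrite /gfun.
have -> : (\int[lebesgue_measure]_(u in `[1%R, +oo[)
    ((@buchstab R u - expR (- euler_gamma R)) / (1 + v^-1 * u) `^ (s + 1))) =
    v `^ (s + 1) * Imom (- s - 1) v.
  rewrite HImom -(J_scale _ c0 d0); apply: eq_Rintegral => u; rewrite inE/= in_itv/= andbT => u1.
  have -> : 1 + v^-1 * u = (v + u) * v^-1 by field; rewrite gt_eqF.
  rewrite powRM ?invr_ge0//; last nlra.
  have -> : v^-1 `^ (s + 1) = (v `^ (s + 1))^-1 by rewrite -[v^-1]powR_inv1// -powRrM mulN1r powRN.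
  have -> : - s - 1 = - (s + 1) by ring.
  have p1 : (v + u) `^ (s + 1) != 0 by rewrite gt_eqF ?powR_gt0//; nlra.
  have p2 : v `^ (s + 1) != 0 by rewrite gt_eqF ?powR_gt0.
  rewrite powRN phE /phi egam.unlock; field.
  by rewrite p1 p2.
have p2 : v `^ (s + 1) != 0 by rewrite gt_eqF ?powR_gt0.
have p3 : v `^ s != 0 by rewrite gt_eqF ?powR_gt0.
have p4 : (v + 1) `^ s != 0 by rewrite gt_eqF ?powR_gt0//; nlra.
rewrite e1 GE opprK (_ : - s - 1 = - (s + 1)); last by ring.
rewrite !powRN (powRS (s + 1) v0) addrK egam.unlock in p2 *; field.
by rewrite p3 p4 gt_eqF.
Qed.

End GFamily.

(** * The exponent as a threshold of positivity: maximum principle and bounds *)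

Section Exponent.
Variable R : realType.
Implicit Types (f g : R -> R) (C l u v b x t m mu nu e th al be ka : R).

Local Notation c := (egam R).

(** Continuity in the index makes the threshold a zero. Each derivative in the exponent costs a
    factor ln(v + u) <= v + u, which the decay of [osc] absorbs. *)
Lemma G_continuous v mu : 1 <= v -> {for mu, continuous (fun m => G m v)}.
Proof.
move=> v1; have v0 : 0 < v by nlra. have vv : 0 <= v by nlra.
have cln : cont1 (fun u => ln (v + u)).
  apply: (@cont1_derive _ _ (fun u => (v + u)^-1 * (0 + 1))) => u u0.
  have vu : 0 < v + u by nlra.
  exact: (is_derive_comp' (is_derive1_ln vu) (is_deriveD' (is_derive_cst v u 1) (is_derive_id u 1))).
have lnb u : 1 <= u -> 0 <= ln (v + u) <= v + u.
  by move=> u1; rewrite ln_ge0; [apply/ltW/ln_sublinear; nlra|nlra].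
have Ider m : exists D, is_derive m 1 (fun k => Imom k v) D.
  have [n mn] := natr_ge_norm (`|m| + 1).
  have mn1 : m + 1 <= n%:R.
    by apply: le_trans mn; rewrite ger0_norm ?addr_ge0// lerD2r ler_norm.
  have [C0 C00 H0] := osc_decay R n.+4.
  pose B := (v + 1) ^+ n.+2.
  have B0 : 0 <= B by rewrite exprn_ge0//; nlra.
  have bnd s u : 1 <= u -> s <= n%:R -> `|ln (v + u) * (ln (v + u) * (v + u) `^ s)| <= B * u ^+ n.+2.
    move=> u1 sn; have /andP[l0 l1] := lnb u u1.
    rewrite ger0_norm ?mulr_ge0 ?powR_ge0//.
    apply: (@le_trans _ _ ((v + u) * ((v + u) * (v + u) ^+ n))).
      apply: ler_pM => //; first by rewrite mulr_ge0 ?powR_ge0.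
      apply: ler_pM => //; rewrite ?powR_ge0//.
      by apply: powR_le_exprn => //; nlra.
    rewrite -!exprS -exprMn; apply: lerXn2r; rewrite ?nnegrE; nra.
  have [c0 [C1 d0]] := @phi_powR R v m vv.
  have cL := cont1M cln (@cont1_powR R v m vv).
  have cphi : cont1 (@osc R) by exact: osc_cont.
  have dec k : (forall u, 1 <= u -> `|k u| <= B * u ^+ n.+2) -> decay2 (C0 * B) (fun u => osc u * k u).
    move=> Hk u u1; rewrite normrM.
    have u0 : 0 < u by nlra.
    apply: le_trans (ler_pM (normr_ge0 _) (normr_ge0 _) (H0 u u1) (Hk u u1)) _.
    have -> : u ^+ n.+4 = u ^+ n.+2 * u ^+ 2 by rewrite -exprD addn2.
    rewrite le_eqVlt; apply/orP; left; apply/eqP; field.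
    by rewrite ?expf_neq0 ?gt_eqF.
  have bnd1 u : 1 <= u -> `|ln (v + u) * (v + u) `^ m| <= B * u ^+ n.+2.
    move=> u1; have /andP[l0 l1] := lnb u u1.
    rewrite ger0_norm ?mulr_ge0 ?powR_ge0//.
    apply: (@le_trans _ _ ((v + u) * ((v + u) * (v + u) ^+ n))).
      apply: ler_pM => //; first by rewrite powR_ge0.
      have p0 : 0 <= (v + u) ^+ n by rewrite exprn_ge0//; nlra.
      apply: le_trans (_ : (v + u) ^+ n <= _); last by nra.
      by apply: powR_le_exprn => //; nlra.
    rewrite -!exprS -exprMn; apply: lerXn2r; rewrite ?nnegrE; nra.
  have bnd0 s u : s <= n%:R -> 1 <= u -> `|(v + u) `^ s| <= B * u ^+ n.+2.
    move=> sn u1; apply: le_trans (powR_shift_le vv (n := n.+2) _ u1) _ => //.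
    by apply: le_trans sn _; rewrite ler_nat; lia.
  exists (J (fun u => osc u * (ln (v + u) * (v + u) `^ m))).
  have -> : (fun k => Imom k v) = (fun k => J (fun u => osc u * (v + u) `^ k)).
    by apply/funext => k; rewrite Imom.unlock.
  have cK (s : R) : `|s - m| < 1 -> cont1 (fun u => osc u * (v + u) `^ s).
    by move=> _; have [] := @phi_powR R v s vv.
  have dK (s : R) : `|s - m| < 1 -> decay2 (C0 * B) (fun u => osc u * (v + u) `^ s).
    rewrite ltr_norml => /andP[h1 h2]; apply: dec => u u1; apply: bnd0 => //; nlra.
  have M0 : 0 <= C0 * B by rewrite mulr_ge0.
  apply: (@J_derive _ (fun s u => osc u * (v + u) `^ s) _ m (C0 * B) 1 _ _ ltr01 M0 cK dK
    (cont1M cphi cL) (dec _ bnd1)).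
  move=> h u hh u1.
  have -> : osc u * (v + u) `^ (m + h) - osc u * (v + u) `^ m - h * (osc u * (ln (v + u) * (v + u) `^ m)) =
    osc u * ((v + u) `^ (m + h) - (v + u) `^ m - h * (ln (v + u) * (v + u) `^ m)) by ring.
  rewrite normrM; have vu : 0 < v + u by nlra.
  have T : `|(v + u) `^ (m + h) - (v + u) `^ m - h * (ln (v + u) * (v + u) `^ m)| <= (B * u ^+ n.+2) * h ^+ 2.
    apply: (@taylor2 _ (fun s => (v + u) `^ s) (fun s => ln (v + u) * (v + u) `^ s)
      (fun s => ln (v + u) * (ln (v + u) * (v + u) `^ s)) m 1 _ _ _ _ h hh).
    - by move=> t _; exact: powR_exp_is_derive.
    - by move=> t _; exact: (is_deriveZ' _ (powR_exp_is_derive t vu)).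
    - by move=> t; rewrite ltr_norml => /andP[h1 h2]; apply: bnd => //; nlra.
  apply: le_trans (ler_pM (normr_ge0 _) (normr_ge0 _) (H0 u u1) T) _.
  have u0 : 0 < u by nlra.
  have -> : u ^+ n.+4 = u ^+ n.+2 * u ^+ 2 by rewrite -exprD addn2.
  rewrite le_eqVlt; apply/orP; left; apply/eqP; field.
  by rewrite ?expf_neq0 ?gt_eqF.
have [D HD] := Ider (mu - 1).
have v10 : 0 < v + 1 by nlra.
have HI := is_derive_shift' HD.
have Hp := is_derive_shift' (powR_exp_is_derive (mu - 1) v0).
have Hid := is_derive_id mu (1 : R).
have := is_deriveB' (is_deriveD' (is_deriveM' (is_deriveN (Hid)) Hp)
  (is_deriveZ' c (powR_exp_is_derive mu v10))) (is_deriveM' Hid HI).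
rewrite (_ : (fun m => G m v) = fun m => - m * v `^ (m + (-1)) + c * (v + 1) `^ m - m * Imom (m + (-1)) v).
  by move=> /is_derive_continuous.
by apply/funext => m; rewrite G.unlock.
Qed.

(** At a positive maximum q of f / g one has f' = q g', while f <= q g at the advanced point v + 1;
    the two inequalities then give (be - al) q g <= 0. As the equation looks forward, the maximum
    must be one over the whole half-line, and this is why f has to be negligible against g. *)
Lemma max_principle (a al be : R) f g (f' g' : R -> R) : 0 < a -> al < be ->
  (forall v, a <= v -> is_derive v 1 f (f' v)) ->
  (forall v, a <= v -> is_derive v 1 g (g' v)) ->
  (forall v, a <= v -> 0 < g v) ->
  (forall v, a <= v -> g (v + 1) + (be - 1) * g v <= v * g' v) ->
  (forall v, a <= v -> 0 < f v -> v * f' v <= f (v + 1) + (al - 1) * f v) ->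
  f a <= 0 ->
  (forall e, 0 < e -> exists V, forall v, V <= v -> f v <= e * g v) ->
  forall v, a <= v -> f v <= 0.
Proof.
move=> a0 ab df dg g0 Hg Hf fa lim v1 av1; rewrite leNgt; apply/negP => fv1.
have q1 : 0 < f v1 / g v1 by rewrite divr_gt0// g0.
have [V HV] := lim _ (divr_gt0 q1 (ltr0n R 2)).
(* Beyond b the quotient is at most half of its value at v1, so the maximum over [a, b] is the
   maximum over [a, oo). *)
pose b := Num.max V (v1 + 1).
have Vb : V <= b by rewrite le_max lexx.
have vb : v1 + 1 <= b by rewrite le_max lexx orbT.
have abb : a <= b by nlra.
have cq : {within `[a, b], continuous (fun v => f v / g v)}.
  apply: continuous_in_subspaceT => x; rewrite inE/= in_itv/= => /andP[ax _].
  apply: (@continuousM R R f (fun v => (g v)^-1)); first exact: is_derive_continuous (df x ax).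
  apply: continuousV; first by rewrite gt_eqF// g0.
  exact: is_derive_continuous (dg x ax).
have [v0] := EVT_max abb cq; rewrite in_itv/= => /andP[av0 v0b] mx.
set q := f v0 / g v0 in mx.
have qq : f v1 / g v1 <= q by apply: mx; rewrite in_itv/= av1; nlra.
have q0 : 0 < q by exact: lt_le_trans qq.
have all v : a <= v -> f v <= q * g v.
  move=> av; have [bv|vb'] := leP b v.
    apply: le_trans (HV v (le_trans Vb bv)) _.
    by apply: ler_wpM2r; [exact/ltW/g0|nlra].
  by rewrite -ler_pdivrMr ?g0//; apply: mx; rewrite in_itv/= av ltW.
have E : f v0 = q * g v0 by rewrite /q mulfVK// gt_eqF// g0.
have f0 : 0 < f v0 by rewrite E mulr_gt0// g0.
have av0' : a < v0.
  by rewrite lt_neqAle av0 andbT; apply/eqP => h; rewrite -h in f0; nlra.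
pose h := fun v => f v - q * g v.
have dh v : a <= v -> is_derive v 1 h (f' v - q * g' v).
  by move=> av; exact: (is_deriveB' (df v av) (is_deriveZ' q (dg v av))).
have aL : a <= v0 + 1 by nlra.
have I0 : v0 \in `]a, (v0 + 1)[%R by rewrite in_itv/= av0'; nlra.
have D0 : is_derive v0 1 h 0.
  apply: (derive1_at_max aL _ I0) => t; rewrite in_itv/= => /andP[at0 _].
    by have [] := dh t (ltW at0).
  by rewrite /h E subrr subr_le0; apply: all; exact: ltW.
have := is_derive_uniq (dh v0 av0) D0 => Z.
have := Hg v0 av0; have := Hf v0 av0 f0; have := all (v0 + 1) aL.
have -> : f' v0 = q * g' v0 by nlra.
rewrite E => h1 h2 h3.
have h4 : q * (g (v0 + 1) + (be - 1) * g v0) <= q * (v0 * g' v0) by rewrite ler_wpM2l// ltW.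
have h5 : 0 < (be - al) * (q * g v0) by rewrite mulr_gt0 ?subr_gt0// -E.
nlra.
Qed.

Lemma powR_little nu ka e : nu < ka -> 0 < e ->
  exists2 V, 1 <= V & forall v, V <= v -> v `^ nu <= e * v `^ ka.
Proof.
move=> nk e0; have s0 : 0 < ka - nu by rewrite subr_gt0.
have [V V1 HV] := powR_neg_small s0 e0; exists V => // v Vv.
have v0 : 0 < v by nlra.
have -> : nu = (- (ka - nu)) + ka by ring.
rewrite powRD; last by rewrite (gt_eqF v0) implybT.
apply: ler_wpM2r; first exact: powR_ge0.
apply: le_trans HV; rewrite !(powRN _ (ka - nu)) lef_pV2 ?posrE ?powR_gt0//; last nlra.
by apply: ge0_ler_powR; rewrite ?nnegrE; nlra.
Qed.

Lemma powR_expR_little l th e : 0 < th -> 0 < e ->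
  exists2 V, 1 <= V & forall v, V <= v -> v `^ l <= e * expR (th * v).
Proof.
move=> th0 e0; have [n ln'] := natr_ge_norm l.
have l1 : l <= n%:R by exact: le_trans (ler_norm _) ln'.
pose k := (th / n.+1%:R) ^+ n.+1.
have k0 : 0 < k by rewrite exprn_gt0// divr_gt0.
exists (1 + (e * k)^-1) => [|v hv]; first by rewrite lerDl invr_ge0 mulr_ge0// ltW.
have q0 : 0 < (e * k)^-1 by rewrite invr_gt0 mulr_gt0.
have v0 : 0 < v by nlra.
have v1 : 1 <= v by nlra.
apply: le_trans (powR_le_exprn v1 l1) _.
have -> : th * v = (th * v / n.+1%:R) * n.+1%:R by rewrite divfK.
rewrite expRM_natr.
have h : k * v ^+ n.+1 <= expR (th * v / n.+1%:R) ^+ n.+1.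
  rewrite /k -exprMn; apply: lerXn2r; rewrite ?nnegrE ?expR_ge0//.
    by rewrite !mulr_ge0// ltW.
  have := expR_ge1Dx (th * v / n.+1%:R).
  by rewrite (mulrAC th v) => h; apply: le_trans h; rewrite lerDr.
apply: (@le_trans _ _ (e * (k * v ^+ n.+1))); last by rewrite ler_wpM2l// ltW.
rewrite exprS !mulrA ler_peMl ?exprn_ge0 ?(ltW v0)//.
have : (e * k)^-1 <= v by nlra.
by rewrite -[X in X <= _]mul1r ler_pdivrMr ?mulr_gt0// mulrC.
Qed.

Section Base.
Variable a : R.
Hypothesis a1 : 1 <= a.

Let a0 : 0 < a. Proof. exact: lt_le_trans a1. Qed.

Local Ltac alra := have ? := a1; nlra.
Local Ltac anra := have ? := a1; nra.

Definition Gpos mu := forall v, a <= v -> 0 < G mu v.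

Lemma Gpos_neg mu : mu <= 0 -> Gpos mu.
Proof.
rewrite le_eqVlt => /predU1P[->|mu0] v av; last by apply: G_neg => //; alra.
by rewrite G0; have /andP[] := (buchstab_facts R).1; alra.
Qed.

(** If [G nu] were nonpositive at some v1, comparison with [G ka] from v1 on would keep it
    nonpositive, against its growth like a positive multiple of v^nu; nu < ka also makes it
    negligible against [G ka]. *)
Lemma Gpos_down nu ka : 0 <= nu -> nu < ka -> Gpos ka -> Gpos nu.
Proof.
move=> nu0 nk P v1 av1; rewrite ltNge; apply/negP => neg.
have [C C0 HC] := G_le nu.
have ka0 : 0 <= ka by alra.
have [V V1 HV] := G_ge ka0; have [W W1 HW] := G_ge nu0.
have v10 : 0 < v1 by alra.
have /andP[c1 c2] := (buchstab_facts R).1; have c0 : 0 < c by alra.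
have H : forall v, v1 <= v -> G nu v <= 0.
  apply: (max_principle v10 nk (f' := fun v => nu * G (nu - 1) v) (g := G ka) (g' := fun v => ka * G (ka - 1) v)) => //.
  - by move=> v h; apply: G_is_derive; alra.
  - by move=> v h; apply: G_is_derive; alra.
  - by move=> v h; apply: P; alra.
  - by move=> v h; rewrite G_shift//; alra.
  - by move=> v h _; rewrite G_shift//; alra.
  move=> e e0; have e1 : 0 < e * (c / 2) / (C + 1) by rewrite divr_gt0 ?mulr_gt0//; nlra.
  have [X X1 HX] := powR_little nk e1.
  exists (Num.max X V) => v; rewrite ge_max => /andP[Xv Vv].
  have v2 : 2^-1 <= v by alra.
  have := HX v Xv; rewrite mulrAC ler_pdivlMr; last alra.
  have := HV v Vv; have := HC v v2; rewrite ler_norml => /andP[_ h1] h2.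
  have h3 : e * (c / 2 * v `^ ka) <= e * G ka v by rewrite ler_wpM2l// ltW.
  by have := powR_ge0 v nu; alra.
have := HW (Num.max W v1); rewrite le_max lexx => /(_ isT).
have := H (Num.max W v1); rewrite le_max lexx orbT => /(_ isT) h1 h2.
have : 0 < (Num.max W v1) `^ nu by rewrite powR_gt0// lt_max v10 orbT.
by anra.
Qed.

Lemma Gpos_step nu : 0 < nu -> Gpos (nu - 1) -> 0 <= G nu a ->
  forall v, a < v -> G nu a < G nu v.
Proof.
move=> nu0 P Ga v av.
apply: (@derive_gt0_lt_cc _ (G nu) (fun t => nu * G (nu - 1) t)) => //.
  by move=> x /andP[h _]; apply: G_is_derive; alra.
by move=> x /andP[h _]; rewrite mulr_gt0//; apply: P; exact: ltW.
Qed.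

(** A subsolution that is positive somewhere, but neither at a nor near infinity, contradicts the
    maximum principle against [G be]; its eventual sign makes the growth condition free. *)
Lemma sub_not_Gpos al be f (f' : R -> R) : 0 <= be -> al < be ->
  (forall v, a <= v -> is_derive v 1 f (f' v)) ->
  (forall v, a <= v -> 0 < f v -> v * f' v <= f (v + 1) + (al - 1) * f v) ->
  f a <= 0 -> (exists V, forall v, V <= v -> f v <= 0) ->
  (exists2 v, a <= v & 0 < f v) -> ~ Gpos be.
Proof.
move=> be0 ab df Hf fa [V HV] [v1 av1 fv1] P.
suff : f v1 <= 0 by alra.
apply: (max_principle a0 ab df (g := G be) (g' := fun v => be * G (be - 1) v)) => //.
- by move=> v h; apply: G_is_derive; alra.
- by move=> v h; rewrite G_shift//; alra.
move=> e e0; exists (Num.max V a) => v; rewrite ge_max => /andP[Vv av].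
by apply: le_trans (HV v Vv) _; rewrite mulr_ge0// ltW//; apply: P.
Qed.

(** The subsolution is an exponential of rate th times a parabola positive on (a, a + b). With e^th
    close to a, the advance by 1 adds about e^th times the derivative of the parabola, which
    compensates the term v times that derivative. What remains is the exponent a th - e^th of a pure
    exponential, about a ln a - a, plus a loss th b. *)
Lemma bump_not_Gpos be : a * ln a - a + 4 * Num.sqrt a * ln a + 5 < be -> ~ Gpos be.
Proof.
pose s : R := Num.sqrt a; rewrite -/s; have s2 : s ^+ 2 = a by rewrite sqr_sqrtr// ltW.
have s1 : 1 <= s by rewrite -sqrtr1 ler_wsqrtr.
have l0 : 0 <= ln a by exact: ln_ge0.
(* b^2 = 16 a is large enough to absorb the term a eta (b - 2 x) in 2 x (b - x), and b is what
   multiplies ln a in the bound; eta b = 2 keeps the other errors bounded. *)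
pose b : R := 4 * s; pose eta : R := 2 / b; pose E := a * (1 + eta); pose th := ln E.
have b4 : 4 <= b by rewrite /b; alra.
have eb : eta * b = 2 by rewrite /eta; field; alra.
have eta0 : 0 < eta by rewrite divr_gt0//; alra.
have E0 : 0 < E by rewrite mulr_gt0//; alra.
have thE : expR th = E by rewrite lnK.
have th_le : th <= ln a + eta.
  rewrite /th lnM ?posrE//; last alra.
  by rewrite lerD2l; apply: le_ln1Dx; alra.
have th0 : 0 <= th by apply: ln_ge0; rewrite /E; anra.
move=> hbe; pose al := th * (b + a) - E + 3.
have bb : b ^+ 2 = 16 * a by rewrite /b exprMn s2; ring.
have albe : al < be.
  apply: le_lt_trans hbe; rewrite /al /E.
  have h1 : th * (b + a) <= (ln a + eta) * (b + a) by rewrite ler_wpM2r//; alra.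
  have h2 : (ln a + eta) * (b + a) - a * (1 + eta) = a * ln a - a + b * ln a + eta * b by ring.
  rewrite eb in h2; rewrite -/s -/b; alra.
pose f := fun v => expR (th * (v - a)) * ((v - a) * (b - (v - a))).
pose f' := fun v => expR (th * (v - a)) * (th * ((v - a) * (b - (v - a))) + (b - 2 * (v - a))).
have e_pos x : 0 < expR x by exact: expR_gt0.
have be0 : 0 <= be.
  apply: le_trans (ltW hbe); have : 0 <= 4 * s * ln a by rewrite !mulr_ge0//; alra.
  have : a - 1 <= a * ln a.
    have := le_ln1Dx (_ : -1 < a^-1 - 1); rewrite ltrBrDr addNr invr_gt0 => /(_ a0).
    rewrite addrC subrK lnV// => h.
    have : a * (- ln a) <= a * (a^-1 - 1) by rewrite ler_wpM2l// ltW.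
    by rewrite mulrBr divff ?gt_eqF//; alra.
  alra.
apply: (@sub_not_Gpos al be f f') => //.
- move=> v _; rewrite /f /f'.
  have D0 : is_derive v 1 (fun v => v - a) 1.
    by have := is_deriveB' (is_derive_id v 1) (is_derive_cst a v 1); rewrite subr0.
  have D1 := is_derive_comp' (g := fun v => th * (v - a)) (is_derive_expR _) (is_deriveZ' th D0).
  have D2 := is_deriveM' D0 (is_deriveB' (is_derive_cst b v 1) D0).
  by apply: (is_derive_eq (is_deriveM' D1 D2)); rewrite /cst; ring.
- move=> v av; rewrite /f => fp; have {fp} : 0 < (v - a) * (b - (v - a)).
    by move: fp; rewrite pmulr_rgt0.
  set x := v - a => P0.
  have x0 : 0 <= x by rewrite subr_ge0.
  have xb : x <= b by rewrite leNgt; apply/negP => h; anra.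
  rewrite /f' -/x (_ : v + 1 - a = x + 1); last by rewrite /x; ring.
  rewrite (mulrDr th x 1) mulr1 expRD thE (_ : v = x + a); last by rewrite /x; ring.
  set P := x * (b - x) in P0 *.
  have -> : (x + 1) * (b - (x + 1)) = P + b - 2 * x - 1 by rewrite /P; ring.
  have key : (x + a) * (th * P + (b - 2 * x)) <= E * (P + b - 2 * x - 1) + (al - 1) * P.
    have k1 : th * (x + a) * P <= th * (b + a) * P.
      by rewrite ler_wpM2r ?(ltW P0)// ler_wpM2l//; alra.
    have k2 : (x - a * eta) * (b - 2 * x) + E <= 2 * P.
      have k3 : a * eta * (2 * x) <= b * x.
        have b0 : 0 < b by nlra.
        have h : 4 * a * eta <= 2 * b.
          by rewrite -(ler_pM2r b0) -(mulrA (4 * a)) eb -(mulrA 2 b b) -expr2 bb; alra.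
        by nra.
      have k4 : a * eta * b = 2 * a by rewrite -mulrA eb mulrC.
      have k5 : a * eta <= a by anra.
      rewrite /P /E; anra.
    have k3 : (x + a) * (b - 2 * x) - E * (b - 2 * x) = (x - a * eta) * (b - 2 * x) by rewrite /E; ring.
    rewrite /al; clearbody P E al th; nlra.
  have := e_pos (th * x); set X := expR _ => X0.
  have := ler_wpM2l (ltW X0) key; alra.
- by rewrite /f subrr mul0r mulr0.
- exists (a + b) => v h; rewrite /f mulr_ge0_le0 ?expR_ge0//.
  by rewrite mulr_ge0_le0//; alra.
- exists (a + 1); first alra.
  by rewrite /f (_ : a + 1 - a = 1); [rewrite mulr_gt0 ?expR_gt0//; nlra|ring].
Qed.

Let S : set R := [set mu | 0 <= mu /\ Gpos mu].

Let S_sup : has_sup S.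
Proof.
split; first by exists 0; split => //; exact: Gpos_neg.
exists (a * ln a - a + 4 * Num.sqrt a * ln a + 5) => mu [_ P].
by rewrite leNgt; apply/negP => /bump_not_Gpos.
Qed.

Let l := sup S.

Let S0 : S 0. Proof. by split => //; exact: Gpos_neg. Qed.

Let l_ge0 : 0 <= l. Proof. exact: sup_upper_bound S0. Qed.

Let Gpos_lt mu : mu < l -> Gpos mu.
Proof.
move=> mul; have [/Gpos_neg//|mu0] := leP mu 0.
have e0 : 0 < l - mu by rewrite subr_gt0.
have [nu [nu0 Pnu]] := sup_adherent e0 S_sup; rewrite subKr => mn.
exact: (Gpos_down (ltW mu0) mn Pnu).
Qed.

Let l_not mu : l < mu -> ~ Gpos mu.
Proof.
move=> lm P; have : mu <= l by apply: sup_upper_bound => //; split => //; have ? := l_ge0; nlra.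
alra.
Qed.

(* If [G l] were positive at [a] it would stay so for slightly larger exponents. *)
Let G_l_a_le0 : G l a <= 0.
Proof.
rewrite leNgt; apply/negP => Gl.
have /cvgrPdist_lt/(_ _ Gl)[r /= r0 Hr] := @G_continuous a l a1.
pose d := Num.min (r / 2) 2^-1.
have d0 : 0 < d by rewrite lt_min; apply/andP; split; alra.
have d1 : d <= 2^-1 by rewrite ge_min lexx orbT.
have dr : d <= r / 2 by rewrite ge_min lexx.
have : ball_ Num.norm l r (l + d).
  by rewrite /ball_/= opprD addNKr normrN gtr0_norm//; alra.
move=> /Hr; rewrite ltr_norml => /andP[_ h].
have pa : 0 < G (l + d) a by alra.
have P1 : Gpos (l + d - 1) by apply: Gpos_lt; alra.
apply: (@l_not (l + d)); first alra.
move=> v; rewrite le_eqVlt => /predU1P[<-//|av].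
by apply: lt_trans pa _; apply: Gpos_step => //; have ? := l_ge0; nlra.
Qed.

Let l_gt0 : 0 < l.
Proof.
rewrite lt_neqAle l_ge0 andbT eq_sym; apply/eqP => l0.
have := G_l_a_le0; rewrite l0 G0; have /andP[] := (buchstab_facts R).1; alra.
Qed.

Let G_l_a : G l a = 0.
Proof.
apply/eqP; rewrite eq_le G_l_a_le0/= leNgt; apply/negP => neg.
have e0 : 0 < - G l a by rewrite oppr_gt0.
have /cvgrPdist_lt/(_ _ e0)[r /= r0 Hr] := @G_continuous a l a1.
have : ball_ Num.norm l r (l - r / 2).
  by rewrite /ball_/= subKr gtr0_norm//; alra.
move=> /Hr; rewrite ltr_norml => /andP[h _].
by have := Gpos_lt (_ : l - r / 2 < l) (lexx a); alra.
Qed.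

(** Below the supremum [G] is positive at a, so -l is the largest zero of g; a largest zero is
    unique, hence it is the one that [xget] returns. *)
Let lambdaE : lambda (a^-1) = l.
Proof.
have Z : is_largest_zero (gfun a^-1) (- l).
  split; first by rewrite gfunE// opprK G_l_a mulr0.
  move=> t; rewrite gfunE// => /eqP; rewrite mulf_eq0 gt_eqF ?powR_gt0//= => /eqP Gt.
  rewrite leNgt; apply/negP => tl.
  by have := Gpos_lt (_ : - t < l) (lexx a); alra.
rewrite /lambda; case: xgetP => [s _ [Zs Ms]|/(_ _ Z)//].
have h1 := Ms _ Z.1; have h2 := Z.2 _ Zs; alra.
Qed.

(** The counting argument uses lambda only through these facts. *)
Lemma lambda_spec : [/\ 0 < lambda a^-1, G (lambda a^-1) a = 0,
  forall mu, mu < lambda a^-1 -> Gpos mu & forall v, a < v -> 0 < G (lambda a^-1) v].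
Proof.
rewrite lambdaE; split => // v av.
have h1 : Gpos (l - 1) by apply: Gpos_lt; nlra.
have h2 : 0 <= G l a by rewrite G_l_a.
by have := Gpos_step l_gt0 h1 h2 av; rewrite G_l_a.
Qed.

Lemma lambda_upper : lambda a^-1 <= a * ln a - a + 4 * Num.sqrt a * ln a + 5.
Proof.
rewrite lambdaE; apply: ge_sup; first by exists 0.
by move=> mu [_ P]; rewrite leNgt; apply/negP => /bump_not_Gpos.
Qed.

(** A subsolution at al excludes positivity at every larger index, in particular halfway between al
    and lambda if al were smaller. *)
Lemma lambda_le al f (f' : R -> R) : 0 <= al ->
  (forall v, a <= v -> is_derive v 1 f (f' v)) ->
  (forall v, a <= v -> 0 < f v -> v * f' v <= f (v + 1) + (al - 1) * f v) ->
  f a <= 0 -> (exists V, forall v, V <= v -> f v <= 0) ->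
  (exists2 v, a <= v & 0 < f v) -> lambda a^-1 <= al.
Proof.
move=> al0 df Hf fa fV fv; rewrite leNgt; apply/negP => hl.
have h1 : al < (al + lambda a^-1) / 2 by alra.
have h2 : (al + lambda a^-1) / 2 < lambda a^-1 by alra.
apply: (sub_not_Gpos _ h1 df Hf fa fV fv); first alra.
by have [_ _ P _] := lambda_spec; exact: P.
Qed.

(** If lambda < be, comparing [G lambda], which vanishes at a, with the supersolution would make it
    nonpositive at a + 1. Monotonicity of g provides the growth that makes [G lambda] negligible. *)
Lemma lambda_ge be g (g' : R -> R) :
  (forall v, a <= v -> is_derive v 1 g (g' v)) ->
  (forall v, a <= v -> 0 < g v) ->
  (forall v, a <= v -> 0 <= g' v) ->
  (forall v, a <= v -> g (v + 1) + (be - 1) * g v <= v * g' v) ->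
  be <= lambda a^-1.
Proof.
move=> dg g0 ig Hg; rewrite leNgt; apply/negP => hl.
have [l0 Ga _ Gp] := lambda_spec; set la := lambda _ in hl l0 Ga Gp.
have a2 : a < a + 1 by nlra.
suff : G la (a + 1) <= 0 by have := Gp _ a2; nlra.
have [C C0 HC] := G_le la.
apply: (max_principle a0 hl (f' := fun v => la * G (la - 1) v) _ dg g0 Hg) => //; last nlra.
- by move=> v h; apply: G_is_derive; alra.
- by move=> v h _; rewrite G_shift//; alra.
- by rewrite Ga.
(* [g] increases, so [v g' >= be g] and [g] grows at least like [v `^ be]. *)
have gr v : a <= v -> g a * a `^ (- be) <= g v * v `^ (- be).
  move=> av; apply: (@derive_ge0_le_cc _ (fun t => g t * t `^ (- be))
    (fun t => g' t * t `^ (- be) + g t * (- be * t `^ (- be - 1)))) => //.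
    move=> x /andP[ax _]; apply: is_deriveM'; first exact: dg.
    have x00 : 0 < x + 0 by alra.
    have := is_derive_powR (- be) x00; rewrite addr0.
    by rewrite (_ : (fun t => (t + 0) `^ (- be)) = fun t => t `^ (- be))//; apply/funext => t; rewrite addr0.
  move=> x /andP[ax _]; have x0 : 0 < x by alra.
  rewrite (powRS (- be) x0).
  have -> : g' x * (x * x `^ (- be - 1)) + g x * (- be * x `^ (- be - 1)) =
    x `^ (- be - 1) * (x * g' x - be * g x) by ring.
  rewrite mulr_ge0 ?powR_ge0// subr_ge0.
  have x1 : x <= x + 1 by nlra.
  have : g x <= g (x + 1).
    apply: (derive_ge0_le_cc x1 (df := g')) => y /andP[h _]; first by apply: dg; nlra.
    by apply: ig; nlra.
  by have := Hg x (ltW ax); nlra.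
have k0 : 0 < g a * a `^ (- be) by rewrite mulr_gt0 ?powR_gt0// g0.
move=> e e0; have e1 : 0 < e * (g a * a `^ (- be)) / (C + 1).
  by rewrite divr_gt0 ?mulr_gt0// ?powR_gt0 ?g0//; nlra.
have [V V1 HV] := powR_little hl e1.
exists (Num.max V a) => v; rewrite ge_max => /andP[Vv av].
have v2 : 2^-1 <= v by nlra.
have v0 : 0 < v by nlra.
have h2 : g a * a `^ (- be) * v `^ be <= g v.
  have := gr v av; rewrite [X in _ <= _ * X]powRN.
  by rewrite ler_pdivlMr ?powR_gt0.
have := HV v Vv; rewrite mulrAC ler_pdivlMr; last nlra.
have := HC v v2; rewrite ler_norml => /andP[_ h1] h3.
have h4 : e * (g a * a `^ (- be) * v `^ be) <= e * g v by rewrite ler_wpM2l// ltW.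
by have := powR_ge0 v la; nlra.
Qed.

(* Subtracting a small multiple of an exponential makes [f] eventually negative, and the
   slack in the differential inequality absorbs the error on compact sets. *)
Lemma lambda_le_slack al f (f' : R -> R) C th th' : 0 <= al -> 0 < th -> th < th' -> 0 <= C ->
  (forall v, a <= v -> is_derive v 1 f (f' v)) ->
  (forall v, a <= v -> v * f' v <= f (v + 1) + (al - 1) * f v) ->
  (forall V, exists2 r : R, 0 < r & forall v, a <= v <= V -> v * f' v + r <= f (v + 1) + (al - 1) * f v) ->
  (forall v, a <= v -> f v <= C * expR (th * v)) ->
  f a <= 0 -> (exists2 v, a <= v & 0 < f v) -> lambda a^-1 <= al.
Proof.
move=> al0 th0 thh C0 df Hf Hr fC fa [v1 av1 fv1].
have th1 : 0 < th' by nlra.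
pose Y : R := expR th'; have Y0 : 0 < Y by exact: expR_gt0.
pose V0 : R := a + (Y + al) / th'.
have [r r0 Hr0] := Hr V0.
have E0 v : 0 < expR (th' * v) by exact: expR_gt0.
pose eta := Num.min (r / (expR (th' * V0) * (Y + al))) (f v1 / (2 * expR (th' * v1))).
have Ea : 0 < Y + al by nlra.
have eta0 : 0 < eta.
  by rewrite lt_min !divr_gt0// mulr_gt0.
have eta1 : eta * (expR (th' * V0) * (Y + al)) <= r.
  by rewrite -ler_pdivlMr ?mulr_gt0// ge_min lexx.
have eta2 : eta * (2 * expR (th' * v1)) <= f v1.
  by rewrite -ler_pdivlMr ?mulr_gt0// ge_min lexx orbT.
have dE v : is_derive v 1 (fun v => expR (th' * v)) (expR (th' * v) * (th' * 1)).
  exact: (is_derive_comp' (g := fun v => th' * v) (is_derive_expR _) (is_deriveZ' th' (is_derive_id v 1))).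
apply: (@lambda_le _ (fun v => f v - eta * expR (th' * v)) (fun v => f' v - eta * (expR (th' * v) * (th' * 1)))) => //.
- by move=> v av; exact: (is_deriveB' (df v av) (is_deriveZ' eta (dE v))).
- move=> v av _; rewrite (mulrDr th' v 1) mulr1 expRD -/Y.
  have e0 := E0 v; set X := expR (th' * v) in e0 *.
  have [vV|Vv] := leP v V0.
    have h := Hr0 v; rewrite av vV in h; have {}h := h isT.
    have XV : X <= expR (th' * V0) by rewrite ler_expR ler_wpM2l// ltW.
    have h1 : eta * (X * (Y + al)) <= r.
      by apply: le_trans eta1; rewrite ler_wpM2l ?(ltW eta0)// ler_wpM2r// ltW.
    have h2 : 0 <= eta * (v * (X * th')).
      have v0 : 0 <= v by alra.
      have Xt : 0 <= X * th' by rewrite mulr_ge0// ltW.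
      by rewrite mulr_ge0 ?(ltW eta0)//; exact: mulr_ge0.
    have h3 : 0 <= eta * X by rewrite mulr_ge0// ltW.
    nlra.
  have h := Hf v av.
  have h1 : Y + al <= v * th'.
    rewrite -ler_pdivrMr//; apply: le_trans (ltW Vv); rewrite /V0; alra.
  have h2 : (eta * X) * (Y + al) <= (eta * X) * (v * th').
    by rewrite ler_wpM2l// mulr_ge0// ltW.
  have h3 : 0 <= eta * X by rewrite mulr_ge0// ltW.
  nlra.
- have h : 0 < eta * expR (th' * a) by exact: mulr_gt0.
  nlra.
- have d0 : 0 < th' - th by rewrite subr_gt0.
  have e1 : 0 < eta / (C + 1) by rewrite divr_gt0//; nlra.
  have [V V1 HV] := powR_expR_little 0 d0 e1.
  exists (Num.max V a) => v; rewrite ge_max => /andP[Vv av].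
  have := HV v Vv; rewrite powRr0 mulrAC ler_pdivlMr; last nlra.
  have := fC v av; have -> : th' * v = (th' - th) * v + th * v by ring.
  rewrite expRD; have := expR_gt0 (th * v); have := expR_gt0 ((th' - th) * v).
  set X := expR _; set Z := expR _ => X0 Z0 h1; rewrite mul1r => h2.
  have : Z * (C + 1) <= Z * (eta * X) by rewrite ler_wpM2l// ltW.
  nlra.
- by exists v1 => //; have := E0 v1; nlra.
Qed.

(** The exponential of rate th is a supersolution for the exponent a th - e^th + 1, which is largest
    at th = ln a. *)
Lemma lambda_lower : a * ln a - a + 1 <= lambda a^-1.
Proof.
have [l0 _ _ _] := lambda_spec.
have [a_1|an1] := eqVneq a 1.
  by apply: le_trans (ltW l0); rewrite a_1 ln1; nlra.
have a2 : 1 < a by rewrite lt_neqAle eq_sym an1.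
have th0 : 0 < ln a by rewrite ln_gt0.
apply: (@lambda_ge _ (fun v => expR (ln a * v)) (fun v => expR (ln a * v) * ln a)).
- move=> v _; have := is_deriveZ' (ln a) (is_derive_id v 1); rewrite mulr1 => D.
  exact: (is_derive_comp' (is_derive_expR _) D).
- by move=> v _; exact: expR_gt0.
- by move=> v _; rewrite mulr_ge0 ?expR_ge0// ltW.
- move=> v av; rewrite mulrDr mulr1 expRD lnK//.
  have := expR_gt0 (ln a * v); set X := expR _ => X0.
  have X1 := ltW X0; have t1 := ltW th0.
  have : 0 <= X * ((v - a) * ln a) by rewrite !mulr_ge0//; nlra.
  alra.
Qed.

End Base.

Lemma lambda1 : lambda (1 : R) = 1.
Proof.
have [] := @lambda_spec 1 (lexx 1); rewrite invr1; set la := lambda 1 => l0 G1a P _.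
apply/eqP; rewrite eq_le; apply/andP; split; rewrite leNgt; apply/negP => h.
  by have := P 1 h 1 (lexx _); rewrite G1// subrr mulr0 ltxx.
(* la < 1 : G la (2) - G la 1 = la (G (la - 1) 1 - G la 1), against the mean value theorem *)
have S := G_shift la (ltr01 : 0 < (1 : R)).
have h12 : (1 : R) < 1 + 1 by rewrite ltrDl.
have D (x : R) : 1 <= x <= 1 + 1 -> is_derive x 1 (G la) (la * G (la - 1) x).
  by move=> /andP[h1 _]; apply: G_is_derive; nlra.
have [x /andP[x1 x2] Ex] := mean_value_cc h12 D.
have : G (la - 1) x < G (la - 1) 1.
  rewrite -ltrN2; apply: (@derive_gt0_lt_cc _ (fun t => - G (la - 1) t) (fun t => - ((la - 1) * G (la - 1 - 1) t))) => //.
    by move=> y /andP[h1 _]; apply: is_deriveN; apply: G_is_derive; nlra.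
  move=> y /andP[h1 _]; have : 0 < G (la - 1 - 1) y by apply: G_neg; nlra.
  by nra.
rewrite G1a mulr0 addr0 mul1r in S; rewrite G1a subr0 -S addrK mulr1 in Ex.
move/eqP: Ex; rewrite -subr_eq0 -mulrBr mulf_eq0 gt_eqF//= subr_eq0 => /eqP ->.
by rewrite ltxx.
Qed.

Lemma lambda_asymptotic : exists e : nat -> R, e @ \oo --> (0 : R) /\
  forall i, (0 < i)%N -> lambda (i%:R^-1 : R) = i%:R * (ln (i%:R : R) - 1 + e i).
Proof.
exists (fun i => lambda (i%:R^-1 : R) / i%:R - ln (i%:R : R) + 1); split; last first.
  move=> i i0; have i1 : (i%:R : R) != 0 by rewrite pnatr_eq0 -lt0n.
  by field.
apply/cvgrPdist_le => e e0; near=> i.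
have i1 : (1 : R) <= i%:R.
  by rewrite ler1n; near: i; exact: nbhs_infty_gt.
(* With r = i^(1/4) and ln i <= 4 r, the gap 4 sqrt(i) ln i + 5 is at most (16 + 5) r^3, and 21 r^3
   <= e i as soon as r >= 21 / e. *)
have ie : (21 / e) ^+ 4 <= i%:R by near: i; exact: nbhs_infty_ger.
have i0 : (0 : R) < i%:R by nlra.
pose s : R := Num.sqrt i%:R; pose r : R := Num.sqrt s.
have s2 : s ^+ 2 = i%:R by rewrite sqr_sqrtr// ltW.
have s1 : 1 <= s by rewrite -sqrtr1 ler_wsqrtr.
have r2 : r ^+ 2 = s by rewrite sqr_sqrtr//; nlra.
have r1 : 1 <= r by rewrite -sqrtr1 ler_wsqrtr.
have r0 : 0 < r by nlra.
have r4 : r ^+ 4 = i%:R by rewrite -s2 -r2 -exprM.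
have er : 21 / e <= r.
  rewrite -(@ler_pXn2r _ 4)// ?r4// nnegrE; last nlra.
  by rewrite divr_ge0// ltW.
have L := lambda_lower i1; have U := lambda_upper i1; rewrite -/s in U.
have lnr : ln (i%:R : R) <= 4 * r.
  by rewrite -r4 lnXn// -[_ *+ 4]mulr_natl ler_wpM2l//; apply/ltW/ln_sublinear.
set l := lambda _ in L U *; set g := ln _ in L U lnr *.
rewrite sub0r normrN.
have E : l / i%:R - g + 1 = (l - (i%:R * g - i%:R)) / i%:R by field; rewrite gt_eqF.
rewrite E ger0_norm; last by rewrite divr_ge0//; nlra.
rewrite ler_pdivrMr//.
have h1 : 4 * s * g <= 4 * s * (4 * r) by rewrite ler_wpM2l//; nlra.
have h2 : 21 * r ^+ 3 <= e * i%:R.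
  have h : 21 <= e * r by move: er; rewrite ler_pdivrMr// mulrC.
  have r3 : 0 <= r ^+ 3 by rewrite exprn_ge0// ltW.
  have -> : e * i%:R = e * r * r ^+ 3 by rewrite -r4; ring.
  by apply: ler_wpM2r.
have h3 : 1 <= r ^+ 3 by rewrite exprn_ege1.
have h4 : s * r = r ^+ 3 by rewrite -r2 -exprSr.
nlra.
Unshelve. all: by end_near.
Qed.

End Exponent.

(** * Decimals of the exponent *)

Section GeometricSeries.
Variable R : realType.
Implicit Types (a b : nat -> R) (C r m : R).

Definition geo C r a := forall k, `|a k| <= C * r ^+ k.

Definition Ser a : R := limn (series a).

Lemma geo_cvg C r a : 0 <= r < 1 -> geo C r a -> cvgn (series a).
Proof.
move=> /andP[r0 r1] H; apply: normed_cvg.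
have C0 : 0 <= C by have := H 0%N; rewrite expr0 mulr1; apply: le_trans.
apply: (@series_le_cvg _ _ (geometric C r)) => [n|n|n|] /=; rewrite ?mulr_ge0 ?exprn_ge0//.
by apply: is_cvg_geometric_series; rewrite ger0_norm.
Qed.

Lemma Ser_lin m a b C C' r : 0 <= r < 1 -> geo C r a -> geo C' r b ->
  Ser (fun k => a k + m * b k) = Ser a + m * Ser b.
Proof.
move=> r01 Ha Hb; have ca := geo_cvg r01 Ha; have cb := geo_cvg r01 Hb.
apply: cvg_lim => //.
have -> : series (fun k => a k + m * b k) = (fun n => series a n + m * series b n).
  by apply/funext => n; rewrite !seriesEord/= mulr_sumr -big_split.
by apply: cvgD => //; apply: cvgMl_tmp.
Qed.

Lemma Ser_le a b C C' r : 0 <= r < 1 -> geo C r a -> geo C' r b ->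
  (forall k, a k <= b k) -> Ser a <= Ser b.
Proof. by move=> r01 Ha Hb; exact: lim_series_le (geo_cvg r01 Ha) (geo_cvg r01 Hb). Qed.

Lemma Ser_geometric C r : 0 <= r < 1 -> Ser (geometric C r) = C / (1 - r).
Proof. by move=> /andP[r0 r1]; apply/cvg_lim => //; apply: cvg_geometric_series; rewrite ger0_norm. Qed.

Lemma Ser_norm a C r : 0 <= r < 1 -> geo C r a -> `|Ser a| <= C / (1 - r).
Proof.
move=> r01 Ha; have /andP[r0 r1] := r01.
have C0 : 0 <= C by have := Ha 0%N; rewrite expr0 mulr1; apply: le_trans.
have H2 C' : geo `|C'| r (geometric C' r).
  by move=> k /=; rewrite normrM (ger0_norm (exprn_ge0 _ r0)).
rewrite ler_norml; apply/andP; split.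
  rewrite -mulNr -Ser_geometric//; apply: (Ser_le r01 (H2 _) Ha) => k /=.
  by have := Ha k; rewrite ler_norml mulNr => /andP[].
rewrite -Ser_geometric//; apply: (Ser_le r01 Ha (H2 _)) => k /=.
by have := Ha k; rewrite ler_norml => /andP[].
Qed.

Lemma Ser_split K a C r : 0 <= r < 1 -> geo C r a ->
  Ser a = \sum_(k < K) a k + Ser (fun k => a (k + K)%N).
Proof.
move=> r01 Ha; have /andP[r0 r1] := r01.
have Hb : geo (C * r ^+ K) r (fun k => a (k + K)%N).
  by move=> k; rewrite -mulrA -exprD addnC; exact: Ha.
apply/cvg_lim => //; rewrite -(cvg_shiftn K).
have -> : (fun n => series a (n + K)%N) = (fun n => \sum_(k < K) a k + series (fun k => a (k + K)%N) n).
  apply/funext => n; rewrite !seriesEnat/= (@big_cat_nat _ _ _ K)//= ?leq_addl//.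
  by rewrite big_mkord; congr (_ + _); rewrite -{1}[K]add0n big_addn addnK.
by apply: cvgD; [exact: cvg_cst|exact: (geo_cvg r01 Hb)].
Qed.

(** The counterpart of [J_derive] for series: the quadratic remainders are summed against a
    geometric majorant. *)
Lemma Ser_derive (f : nat -> R -> R) a (x d C C' C'' r : R) : 0 < d -> 0 <= r < 1 -> 0 <= C' ->
  (forall y, `|y - x| < d -> geo C r (fun k => f k y)) -> geo C'' r a ->
  (forall h k, `|h| < d -> `|f k (x + h) - f k x - h * a k| <= C' * r ^+ k * h ^+ 2) ->
  is_derive x 1 (fun y => Ser (fun k => f k y)) (Ser a).
Proof.
move=> d0 r01 C0 Hf Ha Hq; have /andP[r0 r1] := r01.
apply: (@is_derive_quad _ _ _ _ (C' / (1 - r)) d d0) => [|h hd].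
  by rewrite divr_ge0// subr_ge0 ltW.
have x0 : `|x - x| < d by rewrite subrr normr0.
have xh : `|x + h - x| < d by rewrite addrC addKr.
have G1 := Hf _ x0; have G2 := Hf _ xh.
have L1 := Ser_lin (-1) r01 G2 G1.
have G3 : geo (C + C) r (fun k => f k (x + h) + -1 * f k x).
  move=> k; rewrite mulN1r mulrDl; apply: le_trans (ler_normB _ _) _.
  exact: lerD (G2 k) (G1 k).
have L2 := Ser_lin (- h) r01 G3 Ha.
have -> : Ser (fun k => f k (x + h)) - Ser (fun k => f k x) - Ser a * h =
    Ser (fun k => f k (x + h) + -1 * f k x + - h * a k).
  by rewrite L2 L1; ring.
rewrite mulrAC; apply: Ser_norm => // k.
by rewrite mulN1r mulNr mulrAC; exact: Hq.
Qed.

End GeometricSeries.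

(** * The Appell sequence generated by e^(-v t) E(t), E related to the Laplace transform of w *)

Section AppellSequence.
Variable R : realType.
Implicit Types (k n : nat) (v q r C M V : R).

(** Horner form of an alternating sum with factorial denominators: it divides by small integers
    only, which fixed-point arithmetic can imitate step by step. *)
Fixpoint nest (j : nat) (l : seq R) : R :=
  if l is x :: l' then (x - nest j.+1 l') / j%:R else 0.

(** The Taylor coefficients e_n, ..., e_0 of the solution of t E' = (1 - e^(-t)) E with E(0) = 1. By
    the equation for [laplace1], t [laplace1 t] equals e^(-gamma) E(t). *)
Fixpoint enest (n : nat) : seq R :=
  if n is m.+1 then nest 1 (enest m) / n%:R :: enest m else [:: 1].

Definition ecoef n : R := head 0 (enest n).

(** The coefficient of t^n in e^(-v t) E(t). *)
Definition appell n v : R := \sum_(j < n.+1) ecoef (n - j) * ((- v) ^+ j / j`!%:R).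

Lemma size_enest n : size (enest n) = n.+1.
Proof. by elim: n => //= n ->. Qed.

Lemma nth_enest n j : (j <= n)%N -> nth 0 (enest n) j = ecoef (n - j).
Proof.
elim: n j => [|n IH] [|j] jn //.
by rewrite subSS /= IH.
Qed.

Lemma nestE j l : (0 < j)%N ->
  nest j l = (j.-1)`!%:R * \sum_(k < size l) (-1) ^+ k * nth 0 l k / (j + k)`!%:R.
Proof.
have fn (n : nat) : (n`!%:R : R) != 0 by rewrite pnatr_eq0 -lt0n fact_gt0.
elim: l j => [|x l IH] [//|j] _; first by rewrite big_ord0 mulr0.
rewrite /= IH//= big_ord_recl/= expr0 mul1r addn0 factS natrM.
set S := \sum_(_ < _) _; rewrite (_ : \sum_(i < size l) _ = - S); last first.
  rewrite /S -sumrN; apply: eq_bigr => k _.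
  by rewrite -[bump 0 k]/(k.+1) add0n exprS addnS mulN1r !mulNr.
have j0 : (j.+1%:R : R) != 0 by rewrite pnatr_eq0.
by field; rewrite nat1r fn pnatr_eq0.
Qed.

Lemma ecoefS n : n.+1%:R * ecoef n.+1 = \sum_(j < n.+1) (-1) ^+ j * ecoef (n - j) / (j.+1)`!%:R.
Proof.
rewrite /ecoef /= nestE//= mul1r mulrC divfK ?pnatr_eq0// size_enest.
by apply: eq_bigr => j _; rewrite nth_enest// -ltnS.
Qed.

Lemma appell0 v : appell 0 v = 1.
Proof. by rewrite /appell big_ord1 /ecoef/= expr0 fact0 divr1 mulr1. Qed.

Lemma appell_at0 n : appell n 0 = ecoef n.
Proof.
rewrite /appell big_ord_recl subn0 expr0 fact0 divr1 mulr1 big1 ?addr0// => j _.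
by rewrite oppr0 expr0n/= mul0r mulr0.
Qed.

Lemma appell_is_derive n v : is_derive v 1 (appell n.+1) (- appell n v).
Proof.
pose h (j : 'I_n.+2) : R -> R := fun v => ecoef (n.+1 - j) * ((- v) ^+ j / j`!%:R).
pose dh (j : 'I_n.+2) : R := if j == 0%N :> nat then 0 else - (ecoef (n.+1 - j) * ((- v) ^+ j.-1 / (j.-1)`!%:R)).
have H (j : 'I_n.+2) : is_derive v 1 (h j) (dh j).
  rewrite /h /dh; case: j => [[|j] jn] /=.
    rewrite (_ : (fun v0 => _) = fun=> ecoef (n.+1 - 0) * (1 / 0`!%:R)); first exact: is_derive_cst.
    by apply/funext => x; rewrite expr0.
  have D : is_derive v 1 (fun v => - v) (-1) by exact: is_deriveN.
  have -> : (fun v => ecoef (n.+1 - j.+1) * ((- v) ^+ j.+1 / (j.+1)`!%:R)) =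
      (fun v => (ecoef (n.+1 - j.+1) / (j.+1)`!%:R) * (- v) ^+ j.+1).
    by apply/funext => x; rewrite mulrCA mulrC -!mulrA (mulrC _^-1).
  apply: (is_derive_eq (is_deriveZ' _ (is_deriveX' j D))).
  rewrite factS natrM; field.
  by rewrite nat1r !pnatr_eq0 -lt0n fact_gt0.
have := is_derive_sum H.
have -> : (\sum_(i < n.+2) h i)%R = appell n.+1.
  by apply/funext => x; rewrite fct_sumE.
move=> Hd; apply: (is_derive_eq Hd); rewrite big_ord_recl /dh/= add0r -sumrN.
by apply: eq_bigr => j _; rewrite /= -[bump 0 j]/(j.+1) subSS.
Qed.

Lemma derive0_eq_cc (f : R -> R) (a b : R) : a <= b ->
  (forall x : R, a <= x <= b -> is_derive x 1 f 0) -> f a = f b.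
Proof.
move=> ab D; apply: (derive0_eq ab _ (is_derive_within D)) => x /andP[h1 h2].
by apply: D; rewrite !ltW.
Qed.

Lemma eq_derive0 (g h : R -> R) (d : R -> R) v : 0 <= v -> g 0 = h 0 ->
  (forall x : R, is_derive x 1 g (d x)) -> (forall x : R, is_derive x 1 h (d x)) -> g v = h v.
Proof.
move=> v0 E Dg Dh; apply/eqP; rewrite -subr_eq0; apply/eqP.
have D (x : R) : is_derive x 1 (fun t => g t - h t) 0.
  by have := is_deriveB' (Dg x) (Dh x); rewrite subrr.
by have := @derive0_eq_cc (fun t => g t - h t) 0 v v0 (fun x _ => D x); rewrite E subrr => <-.
Qed.

(** On generating functions this is multiplication by e^(-t). Both sides have the same derivative in
    v by induction and agree at v = 0 by definition. *)
Lemma appell_add1 n v : 0 <= v ->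
  appell n (v + 1) = \sum_(j < n.+1) (-1) ^+ j * appell (n - j) v / j`!%:R.
Proof.
elim: n v => [|n IH] v v0.
  by rewrite big_ord1 !appell0 expr0 fact0 divr1 mul1r.
have D1 (x : R) : is_derive x 1 (fun t => appell n.+1 (t + 1)) (- appell n (x + 1)).
  exact: is_derive_shift' (appell_is_derive n (x + 1)).
pose rhs n t : R := \sum_(j < n.+1) (-1) ^+ j * appell (n - j) t / j`!%:R.
have D2 (x : R) : is_derive x 1 (rhs n.+1) (- rhs n x).
  pose h (j : 'I_n.+2) : R -> R := fun t => (-1) ^+ j * appell (n.+1 - j) t / j`!%:R.
  pose dh (j : 'I_n.+2) : R := if j == n.+1 :> nat then 0 else - ((-1) ^+ j * appell (n - j) x / j`!%:R).
  have H (j : 'I_n.+2) : is_derive x 1 (h j) (dh j).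
    have -> : h j = (fun t => (-1) ^+ j / j`!%:R * appell (n.+1 - j) t).
      by apply/funext => t; rewrite /h mulrAC.
    rewrite /dh; case: eqP => [->|/eqP jn].
      rewrite subnn (_ : appell 0 = fun=> 1); last by apply/funext => t; rewrite appell0.
      exact: is_derive_cst.
    have jn' : (j <= n)%N by have := ltn_ord j; rewrite ltnS leq_eqVlt (negPf jn).
    rewrite subSn//; apply: (is_derive_eq (is_deriveZ' _ (appell_is_derive (n - j) x))).
    by rewrite mulrN mulrAC.
  have := is_derive_sum H.
  have -> : (\sum_(i < n.+2) h i)%R = rhs n.+1 by apply/funext => t; rewrite fct_sumE.
  move=> Hd; apply: (is_derive_eq Hd); rewrite big_ord_recr /dh/= eqxx addr0 /rhs -sumrN.
  by apply: eq_bigr => j _; rewrite /= ltn_eqF.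
have E0 : appell n.+1 (0 + 1) = rhs n.+1 0.
  rewrite add0r /appell /rhs; apply: eq_bigr => j _.
  by rewrite appell_at0 mulrCA mulrA mulrAC -mulrA mulrCA mulrA.
have D2' (x : R) : is_derive x 1 (rhs n.+1) (- appell n (x + 1)) \/ x < 0.
  have [x0|x0] := leP 0 x; [left|by right].
  by rewrite IH//; exact: D2.
have [->|v1] := eqVneq v 0; first exact: E0.
have vp : 0 < v by rewrite lt_neqAle eq_sym v1.
apply/eqP; rewrite -subr_eq0; apply/eqP.
have D (x : R) : 0 <= x <= v -> is_derive x 1 (fun t => appell n.+1 (t + 1) - rhs n.+1 t) 0.
  move=> /andP[x0 _]; have [D3|] := D2' x; last by rewrite ltNge x0.
  by have := is_deriveB' (D1 x) D3; rewrite subrr.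
by have := derive0_eq_cc v0 D; rewrite E0 subrr => <-.
Qed.

(** Coefficients in t F' = (1 - e^(-t) - v t) F for F = e^(-v t) E(t). Solved for the value at v +
    1, it advances v by one with two products per coefficient. *)
Lemma appell_rec n v : 0 <= v ->
  n.+1%:R * appell n.+1 v = - v * appell n v + appell n.+1 v - appell n.+1 (v + 1).
Proof.
elim: n v => [|n IH] v v0.
  have E : appell 1 (v + 1) = appell 1 v - 1.
    rewrite appell_add1// big_ord_recl big_ord1/= -[bump 0 0]/1%N subnn appell0.
    by rewrite expr0 expr1 fact0 (_ : 1`! = 1%N)// !divr1 subn0 mul1r mulr1.
  rewrite appell0 E mulr1 mul1r.
  have D (x : R) : is_derive x 1 (appell 1) (- 1) by have := appell_is_derive 0 x; rewrite appell0.
  have D' (x : R) : is_derive x 1 (fun t => 1 - t) (- 1).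
    by have := is_deriveB' (is_derive_cst (1 : R) x 1) (is_derive_id x 1); rewrite sub0r.
  have -> : appell 1 v = 1 - v.
    apply: (@eq_derive0 (appell 1) (fun t => 1 - t) (fun=> -1)) => //.
    rewrite appell_at0 subr0; have := ecoefS 0; rewrite mul1r big_ord1 expr0 mul1r (_ : 1`! = 1%N)// divr1 => ->.
    by rewrite /ecoef.
  by field.
pose g (t : R) : R := - t * appell n.+1 t + appell n.+2 t - appell n.+2 (t + 1) - n.+2%:R * appell n.+2 t.
suff E : g v = 0 by have := E; rewrite /g; nlra.
have D (x : R) : 0 <= x <= v -> is_derive x 1 g 0.
  move=> /andP[x0 _].
  have D0 : is_derive x 1 (fun t : R => - t) (-1) by exact: is_deriveN.
  have := is_deriveB' (is_deriveB' (is_deriveD' (is_deriveM' D0 (appell_is_derive n x)) (appell_is_derive n.+1 x))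
    (is_derive_shift' (appell_is_derive n.+1 (x + 1)))) (is_deriveZ' n.+2%:R (appell_is_derive n.+1 x)).
  move=> Hd; apply: (is_derive_eq Hd); have := IH x x0; rewrite (_ : n.+2%:R = n.+1%:R + 1 :> R) ?natr1//; nlra.
have E0 : g 0 = 0.
  rewrite /g oppr0 mul0r add0r add0r appell_at0 ecoefS.
  have := appell_add1 n.+2 (lexx (0 : R)); rewrite add0r big_ord_recl => ->.
  rewrite expr0 mul1r subn0 appell_at0 fact0 divr1 opprD addrA subrr add0r -sumrN -sumrB big1// => j _.
  by rewrite /= -[bump 0 j]/(j.+1) subSS appell_at0 exprS mulN1r !mulNr opprK subrr.
by rewrite -E0; exact/esym/derive0_eq_cc.
Qed.

Lemma expR_ge_psum n (x : R) : 0 <= x -> \sum_(k < n) x ^+ k / k`!%:R <= expR x.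
Proof.
move=> x0; have nd : nondecreasing_seq (series (exp_coeff x)).
  by apply: nondecreasing_series => k _ _; rewrite /exp_coeff /= divr_ge0 ?exprn_ge0.
have <- : series (exp_coeff x) n = \sum_(k < n) x ^+ k / k`!%:R by rewrite seriesEord.
exact: nondecreasing_cvgn_le nd (is_cvg_series_exp_coeff x) n.
Qed.

(** In the recurrence (k + 1) times a new coefficient is a combination of earlier ones of total
    weight at most v / r + e^(1/r) - 1, relative to r^(k+1). Beyond K the bound therefore reproduces
    itself, and a finite check controls the whole tail. *)
Lemma appell_bound K M r v : (0 < K)%N -> 0 <= v -> 0 < r -> 0 <= M ->
  v / r + expR r^-1 - 1 <= K%:R ->
  (forall k, (k < K)%N -> `|appell k v| <= M * r ^+ k) -> forall k, `|appell k v| <= M * r ^+ k.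
Proof.
move=> K0 v0 r0 M0 HK H; elim/ltn_ind => -[|k] IH; first exact: H.
have [kK|Kk] := ltnP k.+1 K; first exact: H.
have K1 : (0 : R) < k.+1%:R by rewrite ltr0n.
have E : k.+1%:R * appell k.+1 v = - v * appell k v - \sum_(j < k.+1) (-1) ^+ j.+1 * appell (k - j) v / (j.+1)`!%:R.
  rewrite appell_rec// appell_add1// big_ord_recl expr0 mul1r subn0 fact0 divr1.
  rewrite opprD addrA addrK; congr (_ - _).
rewrite -(ler_pM2l K1) -[k.+1%:R in X in X <= _]ger0_norm// -normrM E.
have B1 : `|- v * appell k v| <= v / r * (M * r ^+ k.+1).
  rewrite normrM normrN (ger0_norm v0) exprS -!mulrA ler_wpM2l//.
  by rewrite mulrCA mulKf ?gt_eqF//; apply: IH.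
have B2 : `|\sum_(j < k.+1) (-1) ^+ j.+1 * appell (k - j) v / (j.+1)`!%:R| <= (expR r^-1 - 1) * (M * r ^+ k.+1).
  apply: le_trans (ler_norm_sum _ _ _) _.
  apply: (@le_trans _ _ (\sum_(j < k.+1) (r^-1 ^+ j.+1 / (j.+1)`!%:R) * (M * r ^+ k.+1))).
    apply: ler_sum => j _; rewrite !normrM normrX normrN1 expr1n mul1r normfV (ger0_norm (ler0n _ _)).
    rewrite (mulrAC _ (_`!%:R^-1)) ler_wpM2r ?invr_ge0//.
    apply: le_trans (IH (k - j)%N _) _; first by rewrite ltnS leq_subr.
    rewrite mulrCA ler_wpM2l// exprVn -exprVn.
    have jk : (j <= k)%N by rewrite -ltnS.
    rewrite (_ : r ^+ k.+1 = r ^+ (k - j) * r ^+ j.+1); last by rewrite -exprD addnS subnK.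
    by rewrite mulrCA -exprMn mulVf ?gt_eqF// expr1n mulr1.
  rewrite -mulr_suml ler_wpM2r ?mulr_ge0 ?exprn_ge0 ?(ltW r0)//.
  have r10 : 0 <= r^-1 by rewrite invr_ge0 ltW.
  rewrite lerBrDl; apply: le_trans (expR_ge_psum k.+2 r10).
  by rewrite [leRHS]big_ord_recl expr0 fact0 divr1.
apply: le_trans (ler_normB _ _) _.
apply: le_trans (lerD B1 B2) _; rewrite -mulrDl ler_wpM2r ?mulr_ge0 ?exprn_ge0 ?(ltW r0)//.
apply: le_trans (_ : K%:R <= _); last by rewrite ler_nat.
by nlra.
Qed.

End AppellSequence.

(** * The Mellin transform of e^(-v t) E(t), cut at a finite T *)

Section TruncatedMellin.
Variable R : realType.
Implicit Types (k n : nat) (t v q r C M V W T nu s h : R) (w : nat -> R).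

(** [appell_bound] at v = 0, with K taken beyond e^(1/r): E is entire. *)
Lemma ecoef_bound r : 0 < r -> exists2 C, 0 <= C & forall k, `|ecoef R k| <= C * r ^+ k.
Proof.
move=> r0; pose K := (Num.truncn (expR r^-1)).+1.
pose M : R := \sum_(k < K) `|ecoef R k| / r ^+ k.
have M0 : 0 <= M by apply: sumr_ge0 => k _; rewrite divr_ge0// exprn_ge0// ltW.
exists M => // k; rewrite -appell_at0.
apply: (@appell_bound R K) => //.
  rewrite mul0r add0r; have := truncnS_gt (expR r^-1); rewrite -/K; nlra.
move=> j jK; rewrite appell_at0 -ler_pdivrMr ?exprn_gt0// /M (bigD1 (Ordinal jK))//= lerDl.
by apply: sumr_ge0 => i _; rewrite divr_ge0// exprn_ge0// ltW.
Qed.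

Lemma appell_growth r : 0 < r -> exists2 C, 0 <= C &
  forall k v, 0 <= v -> `|appell k v| <= C * expR (v / r) * r ^+ k.
Proof.
move=> r0; have [C C0 HC] := ecoef_bound r0; exists C => // k v v0.
apply: le_trans (ler_norm_sum _ _ _) _.
have vr : 0 <= v / r by rewrite divr_ge0// ltW.
apply: (@le_trans _ _ (\sum_(j < k.+1) (C * r ^+ k) * ((v / r) ^+ j / j`!%:R))).
  apply: ler_sum => j _; rewrite !normrM normrX normrN (ger0_norm v0) normfV (ger0_norm (ler0n _ _)).
  rewrite !mulrA ler_wpM2r ?invr_ge0//.
  have jk : (j <= k)%N by rewrite -ltnS.
  apply: le_trans (ler_wpM2r (exprn_ge0 j v0) (HC (k - j)%N)) _.
  rewrite -(mulrA C (r ^+ k)) -mulrA ler_wpM2l//.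
  rewrite (_ : r ^+ k = r ^+ (k - j) * r ^+ j); last by rewrite -exprD subnK.
  by rewrite -mulrA -exprMn (mulrC r) divfK ?gt_eqF.
rewrite -mulr_sumr mulrAC ler_wpM2r ?exprn_ge0 ?(ltW r0)//.
by rewrite ler_wpM2l//; exact: expR_ge_psum.
Qed.

Definition wsum T w v := Ser (fun k => appell k v * T ^+ k * w k).

Lemma wsum_geo T r C W w v : 0 < r -> 0 <= T -> 0 <= v ->
  (forall k v, 0 <= v -> `|appell k v| <= C * expR (v / r) * r ^+ k) ->
  (forall k, `|w k| <= W) ->
  geo (C * expR (v / r) * W) (T * r) (fun k => appell k v * T ^+ k * w k).
Proof.
move=> r0 T0 v0 HC Hw k; rewrite !normrM normrX (ger0_norm T0) exprMn.
apply: le_trans (ler_pM _ _ (ler_wpM2r (exprn_ge0 k T0) (HC k v v0)) (Hw k)) _ => //.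
  by rewrite mulr_ge0// exprn_ge0.
by rewrite le_eqVlt; apply/orP; left; apply/eqP; ring.
Qed.

Lemma wsum_geo_half T w W v : 0 < T -> 0 <= v -> (forall k, `|w k| <= W) ->
  exists C, geo C 2^-1 (fun k => appell k v * T ^+ k * w k).
Proof.
move=> T0 v0 Hw; have r0 : 0 < (2 * T)^-1 by rewrite invr_gt0 mulr_gt0.
have [C C0 HC] := appell_growth r0.
exists (C * expR (v / (2 * T)^-1) * W).
have -> : 2^-1 = T * (2 * T)^-1 by field; rewrite gt_eqF.
exact: wsum_geo (ltW T0) v0 HC Hw.
Qed.

Lemma geo_ge0 C r (a : nat -> R) : geo C r a -> 0 <= C.
Proof. by move=> /(_ 0%N); rewrite expr0 mulr1; apply: le_trans. Qed.

Lemma half01 : (0 : R) <= 2^-1 < (1 : R). Proof. by apply/andP; split; nlra. Qed.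

Lemma wsum_growth T th w W : 0 < T -> T < th -> (forall k, `|w k| <= W) ->
  exists2 C, 0 <= C & forall v, 0 <= v -> `|wsum T w v| <= C * expR (th * v).
Proof.
move=> T0 Tth Hw; have th0 : 0 < th by nlra.
have r0 : 0 < th^-1 by rewrite invr_gt0.
have [C C0 HC] := appell_growth r0.
have W0 : 0 <= W by exact: le_trans (Hw 0%N).
have q1 : T * th^-1 < 1 by rewrite ltr_pdivrMr// mul1r.
exists (C * W / (1 - T * th^-1)) => [|v v0]; first by rewrite divr_ge0 ?mulr_ge0//; nlra.
have r01 : 0 <= T * th^-1 < 1 by rewrite q1 andbT divr_ge0// ltW.
apply: le_trans (Ser_norm r01 (wsum_geo r0 (ltW T0) v0 HC Hw)) _.
by rewrite invrK (mulrC v) le_eqVlt; apply/orP; left; apply/eqP; ring.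
Qed.

Definition apm k v : R := if k is j.+1 then appell j v else 0.

Lemma appell_is_derive' k v : is_derive v 1 (appell k) (- apm k v).
Proof.
case: k => [|k] /=; last exact: appell_is_derive.
rewrite oppr0 (_ : appell 0 = fun=> 1); first exact: is_derive_cst.
by apply/funext => x; rewrite appell0.
Qed.

Lemma apm_is_derive k v : is_derive v 1 (apm k) (- apm k.-1 v).
Proof.
case: k => [|k] /=; last exact: appell_is_derive'.
by rewrite oppr0; exact: is_derive_cst.
Qed.

Lemma apm_growth r C k v : 0 < r -> 0 <= v -> 0 <= C ->
  (forall k v, 0 <= v -> `|appell k v| <= C * expR (v / r) * r ^+ k) ->
  `|apm k v| <= C / r * expR (v / r) * r ^+ k.
Proof.
move=> r0 v0 C0 HC; case: k => [|k] /=.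
  by rewrite normr0 !mulr_ge0 ?invr_ge0 ?expR_ge0// ltW.
apply: le_trans (HC k v v0) _; rewrite exprS le_eqVlt; apply/orP; left; apply/eqP.
by field; rewrite gt_eqF.
Qed.

Lemma wsum_is_derive T w W v : 0 < T -> 0 < v -> (forall k, `|w k| <= W) ->
  is_derive v 1 (wsum T w) (- T * wsum T (fun k => w k.+1) v).
Proof.
move=> T0 v0 Hw; have vv := ltW v0; have r0 : 0 < (2 * T)^-1 by rewrite invr_gt0 mulr_gt0.
have W0 : 0 <= W by exact: le_trans (Hw 0%N).
set r := (2 * T)^-1 in r0; have Tr : T * r = 2^-1 by rewrite /r; field; rewrite gt_eqF.
have [C C0 HC] := appell_growth r0.
pose a k : R := - apm k v * T ^+ k * w k.
have T00 := ltW T0.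
pose E := expR ((2 * v) / r).
have EE s : s <= 2 * v -> expR (s / r) <= E.
  by move=> sv; rewrite ler_expR ler_wpM2r// invr_ge0 ltW.
have bd (p : R) k B : `|p| <= B * r ^+ k -> `|p * T ^+ k * w k| <= B * W * 2^-1 ^+ k.
  move=> hp; rewrite !normrM normrX (ger0_norm T00) -Tr exprMn.
  apply: le_trans (ler_pM _ _ (ler_wpM2r (exprn_ge0 k T00) hp) (Hw k)) _ => //.
    by rewrite mulr_ge0// exprn_ge0.
  by rewrite le_eqVlt; apply/orP; left; apply/eqP; ring.
have Ha : geo (C / r * expR (v / r) * W) 2^-1 a.
  by move=> k; apply: bd; rewrite normrN; exact: apm_growth.
have D : is_derive v 1 (wsum T w) (Ser a).
  have ri : 0 <= r^-1 by rewrite invr_ge0 ltW.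
  have E0 : 0 <= E by exact: expR_ge0.
  have C10 : 0 <= C / r / r * E * W by rewrite !mulr_ge0.
  apply: (@Ser_derive _ (fun k y => appell k y * T ^+ k * w k) a v v (C * E * W) (C / r / r * E * W) _ 2^-1 v0 half01 C10 _ Ha).
    move=> y; rewrite ltr_norml => /andP[y1 y2] k; apply: bd.
    have y0 : 0 <= y by nlra.
    apply: le_trans (HC k y y0) _; rewrite ler_wpM2r ?exprn_ge0 ?(ltW r0)//.
    by rewrite ler_wpM2l//; apply: EE; nlra.
  move=> h k hv.
  have -> : appell k (v + h) * T ^+ k * w k - appell k v * T ^+ k * w k - h * a k =
    (appell k (v + h) - appell k v - h * - apm k v) * T ^+ k * w k by rewrite /a; ring.
  have E2 : C / r / r * E * W * 2^-1 ^+ k * h ^+ 2 = (C / r / r * E * h ^+ 2) * W * 2^-1 ^+ k by ring.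
  rewrite E2; apply: bd.
  have := @taylor2 _ (appell k) (fun y => - apm k y) (fun y => - (- apm k.-1 y)) v v (C / r / r * E * r ^+ k).
  move=> /(_ _ _ _ h hv) Tl; rewrite mulrAC; apply: Tl.
  - by move=> t _; exact: appell_is_derive'.
  - by move=> t _; apply: is_deriveN; exact: apm_is_derive.
  - move=> t; rewrite ltr_norml => /andP[t1 t2]; have t0 : 0 <= t by nlra.
    rewrite opprK; apply: le_trans (_ : C / r / r * expR (t / r) * r ^+ k <= _); last first.
      rewrite ler_wpM2r ?exprn_ge0 ?(ltW r0)// ler_wpM2l//; last by apply: EE; nlra.
      by rewrite !divr_ge0// ltW.
    case: k {E2} => [|k] /=.
      by rewrite normr0 expr0 mulr1 !mulr_ge0 ?expR_ge0.
    apply: le_trans (apm_growth k r0 t0 C0 HC) _; rewrite exprS le_eqVlt; apply/orP; left; apply/eqP.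
    by field; rewrite gt_eqF.
have -> : - T * wsum T (fun k => w k.+1) v = Ser a; last exact: D.
rewrite (Ser_split 1 half01 Ha) big_ord1 /a /= oppr0 !mul0r add0r.
have Hw1 k : `|w k.+1| <= W by exact: Hw.
have [C1 H1] := wsum_geo_half T0 vv Hw1.
have H0 : geo 0 2^-1 (fun=> 0 : R) by move=> k; rewrite normr0 mul0r.
have := Ser_lin (- T) half01 H0 H1.
have -> : Ser (fun=> 0 : R) = 0.
  have := Ser_norm half01 H0; rewrite mul0r normr_le0 => /eqP //.
rewrite add0r => <-; congr Ser; apply/funext => k.
by rewrite addn1 /= exprS; ring.
Qed.

(** The value e^(-v T) E(T) of the generating function at the cut. *)
Definition Fs T := wsum T (fun=> 1).
(** T^nu times the integral of t^(-nu - 1) e^(-v t) E(t) over [0, T], continued in nu term by term.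
    For nu < 0 the integral over [0, oo) is e^gamma Gamma(-nu) [G nu v]; the sign of Gamma(-nu)
    alternates with the integer part of nu. *)
Definition Ss T nu := wsum T (fun k => (k%:R - nu)^-1).
Definition away (d nu : R) := forall k, d <= `|k%:R - nu|.

Lemma away_inv (d nu : R) k : 0 < d -> away d nu -> `|(k%:R - nu)^-1| <= d^-1.
Proof.
move=> d0 /(_ k) h; rewrite normfV lef_pV2 ?posrE//; exact: lt_le_trans h.
Qed.

Lemma away_neq0 (d nu : R) k : 0 < d -> away d nu -> k%:R - nu != 0.
Proof. by move=> d0 /(_ k) h; rewrite -normr_gt0; exact: lt_le_trans h. Qed.

Lemma awayB1 (d nu : R) : away d nu -> away d (nu - 1).
Proof. by move=> h k; have := h k.+1; rewrite -natr1 opprB addrA addrAC. Qed.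

Lemma norm1_le k : `|1 : R| <= 1. Proof. by rewrite normr1. Qed.

Lemma Ss_is_derive T (d nu v : R) : 0 < T -> 0 < v -> 0 < d -> away d nu ->
  is_derive v 1 (Ss T nu) (- T * Ss T (nu - 1) v).
Proof.
move=> T0 v0 d0 aw; have Hw k := away_inv k d0 aw.
apply: (is_derive_eq (wsum_is_derive T0 v0 Hw)); congr (_ * wsum _ _ _).
by apply/funext => k; rewrite -natr1 opprB addrA addrAC.
Qed.

Lemma Fs_is_derive T v : 0 < T -> 0 < v -> is_derive v 1 (Fs T) (- T * Fs T v).
Proof. by move=> T0 v0; exact: wsum_is_derive T0 v0 norm1_le. Qed.

(** The delay equation of [G] with the boundary term [Fs] of the cut as inhomogeneity;
    coefficientwise it is [appell_rec], and the terms of index 0 cancel. *)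
Lemma Ss_eq T (d nu v : R) : 0 < T -> 0 < v -> 0 < d -> away d nu ->
  v * (- T * Ss T (nu - 1) v) = Ss T nu (v + 1) + (nu - 1) * Ss T nu v + Fs T v.
Proof.
move=> T0 v0 d0 aw; have vv := ltW v0; have v1 : 0 <= v + 1 by nlra.
have Hw k := away_inv k d0 aw; have Hw' k := away_inv k d0 (awayB1 aw).
have [C1 H1] := wsum_geo_half T0 v1 Hw; have [C2 H2] := wsum_geo_half T0 vv Hw.
have [C3 H3] := wsum_geo_half T0 vv norm1_le; have [C4 H4] := wsum_geo_half T0 vv Hw'.
have E1 := Ser_lin (nu - 1) half01 H1 H2.
have G1 : geo (C1 + `|nu - 1| * C2) 2^-1 (fun k => appell k (v + 1) * T ^+ k * (k%:R - nu)^-1 +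
    (nu - 1) * (appell k v * T ^+ k * (k%:R - nu)^-1)).
  move=> k; rewrite [leRHS]mulrDl; apply: le_trans (ler_normD _ _) _; apply: lerD (H1 k) _.
  by rewrite normrM -[leRHS]mulrA; apply: ler_wpM2l => //; first [exact: H2 | exact: H3].
have E2 := Ser_lin 1 half01 G1 H3.
have G2 : geo (C1 + `|nu - 1| * C2 + `|1| * C3) 2^-1 (fun k => appell k (v + 1) * T ^+ k * (k%:R - nu)^-1 +
    (nu - 1) * (appell k v * T ^+ k * (k%:R - nu)^-1) + 1 * (appell k v * T ^+ k * 1)).
  move=> k; rewrite [leRHS]mulrDl; apply: le_trans (ler_normD _ _) _; apply: lerD (G1 k) _.
  by rewrite normrM -[leRHS]mulrA; apply: ler_wpM2l => //; first [exact: H2 | exact: H3].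
have H0 : geo 0 2^-1 (fun=> 0 : R) by move=> k; rewrite normr0 mul0r.
have E3 := Ser_lin (v * - T) half01 H0 H4.
have S0 : Ser (fun=> 0 : R) = 0.
  by have := Ser_norm half01 H0; rewrite mul0r normr_le0 => /eqP.
rewrite mul1r in E2; rewrite /Ss /Fs /wsum -E1 -E2 mulrA -[LHS]add0r -{1}S0 -E3.
rewrite (Ser_split 1 half01 G2) big_ord1 !appell0 !expr0 !mul1r ?mulr1.
have n0 := away_neq0 0 d0 aw.
have n0' : nu != 0 by rewrite sub0r oppr_eq0 in n0.
rewrite [X in _ = X + _](_ : _ = 0); last by rewrite /= sub0r; field.
rewrite add0r; congr Ser; apply/funext => k; rewrite addn1 add0r.
have rec := appell_rec k vv.
have -> : appell k.+1 (v + 1) = - v * appell k v + appell k.+1 v - k.+1%:R * appell k.+1 v.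
  by rewrite rec; ring.
have n1 := away_neq0 k.+1 d0 aw; have := n1; rewrite -natr1 => n2.
rewrite (_ : k%:R - (nu - 1) = k%:R + 1 - nu) ?exprS; last by ring.
by field.
Qed.

Lemma Fs_shift T v u : 0 < T -> 0 < v -> v <= u -> Fs T u = expR (- (T * (u - v))) * Fs T v.
Proof.
move=> T0 v0 vu.
have D (x : R) : v <= x <= u -> is_derive x 1 (fun x => expR (T * x) * Fs T x) 0.
  move=> /andP[vx _]; have x0 : 0 < x by nlra.
  have DE := is_derive_comp' (g := fun x => T * x) (is_derive_expR (T * x)) (is_deriveZ' T (is_derive_id x 1)).
  by apply: (is_derive_eq (is_deriveM' DE (Fs_is_derive T0 x0))); ring.
have E := derive0_eq_cc vu D.
have e0 : expR (T * u) != 0 by rewrite gt_eqF ?expR_gt0.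
apply: (mulfI e0); rewrite -E mulrA -expRD; congr (expR _ * _); ring.
Qed.

Lemma natr_le_exp2 k : (k%:R : R) <= 2 ^+ k.
Proof. by rewrite -natrX ler_nat ltnW// ltn_expl. Qed.

Lemma is_derive_exprn k (y : R) : is_derive y 1 (fun y => y ^+ k) (k%:R * y ^+ k.-1).
Proof.
case: k => [|k]; first by rewrite mul0r; exact: is_derive_cst.
by have := is_deriveX' k (is_derive_id y 1); rewrite mulr1.
Qed.

Definition smallc (c : nat -> R) := forall r, 0 < r -> exists2 C, 0 <= C & forall k, `|c k| <= C * r ^+ k.

Lemma smallc_geo c t : smallc c -> 0 < t -> exists C, geo C 2^-1 (fun k => c k * t ^+ k).
Proof.
move=> H t0; have r0 : 0 < (2 * t)^-1 by rewrite invr_gt0 mulr_gt0.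
have [C C0 HC] := H _ r0; exists C => k; rewrite normrM normrX (gtr0_norm t0).
apply: le_trans (ler_wpM2r (exprn_ge0 k (ltW t0)) (HC k)) _.
rewrite -mulrA -exprMn (_ : (2 * t)^-1 * t = 2^-1)//; field; by rewrite gt_eqF.
Qed.

Lemma tsum_is_derive c t : smallc c -> 0 <= t ->
  is_derive t 1 (fun t => Ser (fun k => c k * t ^+ k)) (Ser (fun k => k%:R * c k * t ^+ k.-1)).
Proof.
move=> H t0; pose U := t + 1; have U1 : 1 <= U by rewrite /U; nlra.
have r0 : 0 < (8 * U)^-1 by rewrite invr_gt0; nlra.
have [C C0 HC] := H _ r0.
have bd (y : R) j k : `|y| <= U -> (k - 2 <= j <= k)%N -> k%:R * k%:R * `|c k| * `|y| ^+ j <= C * 2^-1 ^+ k.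
  move=> yU /andP[_ jk]; have k0 : (0 : R) <= k%:R by [].
  have y1 : `|y| ^+ j <= U ^+ k.
    apply: le_trans (_ : U ^+ j <= _); first by apply: lerXn2r; rewrite ?nnegrE//; nlra.
    exact: ler_weXn2l.
  have e4 : k%:R * k%:R <= (4 : R) ^+ k.
    have -> : (4 : R) ^+ k = 2 ^+ k * 2 ^+ k by rewrite -exprMn; congr (_ ^+ _); ring.
    by apply: ler_pM => //; exact: natr_le_exp2.
  apply: le_trans (_ : 4 ^+ k * (C * (8 * U)^-1 ^+ k) * U ^+ k <= _).
    by apply: ler_pM => //; rewrite ?mulr_ge0//; apply: ler_pM => //; rewrite mulr_ge0.
  have -> : 4 ^+ k * (C * (8 * U)^-1 ^+ k) * U ^+ k = C * (4 * (8 * U)^-1 * U) ^+ k by rewrite !exprMn; ring.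
  by rewrite (_ : 4 * (8 * U)^-1 * U = 2^-1)//; field; nlra.
have bd1 (y : R) j k : `|y| <= U -> (k - 2 <= j <= k)%N -> `|c k| * `|y| ^+ j <= C * 2^-1 ^+ k \/ k = 0%N.
  case: k => [|k] yU jk; [by right|left]; apply: le_trans (bd y j k.+1 yU jk).
  rewrite -[leLHS]mul1r -mulrA ler_wpM2r ?mulr_ge0//.
  by rewrite -natrM ler1n muln_gt0.
have g0 (y : R) : `|y - t| < 1 -> geo C 2^-1 (fun k => c k * y ^+ k).
  rewrite ltr_norml => /andP[y1 y2] k; rewrite normrM normrX.
  have yU : `|y| <= U by rewrite ler_norml /U; apply/andP; split; nlra.
  have kk : (k - 2 <= k <= k)%N by rewrite leq_subr leqnn.
  have [//|->] := bd1 y k k yU kk.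
  by rewrite !expr0 !mulr1; have := HC 0%N; rewrite expr0 mulr1.
have tU : `|t| <= U by rewrite ger0_norm// /U; nlra.
have Ha : geo C 2^-1 (fun k => k%:R * c k * t ^+ k.-1).
  move=> [|k]; first by rewrite !mul0r normr0 expr0 mulr1.
  rewrite !normrM normrX; apply: le_trans (bd t k k.+1 tU _); last by rewrite leqnSn andbT; lia.
  rewrite ler_wpM2r ?exprn_ge0// ler_wpM2r// normr_nat ler_peMr// ler1n//.
apply: (@Ser_derive _ (fun k y => c k * y ^+ k) _ t 1 C C C 2^-1 ltr01 half01 C0 g0 Ha).
move=> h k h1.
have -> : c k * (t + h) ^+ k - c k * t ^+ k - h * (k%:R * c k * t ^+ k.-1) =
  c k * ((t + h) ^+ k - t ^+ k - h * (k%:R * t ^+ k.-1)) by ring.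
rewrite !mulrBr (mulrCA (c k) h).
apply: (@taylor2 _ (fun y => c k * y ^+ k) (fun y => c k * (k%:R * y ^+ k.-1))
  (fun y => c k * (k%:R * (k.-1%:R * y ^+ k.-1.-1))) t 1 (C * 2^-1 ^+ k) _ _ _ h h1).
- by move=> y _; exact: is_deriveZ' (is_derive_exprn k y).
- by move=> y _; exact: is_deriveZ' (is_deriveZ' _ (is_derive_exprn k.-1 y)).
- move=> y; rewrite ltr_norml => /andP[y1 y2].
  have yU : `|y| <= U by rewrite ler_norml /U; apply/andP; split; nlra.
  rewrite !normrM normrX !normr_nat.
  apply: le_trans (bd y k.-1.-1 k yU _); last by apply/andP; split; lia.
  rewrite mulrCA mulrA (mulrCA _ k.-1%:R) !mulrA ler_wpM2r ?exprn_ge0//.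
  by do 2 apply: ler_wpM2r => //; rewrite ler_nat leq_pred.
Qed.

Lemma appell_smallc v w W : 0 <= v -> (forall k, `|w k| <= W) -> smallc (fun k => appell k v * w k).
Proof.
move=> v0 Hw r r0; have [C C0 HC] := appell_growth r0.
have W0 : 0 <= W by exact: le_trans (Hw 0%N).
exists (C * expR (v / r) * W) => [|k]; first by rewrite !mulr_ge0 ?expR_ge0.
rewrite normrM; apply: le_trans (ler_pM _ _ (HC k v v0) (Hw k)) _ => //.
by rewrite mulrAC.
Qed.

Lemma Fs_gt0 T v : 0 < T -> 0 < v -> 0 < Fs T v.
Proof.
move=> T0 v0; have vv := ltW v0; have v1 : 0 <= v + 1 by nlra.
pose c k : R := appell k v * 1.
have Hc : smallc c by exact: appell_smallc vv norm1_le.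
pose P t : R := Ser (fun k => c k * t ^+ k).
pose P' t : R := Ser (fun k => k%:R * c k * t ^+ k.-1).
have FP t : Fs t v = P t by congr Ser; apply/funext => k; rewrite /c mulrAC.
have dP t : 0 <= t -> is_derive t 1 P (P' t) by move=> t0; exact: tsum_is_derive.
have eqP' t : 0 < t -> t * P' t = (1 - expR (- t) - v * t) * P t.
  move=> t0.
  have Es : Fs t (v + 1) = expR (- t) * P t.
    by rewrite -FP (@Fs_shift t v (v + 1))//; [congr (expR _ * _); ring|nlra].
  have [C1 H1] := smallc_geo Hc t0.
  have [C2 H2] := wsum_geo_half t0 v1 norm1_le.
  have H1' : geo (C1 * 2^-1) 2^-1 (fun k => c k.+1 * t ^+ k.+1).
    by move=> k; have := H1 k.+1; rewrite [2^-1 ^+ _]exprS mulrA.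
  have H2' : geo (C2 * 2^-1) 2^-1 (fun k => appell k.+1 (v + 1) * t ^+ k.+1 * 1).
    by move=> k; have := H2 k.+1; rewrite [2^-1 ^+ _]exprS mulrA.
  have E1 : P t = 1 + Ser (fun k => c k.+1 * t ^+ k.+1).
    rewrite /P (Ser_split 1 half01 H1) big_ord1 /c appell0 expr0 !mulr1; congr (_ + Ser _).
    by apply/funext => k; rewrite addn1.
  have E2 : Fs t (v + 1) = 1 + Ser (fun k => appell k.+1 (v + 1) * t ^+ k.+1 * 1).
    rewrite /Fs /wsum (Ser_split 1 half01 H2) big_ord1 appell0 expr0 !mulr1; congr (_ + Ser _).
    by apply/funext => k; rewrite addn1.
  have L1 := Ser_lin (-1) half01 H1' H2'.
  have G1 : geo (C1 * 2^-1 + C2 * 2^-1) 2^-1 (fun k => c k.+1 * t ^+ k.+1 + -1 * (appell k.+1 (v + 1) * t ^+ k.+1 * 1)).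
    move=> k; rewrite [leRHS]mulrDl mulN1r; apply: le_trans (ler_normB _ _) _; apply: lerD; [exact: H1'|exact: H2'].
  have L2 := Ser_lin (- v * t) half01 G1 H1.
  have [C3 H3] : exists C, geo C 2^-1 (fun k => k%:R * c k * t ^+ k.-1).
    have [C C0 HC] := Hc (4 * (t + 1))^-1 (ltac:(rewrite invr_gt0; nlra)).
    exists C => k; rewrite normrM normrX (gtr0_norm t0) normrM normr_nat.
    have tk : t ^+ k.-1 <= (t + 1) ^+ k.
      apply: le_trans (_ : (t + 1) ^+ k.-1 <= _); first by apply: lerXn2r; rewrite ?nnegrE; nlra.
      by apply: ler_weXn2l; [nlra|exact: leq_pred].
    apply: le_trans (_ : 2 ^+ k * (C * (4 * (t + 1))^-1 ^+ k) * (t + 1) ^+ k <= _).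
      apply: ler_pM => //; rewrite ?mulr_ge0 ?exprn_ge0 ?(ltW t0)//; apply: ler_pM => //; exact: natr_le_exp2.
    have -> : 2 ^+ k * (C * (4 * (t + 1))^-1 ^+ k) * (t + 1) ^+ k = C * (2 * (4 * (t + 1))^-1 * (t + 1)) ^+ k by rewrite !exprMn; ring.
    by rewrite (_ : 2 * (4 * (t + 1))^-1 * (t + 1) = 2^-1)//; field; nlra.
  have H0 : geo 0 2^-1 (fun=> 0 : R) by move=> k; rewrite normr0 mul0r.
  have S0 : Ser (fun=> 0 : R) = 0.
    by have := Ser_norm half01 H0; rewrite mul0r normr_le0 => /eqP.
  have L3 := Ser_lin t half01 H0 H3.
  rewrite S0 add0r in L3; rewrite /P' -L3.
  have G3 : geo (`|t| * C3) 2^-1 (fun k => 0 + t * (k%:R * c k * t ^+ k.-1)).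
    by move=> k; rewrite add0r normrM -[leRHS]mulrA; apply: ler_wpM2l => //; exact: H3.
  rewrite (Ser_split 1 half01 G3) big_ord1 mul0r !mul0r mulr0 !add0r.
  have -> : Ser (fun k => 0 + t * ((k + 1)%:R * c (k + 1)%N * t ^+ (k + 1).-1)) =
      Ser (fun k => c k.+1 * t ^+ k.+1 + -1 * (appell k.+1 (v + 1) * t ^+ k.+1 * 1) + - v * t * (c k * t ^+ k)).
    congr Ser; apply/funext => k; rewrite addn1 add0r /= /c !mulr1 appell_rec//.
    by rewrite exprS; ring.
  rewrite L2 L1 -/(P t).
  have -> : Ser (fun k => c k.+1 * t ^+ k.+1) = P t - 1 by rewrite E1; ring.
  have -> : Ser (fun k => appell k.+1 (v + 1) * t ^+ k.+1 * 1) = expR (- t) * P t - 1.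
    by rewrite -Es E2; ring.
  by ring.
(* [Q^2] is nondecreasing for [Q = e^{vt} P], hence [Q] has no zero. *)
pose Q t : R := expR (v * t) * P t.
have dE t : is_derive t 1 (fun t => expR (v * t)) (expR (v * t) * (v * 1)).
  exact: (is_derive_comp' (g := fun x => v * x) (is_derive_expR _) (is_deriveZ' v (is_derive_id t 1))).
have dQ t : 0 <= t -> is_derive t 1 Q (expR (v * t) * (v * 1) * P t + expR (v * t) * P' t).
  by move=> t0; exact: is_deriveM' (dE t) (dP t t0).
have P00 : P 0 = 1.
  have H0 : geo 1 2^-1 (fun k => c k * 0 ^+ k).
    move=> [|k]; first by rewrite /c appell0 !expr0 !mulr1 normr1.
    by rewrite expr0n mulr0 normr0 mul1r exprn_ge0.
  have H0' : geo 0 2^-1 (fun=> 0 : R) by move=> k; rewrite normr0 mul0r.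
  rewrite /P (Ser_split 1 half01 H0) big_ord1 /c appell0 !expr0 !mulr1.
  have -> : (fun k => appell (k + 1) v * 1 * 0 ^+ (k + 1)) = fun=> 0 : R.
    by apply/funext => k; rewrite addn1 expr0n mulr0.
  have := Ser_norm half01 H0'; rewrite mul0r normr_le0 => /eqP ->.
  by rewrite addr0.
have Q2 t : 0 <= t -> 1 <= Q t * Q t.
  move=> t0; have -> : 1 = Q 0 * Q 0 by rewrite /Q mulr0 expR0 P00 !mulr1.
  apply: (derive_ge0_le_cc t0 (f := fun t => Q t * Q t)
     (df := fun t => (expR (v * t) * (v * 1) * P t + expR (v * t) * P' t) * Q t + Q t * (expR (v * t) * (v * 1) * P t + expR (v * t) * P' t))).
    by move=> x /andP[x0 _]; exact: is_deriveM' (dQ x x0) (dQ x x0).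
  move=> x /andP[x0 _]; have := eqP' x x0; have x0' := x0; rewrite -(pmulr_rge0 _ x0').
  set p := P x; set p' := P' x; set e := expR (v * x) => E.
  have -> : x * ((e * (v * 1) * p + e * p') * Q x + Q x * (e * (v * 1) * p + e * p')) =
     2 * e * e * p * (x * v * p + x * p') by rewrite /Q -/p -/e; ring.
  rewrite E (_ : _ * (_ + _) = 2 * (1 - expR (- x)) * (e * p) ^+ 2); last by ring.
  have ex : expR (- x) <= 1 by rewrite -expR0 ler_expR; nlra.
  by rewrite mulr_ge0 ?sqr_ge0//; nlra.
rewrite FP ltNge; apply/negP => PT.
have cQ : {within `[0, T], continuous Q}.
  by apply: (@is_derive_within _ _ (fun t => expR (v * t) * (v * 1) * P t + expR (v * t) * P' t)) => x /andP[x0 _]; exact: dQ.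
have Q0 : Q 0 = 1 by rewrite /Q mulr0 expR0 P00 mulr1.
have QT : Q T <= 0 by rewrite /Q mulr_ge0_le0 ?expR_ge0.
have I0 : Num.min (Q 0) (Q T) <= 0 <= Num.max (Q 0) (Q T).
  by rewrite Q0 ge_min QT orbT/= le_max ler01.
have [x] := IVT (ltW T0) cQ I0.
rewrite in_itv/= => /andP[x0 _] Qx.
by have := Q2 x x0; rewrite Qx mul0r ler10.
Qed.

(** For nu < 0 the truncated integral is genuine: T^(-nu) [Ss] has the positive derivative T^(-nu -
    1) [Fs] in T and tends to 0 with T. *)
Lemma Ss_gt0 T nu v : 0 < T -> 0 < v -> nu < 0 -> 0 < Ss T nu v.
Proof.
move=> T0 v0 nu0; have vv := ltW v0.
pose s := - nu; have s0 : 0 < s by rewrite oppr_gt0.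
have ks k : 0 < k%:R + s by rewrite ltr_wpDl.
pose w k : R := (k%:R - nu)^-1.
have Hw k : `|w k| <= s^-1.
  by rewrite /w -/s ger0_norm ?invr_ge0 ?(ltW (ks k))// lef_pV2 ?posrE// lerDr.
pose c k : R := appell k v * w k.
have Hc : smallc c by exact: appell_smallc vv Hw.
pose c1 k : R := appell k v * 1.
have Hc1 : smallc c1 by exact: appell_smallc vv norm1_le.
pose H t : R := Ser (fun k => c k * t ^+ k).
pose H' t : R := Ser (fun k => k%:R * c k * t ^+ k.-1).
have SH t : Ss t nu v = H t by congr Ser; apply/funext => k; rewrite /c mulrAC.
have FP t : Fs t v = Ser (fun k => c1 k * t ^+ k) by congr Ser; apply/funext => k; rewrite /c1 mulrAC.
have dH t : 0 <= t -> is_derive t 1 H (H' t) by move=> t0; exact: tsum_is_derive.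
have eqH t : 0 < t -> t * H' t = Fs t v - s * H t.
  move=> t0; have [C1 H1] := smallc_geo Hc1 t0; have [C2 H2] := smallc_geo Hc t0.
  rewrite FP -mulNr -(Ser_lin (- s) half01 H1 H2).
  have G k : k%:R * c k * t ^+ k = c1 k * t ^+ k + - s * (c k * t ^+ k).
    by rewrite /c /c1 /w /s; field; rewrite gt_eqF// -/s.
  have [C3 H3] : exists C, geo C 2^-1 (fun k => k%:R * c k * t ^+ k.-1).
    exists ((C1 + s * C2) / t) => k; case: k => [|k].
      have C10 := geo_ge0 H1.
      have C20 := geo_ge0 H2.
      by rewrite !mul0r normr0 expr0 mulr1 divr_ge0 ?(ltW t0)// addr_ge0// mulr_ge0// ltW.
    rewrite -(ler_pM2l t0) -[X in X * `|_| <= _](gtr0_norm t0) -normrM.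
    have -> : t * (k.+1%:R * c k.+1 * t ^+ k) = k.+1%:R * c k.+1 * t ^+ k.+1 by rewrite exprS; ring.
    rewrite G; have -> : t * ((C1 + s * C2) / t * 2^-1 ^+ k.+1) = C1 * 2^-1 ^+ k.+1 + s * (C2 * 2^-1 ^+ k.+1).
      by field; rewrite gt_eqF.
    apply: le_trans (ler_normD _ _) _; apply: lerD (H1 _) _.
    by rewrite normrM normrN (gtr0_norm s0) ler_wpM2l ?(ltW s0)//; exact: H2.
  have H0 : geo 0 2^-1 (fun=> 0 : R) by move=> k; rewrite normr0 mul0r.
  have S0 : Ser (fun=> 0 : R) = 0.
    by have := Ser_norm half01 H0; rewrite mul0r normr_le0 => /eqP.
  have L3 := Ser_lin t half01 H0 H3; rewrite S0 add0r in L3; rewrite /H' -L3.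
  congr Ser; apply/funext => k; rewrite add0r -G; case: k => [|k]; first by rewrite !mul0r mulr0.
  by rewrite exprS /=; ring.
pose K t : R := t `^ s * H t.
have dK t : 0 < t -> is_derive t 1 K (s * t `^ (s - 1) * H t + t `^ s * H' t).
  move=> t0; have t00 : 0 < t + 0 by rewrite addr0.
  have := is_derive_powR s t00; rewrite addr0.
  rewrite (_ : (fun t => (t + 0) `^ s) = fun t => t `^ s); last by apply/funext => z; rewrite addr0.
  by move=> D; exact: is_deriveM' D (dH t (ltW t0)).
have K'0 t : 0 < t -> 0 < s * t `^ (s - 1) * H t + t `^ s * H' t.
  move=> t0; rewrite (powRS s t0).
  have -> : s * t `^ (s - 1) * H t + t * t `^ (s - 1) * H' t = t `^ (s - 1) * (s * H t + t * H' t) by ring.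
  have -> : s * H t + t * H' t = Fs t v by rewrite eqH//; ring.
  by rewrite mulr_gt0 ?powR_gt0// Fs_gt0.
have inc x y : 0 < x -> x < y -> K x < K y.
  move=> x0 xy; apply: (derive_gt0_lt_cc xy (df := fun t => s * t `^ (s - 1) * H t + t `^ s * H' t)).
    by move=> z /andP[xz _]; apply: dK; nlra.
  by move=> z /andP[xz _]; apply: K'0; nlra.
suff K0 : 0 <= K (T / 2).
  have T2 : 0 < T / 2 by rewrite divr_gt0.
  have TT : T / 2 < T by nlra.
  have := inc _ _ T2 TT; rewrite SH /K => KT; have : 0 < T `^ s * H T by exact: le_lt_trans KT.
  by rewrite pmulr_rgt0// powR_gt0.
rewrite leNgt; apply/negP => Kneg.
have [C C0 HC] := Hc (2 * (T + 1))^-1 (ltac:(rewrite invr_gt0; nlra)).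
have e0 : 0 < - K (T / 2) / (2 * C + 1) by rewrite divr_gt0//; nlra.
have [x x1 hx] := powR_neg_small s0 e0.
(* So small that t^s times the bound 2 C on the series stays below - K(T/2), which contradicts the
   monotonicity of [K]. *)
pose t := Num.min x^-1 (T / 4).
have x0 : 0 < x by nlra.
have t0 : 0 < t by rewrite lt_min invr_gt0 x0/= divr_gt0.
have tx : t <= x^-1 by rewrite ge_min lexx.
have tT : t <= T / 4 by rewrite ge_min lexx orbT.
have ts : t `^ s <= x `^ (- s).
  rewrite powRN -powR_inv1 ?powR_ge0// -powRrM mulrN1 -mulN1r powRrM powR_inv1 ?(ltW x0)//.
  by apply: ge0_ler_powR; rewrite ?nnegrE ?invr_ge0; nlra.
have Ht : `|H t| <= 2 * C.
  have g : geo C 2^-1 (fun k => c k * t ^+ k).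
    move=> k; rewrite normrM normrX (gtr0_norm t0).
    apply: le_trans (ler_wpM2r (exprn_ge0 k (ltW t0)) (HC k)) _.
    rewrite -mulrA ler_wpM2l// -exprMn; apply: lerXn2r; rewrite ?nnegrE ?mulr_ge0 ?invr_ge0 ?(ltW t0)//; try nlra.
    by rewrite ler_pdivrMl; nlra.
  by apply: le_trans (Ser_norm half01 g) _; rewrite le_eqVlt; apply/orP; left; apply/eqP; field.
have t2 : t < T / 2 by nlra.
have := inc t _ t0 t2; have : - (t `^ s * (2 * C)) <= K t.
  rewrite /K; move: Ht; rewrite ler_norml => /andP[h _]; have := powR_ge0 t s; nra.
have : t `^ s * (2 * C + 1) <= - K (T / 2).
  by rewrite -ler_pdivlMr; [exact: le_trans hx|nlra].
by have := powR_ge0 t s; nlra.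
Qed.

End TruncatedMellin.

(** * Certificates: bounds for the exponent from finitely many signs *)

Section Certificates.
Variable R : realType.
Implicit Types (T d mu nu kap th v : R) (sg : R).

(** [Fs] obeys the same rule for the derivative, and a suitable multiple of it reverses the sign of
    the defect in the delay equation. *)
Definition comb T mu kap v := Ss T mu v + kap * Fs T v.

Lemma comb_is_derive T d mu kap v : 0 < T -> 0 < v -> 0 < d -> away d mu ->
  is_derive v 1 (comb T mu kap) (- T * comb T (mu - 1) kap v).
Proof.
move=> T0 v0 d0 aw; have := is_deriveD' (Ss_is_derive T0 v0 d0 aw) (is_deriveZ' kap (Fs_is_derive T0 v0)).
by move=> D; apply: (is_derive_eq D); rewrite /comb; ring.
Qed.

Lemma comb_eq T d mu kap v : 0 < T -> 0 < v -> 0 < d -> away d mu ->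
  v * (- T * comb T (mu - 1) kap v) = comb T mu kap (v + 1) + (mu - 1) * comb T mu kap v +
    (Fs T v - kap * ((v * T + mu - 1) * Fs T v + Fs T (v + 1))).
Proof.
move=> T0 v0 d0 aw; have := Ss_eq T0 v0 d0 aw.
rewrite /comb => E; have -> : v * (- T * (Ss T (mu - 1) v + kap * Fs T v)) =
  v * (- T * Ss T (mu - 1) v) - kap * (v * T * Fs T v) by ring.
by rewrite E; ring.
Qed.

Lemma comb_growth T th d mu kap : 0 < T -> T < th -> 0 < d -> away d mu ->
  exists2 C, 0 <= C & forall v, 0 <= v -> `|comb T mu kap v| <= C * expR (th * v).
Proof.
move=> T0 Tth d0 aw; have [C1 C10 H1] := wsum_growth T0 Tth (fun k => away_inv k d0 aw).
have [C2 C20 H2] := wsum_growth T0 Tth (@norm1_le R).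
exists (C1 + `|kap| * C2) => [|v v0]; first by rewrite addr_ge0// mulr_ge0.
rewrite mulrDl; apply: le_trans (ler_normD _ _) _; apply: lerD; first exact: H1.
by rewrite normrM -mulrA; apply: ler_wpM2l => //; exact: H2.
Qed.

(* Signs for which [sg * comb] is a supersolution on [a, oo). *)
Definition super_sign (a T mu kap sg : R) :=
  (sg = 1 /\ kap = 0) \/ (sg = -1 /\ 0 <= kap /\ 1 <= kap * (a * T + mu - 1)).

Lemma comb_super a T d mu kap sg v : 0 < a -> 0 < T -> 0 < d -> away d mu ->
  super_sign a T mu kap sg -> a <= v ->
  sg * comb T mu kap (v + 1) + (mu - 1) * (sg * comb T mu kap v) <= v * (sg * (- T * comb T (mu - 1) kap v)).
Proof.
move=> a0 T0 d0 aw Hs av; have v0 : 0 < v by nlra.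
rewrite [leRHS]mulrCA (comb_eq kap T0 v0 d0 aw).
have v1 : 0 < v + 1 by nlra.
have F0 := Fs_gt0 T0 v0; have F1 := Fs_gt0 T0 v1.
case: Hs => [[-> ->]|[-> [k0 k1]]]; first by rewrite mul0r; nlra.
have aT : 0 <= kap * ((v - a) * T) by rewrite !mulr_ge0 ?(ltW T0)//; nlra.
have h : Fs T v <= kap * (v * T + mu - 1) * Fs T v by rewrite ler_peMl ?(ltW F0)//; nlra.
have h2 : 0 <= kap * Fs T (v + 1) by rewrite mulr_ge0// ltW.
nlra.
Qed.

Lemma awayB (j : nat) d nu : away d nu -> away d (nu - j%:R).
Proof.
by elim: j => [|j IH] aw; [rewrite subr0|rewrite -natr1 opprD addrA; exact/awayB1/IH].
Qed.

(** Maximum principle against e^(th v), a supersolution of exponent a th - e^th + 1. As th > T,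
    [comb], whose growth rate may be taken halfway between T and th, is negligible. *)
Lemma base_nonneg a T d mu kap sg th : 0 < a -> 0 < T -> 0 < d -> away d mu ->
  super_sign a T mu kap sg -> T < th -> mu < a * th - expR th + 1 ->
  0 <= sg * comb T mu kap a -> forall v, a <= v -> 0 <= sg * comb T mu kap v.
Proof.
move=> a0 T0 d0 aw Hs Tth hth ha v av; rewrite -oppr_le0.
have Tm : T < (T + th) / 2 by nlra.
have mth : 0 < th - (T + th) / 2 by nlra.
have [C C0 HC] := comb_growth kap T0 Tm d0 aw.
have dE (x : R) : is_derive x 1 (fun v => expR (th * v)) (expR (th * x) * (th * 1)).
  exact: (is_derive_comp' (g := fun x => th * x) (is_derive_expR _) (is_deriveZ' th (is_derive_id x 1))).
apply: (max_principle a0 hth (f := fun v => - (sg * comb T mu kap v)) (f' := fun v => - (sg * (- T * comb T (mu - 1) kap v)))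
  (g := fun v => expR (th * v)) (g' := fun v => expR (th * v) * (th * 1))) => //.
- move=> x ax; have x0 : 0 < x by nlra.
  exact: (is_deriveN (is_deriveZ' sg (comb_is_derive kap T0 x0 d0 aw))).
- by move=> x _; exact: expR_gt0.
- move=> x ax; rewrite (mulrDr th x 1) mulr1 expRD.
  have := expR_gt0 (th * x); set X := expR (th * x); set Y := expR th => X0.
  have : 0 <= X * ((x - a) * th) by rewrite !mulr_ge0 ?(ltW X0)//; nlra.
  nlra.
- by move=> x ax _; have := comb_super a0 T0 d0 aw Hs ax; nlra.
- by rewrite oppr_le0.
move=> e e0; have sg1 : `|sg| <= 1 by case: Hs => [[-> _]|[-> _]]; rewrite ?normrN normr1.
have e1 : 0 < e / (C + 1) by rewrite divr_gt0//; nlra.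
have [V V1 HV] := powR_expR_little 0 mth e1.
exists (Num.max V a) => x; rewrite ge_max => /andP[Vx ax].
have := HV x Vx; rewrite powRr0 mulrAC ler_pdivlMr; last nlra.
have x0 : 0 <= x by nlra.
have -> : th * x = (th - (T + th) / 2) * x + (T + th) / 2 * x by ring.
rewrite expRD; have := HC x x0; have := expR_gt0 ((T + th) / 2 * x).
set Z := expR ((T + th) / 2 * x); set X := expR _ => Z0 h1; rewrite mul1r => h2.
have h3 : Z * (C + 1) <= Z * (e * X) by rewrite ler_wpM2l// ltW.
apply: le_trans (ler_norm _) _; rewrite normrN normrM.
have h4 : `|sg| * `|comb T mu kap x| <= 1 * (C * Z) by apply: ler_pM.
nlra.
Qed.

(** The alternating functions g_j satisfy g_j' = T g_(j+1), so signs at the single point a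
    propagate: once g_J is nonnegative on [a, oo), g_(J-1) increases from a positive value, and so
    on down to g_0, an increasing positive supersolution. *)
Lemma lambda_ge_cert a T d nu kap sg (J : nat) : 1 <= a -> 0 < T -> 0 < d -> away d nu ->
  super_sign a T nu kap sg -> (0 < J)%N ->
  (forall j, (j < J)%N -> 0 < (-1) ^+ j * (sg * comb T (nu - j%:R) kap a)) ->
  (forall v, a <= v -> 0 <= (-1) ^+ J * (sg * comb T (nu - J%:R) kap v)) ->
  nu <= lambda a^-1.
Proof.
move=> a1 T0 d0 aw Hs J0 Hj HJ; have a0 : 0 < a by nlra.
pose g j v := (-1) ^+ j * (sg * comb T (nu - j%:R) kap v).
have dg j (x : R) : 0 < x -> is_derive x 1 (g j) (T * g j.+1 x).
  move=> x0; have := is_deriveZ' ((-1) ^+ j) (is_deriveZ' sg (comb_is_derive kap T0 x0 d0 (awayB j aw))).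
  move=> D; apply: (is_derive_eq D); rewrite /g exprS -(natr1 j) opprD addrA; ring.
have inc j v : (j < J)%N -> (forall v, a <= v -> 0 <= g j.+1 v) -> a <= v -> g j a <= g j v.
  move=> jJ H av; apply: (derive_ge0_le_cc av (df := fun x => T * g j.+1 x)) => x /andP[ax _].
    by apply: dg; nlra.
  by rewrite mulr_ge0 ?(ltW T0)//; apply: H; exact: ltW.
have all j : (j <= J)%N -> forall v, a <= v -> 0 <= g (J - j)%N v.
  elim: j => [|j IH] jJ v av; first by rewrite subn0; exact: HJ.
  have e : (J - j = (J - j.+1).+1)%N by lia.
  have jl : (J - j.+1 < J)%N by lia.
  apply: le_trans (inc _ v jl _ av); first by apply/ltW/Hj.
  by rewrite -e; apply: IH; exact: ltnW.
have g1 v : a <= v -> 0 <= g 1%N v.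
  have -> : 1%N = (J - J.-1)%N by lia.
  by apply: all; lia.
have g0E v : g 0%N v = sg * comb T nu kap v by rewrite /g expr0 mul1r subr0.
have g1E v : T * g 1%N v = sg * (- T * comb T (nu - 1) kap v) by rewrite /g expr1; ring.
apply: (lambda_ge a1 (g := g 0%N) (g' := fun x => T * g 1%N x)).
- by move=> v av; apply: dg; nlra.
- move=> v av; apply: lt_le_trans (inc _ _ J0 g1 av); exact: Hj.
- by move=> v av; rewrite mulr_ge0 ?(ltW T0)// g1.
- by move=> v av; rewrite !g0E g1E; exact: (comb_super a0 T0 d0 aw Hs av).
Qed.

(** Here [comb] is itself a subsolution with slack kap [Fs] at v + 1, and this slack lets
    [lambda_le_slack] dispose of its growth at infinity. *)
Lemma lambda_le_cert_pos a T d mu kap : 1 <= a -> 0 < T -> 0 < d -> away d mu -> 0 <= mu ->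
  0 < kap -> 1 <= kap * (a * T + mu - 1) ->
  comb T mu kap a <= 0 -> 0 < comb T mu kap (a + 1) -> lambda a^-1 <= mu.
Proof.
move=> a1 T0 d0 aw mu0 k0 k1 fa fa1; have a0 : 0 < a by nlra.
have T1 : T < T + 1 by nlra.
have T12 : T + 1 < T + 2 by nlra.
have T10 : 0 < T + 1 by nlra.
have [C C0 HC] := comb_growth kap T0 T1 d0 aw.
have key v : a <= v -> v * (- T * comb T (mu - 1) kap v) + kap * Fs T (v + 1) <=
    comb T mu kap (v + 1) + (mu - 1) * comb T mu kap v.
  move=> av; have v0 : 0 < v by nlra.
  rewrite (comb_eq kap T0 v0 d0 aw); have F0 := Fs_gt0 T0 v0.
  have aT : 0 <= kap * ((v - a) * T) by rewrite !mulr_ge0 ?(ltW T0) ?(ltW k0)//; nlra.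
  have h : Fs T v <= kap * (v * T + mu - 1) * Fs T v by rewrite ler_peMl ?(ltW F0)//; nlra.
  nlra.
apply: (lambda_le_slack a1 mu0 T10 T12 C0 (f := comb T mu kap) (f' := fun v => - T * comb T (mu - 1) kap v)) => //.
- by move=> v av; apply: comb_is_derive aw => //; nlra.
- move=> v av; have := key v av; have v1 : 0 < v + 1 by nlra.
  by have := mulr_gt0 k0 (Fs_gt0 T0 v1); nlra.
- move=> V; have V1 : 0 < Num.max V a + 1 by rewrite ltr_wpDl// le_max (ltW a0) orbT.
  exists (kap * Fs T (Num.max V a + 1)) => [|v /andP[av vV]]; first by rewrite mulr_gt0 ?Fs_gt0.
  apply: le_trans (key v av); rewrite lerD2l ler_wpM2l ?(ltW k0)//.
  have v1 : 0 < v + 1 by nlra.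
  have vm : v + 1 <= Num.max V a + 1 by rewrite lerD2r le_max vV.
  rewrite (Fs_shift T0 v1 vm) ler_piMl ?(ltW (Fs_gt0 T0 v1))// -[leRHS]expR0 ler_expR oppr_le0.
  by rewrite mulr_ge0 ?(ltW T0)//; nlra.
- by move=> v av; apply: le_trans (ler_norm _) (HC v _); nlra.
- by exists (a + 1); [nlra|].
Qed.

(** For the other sign -[Ss] is a strict subsolution with slack [Fs], possibly positive at a. Part
    of the slack is spent on subtracting a multiple of e^(-(T + 1)(v - a)). This decays one unit
    faster than [Fs], so the factor v in front of its derivative is absorbed: e^(-x) (1 + x) <=
    1. *)
Lemma lambda_le_cert_neg a T d mu kap : 1 <= a -> 0 < T -> 0 < d -> away d mu -> 0 <= mu ->
  0 < kap -> kap * (a * (T + 1) + mu) <= 1 ->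
  0 <= comb T mu kap a -> comb T mu 0 (a + 1) + kap * Fs T a < 0 -> lambda a^-1 <= mu.
Proof.
move=> a1 T0 d0 aw mu0 k0 k1 fa fa1; have a0 : 0 < a by nlra.
have T1 : T < T + 1 by nlra.
have T12 : T + 1 < T + 2 by nlra.
have T10 : 0 < T + 1 by nlra.
have [C C0 HC] := comb_growth 0 T0 T1 d0 aw.
have Fa := Fs_gt0 T0 a0.
pose X v : R := expR (- (T + 1) * (v - a)).
have X0 v : 0 < X v by exact: expR_gt0.
pose f v := - (comb T mu 0 v + kap * Fs T a * X v).
pose f' v := - (- T * comb T (mu - 1) 0 v + kap * Fs T a * (X v * (- (T + 1) * 1))).
have dX (v : R) : is_derive v 1 X (X v * (- (T + 1) * 1)).
  have D0 : is_derive v 1 (fun v => v - a) 1.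
    by have := is_deriveB' (is_derive_id v 1) (is_derive_cst a v 1); rewrite subr0.
  exact: (is_derive_comp' (g := fun v => - (T + 1) * (v - a)) (is_derive_expR _) (is_deriveZ' (- (T + 1)) D0)).
pose de : R := 1 - expR (- (T + 1)).
have de0 : 0 < de by rewrite /de subr_gt0 -[ltRHS]expR0 ltr_expR; nlra.
have key v : a <= v -> v * f' v + kap * de * Fs T a * (expR (- T * (v - a)) * expR (- (v - a)) * expR (- (v - a))) <=
    f (v + 1) + (mu - 1) * f v.
  move=> av; have v0 : 0 < v by nlra.
  have E := comb_eq 0 T0 v0 d0 aw; rewrite mul0r subr0 in E.
  have -> : v * f' v = - (comb T mu 0 (v + 1) + (mu - 1) * comb T mu 0 v + Fs T v) + kap * Fs T a * X v * (v * (T + 1)).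
    by rewrite -E /f'; ring.
  have X1 : X (v + 1) = X v * expR (- (T + 1)) by rewrite /X -expRD; congr expR; ring.
  have XE : X v = expR (- T * (v - a)) * expR (- (v - a)) by rewrite /X -expRD; congr expR; ring.
  have FE : Fs T v = expR (- T * (v - a)) * Fs T a by rewrite (Fs_shift T0 a0 av) mulNr.
  rewrite /f X1 FE.
  set x := v - a; have x0 : 0 <= x by rewrite subr_ge0.
  set A : R := a * (T + 1) + mu in k1.
  have A0 : 0 <= (a - 1) * (T + 1) by rewrite mulr_ge0//; nlra.
  have A1 : T + 1 <= A by rewrite /A; nlra.
  have vA : v * (T + 1) + expR (- (T + 1)) + mu - 1 <= A * (1 + x) - de.
    have : 0 <= x * (A - (T + 1)) by rewrite mulr_ge0//; nlra.
    by rewrite /de /A /x; nlra.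
  have ex : expR (- x) * (1 + x) <= 1.
    rewrite expRN mulrC ler_pdivrMr ?expR_gt0// mul1r; exact: expR_ge1Dx.
  have e0 := expR_gt0 (- x); have E0 := expR_gt0 (- T * x); rewrite XE -/x.
  set P := expR (- T * x) in E0 *; set q := expR (- x) in e0 ex *; set F := Fs T a in Fa *.
  have m1 : kap * q * (v * (T + 1) + expR (- (T + 1)) + mu - 1) <= 1 - kap * de * q.
    have : kap * q * (v * (T + 1) + expR (- (T + 1)) + mu - 1) <= kap * q * (A * (1 + x) - de).
      by rewrite ler_wpM2l// mulr_ge0// ltW.
    have : kap * A * (q * (1 + x)) <= 1 * 1.
      by apply: ler_pM => //; rewrite mulr_ge0 ?(ltW k0) ?(ltW e0)//; nlra.
    nlra.
  have m2 : P * F * (kap * q * (v * (T + 1) + expR (- (T + 1)) + mu - 1)) <= P * F * (1 - kap * de * q).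
    by rewrite ler_wpM2l// mulr_ge0// ltW.
  have q1 : q <= 1 by rewrite /q -expR0 ler_expR; nlra.
  have m3 : kap * de * F * (P * q * q) <= kap * de * F * (P * q).
    by rewrite ler_wpM2l ?mulr_ge0 ?(ltW k0) ?(ltW de0) ?(ltW Fa)// ler_piMr// mulr_ge0 ?(ltW E0) ?(ltW e0).
  move: m2 m3; set eT := expR (- (T + 1)); nlra.
have slack v : 0 < kap * de * Fs T a * (expR (- T * (v - a)) * expR (- (v - a)) * expR (- (v - a))).
  by rewrite !mulr_gt0 ?expR_gt0.
apply: (lambda_le_slack a1 mu0 T10 T12 C0 (f := f) (f' := f')) => //.
- move=> v av; have v0 : 0 < v by nlra.
  exact: is_deriveN (is_deriveD' (comb_is_derive 0 T0 v0 d0 aw) (is_deriveZ' (kap * Fs T a) (dX v))).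
- by move=> v av; have := key v av; have := slack v; nlra.
- move=> V; exists (kap * de * Fs T a * (expR (- T * (V - a)) * expR (- (V - a)) * expR (- (V - a)))) => // v /andP[av vV].
  apply: le_trans (key v av); rewrite lerD2l ler_wpM2l//; first by rewrite !mulr_ge0// ltW.
  rewrite -!expRD ler_expR; have : 0 <= (V - v) * T by rewrite mulr_ge0 ?(ltW T0)//; nlra.
  nlra.
- move=> v av; have v0 : 0 <= v by nlra.
  have : 0 <= kap * Fs T a * X v by rewrite !mulr_ge0 ?(ltW k0) ?(ltW Fa) ?(ltW (X0 v)).
  by have := HC v v0; rewrite ler_norml /f => /andP[h _]; nlra.
- by rewrite /f /X subrr mulr0 expR0 mulr1; rewrite /comb mul0r addr0 in fa *; nlra.
- exists (a + 1); first nlra.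
  have X1 : X (a + 1) <= 1 by rewrite /X -[leRHS]expR0 ler_expR; nlra.
  have : kap * Fs T a * X (a + 1) <= kap * Fs T a * 1 by rewrite ler_wpM2l// mulr_ge0// ltW.
  by rewrite /f; nlra.
Qed.

End Certificates.

(** * Fixed-point integer arithmetic for the Appell coefficients *)

Section FixedPoint.

Fixpoint znest (j : Z) (l : seq Z) : Z :=
  if l is x :: l' then Z.div (Z.sub x (znest (Z.succ j) l')) j else Z0.

(** The coefficients of E scaled by 2^B, starting from the exact values e_2 = 1/4, e_1 = 1, e_0 =
    1. *)
Fixpoint ztab (B n : nat) : seq Z :=
  if n is m.+1 then
    let l := ztab B m in Z.div (znest 1 l) (Z.of_nat n.+2) :: l
  else [:: Z.pow 2 (Z.of_nat (B - 2)); Z.pow 2 (Z.of_nat B); Z.pow 2 (Z.of_nat B)].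

(** The shift decreases by t from entry to entry, which multiplies the k-th coefficient by T^k, T =
    2^t, while excess bits are dropped. *)
Fixpoint zscale (s t : nat) (l : seq Z) : seq Z :=
  if l is x :: l' then Z.shiftr x (Z.of_nat s) :: zscale (s - t) t l' else [::].

(** [appell_rec] solved for the value at v + 1, where c stands for v T and p is the preceding
    entry. *)
Fixpoint zshift (k c p : Z) (l : seq Z) : seq Z :=
  if l is x :: l' then
    Z.sub (Z.mul (Z.sub 1 k) x) (Z.mul c p) :: zshift (Z.succ k) c x l'
  else [::].

Definition zsum (l : seq Z) : Z := foldr Z.add Z0 l.

Fixpoint zssum (D n k : Z) (l : seq Z) : Z :=
  if l is x :: l' then
    Z.add (Z.div (Z.mul D x) (Z.sub (Z.mul k D) n)) (zssum D n (Z.succ k) l')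
  else Z0.

(** Running maximum of (abs x_k + e) theta^(K - k), theta = tn / qn, K the length, always rounded
    up: the geometric constant for [appell_bound]. *)
Fixpoint ztail (tn qn e m : Z) (l : seq Z) : Z :=
  if l is x :: l' then
    ztail tn qn e (Z.succ (Z.div (Z.mul (Z.max (Z.add (Z.abs x) e) m) tn) qn)) l'
  else m.

End FixedPoint.

Section FixedPointCorrect.
Variable R : realType.
Implicit Types (v T e : R) (k n : nat) (z : Z) (l : seq Z).

Definition zr z : R := (int_of_Z z)%:~R.

Lemma zrD x y : zr (Z.add x y) = zr x + zr y.
Proof. by rewrite /zr -intrD; congr (_%:~R); lia. Qed.
Lemma zrB x y : zr (Z.sub x y) = zr x - zr y.
Proof. by rewrite /zr -intrB; congr (_%:~R); lia. Qed.
Lemma zrM x y : zr (Z.mul x y) = zr x * zr y.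
Proof. by rewrite /zr -intrM; congr (_%:~R); lia. Qed.
Lemma zr_nat n : zr (Z.of_nat n) = n%:R.
Proof. by rewrite /zr (_ : int_of_Z (Z.of_nat n) = n%:Z) -?pmulrn//; lia. Qed.
Lemma zr0 : zr Z0 = 0. Proof. by []. Qed.
Lemma zr1 : zr 1 = 1. Proof. by []. Qed.
Lemma zrS z : zr (Z.succ z) = zr z + 1.
Proof. by rewrite -Z.add_1_r zrD. Qed.
Lemma zr_le x y : Z.le x y -> zr x <= zr y.
Proof. by move=> h; rewrite /zr ler_int; lia. Qed.
Lemma zr_lt x y : Z.lt x y -> zr x < zr y.
Proof. by move=> h; rewrite /zr ltr_int; lia. Qed.
Lemma zr_abs z : zr (Z.abs z) = `|zr z|.
Proof.
have [h|h] := Z.abs_spec z; case: h => [h ->].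
  by rewrite ger0_norm// -zr0; exact: zr_le.
rewrite ltr0_norm; first by rewrite -Z.sub_0_l zrB zr0 sub0r.
by rewrite -zr0; exact: zr_lt.
Qed.
Lemma zr_pow2 n : zr (Z.pow 2 (Z.of_nat n)) = 2 ^+ n.
Proof.
elim: n => [//|n IH]; rewrite Nat2Z.inj_succ Z.pow_succ_r; last lia.
by rewrite zrM IH exprS.
Qed.

Lemma zdiv_err x y : y <> Z0 -> `|zr x / zr y - zr (Z.div x y)| <= 1.
Proof.
move=> y0; have yr0 : zr y != 0.
  by rewrite /zr intr_eq0; lia.
have E := Z.div_mod x y y0.
have -> : zr x / zr y - zr (Z.div x y) = zr (Z.modulo x y) / zr y.
  by rewrite {1}E zrD zrM; field.
rewrite normrM normfV ler_pdivrMr ?normr_gt0// mul1r -!zr_abs; apply: zr_le.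
have := Z.mod_pos_bound x y; have := Z.mod_neg_bound x y; lia.
Qed.

Lemma zshiftr_err x n : `|zr x / 2 ^+ n - zr (Z.shiftr x (Z.of_nat n))| <= 1.
Proof.
rewrite Z.shiftr_div_pow2; last lia.
rewrite -zr_pow2; apply: zdiv_err; have := Z.pow_pos_nonneg 2 (Z.of_nat n); lia.
Qed.

Fixpoint closes (B : nat) e (lR : seq R) (l : seq Z) : Prop :=
  match lR, l with
  | x :: lR', z :: l' => `|2 ^+ B * x - zr z| <= e /\ closes B e lR' l'
  | [::], [::] => True
  | _, _ => False
  end.

(** Division by j >= 2 halves what has accumulated, (e + (e + 3)) / 2 + 1 <= e + 3, so the depth of
    the nest does not matter. *)
Lemma znestP B e lR l j : 0 <= e -> closes B e lR l -> (2 <= j)%N ->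
  `|2 ^+ B * nest j lR - zr (znest (Z.of_nat j) l)| <= e + 3.
Proof.
move=> e0; elim: lR l j => [|x lR IH] [|z l] j //= H j2.
  by rewrite mulr0 zr0 subrr normr0; nlra.
have [h1 {}/IH IH] := H; have {IH} := IH j.+1 (leqW j2).
rewrite Nat2Z.inj_succ; set h := znest _ _; set r := nest _ _ => h2.
have j0 : Z.of_nat j <> Z0 by lia.
have := zdiv_err (Z.sub z h) j0; rewrite zrB zr_nat; set q := zr (Z.div _ _) => h3.
have jR : (2 : R) <= j%:R by rewrite ler_nat.
have jp : (0 : R) < j%:R by nlra.
have -> : 2 ^+ B * ((x - r) / j%:R) - q = ((2 ^+ B * x - zr z) - (2 ^+ B * r - zr h)) / j%:R + ((zr z - zr h) / j%:R - q).
  by field; rewrite gt_eqF.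
apply: le_trans (ler_normD _ _) _.
have h4 : `|((2 ^+ B * x - zr z) - (2 ^+ B * r - zr h)) / j%:R| <= (e + (e + 3)) / 2.
  rewrite normrM normfV [`|j%:R|]ger0_norm//; apply: ler_pM; rewrite ?invr_ge0 ?lef_pV2 ?posrE//.
  by apply: le_trans (ler_normB _ _) _; exact: lerD.
nlra.
Qed.

(** The error 7 reproduces itself: dividing by n + 3 >= 3 gives at most (7 + 10) / 3 + 1 < 7. *)
Lemma ztabP B n : (2 <= B)%N -> closes B 7 (enest R n.+2) (ztab B n).
Proof.
move=> B2; elim: n => [|n IH].
  rewrite /= !zr_pow2 subr0; have -> : (2 : R) ^+ B = 2 ^+ (B - 2) * 4.
    by rewrite -{1}(subnK B2) exprD; congr (_ * _); rewrite expr2; ring.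
  have z x : x = 0 :> R -> `|x| <= 7 by move=> ->; rewrite normr0.
  by do ![split; first by apply: z; field].
have -> : enest R n.+3 = nest 1 (enest R n.+2) / n.+3%:R :: enest R n.+2 by [].
have -> : ztab B n.+1 = Z.div (znest 1 (ztab B n)) (Z.of_nat n.+3) :: ztab B n by [].
split=> //; move: IH; case: (enest R n.+2) (size_enest R n.+2) => [//|x lR] _.
case: (ztab B n) => [[]|z l [h1 h2]] /=.
have e7 : (0 : R) <= 7 by [].
have := znestP e7 h2 (leqnn 2); set h := znest _ _; set r := nest _ _ => h3.
rewrite divr1 Z.div_1_r.
have j0 : Z.of_nat n.+3 <> Z0 by lia.
have := zdiv_err (Z.sub z h) j0; rewrite zrB zr_nat; set q := zr (Z.div _ _) => h4.
have jR : (3 : R) <= n.+3%:R by rewrite ler_nat.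
have jp : (0 : R) < n.+3%:R by nlra.
have -> : 2 ^+ B * ((x - r) / n.+3%:R) - q = ((2 ^+ B * x - zr z) - (2 ^+ B * r - zr h)) / n.+3%:R + ((zr z - zr h) / n.+3%:R - q).
  by field; rewrite gt_eqF.
apply: le_trans (ler_normD _ _) _.
have h5 : `|((2 ^+ B * x - zr z) - (2 ^+ B * r - zr h)) / n.+3%:R| <= (7 + (7 + 3)) / 3.
  rewrite normrM normfV [`|n.+3%:R|]ger0_norm//; apply: ler_pM; rewrite ?invr_ge0 ?lef_pV2 ?posrE//.
  by apply: le_trans (ler_normB _ _) _; exact: lerD.
nlra.
Qed.

Lemma closes_nth B e lR l : closes B e lR l -> size lR = size l /\
  forall j, (j < size l)%N -> `|2 ^+ B * nth 0 lR j - zr (nth Z0 l j)| <= e.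
Proof.
elim: lR l => [|x lR IH] [|z l] //= [h1 /IH[h2 h3]]; split; first by rewrite h2.
by case=> [//|j]; exact: h3.
Qed.

(* [l] lists [2 ^ b * appell k v * T ^ k] up to an error [e]. *)
Definition lists (b : nat) T v e l := forall k, (k < size l)%N ->
  `|2 ^+ b * (appell k v * T ^+ k) - zr (nth Z0 l k)| <= e.

Lemma nth_zscale s t l k : (k < size l)%N ->
  nth Z0 (zscale s t l) k = Z.shiftr (nth Z0 l k) (Z.of_nat (s - k * t)).
Proof.
elim: l s k => [//|x l IH] s [|k] /= kl; first by rewrite mul0n subn0.
by rewrite IH// mulSn subnDA.
Qed.

Lemma size_zscale s t l : size (zscale s t l) = size l.
Proof. by elim: l s => //= x l IH s; rewrite IH. Qed.

Lemma rescale_split (p q c x w u : R) : 1 <= p ->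
  c * (x * q) - w = (c * q * p * x - u) / p + (u / p - w).
Proof. by move=> p1; field; nlra. Qed.

Lemma zscaleP B b t K n : (2 <= B)%N -> (b + K * t <= B)%N -> (K <= n.+3)%N ->
  lists b (2 ^+ t) 0 8 (zscale (B - b) t (take K (rev (ztab B n)))).
Proof.
move=> B2 bB Kn; have [hs hn] := closes_nth (ztabP n B2).
rewrite size_enest in hs.
move=> k; rewrite size_zscale => kl.
have kK : (k < K)%N by move: kl; rewrite size_takel// size_rev -hs.
rewrite nth_zscale// nth_take// nth_rev; last by rewrite -hs (leq_trans kK).
rewrite -hs subSS; have kn : (k <= n.+2)%N by rewrite -ltnS (leq_trans kK).
have := hn (n.+2 - k)%N; rewrite -hs ltnS leq_subr nth_enest ?leq_subr// subKn// => /(_ isT).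
set z := nth _ _ _ => h; have := zshiftr_err z (B - b - k * t).
set s := (B - b - k * t)%N; set y := zr (Z.shiftr _ _) => h2.
have kt : (k * t <= K * t)%N by rewrite leq_mul2r ltnW ?orbT.
have Es : (2 : R) ^+ B = 2 ^+ b * (2 ^+ t) ^+ k * 2 ^+ s.
  by rewrite -exprM -!exprD; congr (_ ^+ _); rewrite /s mulnC; lia.
have p1 : (1 : R) <= 2 ^+ s by rewrite exprn_ege1//; nlra.
rewrite appell_at0.
have -> : 2 ^+ b * (ecoef R k * (2 ^+ t) ^+ k) - y = (2 ^+ B * ecoef R k - zr z) / 2 ^+ s + (zr z / 2 ^+ s - y).
  by rewrite Es; exact: rescale_split.
apply: le_trans (ler_normD _ _) _.
have : `|(2 ^+ B * ecoef R k - zr z) / 2 ^+ s| <= 7 * 1.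
  rewrite normrM normfV (ger0_norm (_ : 0 <= 2 ^+ s)); last nlra.
  by apply: ler_pM => //; rewrite ?invr_ge0 ?invf_le1//; nlra.
nlra.
Qed.

Lemma size_zshift (k c p : Z) l : size (zshift k c p l) = size l.
Proof. by elim: l k p => //= x l IH k p; rewrite IH. Qed.

Lemma nth_zshift (k0 c p : Z) l k : (k < size l)%N ->
  zr (nth Z0 (zshift k0 c p l) k) = (1 - (zr k0 + k%:R)) * zr (nth Z0 l k) - zr c * zr (nth Z0 (p :: l) k).
Proof.
elim: l k0 p k => [//|x l IH] k0 p [|k] kl.
  have -> : nth Z0 (zshift k0 c p (x :: l)) 0 = Z.sub (Z.mul (Z.sub 1 k0) x) (Z.mul c p) by [].
  by rewrite zrB !zrM zrB zr1 addr0.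
by rewrite /= IH// zrS -(natr1 k); congr (_ * _ - _); ring.
Qed.

(** The error bound is multiplied by K + v 2^t at each unit step in v; the guard bits removed later
    by [ztrunc] are there for this growth. *)
Lemma zshiftP b t (v : nat) (e : Z) l K : (size l <= K)%N -> lists b (2 ^+ t) v%:R (zr e) l ->
  lists b (2 ^+ t) (v.+1)%:R (zr (Z.mul (Z.of_nat (K + v * 2 ^ t)) e)) (zshift 0 (Z.of_nat (v * 2 ^ t)) 0 l).
Proof.
move=> lK H k; rewrite size_zshift => kl; rewrite nth_zshift// zr0 add0r zrM !zr_nat.
have v0 : (0 : R) <= v%:R by [].
have H1 := H k kl; have e0 : 0 <= zr e by exact: le_trans H1.
rewrite -(natr1 v) natrM natrX natrD natrM natrX.
set T : R := 2 ^+ t in H1 *; have T0 : 0 <= T by rewrite exprn_ge0.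
case: k kl H1 => [|k] kl H1 /=.
  rewrite (_ : _ - _ = 2 ^+ b * (appell 0 v%:R * T ^+ 0) - zr (nth Z0 l 0)); last by rewrite !appell0 zr0; ring.
  apply: le_trans H1 _.
  have K1 : (1 : R) <= K%:R by rewrite ler1n (leq_trans _ lK)// (leq_ltn_trans _ kl).
  by rewrite ler_peMl//; have := mulr_ge0 v0 T0; nlra.
have H2 := H k (ltnW kl); rewrite -/T in H2.
have rec := appell_rec k v0.
have -> : 2 ^+ b * (appell k.+1 (v%:R + 1) * T ^+ k.+1) -
    ((1 - k.+1%:R) * zr (nth Z0 l k.+1) - v%:R * T * zr (nth Z0 l k)) =
  (1 - k.+1%:R) * (2 ^+ b * (appell k.+1 v%:R * T ^+ k.+1) - zr (nth Z0 l k.+1)) -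
    v%:R * T * (2 ^+ b * (appell k v%:R * T ^+ k) - zr (nth Z0 l k)).
  have -> : appell k.+1 (v%:R + 1) = - v%:R * appell k v%:R + appell k.+1 v%:R - k.+1%:R * appell k.+1 v%:R :> R.
    by nlra.
  by rewrite exprS; ring.
apply: le_trans (ler_normB _ _) _; rewrite [leRHS]mulrDl; apply: lerD; rewrite normrM; apply: ler_pM => //.
  rewrite -(natr1 k) opprD addrCA subrr addr0 normrN normr_nat ler_nat.
  by apply: leq_trans lK; exact: leq_trans (leqnSn k) (ltnW kl).
by rewrite ger0_norm// mulr_ge0.
Qed.

Lemma ztruncP b s T v (e : Z) l : lists (b + s) T v (zr e) l ->
  lists b T v (zr (Z.add (Z.div e (Z.pow 2 (Z.of_nat s))) 2)) (map (fun z => Z.shiftr z (Z.of_nat s)) l).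
Proof.
move=> H k; rewrite size_map => kl; rewrite (nth_map Z0)//.
have := H k kl; set z := nth _ _ _ => h; have := zshiftr_err z s; set y := zr (Z.shiftr _ _) => h2.
have p0 : Z.pow 2 (Z.of_nat s) <> Z0 by have := Z.pow_pos_nonneg 2 (Z.of_nat s); lia.
have := zdiv_err e p0; rewrite zrD zr_pow2; set q := zr (Z.div _ _).
rewrite ler_norml => /andP[_ h3].
have p1 : (0 : R) < 2 ^+ s by rewrite exprn_gt0.
have -> : 2 ^+ b * (appell k v * T ^+ k) - y = (2 ^+ (b + s) * (appell k v * T ^+ k) - zr z) / 2 ^+ s + (zr z / 2 ^+ s - y).
  by rewrite exprD; field; rewrite gt_eqF.
apply: le_trans (ler_normD _ _) _.
have : `|(2 ^+ (b + s) * (appell k v * T ^+ k) - zr z) / 2 ^+ s| <= zr e / 2 ^+ s.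
  by rewrite normrM normfV (gtr0_norm p1) ler_wpM2r// invr_ge0 ltW.
have -> : zr 2 = 2 by [].
nlra.
Qed.

Lemma zsumP b T v e l : lists b T v e l ->
  `|2 ^+ b * (\sum_(k < size l) appell k v * T ^+ k) - zr (zsum l)| <= (size l)%:R * e.
Proof.
move=> H; have -> : zr (zsum l) = \sum_(k < size l) zr (nth Z0 l k).
  elim: l {H} => [|x l IH] /=; first by rewrite big_ord0.
  by rewrite zrD IH big_ord_recl.
rewrite mulr_sumr -sumrB; apply: le_trans (ler_norm_sum _ _ _) _.
apply: le_trans (_ : \sum_(k < size l) e <= _).
  by apply: ler_sum => k _; exact: H.
by rewrite sumr_const card_ord mulr_natl.
Qed.

Lemma away_frac (D n : Z) : Z.lt 0 D -> Z.modulo n D <> Z0 -> away (zr D)^-1 (zr n / zr D).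
Proof.
move=> D0 nD k; have d0 : 0 < zr D by rewrite -zr0; exact: zr_lt.
have -> : k%:R - zr n / zr D = (zr (Z.sub (Z.mul (Z.of_nat k) D) n)) / zr D.
  by rewrite zrB zrM zr_nat; field; rewrite gt_eqF.
rewrite normrM normfV (gtr0_norm d0) ler_peMl ?invr_ge0 ?(ltW d0)//.
rewrite -zr_abs -zr1; apply: zr_le.
suff : Z.sub (Z.mul (Z.of_nat k) D) n <> Z0 by lia.
move=> h; apply: nD; have -> : n = Z.mul (Z.of_nat k) D by lia.
by rewrite Z.mod_mul//; lia.
Qed.

Lemma zssumP b T v (e : R) l (D n : Z) : lists b T v e l -> Z.lt 0 D -> Z.modulo n D <> Z0 ->
  `|2 ^+ b * (\sum_(k < size l) appell k v * T ^+ k * (k%:R - zr n / zr D)^-1) - zr (zssum D n 0 l)| <=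
    (size l)%:R * (e * zr D + 1).
Proof.
move=> H D0 nD; have aw := away_frac D0 nD; have d0 : 0 < zr D by rewrite -zr0; exact: zr_lt.
have -> : zr (zssum D n 0 l) = \sum_(k < size l) zr (Z.div (Z.mul D (nth Z0 l k)) (Z.sub (Z.mul (Z.of_nat k) D) n)).
  have G l' k0 : zr (zssum D n (Z.of_nat k0) l') = \sum_(k < size l') zr (Z.div (Z.mul D (nth Z0 l' k)) (Z.sub (Z.mul (Z.of_nat (k0 + k)) D) n)).
    elim: l' k0 => [|x l' IH] k0 /=; first by rewrite big_ord0.
    rewrite zrD big_ord_recl addn0 -Nat2Z.inj_succ IH; congr (_ + _).
    apply: eq_bigr => k _.
    by have -> : (k0 + lift ord0 k = k0.+1 + k)%N by rewrite lift0 addnS.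
  exact: (G l 0%N).
rewrite mulr_sumr -sumrB; apply: le_trans (ler_norm_sum _ _ _) _.
apply: le_trans (_ : \sum_(k < size l) (e * zr D + 1) <= _); last by rewrite sumr_const card_ord mulr_natl.
apply: ler_sum => k _; have := H k (ltn_ord k); set z := nth _ _ _; set x := appell k v * T ^+ k => h.
set y := Z.sub _ _; have y0 : y <> Z0.
  move=> h0; apply: nD; have -> : n = Z.mul (Z.of_nat k) D by rewrite /y in h0; lia.
  by rewrite Z.mod_mul//; lia.
have yE : k%:R - zr n / zr D = zr y / zr D.
  by rewrite /y zrB zrM zr_nat; field; rewrite gt_eqF.
have yr0 : zr y != 0 by rewrite /zr intr_eq0; lia.
have := zdiv_err (Z.mul D z) y0; rewrite zrM; set q := zr (Z.div _ _) => h2.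
have -> : 2 ^+ b * (x * (k%:R - zr n / zr D)^-1) - q = (2 ^+ b * x - zr z) * (k%:R - zr n / zr D)^-1 + (zr D * zr z / zr y - q).
  by rewrite yE; field; rewrite yr0 gt_eqF.
apply: le_trans (ler_normD _ _) _; apply: lerD => //.
rewrite normrM; apply: ler_pM => //; rewrite normfV -[leRHS]invrK lef_pV2 ?posrE ?invr_gt0//.
by rewrite normr_gt0 yE mulf_neq0// invr_eq0 gt_eqF.
Qed.

Lemma ztailP (tn qn e m : Z) l : Z.le 0 tn -> Z.lt 0 qn -> Z.le 0 m -> Z.le 0 e ->
  zr m * (zr tn / zr qn) ^+ size l <= zr (ztail tn qn e m l) /\
  forall k, (k < size l)%N -> (`|zr (nth Z0 l k)| + zr e) * (zr tn / zr qn) ^+ (size l - k) <= zr (ztail tn qn e m l).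
Proof.
move=> t0 q0 + e0; elim: l m => [|x l IH] m m0 /=; first by rewrite expr0 mulr1.
have q0' : 0 < zr qn by rewrite -zr0; exact: zr_lt.
have th0 : 0 <= zr tn / zr qn by rewrite divr_ge0 ?(ltW q0')// -zr0; exact: zr_le.
set M := Z.max _ _; set m' := Z.succ _.
have m'0 : Z.le 0 m'.
  by have := Z.div_pos (Z.mul M tn) qn; rewrite /m' /M; nia.
have [H1 H2] := IH m' m'0.
have Mm : zr M * (zr tn / zr qn) <= zr m'.
  have qq : qn <> Z0 by lia.
  have := zdiv_err (Z.mul M tn) qq; rewrite zrM ler_norml => /andP[_ h].
  by rewrite /m' zrS mulrA; nlra.
have step y : Z.le y M -> zr y * (zr tn / zr qn) ^+ (size l).+1 <= zr (ztail tn qn e m' l).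
  move=> yM; apply: le_trans H1; rewrite exprS mulrA ler_wpM2r ?exprn_ge0//.
  by apply: le_trans Mm; rewrite ler_wpM2r//; exact: zr_le.
split; first by apply: step; rewrite /M; lia.
case=> [|k] kl; last by rewrite subSS; exact: H2.
by rewrite subn0 /= -zr_abs -zrD; apply: step; rewrite /M; lia.
Qed.

End FixedPointCorrect.

Section RowCheck.

Definition dec_num (m : nat) (ds : seq nat) : Z :=
  foldl (fun acc d => Z.add (Z.mul 10 acc) (Z.of_nat d)) (Z.of_nat m) ds.

Definition ztrunc (s : nat) (l : seq Z) := map (fun z => Z.shiftr z (Z.of_nat s)) l.

Definition zbound (K D tn qn fac e : Z) (l : seq Z) : Z * Z :=
  let tl := Z.mul fac (ztail tn qn e 0 l) in
  (Z.add (Z.mul K (Z.add (Z.mul e D) 1)) tl, Z.add (Z.mul K e) tl).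

(* Certifies the sign of [comb] at exponent [n / D] with [kap = kn / kd]. *)
Definition zpos (D n kn kd : Z) (s : bool) (es : Z * Z) (l : seq Z) : bool :=
  let c := Z.add (Z.mul kd (zssum D n 0 l)) (Z.mul kn (zsum l)) in
  Z.ltb (Z.add (Z.mul kd es.1) (Z.mul kn es.2)) (if s then c else Z.opp c).

Fixpoint zchain (D n kn kd : Z) (s : bool) (es : Z * Z) (l : seq Z) (J : nat) : bool :=
  if J is J'.+1 then zpos D n kn kd s es l && zchain D (Z.sub n D) kn kd (~~ s) es l J' else true.

(** Exponents are multiples of 10^-7: [nlo] is the tabulated decimal, [nhi] lies 10^-7 below its
    successor in the last digit. The sign [s] is that of Gamma(-mu) for mu between m and m + 1. For
    i <= 4 the chain of signs runs down to a negative index, where positivity is automatic. For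
    larger i it stops at an even J, about m + 9 - 2 i, whose index is below 2.01 i - 6.49, and
    [base_nonneg] with th = 2.01 takes over. *)
Definition zrow (t K : nat) (tn qn fac e e1 : Z) (l l1 : seq Z) (i m : nat) (ds : seq nat) : bool :=
  let D := Z.pow 10 7 in
  let p10 := Z.pow 10 (Z.of_nat (7 - size ds)) in
  let nlo := Z.mul (dec_num m ds) p10 in
  let nhi := Z.sub (Z.mul (Z.succ (dec_num m ds)) p10) 1 in
  let s := odd m in
  let neg := (i <= 4)%N in
  let J := if neg then m.+1 else (2 * ((m + 9 - 2 * i) %/ 2))%N in
  let aT := Z.of_nat (i * 2 ^ t) in
  let nJ := Z.sub nlo (Z.mul (Z.of_nat J) D) in
  let kd := Z.add (Z.mul aT D) (Z.sub nJ D) in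
  let: (kn, kd) := if s then (Z0, Zpos xH) else (D, kd) in
  let kd2 := if s then Z.add (Z.mul aT D) (Z.sub nhi D) else Z.add (Z.mul (Z.add aT (Z.of_nat i)) D) nhi in
  let es := zbound (Z.of_nat K) D tn qn fac e l in
  let es1 := zbound (Z.of_nat K) D tn qn fac e1 l1 in
  [&& (size ds <= 7)%N, (0 < J)%N, Z.ltb 0 kd, Z.ltb 0 kd2, ~~ Z.eqb (Z.modulo nlo D) 0, ~~ Z.eqb (Z.modulo nhi D) 0,
      Z.leb 0 nhi, Z.ltb nhi (Z.mul (Z.of_nat K.-1) D), size l == K, size l1 == K,
      zchain D nlo kn kd s es l J,
      (if neg then Z.ltb nJ 0 && (s (+) odd J)
       else [&& ~~ odd J, zpos D nJ kn kd s es l &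
         Z.ltb (Z.mul 100 nJ) (Z.mul D (Z.sub (Z.mul 201 (Z.of_nat i)) 649))]),
      zpos D nhi D kd2 (~~ s) es l &
      if s then zpos D nhi D kd2 true es1 l1
      else Z.ltb (Z.add (Z.mul kd2 es1.1) (Z.mul D es.2))
             (Z.opp (Z.add (Z.mul kd2 (zssum D nhi 0 l1)) (Z.mul D (zsum l))))].

Fixpoint zrows (t K s : nat) (tn qn fac e : Z) (l : seq Z) (i : nat) (r : seq (nat * nat * seq nat)) : bool :=
  if r is (i', m, ds) :: r' then
    let l1 := zshift 0 (Z.of_nat (i * 2 ^ t)) 0 l in
    let e1 := Z.mul (Z.of_nat (K + i * 2 ^ t)) e in
    let tr x := Z.add (Z.div x (Z.pow 2 (Z.of_nat s))) 2 in
    [&& i' == i, zrow t K tn qn fac (tr e) (tr e1) (ztrunc s l) (ztrunc s l1) i m ds &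
        zrows t K s tn qn fac e1 l1 i.+1 r']
  else true.

Fixpoint ziter (t K : nat) (e : Z) (l : seq Z) (v n : nat) : Z * seq Z :=
  if n is n'.+1 then
    ziter t K (Z.mul (Z.of_nat (K + v * 2 ^ t)) e) (zshift 0 (Z.of_nat (v * 2 ^ t)) 0 l) v.+1 n'
  else (e, l).

(** T = 4 with tail ratio 4/5 for i <= 4, and T = 2 with ratio 2/4 beyond. The lengths satisfy v q +
    (49/18)^q - 1 <= K at the largest v reached: K = 176 for v = 5, q = 5 and K = 140 for v = 21, q
    = 4. The second list starts with 200 bits, 130 of them against the error growth over 21 unit
    steps. *)
Definition ztable : bool :=
  let L := rev (ztab 430 173) in
  let: (e4, l4) := ziter 2 176 8 (zscale (430 - 74) 2 (take 176 L)) 0 2 in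
  let: (e2, l2) := ziter 1 140 8 (zscale (430 - 200) 1 (take 140 L)) 0 5 in
  zrows 2 176 4 4 5 5 e4 l4 2 (take 3 lambda_table) &&
  zrows 1 140 130 2 4 2 e2 l2 5 (drop 3 lambda_table).

Lemma ztable_ok : ztable = true.
Proof. vm_compute; reflexivity. Qed.

End RowCheck.

Section RowCheckCorrect.
Variable R : realType.
Local Notation zr := (@zr R).

Lemma zr_pow (z : Z) (n : nat) : zr (Z.pow z (Z.of_nat n)) = zr z ^+ n.
Proof.
elim: n => [//|n IH]; rewrite Nat2Z.inj_succ Z.pow_succ_r; last lia.
by rewrite zrM IH exprS.
Qed.

Lemma expR_le_inv1 (x : R) : x < 1 -> expR x <= (1 - x)^-1.
Proof.
move=> x1; have := expR_ge1Dx (- x); rewrite expRN => h.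
by rewrite -[leLHS]invrK lef_pV2 ?posrE ?invr_gt0 ?expR_gt0 ?subr_gt0.
Qed.

(** From e^(1/n) <= n / (n - 1), raised to the power n = 512. This n is known only through its image
    in Z, so the final comparison is computed in binary. *)
Lemma expR1_le : expR (1 : R) <= 49 / 18.
Proof.
have [n nE] : exists n, Z.of_nat n = Z.pow 2 9 by exists (Z.to_nat (Z.pow 2 9)); rewrite Z2Nat.id.
have n1 : (1 < n)%N by lia.
have n0 : (0 : R) < n%:R by rewrite ltr0n; lia.
have n'0 : (0 : R) < n.-1%:R by rewrite ltr0n; lia.
have nn : (n%:R : R) = n.-1%:R + 1 by rewrite natr1 prednK//; lia.
have h : expR (1 : R) <= (n%:R / n.-1%:R) ^+ n.
  have nz : (n%:R : R) != 0 by rewrite gt_eqF.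
  rewrite -[X in expR X](divff nz) expRM_natl.
  apply: lerXn2r; rewrite ?nnegrE ?expR_ge0 ?divr_ge0//.
  apply: le_trans (expR_le_inv1 _) _; first by rewrite invf_lt1// ltr1n.
  by rewrite le_eqVlt; apply/orP; left; apply/eqP; rewrite nn; field; rewrite !gt_eqF// -nn.
apply: le_trans h _; rewrite expr_div_n ler_pdivrMr ?exprn_gt0// mulrAC ler_pdivlMr ?ltr0n//.
have e (m : nat) : m%:R = zr (Z.of_nat m) by rewrite zr_nat.
have -> : n.-1%:R = zr (Z.pred (Z.pow 2 9)) by rewrite e; congr zr; lia.
rewrite (e 18%N) (e 49%N) (e n) -!zr_pow -!zrM nE; apply: zr_le.
by apply/Z.leb_le; vm_compute.
Qed.

Lemma expR_nat_le (n : nat) : expR (n%:R : R) <= (49 / 18) ^+ n.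
Proof.
rewrite -[n%:R]mulr1 expRM_natl; apply: lerXn2r; rewrite ?nnegrE ?expR_ge0 ?divr_ge0//.
exact: expR1_le.
Qed.

Variables (t K b : nat) (tn qn fac : Z) (q : nat).
Let T : R := 2 ^+ t.

Let T0 : 0 < T. Proof. by rewrite exprn_gt0. Qed.

(* The ratio [tn / qn] is [T / q], and [fac] is [1 / (1 - T / q)]. *)
Definition tail_params := [/\ Z.le 0 tn, Z.lt 0 qn, (0 < q)%N &
  [/\ zr tn / zr qn = T / q%:R, 0 < T / q%:R < 1 & zr fac = (1 - T / q%:R)^-1]].

Definition good_at (v : nat) := v%:R * q%:R + (49 / 18) ^+ q - 1 <= K%:R :> R.

Hypothesis params : tail_params.
Hypothesis K0 : (0 < K)%N.

Lemma list_tail (v : nat) (e : Z) (l : seq Z) : good_at v -> size l = K -> Z.le 0 e ->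
  lists b T v%:R (zr e) l ->
  forall k, 2 ^+ b * `|appell k v%:R * T ^+ k| <= zr (ztail tn qn e 0 l) * (T / q%:R) ^+ k / (T / q%:R) ^+ K.
Proof.
case: params => t0 q0 qq [th /andP[th0 th1] hf] gv sl e0 H k.
have [_ H2] := @ztailP R tn qn e Z0 l t0 q0 (Z.le_refl 0) e0; set m := zr (ztail _ _ _ _ _) in H2 *.
set thv := T / q%:R in th th0 th1 *; rewrite th sl in H2.
have qr : (0 : R) < q%:R by rewrite ltr0n.
have b0 : (0 : R) < 2 ^+ b by rewrite exprn_gt0.
have r0 : (0 : R) < q%:R^-1 by rewrite invr_gt0.
pose M := m / 2 ^+ b / thv ^+ K.
have key j : (j < K)%N -> `|appell j v%:R| <= M * (q%:R^-1) ^+ j.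
  move=> jK; have := H2 j jK; have := H j; rewrite sl => /(_ jK); set z := nth _ _ _ => h1 h2.
  have h3 : 2 ^+ b * `|appell j v%:R * T ^+ j| <= `|zr z| + zr e.
    rewrite -[2 ^+ b](ger0_norm (ltW b0)) -normrM.
    have := ler_normD (2 ^+ b * (appell j v%:R * T ^+ j) - zr z) (zr z); rewrite subrK; nlra.
  have h4 : 2 ^+ b * `|appell j v%:R * T ^+ j| * thv ^+ (K - j) <= m.
    by apply: le_trans h2; rewrite ler_wpM2r// exprn_ge0// ltW.
  have Tj : 0 < T ^+ j by rewrite exprn_gt0.
  have EK : thv ^+ K = thv ^+ (K - j) * thv ^+ j by rewrite -exprD subnK// ltnW.
  have Ej : T ^+ j = thv ^+ j * q%:R ^+ j by rewrite -exprMn /thv divfK// gt_eqF.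
  have t1 : 0 < thv ^+ (K - j) by rewrite exprn_gt0.
  have t2 : 0 < thv ^+ j by rewrite exprn_gt0.
  have q1 : (0 : R) < q%:R ^+ j by rewrite exprn_gt0.
  rewrite /M exprVn -!mulrA -ler_pdivrMr ?mulr_gt0 ?invr_gt0 ?exprn_gt0//.
  move: h4; rewrite normrM (gtr0_norm Tj) Ej EK; set X := `|_|; move: t1 t2 q1 b0.
  set A := thv ^+ (K - j); set C := thv ^+ j; set Q := q%:R ^+ j; set P := 2 ^+ b => A0 C0 Q0 P0 h4.
  rewrite !invfM !invrK; have -> : X * (P * (A * C * Q)) = P * (X * (C * Q)) * A by ring.
  done.
have M0 : 0 <= M.
  by have := key 0%N K0; rewrite expr0 mulr1; apply: le_trans.
have v0 : (0 : R) <= v%:R by [].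
have gv' : v%:R / q%:R^-1 + expR (q%:R^-1)^-1 - 1 <= K%:R :> R.
  by rewrite !invrK; have := expR_nat_le q; move: gv; rewrite /good_at; nlra.
have := appell_bound K0 v0 r0 M0 gv' key k => h.
rewrite normrM (ger0_norm (exprn_ge0 k (ltW T0))).
apply: le_trans (_ : 2 ^+ b * (M * q%:R^-1 ^+ k * T ^+ k) <= _).
  by rewrite ler_wpM2l ?(ltW b0)// ler_wpM2r// exprn_ge0// ltW.
have e1 : q%:R^-1 ^+ k * T ^+ k = thv ^+ k by rewrite -exprMn mulrC.
have tK : 0 < thv ^+ K by rewrite exprn_gt0.
rewrite -(mulrA M) e1 /M le_eqVlt; apply/orP; left; apply/eqP.
move: tK b0; set X := 2 ^+ b; set A := thv ^+ k; set Q := thv ^+ K => Q0 X0.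
by field; rewrite !gt_eqF.
Qed.

Lemma list_geo (v : nat) : exists2 C, 0 <= C & forall w W, (forall k, `|w k| <= W) ->
  geo (C * W) 2^-1 (fun k => appell k (v%:R : R) * T ^+ k * w k).
Proof.
have r0 : 0 < (2 * T)^-1 by rewrite invr_gt0 mulr_gt0.
have [C C0 HC] := appell_growth r0.
exists (C * expR (v%:R / (2 * T)^-1)) => [|w W Hw]; first by rewrite mulr_ge0 ?expR_ge0.
have -> : 2^-1 = T * (2 * T)^-1 :> R by field; rewrite gt_eqF.
exact: wsum_geo (ltW T0) (ler0n R v) HC Hw.
Qed.

(** Beyond K the terms are dominated by a geometric series of ratio T / q whose first term is the
    [ztail] value, so its sum is [fac] times that value. *)
Lemma wsum_tail (v : nat) (e : Z) (l : seq Z) (w : nat -> R) (W : R) : good_at v -> size l = K -> Z.le 0 e ->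
  lists b T v%:R (zr e) l -> (forall k, `|w k| <= W) -> (forall k, (K <= k)%N -> `|w k| <= 1) ->
  `|2 ^+ b * wsum T w v%:R - 2 ^+ b * (\sum_(k < K) appell k v%:R * T ^+ k * w k)| <=
    zr (Z.mul fac (ztail tn qn e 0 l)).
Proof.
move=> gv sl e0 H Hw Hw1; have LT := list_tail gv sl e0 H; set m := zr (ztail tn qn e 0 l) in LT.
case: params => _ _ qq [_ th hf]; have /andP[th0 th1] := th.
have [C C0 HC] := list_geo v; have G := HC w W Hw.
rewrite -mulrBr; rewrite {1}/wsum (Ser_split K (half01 R) G) addrC addKr.
have b0 : (0 : R) < 2 ^+ b by rewrite exprn_gt0.
have th01 : 0 <= T / q%:R < 1 by rewrite th1 andbT ltW.
have G2 : geo (m / 2 ^+ b) (T / q%:R) (fun k => appell (k + K) (v%:R : R) * T ^+ (k + K) * w (k + K)%N).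
  move=> k; have := LT (k + K)%N; rewrite -ler_pdivlMl// => h.
  rewrite normrM -[leRHS]mulr1; apply: ler_pM => //; last by apply: Hw1; rewrite leq_addl.
  apply: le_trans h _; rewrite exprD le_eqVlt; apply/orP; left; apply/eqP; field.
  by rewrite !gt_eqF ?exprn_gt0 ?ltr0n.
rewrite normrM (gtr0_norm b0) zrM hf -/m.
apply: le_trans (ler_wpM2l (ltW b0) (Ser_norm th01 G2)) _.
rewrite le_eqVlt; apply/orP; left; apply/eqP; field.
have Tq : T < q%:R by move: th1; rewrite ltr_pdivrMr ?ltr0n// mul1r.
by rewrite !gt_eqF ?exprn_gt0 ?subr_gt0 ?ltr0n.
Qed.

Variables (D : Z).
Hypothesis D1 : Z.lt 0 D.

Lemma zbound_S (v : nat) (e n : Z) (l : seq Z) : good_at v -> size l = K -> Z.le 0 e ->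
  lists b T v%:R (zr e) l -> Z.modulo n D <> Z0 -> Z.lt n (Z.mul (Z.of_nat K.-1) D) ->
  `|2 ^+ b * Ss T (zr n / zr D) v%:R - zr (zssum D n 0 l)| <=
    zr (zbound (Z.of_nat K) D tn qn fac e l).1.
Proof.
move=> gv sl e0 H nD nK; have aw := away_frac R D1 nD.
have d0 : 0 < zr D by rewrite -(zr0 R); exact: zr_lt.
have di : 0 < (zr D)^-1 by rewrite invr_gt0.
have Hw1 k : (K <= k)%N -> `|(k%:R - zr n / zr D)^-1| <= 1.
  move=> Kk; have h : 1 <= k%:R - zr n / zr D.
    have : zr n / zr D <= K.-1%:R.
      by rewrite ler_pdivrMr// -zr_nat -zrM; apply: zr_le; lia.
    have : (K.-1%:R + 1 : R) <= k%:R by rewrite natr1 prednK// ler_nat.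
    nlra.
  have h0 := lt_le_trans ltr01 h.
  by rewrite normfV (gtr0_norm h0) invf_le1.
have := wsum_tail gv sl e0 H (fun k => away_inv k di aw) Hw1.
have := zssumP H D1 nD; rewrite sl => h1 h2.
rewrite /zbound/= zrD zrM zrD zrM zr_nat zr1.
have := ler_normD (2 ^+ b * Ss T (zr n / zr D) v%:R - 2 ^+ b * (\sum_(k < K) appell k v%:R * T ^+ k * (k%:R - zr n / zr D)^-1))
  (2 ^+ b * (\sum_(k < K) appell k v%:R * T ^+ k * (k%:R - zr n / zr D)^-1) - zr (zssum D n 0 l)).
rewrite addrA subrK => h; apply: le_trans h _; rewrite [leRHS]addrC; exact: lerD.
Qed.

Lemma zbound_F (v : nat) (e : Z) (l : seq Z) : good_at v -> size l = K -> Z.le 0 e ->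
  lists b T v%:R (zr e) l ->
  `|2 ^+ b * Fs T v%:R - zr (zsum l)| <= zr (zbound (Z.of_nat K) D tn qn fac e l).2.
Proof.
move=> gv sl e0 H.
have := wsum_tail gv sl e0 H (@norm1_le R) (fun k _ => norm1_le R k).
have := zsumP H; rewrite sl => h1.
rewrite (_ : \sum_(k < K) appell k v%:R * T ^+ k * 1 = \sum_(k < K) appell k v%:R * T ^+ k); last first.
  by apply: eq_bigr => k _; rewrite mulr1.
move=> h2; rewrite /zbound/= zrD zrM zr_nat.
have := ler_normD (2 ^+ b * Fs T v%:R - 2 ^+ b * (\sum_(k < K) appell k v%:R * T ^+ k))
  (2 ^+ b * (\sum_(k < K) appell k v%:R * T ^+ k) - zr (zsum l)).
rewrite addrA subrK => h; apply: le_trans h _; rewrite [leRHS]addrC; exact: lerD.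
Qed.

Lemma zposP (v : nat) (e n kn kd : Z) (s : bool) (l : seq Z) : good_at v -> size l = K -> Z.le 0 e ->
  lists b T v%:R (zr e) l -> Z.modulo n D <> Z0 -> Z.lt n (Z.mul (Z.of_nat K.-1) D) ->
  Z.le 0 kn -> Z.lt 0 kd -> zpos D n kn kd s (zbound (Z.of_nat K) D tn qn fac e l) l ->
  0 < (if s then 1 else -1) * comb T (zr n / zr D) (zr kn / zr kd) v%:R.
Proof.
move=> gv sl e0 H nD nK kn0 kd0 /Z.ltb_lt h.
have hS := zbound_S gv sl e0 H nD nK; have hF := zbound_F gv sl e0 H.
set eS := (zbound _ _ _ _ _ _ _).1 in h hS; set eF := (zbound _ _ _ _ _ _ _).2 in h hF.
have k0 : 0 <= zr kn by rewrite -(zr0 R); exact: zr_le.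
have d0 : 0 < zr kd by rewrite -(zr0 R); exact: zr_lt.
have b0 : (0 : R) < 2 ^+ b by rewrite exprn_gt0.
move: hS hF; rewrite !ler_norml => /andP[S1 S2] /andP[F1 F2].
have S1' := ler_wpM2l (ltW d0) S1; have S2' := ler_wpM2l (ltW d0) S2.
have F1' := ler_wpM2l k0 F1; have F2' := ler_wpM2l k0 F2.
have E : comb T (zr n / zr D) (zr kn / zr kd) v%:R =
  (zr kd * (2 ^+ b * Ss T (zr n / zr D) v%:R) + zr kn * (2 ^+ b * Fs T v%:R)) / (zr kd * 2 ^+ b).
  by rewrite /comb; field; rewrite !gt_eqF.
have h' := zr_lt R h; rewrite zrD !zrM in h'.
rewrite E; case: s {h} h' => h'.
  rewrite zrD !zrM in h'; rewrite mul1r divr_gt0 ?mulr_gt0//; clear -h' S1' F1'; lra.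
rewrite -Z.sub_0_l zrB zr0 zrD !zrM in h'.
rewrite mulN1r -mulNr divr_gt0 ?mulr_gt0//; clear -h' S2' F2'; lra.
Qed.

Lemma zchainP (v : nat) (e kn kd : Z) (l : seq Z) (J : nat) : good_at v -> size l = K -> Z.le 0 e ->
  lists b T v%:R (zr e) l -> Z.le 0 kn -> Z.lt 0 kd -> forall (s : bool) n,
  Z.modulo n D <> Z0 -> Z.lt n (Z.mul (Z.of_nat K.-1) D) ->
  zchain D n kn kd s (zbound (Z.of_nat K) D tn qn fac e l) l J ->
  forall j, (j < J)%N ->
  0 < (-1) ^+ j * ((if s then 1 else -1) * comb T (zr n / zr D - j%:R) (zr kn / zr kd) v%:R).
Proof.
move=> gv sl e0 H kn0 kd0; elim: J => [//|J IH] s n nD nK /= /andP[h1 h2] [|j] jJ.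
  by rewrite expr0 mul1r subr0; exact: zposP h1.
have d0 : 0 < zr D by rewrite -(zr0 R); exact: zr_lt.
have nD' : Z.modulo (Z.sub n D) D <> Z0.
  have -> : Z.sub n D = Z.add n (Z.mul (-1) D) by lia.
  by rewrite Z.mod_add//; lia.
have nK' : Z.lt (Z.sub n D) (Z.mul (Z.of_nat K.-1) D) by lia.
have := IH _ _ nD' nK' h2 j jJ.
rewrite zrB mulrBl divff ?gt_eqF// -addrA -opprD nat1r exprS.
by case: s {h1 h2} => /=; rewrite !mulN1r ?mul1r ?mulrN ?mulNr ?opprK.
Qed.

End RowCheckCorrect.

Section Table.
Variable R : realType.
Local Notation zr := (@zr R).

Lemma decimalE m ds : decimal R m ds = zr (dec_num m ds) / 10 ^+ size ds.
Proof.
elim/last_ind: ds => [|ds d IH].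
  have -> : dec_num m [::] = Z.of_nat m by [].
  by rewrite (zr_nat R m) /decimal big_ord0 addr0 expr0 divr1.
have -> : dec_num m (rcons ds d) = Z.add (Z.mul 10 (dec_num m ds)) (Z.of_nat d).
  by rewrite /dec_num foldl_rcons.
have -> : decimal R m (rcons ds d) = decimal R m ds + d%:R / 10 ^+ (size ds).+1.
  rewrite /decimal size_rcons big_ord_recr/= addrA nth_rcons ltnn eqxx; congr (_ + _ + _).
  by apply: eq_bigr => k _; rewrite nth_rcons ltn_ord.
rewrite IH size_rcons zrD zrM zr_nat (_ : zr 10 = 10)// exprS; field.
by rewrite expf_neq0.
Qed.

Section Row.
Variables (t K b : nat) (tn qn fac : Z) (q : nat).
Let T : R := 2 ^+ t.
Hypothesis params : tail_params R t tn qn fac q.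
Hypothesis K0 : (0 < K)%N.

Let T0 : 0 < T. Proof. by rewrite exprn_gt0. Qed.

Lemma zrowP (i m : nat) (ds : seq nat) (e e1 : Z) (l l1 : seq Z) : (0 < i)%N -> (4 < i)%N ==> (t == 1%N) ->
  good_at R K q i -> good_at R K q i.+1 -> Z.le 0 e -> Z.le 0 e1 ->
  lists b T i%:R (zr e) l -> lists b T i.+1%:R (zr e1) l1 ->
  zrow t K tn qn fac e e1 l l1 i m ds -> truncates_to (lambda (i%:R^-1 : R)) m ds.
Proof.
move=> i0 it gi gi1 e0 e10 H H1.
rewrite /zrow; set D := Z.pow 10 7; set p10 := Z.pow 10 (Z.of_nat (7 - size ds)).
set nlo := Z.mul (dec_num m ds) p10; set nhi := Z.sub _ 1; set s := odd m.
set neg := (i <= 4)%N; set J := if neg then _ else _.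
set aT := Z.of_nat (i * 2 ^ t); set nJ := Z.sub nlo _; set kd0 := Z.add (Z.mul aT D) (Z.sub nJ D).
set kk := if s then (Z0, Zpos xH) else (D, kd0); rewrite (surjective_pairing kk).
set kn := kk.1; set kd := kk.2; set kd2 := if s then Z.add (Z.mul aT D) _ else _.
set es := zbound _ _ _ _ _ e l; set es1 := zbound _ _ _ _ _ e1 l1.
case/and5P => sd J0 /Z.ltb_lt kdp /Z.ltb_lt kd2p /and5P[/Z.eqb_spec nloD /Z.eqb_spec nhiD /Z.leb_le nhi0 /Z.ltb_lt nhiK].
case/and5P => /eqP sl /eqP sl1 ch base /andP[hi1 hi2].
have DE : D = Z.pow 10 7 by [].
clearbody D; have D0 : Z.lt 0 D by rewrite DE.
have d0 : 0 < zr D by rewrite -(zr0 R); exact: zr_lt.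
have dd : 0 < (zr D)^-1 by rewrite invr_gt0.
have a1 : (1 : R) <= i%:R by rewrite ler1n.
have a0 : (0 : R) < i%:R by rewrite ltr0n.
have awlo := away_frac R D0 nloD; have awhi := away_frac R D0 nhiD.
have nloK : Z.lt nlo (Z.mul (Z.of_nat K.-1) D).
  have p10p : Z.lt 0 p10 by apply: Z.pow_pos_nonneg => //; exact: Nat2Z.is_nonneg.
  by move: nhiK; rewrite /nhi /nlo; clear -p10p; move: (Z.mul _ D) (dec_num m ds) p10 p10p => a c p; nia.
have aTE : zr aT = i%:R * T by rewrite /aT zr_nat natrM natrX.
have kn0 : Z.le 0 kn by rewrite /kn /kk; case: (s) => //=; exact: Z.lt_le_incl.
pose sg : R := if s then 1 else -1.
pose kap := zr kn / zr kd.
have kap0 : 0 <= kap.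
  by rewrite /kap divr_ge0// -(zr0 R); apply: zr_le => //; exact: Z.lt_le_incl.
have nJE : zr nJ / zr D = zr nlo / zr D - J%:R.
  by rewrite /nJ zrB zrM zr_nat; field; rewrite gt_eqF.
have kdE : s = false -> zr kd = zr D * (i%:R * T + zr nJ / zr D - 1).
  by rewrite /kd /kk => ->; rewrite /kd0 /= zrD zrM zrB aTE; field; rewrite gt_eqF.
have kdr : 0 < zr kd by rewrite -(zr0 R); exact: zr_lt.
have supJ : super_sign i%:R T (zr nJ / zr D) kap sg.
  rewrite /super_sign /sg; case E : s; [left|right].
    by split=> //; rewrite /kap /kn /kk E /= zr0 mul0r.
  split=> //; split=> //.
  have knE : zr kn = zr D by rewrite /kn /kk E.
  by rewrite /kap knE mulrAC -(kdE E) divff ?gt_eqF.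
have suplo : super_sign i%:R T (zr nlo / zr D) kap sg.
  case: supJ => [[h1 h2]|[h1 [h2 h3]]]; [by left|right; split=> //; split=> //].
  apply: le_trans h3 _; apply: ler_wpM2l => //; rewrite nJE.
  by have : (0 : R) <= J%:R by []; nlra.
have awJ := awayB J awlo.
have lo : zr nlo / zr D <= lambda (i%:R^-1 : R).
  apply: (lambda_ge_cert a1 T0 dd awlo suplo J0).
    exact: (zchainP params K0 D0 gi sl e0 H kn0 kdp nloD nloK ch).
  move=> v av; have v0 : 0 < v by nlra.
  rewrite -nJE; case: ifP base => ng.
    case/andP => /Z.ltb_lt nJ0 sJ.
    have n0 : zr nJ / zr D < 0.
      by rewrite pmulr_llt0 ?invr_gt0// -(zr0 R); exact: zr_lt.
    rewrite mulrA (_ : (-1) ^+ J * sg = 1); last first.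
      by rewrite /sg -signr_odd; move: sJ; case: (s); case: (odd J) => //= _; rewrite ?expr0 ?expr1; ring.
    rewrite mul1r /comb; have := Ss_gt0 T0 v0 n0; have := mulr_ge0 kap0 (ltW (Fs_gt0 T0 v0)); nlra.
  case/and3P => Jev bp /Z.ltb_lt bth.
  have t1 : t = 1%N by apply/eqP; move: it; rewrite ltnNge -/neg ng.
  have T2 : T = 2 by rewrite /T t1 expr1.
  rewrite -signr_odd (negPf Jev) expr0 mul1r.
  have nJD : Z.modulo nJ D <> Z0.
    have -> : nJ = Z.add nlo (Z.mul (- Z.of_nat J) D) by rewrite /nJ Z.mul_opp_l Z.add_opp_r.
    by rewrite Z.mod_add; [|rewrite DE].
  have nJK : Z.lt nJ (Z.mul (Z.of_nat K.-1) D).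
    apply: Z.le_lt_trans nloK; rewrite /nJ; clear -D0; move: D D0 nlo => D D0 nlo; nia.
  have awJ' : away (zr D)^-1 (zr nJ / zr D) by rewrite nJE.
  have T21 : T < 2 + 100%:R^-1 by rewrite T2 ltrDl invr_gt0.
  apply: (base_nonneg a0 T0 dd awJ' supJ T21) => //; last first.
    exact: ltW (zposP params K0 D0 gi sl e0 H nJD nJK kn0 kdp bp).
  (* Through e <= 49/18 and e^0.01 <= 100/99. Then a th - e^th + 1 at th = 2.01 is at least 2.01 a -
     6.49, the source of 201 and 649 in the check. *)
  have e2 : expR (2 + 100%:R^-1 : R) <= 749 / 100.
    rewrite expRD; apply: le_trans (_ : (49 / 18) ^+ 2 * (100 / 99) <= _); last by nlra.
    apply: ler_pM; rewrite ?expR_ge0//; first exact: (expR_nat_le R 2).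
    by apply: le_trans (expR_le_inv1 _) _; [nlra|rewrite le_eqVlt; apply/orP; left; apply/eqP; field].
  have aux (x d n : Z) : 0 < zr d -> Z.lt (Z.mul 100 x) (Z.mul d (Z.sub (Z.mul 201 n) 649)) ->
      100 * (zr x / zr d) < 201 * zr n - 649.
    move=> dp /(zr_lt R); rewrite (zrM R 100) (zrM R d) (zrB R _ 649) (zrM R 201).
    by rewrite mulrA ltr_pdivrMr// [in ltRHS]mulrC.
  have := aux _ _ _ d0 bth; rewrite zr_nat => h.
  nlra.
have mu0 : 0 <= zr nhi / zr D.
  by rewrite divr_ge0 ?(ltW d0)// -(zr0 R); exact: zr_le.
have kd2r : 0 < zr kd2 by rewrite -(zr0 R); exact: zr_lt.
have k2 : 0 < zr D / zr kd2 by rewrite divr_gt0.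
have D0' : Z.le 0 D by exact: Z.lt_le_incl.
have hi : lambda (i%:R^-1 : R) <= zr nhi / zr D.
  have hp := zposP params K0 D0 gi sl e0 H nhiD nhiK D0' kd2p hi1.
  case E : s hp hi2 => hp hi2; rewrite /= ?mul1r ?mulN1r ?oppr_gt0 in hp.
    apply: (lambda_le_cert_pos a1 T0 dd awhi mu0 k2); [|exact: ltW|].
      rewrite /kd2 E zrD zrM zrB aTE mulrAC ler_pdivlMr.
        by rewrite le_eqVlt; apply/orP; left; apply/eqP; field; rewrite gt_eqF.
      by move: kd2r; rewrite /kd2 E zrD zrM zrB aTE.
    rewrite natr1; have := zposP params K0 D0 gi1 sl1 e10 H1 nhiD nhiK D0' kd2p hi2.
    by rewrite mul1r.
  apply: (lambda_le_cert_neg a1 T0 dd awhi mu0 k2); [|exact: ltW|].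
    have kE : zr kd2 = (i%:R * T + i%:R) * zr D + zr nhi by rewrite /kd2 E zrD zrM zrD aTE zr_nat.
    rewrite mulrAC ler_pdivrMr// kE le_eqVlt; apply/orP; left; apply/eqP; field.
    by rewrite gt_eqF.
  have hS := zbound_S params K0 D0 gi1 sl1 e10 H1 nhiD nhiK.
  have hF := zbound_F params K0 D gi sl e0 H.
  rewrite -/es in hF; rewrite -/es1 in hS.
  move/Z.ltb_lt/(zr_lt R): hi2 => h; rewrite -Z.sub_0_l zrB zr0 !zrD !zrM in h.
  set eS := zr es1.1 in hS h; set eF := zr es.2 in hF h.
  have b0 : (0 : R) < 2 ^+ b by rewrite exprn_gt0.
  move: hS hF; rewrite !ler_norml => /andP[_ S2] /andP[_ F2].
  have S2' := ler_wpM2l (ltW kd2r) S2; have F2' := ler_wpM2l (ltW d0) F2.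
  have EE : comb T (zr nhi / zr D) 0 (i%:R + 1) + zr D / zr kd2 * Fs T i%:R =
     (zr kd2 * (2 ^+ b * Ss T (zr nhi / zr D) i.+1%:R) + zr D * (2 ^+ b * Fs T i%:R)) / (zr kd2 * 2 ^+ b).
    by rewrite /comb mul0r addr0 natr1; field; rewrite !gt_eqF.
  rewrite EE pmulr_llt0 ?invr_gt0 ?mulr_gt0//; clear -h S2' F2'; lra.
have E10 : zr D = 10 ^+ size ds * zr p10.
  by rewrite DE /p10 zr_pow (_ : Z.pow 10 7 = Z.pow 10 (Z.of_nat 7))// zr_pow -exprD subnKC.
have p0 : 0 < zr p10 by rewrite /p10 zr_pow exprn_gt0// ltr0n.
have s0 : (0 : R) < 10 ^+ size ds by rewrite exprn_gt0.
rewrite /truncates_to decimalE; apply/andP; split.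
  apply: le_trans lo; rewrite /nlo zrM E10 le_eqVlt; apply/orP; left; apply/eqP; field.
  by rewrite !gt_eqF.
apply: le_lt_trans hi _; rewrite /nhi zrB zrM zrS zr1 E10 ltr_pdivrMr ?mulr_gt0//.
rewrite (_ : (_ + _) * _ = (zr (dec_num m ds) + 1) * zr p10); first nlra.
by field; rewrite gt_eqF.
Qed.

End Row.

Lemma ziterP b t K n (e : Z) (l : seq Z) v : size l = K -> Z.le 0 e -> lists b (2 ^+ t) v%:R (zr e) l ->
  [/\ size (ziter t K e l v n).2 = K, Z.le 0 (ziter t K e l v n).1 &
    lists b (2 ^+ t) (v + n)%:R (zr (ziter t K e l v n).1) (ziter t K e l v n).2].
Proof.
elim: n e l v => [|n IH] e l v sl e0 H /=; first by rewrite addn0.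
rewrite -addSnnS; apply: IH; first by rewrite size_zshift.
  by apply: Z.mul_nonneg_nonneg => //; lia.
by apply: zshiftP => //; rewrite sl.
Qed.

Lemma zrowsP b t K s (tn qn fac e : Z) q (l : seq Z) i r : tail_params R t tn qn fac q -> (0 < K)%N ->
  (0 < i)%N -> (4 < i + size r - 1)%N ==> (t == 1%N) -> good_at R K q (i + size r) ->
  size l = K -> Z.le 0 e -> lists (b + s) (2 ^+ t) i%:R (zr e) l ->
  zrows t K s tn qn fac e l i r ->
  forall j m ds, (j, m, ds) \in r -> truncates_to (lambda (j%:R^-1 : R)) m ds.
Proof.
move=> params K0; elim: r i e l => [//|[[i' m'] ds'] r IH] i e l i0 it gi sl e0 H.
rewrite /zrows -/zrows; set l1 := zshift _ _ _ _; set e1 := Z.mul _ e.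
case/and3P => /eqP -> hrow hrows j m ds.
have sl1 : size l1 = K by rewrite size_zshift.
have e10 : Z.le 0 e1 by apply: Z.mul_nonneg_nonneg => //; lia.
have H1 : lists (b + s) (2 ^+ t) i.+1%:R (zr e1) l1 by apply: zshiftP => //; rewrite sl.
have mono v w : (v <= w)%N -> good_at R K q w -> good_at R K q v.
  rewrite /good_at => vw; apply: le_trans; rewrite lerD2r lerD2r ler_wpM2r// ler_nat//.
rewrite inE => /predU1P[[-> -> ->]|]; last first.
  apply: (IH i.+1 e1 l1) => //; first by move: it; rewrite /= addnS addSn.
  by move: gi; rewrite /= addnS addSn.
have tr0 x : Z.le 0 x -> Z.le 0 (Z.add (Z.div x (Z.pow 2 (Z.of_nat s))) 2).
  move=> x0; have := Z.div_pos x (Z.pow 2 (Z.of_nat s)) x0.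
  by have := Z.pow_pos_nonneg 2 (Z.of_nat s); lia.
apply: (zrowP params K0 i0 _ _ _ (tr0 _ e0) (tr0 _ e10) (ztruncP H) (ztruncP H1) hrow).
- by apply/implyP => i4; move: it; rewrite /= (_ : (4 < _)%N)//; lia.
- by apply: mono gi; rewrite /=; lia.
- by apply: mono gi; rewrite /=; lia.
Qed.

Lemma lambda_table_ok (i m : nat) (ds : seq nat) : (i, m, ds) \in lambda_table ->
  truncates_to (lambda (i%:R^-1 : R)) m ds.
Proof.
have p4 : tail_params R 2 4 5 5 5.
  split=> //; rewrite (_ : zr 4 = 4)// (_ : zr 5 = 5)// (_ : (2 : R) ^+ 2 = 4); last by rewrite expr2; ring.
  by split=> //; [apply/andP; split; nlra|field].
have p2 : tail_params R 1 2 4 2 4.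
  split=> //; rewrite (_ : zr 4 = 4)// (_ : zr 2 = 2)// expr1.
  by split=> //; [apply/andP; split; nlra|field].
have g4 : good_at R 176 5 5 by rewrite /good_at; nlra.
have g2 : good_at R 140 4 21 by rewrite /good_at; nlra.
have sz K : (K <= 176)%N -> size (take K (rev (ztab 430 173))) = K.
  by move=> hK; rewrite size_takel// size_rev -(closes_nth (ztabP R 173 (isT : (2 <= 430)%N))).1 size_enest.
have L4 := @zscaleP R 430 74 2 176 173 isT isT isT.
have L2 := @zscaleP R 430 200 1 140 173 isT isT isT.
have := ztable_ok; rewrite /ztable.
set l4 := zscale _ 2 _; set l2 := zscale _ 1 _.
rewrite (surjective_pairing (ziter 2 _ _ _ _ _)) (surjective_pairing (ziter 1 _ _ _ _ _)) => /andP[r4 r2].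
have s4 : size l4 = 176%N := eq_trans (size_zscale _ _ _) (sz 176%N isT).
have s2 : size l2 = 140%N := eq_trans (size_zscale _ _ _) (sz 140%N isT).
have e8 : Z.le 0 8 by [].
have [q1 q2 q3] := ziterP (v := 0) 2 s4 e8 L4.
have [u1 u2 u3] := ziterP (v := 0) 5 s2 e8 L2.
rewrite -[lambda_table](cat_take_drop 3) mem_cat => /orP[]; move: i m ds.
  move=> i m ds; exact: (@zrowsP 70 2 176 4 4 5 5 _ 5 _ 2 (take 3 lambda_table) p4 isT isT isT g4 q1 q2 q3 r4).
move=> i m ds; exact: (@zrowsP 70 1 140 130 2 4 2 _ 4 _ 5 (drop 3 lambda_table) p2 isT isT isT g2 u1 u2 u3 r2).
Qed.

End Table.

(** * Mertens' estimate *)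

Section Mertens.
Variable R : realType.
Implicit Types (n m p z : nat).

Local Notation lnr n := (ln (n%:R : R)).

Lemma natr_pos n : (0 < n)%N -> (n%:R : R) \is Num.pos.
Proof. by rewrite posrE ltr0n. Qed.

Lemma ln_natM m n : (0 < m)%N -> (0 < n)%N -> lnr (m * n) = lnr m + lnr n.
Proof. by move=> m0 n0; rewrite natrM lnM ?natr_pos. Qed.

Lemma ln_nat_ge0 n : 0 <= lnr n.
Proof. by case: n => [|n]; [rewrite ln0|rewrite ln_ge0// ler1n]. Qed.

Lemma ler_ln_nat m n : (0 < m)%N -> (m <= n)%N -> lnr m <= lnr n.
Proof. by move=> m0 mn; rewrite ler_ln ?natr_pos ?ler_nat// (leq_trans m0). Qed.

Lemma ln_nat_factor n N : (0 < n)%N -> (n < N)%N ->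
  lnr n = \sum_(0 <= p < N | prime p) (logn p n)%:R * lnr p.
Proof.
case: N => // N n0 nN; rewrite -{1}(partnT n0) (@widen_partn N)//.
rewrite [RHS]big_mkcond/=.
elim: N {nN} => [|N IH].
  by rewrite !big_nat_recr//= !big_geq//= (lognE 0) expn0 ?mul1n ln1 add0r.
rewrite big_nat_recr// [RHS]big_nat_recr//= ln_natM ?IH; last first.
- by rewrite expn_gt0.
- by rewrite prodn_gt0// => -[|p]; rewrite ?expn_gt0// lognE.
congr (_ + _); case: ifPn => [pr|pr]; last by rewrite lognE (negPf pr) expn0 ln1.
by rewrite natrX lnXn ?ltr0n// mulr_natl.
Qed.

(** The sum stops before z: it is the value of L when the prime z is about to be used, and the step
    at z adds ln z / z. *)
Definition mert (z : nat) : R := \sum_(0 <= p < z | prime p) lnr p / p%:R.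

Definition cheb (z : nat) : R := \sum_(0 <= p < z | prime p) lnr p.

Lemma prime_dvd_fact_le p m : prime p -> (p %| m`!)%N -> (p <= m)%N.
Proof.
move=> pr; elim: m => [|m IH]; first by rewrite fact0 dvdn1 => /eqP E; move: pr; rewrite E.
by rewrite factS Euclid_dvdM// => /orP[/dvdn_leq->//|/IH/leqW].
Qed.

Lemma half_le_sub n : (n./2 <= n - n./2)%N.
Proof. by rewrite -{2}(odd_double_half n) -addnn; lia. Qed.

Lemma logn_bin_ge1 n p : prime p -> (n - n./2 < p <= n)%N -> (1 <= logn p 'C(n, n./2))%N.
Proof.
move=> pr /andP[p1 p2]; have hl := half_le_sub n.
have le : (n./2 <= n)%N by rewrite (leq_trans hl)// leq_subr.
rewrite logn_gt0 mem_primes pr bin_gt0 le/=.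
have h : (p %| n`!)%N by rewrite dvdn_fact// prime_gt0.
move: h; rewrite -(bin_fact le) !Euclid_dvdM// => /orP[//|/orP[]] /(prime_dvd_fact_le pr); lia.
Qed.

Lemma bin_le_exp2 n m : ('C(n, m) <= 2 ^ n)%N.
Proof.
elim: n m => [|n IH] [|m]; rewrite ?bin0 ?bin0n ?expn_gt0//.
by rewrite binS expnS mul2n -addnn leq_add.
Qed.

(** The primes in (n - n/2, n] all divide the central binomial coefficient, which is at most 2^n. *)
Lemma cheb_step n : cheb n.+1 <= cheb (n - n./2).+1 + n%:R * ln 2.
Proof.
set k := (n - n./2)%N; have kn : (k <= n)%N by rewrite leq_subr.
have C0 : (0 < 'C(n, n./2))%N by rewrite bin_gt0 (leq_trans (half_le_sub n))// leq_subr.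
have h : lnr 'C(n, n./2) <= n%:R * ln 2.
  rewrite mulr_natl -lnXn// -natrX; apply: ler_ln_nat => //; exact: bin_le_exp2.
apply: le_trans (lerD (lexx _) h).
rewrite /cheb (@big_cat_nat _ _ _ k.+1)//= lerD2l.
set N := (n.+1 + 'C(n, n./2).+1)%N.
have nN : (n.+1 <= N)%N by exact: leq_addr.
have lt : ('C(n, n./2) < N)%N by exact: leq_addl.
have kn1 : (k.+1 <= n.+1)%N by [].
rewrite (ln_nat_factor C0 lt) (@big_cat_nat _ _ _ k.+1 _ _ _ _ (leq0n _) (leq_trans kn1 nN))/=.
rewrite (@big_cat_nat _ _ _ n.+1 k.+1 _ _ _ kn1 nN)/=.
rewrite addrCA -[leLHS]addr0 lerD//; last first.
  by rewrite addr_ge0// sumr_ge0// => p pr; rewrite mulr_ge0// ln_nat_ge0.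
rewrite big_nat_cond [leRHS]big_nat_cond; apply: ler_sum => p /andP[/andP[p1 p2] pr].
rewrite -[leLHS]mul1r ler_wpM2r ?ln_nat_ge0// ler1n logn_bin_ge1//.
by rewrite -/k p1 -ltnS.
Qed.

(** For n >= 2 the argument shrinks to at most 3 n / 4, and 4 (3/4) + 1 = 4. *)
Lemma cheb_le n : cheb n.+1 <= 4 * ln 2 * n%:R.
Proof.
have l2 : (0 : R) <= ln 2 by rewrite ln_ge0// ler1n.
elim/ltn_ind: n => -[|[|n]] IH; first by rewrite /cheb big_mkcond big_nat1/= mulr0.
  by rewrite /cheb big_mkcond !big_nat_recr//= big_geq// !addr0 mulr1 mulr_ge0.
have hl : (n.+2 - n.+2./2 < n.+2)%N by rewrite ltn_subrL.
apply: le_trans (cheb_step _) _; apply: le_trans (lerD (IH _ hl) (lexx _)) _.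
have : (n.+2 <= 4 * n.+2./2)%N by have := odd_double_half n; rewrite /= -addnn; case: (odd n) => /=; lia.
have le : (n.+2./2 <= n.+2)%N by rewrite (leq_trans (half_le_sub _))// leq_subr.
rewrite -(ler_nat R) natrM => h; rewrite natrB//.
have := ler_wpM2l l2 h; move: (n.+2%:R) (n.+2./2%:R) => a b; nlra.
Qed.

Lemma geom_sum (p : R) m : 1 < p ->
  \sum_(1 <= k < m.+1) (p ^+ k)^-1 = (1 - (p ^+ m)^-1) / (p - 1).
Proof.
move=> p1; have p0 : p - 1 != 0 by rewrite subr_eq0 gt_eqF.
have pp : p != 0 by rewrite gt_eqF//; nlra.
elim: m => [|m IH]; first by rewrite big_geq// expr0 invr1 subrr mul0r.
rewrite big_nat_recr//= IH exprS; have pm : p ^+ m != 0 by rewrite expf_neq0.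
by field; rewrite p0 pm pp.
Qed.

Lemma logn_fact_le n p : prime p -> (logn p n`!)%:R <= (n%:R / (p%:R - 1) : R).
Proof.
move=> pr; have p1 : (1 : R) < p%:R by rewrite ltr1n prime_gt1.
rewrite logn_fact// natr_sum.
apply: (@le_trans _ _ (\sum_(1 <= k < n.+1) n%:R * (p%:R ^+ k)^-1)).
  apply: ler_sum => k _; rewrite ler_pdivlMr ?exprn_gt0//; last nlra.
  by rewrite -natrX -natrM ler_nat leq_divM.
rewrite -mulr_sumr geom_sum// ler_wpM2l// -[leRHS]mul1r ler_wpM2r ?invr_ge0 ?subr_ge0//; first exact: ltW.
Qed.

Lemma logn_fact_ge n p : prime p -> n%:R / p%:R - 1 <= ((logn p n`!)%:R : R).
Proof.
move=> pr; have p0 : (0 : R) < p%:R by rewrite ltr0n prime_gt0.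
rewrite lerBlDr ler_pdivrMr// natr1 -natrM ler_nat.
case: n => [|n]; first by rewrite leq0n.
have : (n.+1 %/ p <= logn p n.+1`!)%N by rewrite logn_fact// big_ltn// expn1 leq_addr.
have := divn_eq n.+1 p; have := ltn_pmod n.+1 (prime_gt0 pr); nia.
Qed.

Lemma ln_fact_factor n : lnr n`! = \sum_(0 <= p < n.+1 | prime p) (logn p n`!)%:R * lnr p.
Proof.
have n0 := fact_gt0 n; rewrite (@ln_nat_factor _ (n.+1 + n`!)%N)//; last by lia.
rewrite (@big_cat_nat _ _ _ n.+1)//=; last by lia.
rewrite [X in _ + X]big_nat_cond [X in _ + X]big1 ?addr0// => p /andP[/andP[p1 p2] pr].
rewrite (_ : logn p _ = 0%N) ?mul0r//; apply/eqP; rewrite -leqn0 leqNgt logn_gt0 mem_primes pr n0/=.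
by apply/negP => /(prime_dvd_fact_le pr); lia.
Qed.

Lemma ln_fact_le n : lnr n`! <= n%:R * lnr n.
Proof.
elim: n => [|n IH]; first by rewrite mul0r fact0 ln1.
rewrite factS ln_natM ?fact_gt0// -natr1 mulrDl mul1r addrC natr1.
rewrite lerD2r; case: n IH => [|n] IH; first by rewrite fact0 ln1 mul0r.
by apply: le_trans IH _; rewrite ler_wpM2l// ler_ln_nat.
Qed.

Lemma ln_fact_ge n : n%:R * lnr n - n%:R <= lnr n`!.
Proof.
elim: n => [|n IH]; first by rewrite mul0r fact0 ln1 subr0.
rewrite factS ln_natM ?fact_gt0//; case: n IH => [|n] IH.
  by rewrite fact0 ln1 mulr0 sub0r addr0; nlra.
have n0 : (0 : R) < n.+1%:R by [].
have h : lnr n.+2 <= lnr n.+1 + n.+1%:R^-1.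
  rewrite -lerBlDl -ln_div ?natr_pos//; apply: le_trans (_ : ln (1 + n.+1%:R^-1 : R) <= _).
    by rewrite le_eqVlt; apply/orP; left; apply/eqP; congr ln; rewrite -[n.+2%:R]natr1 mulrDl divff ?gt_eqF// mul1r.
  by apply: le_ln1Dx; apply: lt_le_trans (_ : 0 <= _) => //; rewrite invr_ge0.
have := ler_wpM2l (ltW n0) h; rewrite mulrDr divff ?gt_eqF//.
have e2 : (n.+2%:R : R) = n.+1%:R + 1 by rewrite natr1.
have aux (a b c d : R) : d * b - d <= a -> d * c <= d * b + 1 -> (d + 1) * c - (d + 1) <= c + a by nlra.
rewrite e2; exact: aux.
Qed.

(** Since ln k <= 2 sqrt k, the left side is of order k^(-3/2), like a difference of inverse square
    roots; the constant is generous, and the bound telescopes. *)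
Lemma ln_tail_le k : (2 <= k)%N ->
  lnr k / (k%:R * (k%:R - 1)) <= 6 * ((Num.sqrt (k%:R - 1))^-1 - (Num.sqrt k%:R)^-1).
Proof.
move=> k2; have k2' : (2 : R) <= k%:R by rewrite ler_nat.
move: k2' {k2}; move: (k%:R : R) => x x2.
pose a : R := Num.sqrt (x - 1); pose b : R := Num.sqrt x; rewrite -/a -/b.
have aE : a ^+ 2 = x - 1 by rewrite sqr_sqrtr//; nlra.
have bE : b ^+ 2 = x by rewrite sqr_sqrtr//; nlra.
have a0 : 0 < a by rewrite sqrtr_gt0; nlra.
have b0 : 0 < b by rewrite sqrtr_gt0; nlra.
have ba : b ^+ 2 = a ^+ 2 + 1 by rewrite aE bE; nlra.
have -> : x * (x - 1) = b ^+ 2 * a ^+ 2 by rewrite aE bE.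
have lx : ln x <= 2 * b.
  rewrite -bE lnXn// -[leLHS]mulr_natl ler_wpM2l//; exact/ltW/ln_sublinear.
have a1 : 1 <= a ^+ 2 by rewrite aE; nlra.
clearbody a b; clear aE bE x2.
have b2a : b <= 2 * a by nra.
apply: (@le_trans _ _ (2 * b / (b ^+ 2 * a ^+ 2))).
  by rewrite ler_wpM2r// invr_ge0 mulr_ge0 ?sqr_ge0.
have -> : 6 * (a^-1 - b^-1) = 6 * a * (b - a) * b / (b ^+ 2 * a ^+ 2).
  by field; rewrite !gt_eqF.
apply: ler_wpM2r; first by rewrite invr_ge0 mulr_ge0 ?sqr_ge0.
apply: ler_wpM2r; first exact: ltW.
have : (a + b) * (b - a) = 1 by nra.
nra.
Qed.

Lemma ln_tail_sum n :
  \sum_(0 <= p < n.+2 | prime p) lnr p / (p%:R * (p%:R - 1)) <= 6 * (1 - (Num.sqrt n.+1%:R)^-1) :> R.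
Proof.
elim: n => [|n IH].
  by rewrite big_mkcond !big_nat_recr//= big_geq//= sqrtr1 invr1 subrr mulr0 !addr0.
rewrite big_mkcond big_nat_recr//= -big_mkcond/=.
have mono : (Num.sqrt (n.+2)%:R)^-1 <= (Num.sqrt (n.+1)%:R)^-1 :> R.
  by rewrite lef_pV2 ?posrE ?sqrtr_gt0// ler_wsqrtr// ler_nat.
have E : 6 * (1 - (Num.sqrt n.+2%:R)^-1) = 6 * (1 - (Num.sqrt n.+1%:R)^-1) +
    6 * ((Num.sqrt (n.+1)%:R)^-1 - (Num.sqrt (n.+2)%:R)^-1) :> R by ring.
rewrite E lerD//; case: ifPn => pr; last by rewrite mulr_ge0// subr_ge0.
apply: le_trans (ln_tail_le _) _ => //.
by rewrite (_ : (n.+2%:R - 1 : R) = n.+1%:R)// -natr1 addrK.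
Qed.

(** Two evaluations of ln n!. The exponent of p lies between n / p - 1 and n / (p - 1): the first
    error adds up to Chebyshev's function, the second to the convergent sum of ln p / (p (p -
    1)). *)
Lemma mertens : exists2 C : R, 1 <= C & forall n, (0 < n)%N -> `|mert n - lnr n| <= C.
Proof.
have l2 : (0 : R) <= ln 2 by rewrite ln_ge0// ler1n.
exists (8 + 5 * ln 2); first by nlra.
move=> [//|n] _; case: n => [|n].
  by rewrite /mert big_mkcond big_nat1/= ln1 subrr normr0; nlra.
have n0 : (0 : R) < n.+1%:R by [].
have s1 : lnr n.+1 <= lnr n.+2 by rewrite ler_ln_nat.
have s2 : lnr n.+2 <= lnr n.+1 + ln 2.
  by rewrite addrC -(ln_natM (m := 2))// ler_ln_nat//; lia.
have up : mert n.+2 <= lnr n.+1 + 4 * ln 2.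
  rewrite -(ler_pM2l n0) mulrDr; apply: le_trans (lerD (ln_fact_le n.+1) (lexx _)).
  have := cheb_le n.+1; rewrite (mulrC n.+1%:R (4 * ln 2)) => h.
  apply: le_trans (lerD (lexx _) h); rewrite ln_fact_factor /mert /cheb mulr_sumr -big_split/=.
  apply: ler_sum => p pr; have := ler_wpM2r (ln_nat_ge0 p) (logn_fact_ge n.+1 pr).
  rewrite mulrBl mul1r (mulrAC _ _ (lnr p)) -mulrA; nlra.
have lo : lnr n.+1 - 7 <= mert n.+2.
  rewrite -(ler_pM2l n0) mulrBr.
  have := ln_fact_ge n.+1.
  have : lnr n.+1`! <= n.+1%:R * mert n.+2 + n.+1%:R * 6.
    have h6 : \sum_(0 <= p < n.+2 | prime p) lnr p / (p%:R * (p%:R - 1)) <= 6 :> R.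
      apply: le_trans (ln_tail_sum n) _; rewrite ler_piMr// lerBlDr lerDl invr_ge0 sqrtr_ge0//.
    apply: le_trans (lerD (lexx _) (ler_wpM2l (ltW n0) h6)).
    rewrite ln_fact_factor /mert !mulr_sumr -big_split/=.
    apply: ler_sum => p pr; apply: le_trans (ler_wpM2r (ln_nat_ge0 p) (logn_fact_le n.+1 pr)) _.
    have p1 : (1 : R) < p%:R by rewrite ltr1n prime_gt1.
    rewrite le_eqVlt; apply/orP; left; apply/eqP; field.
    by rewrite !gt_eqF//; nlra.
  move: (n.+1%:R * lnr n.+1) (n.+1%:R : R) => a b; move: (b * mert _) (lnr _) => c d; nlra.
rewrite ler_norml; move: (mert _) (lnr n.+1) (lnr n.+2) s1 s2 up lo => a b c; nlra.
Qed.

End Mertens.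

(** * Dense divisors *)

Section Density.
Variable R : realType.
Implicit Types (y t : R) (n m d e p k i j : nat) (A B : pred nat).

(** Density expressed at every real scale t rather than between neighbours of a list: in this form
    it passes easily to multiples of n and to other sets. *)
Definition dense_upto y n A := [/\ A 1%N, A n &
  forall t, 1 <= t -> t < n%:R -> exists e, [/\ (e %| n)%N, A e, t < e%:R & e%:R <= y * t]].

Lemma ydense_consP y a s N t : 0 <= y -> ydense y (a :: s) -> (0 < a)%N -> a%:R <= t ->
  N \in s -> t < N%:R -> exists2 e, e \in s & t < e%:R <= y * t.
Proof.
move=> y0; elim: s a => [//|b s IH] a; rewrite /ydense/= => /andP[/andP[ab bay] ps] a0 at1 Ns tN.
have [bt|tb] := leP (b%:R : R) t.
  have [|e es et] := IH b ps (ltn_trans a0 ab) bt _ tN; last first.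
    by exists e => //; rewrite inE es orbT.
  by move: Ns; rewrite inE => /predU1P[E|//]; move: tN; rewrite E ltNge bt.
exists b; rewrite ?inE ?eqxx// tb/=.
have a0' : (0 : R) < a%:R by rewrite ltr0n.
by move: bay; rewrite ler_pdivrMr// => /le_trans -> //; rewrite ler_wpM2l.
Qed.

Lemma dense_from_1_toP y n A : 0 <= y -> (0 < n)%N ->
  reflect (dense_upto y n A) (dense_from_1_to y n [seq d <- divisors n | A d]).
Proof.
move=> y0 n0; set s := [seq d <- _ | _].
have sE d : (d \in s) = A d && (d %| n)%N by rewrite mem_filter -dvdn_divisors.
have srt : sorted ltn s by apply: sorted_filter (sorted_divisors_ltn n); exact: ltn_trans.
apply: (iffP and3P) => [[s1 sn yd]|[A1 An dns]].
  move: (s1) (sn); rewrite !sE => /andP[A1 _] /andP[An _]; split => // t t1 tn.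
  have : exists a s', s = a :: s' by case: (s) s1 => // a s' _; exists a, s'.
  case=> a [s' es].
  have a0 : (0 < a)%N.
    have : a \in s by rewrite es mem_head.
    by rewrite sE => /andP[_ /dvdn_gt0]; apply.
  have a1 : (a <= 1)%N.
    move: s1 srt; rewrite es inE => /predU1P[->//|h] /= /(order_path_min ltn_trans)/allP/(_ _ h).
    exact: ltnW.
  have at1 : a%:R <= t by apply: le_trans t1; rewrite lern1.
  have ns : n \in s'.
    by move: sn; rewrite es inE => /predU1P[E|//]; move: tn; rewrite E ltNge at1.
  rewrite es in yd; have [e es' /andP[e1 e2]] := ydense_consP y0 yd a0 at1 ns tn.
  have : e \in s by rewrite es inE es' orbT.
  by rewrite sE => /andP[Ae en]; exists e.
split; rewrite ?sE ?A1 ?An ?dvd1n ?dvdnn//.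
apply/(sortedP 0%N) => i si.
have lt : (nth 0 s i < nth 0 s i.+1)%N by apply: (sorted_ltn_nth ltn_trans) => //; rewrite inE// ltnW.
rewrite /= lt/=; set a := nth 0%N s i; set b := nth 0%N s i.+1.
have : a \in s by rewrite mem_nth// ltnW.
have : b \in s by rewrite mem_nth.
rewrite !sE => /andP[_ bn] /andP[_ an].
have a0 : (0 < a)%N by exact: dvdn_gt0 an.
have a0' : (0 : R) < a%:R by rewrite ltr0n.
have [||e [en Ae ae eya]] := dns a%:R; first by rewrite ler1n.
  by rewrite ltr_nat (leq_trans lt)// dvdn_leq.
rewrite ler_pdivrMr//; apply: le_trans eya; rewrite ler_nat.
have es : e \in s by rewrite sE Ae en.
rewrite /b -(nth_index 0%N es) leqNgt; apply/negP => lt2.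
have : (index e s < i.+1)%N.
  rewrite ltnNge; apply/negP => h; move: lt2; apply/negP; rewrite -leqNgt.
  by apply: (sorted_leq_nth leq_trans leqnn) => //; rewrite ?inE ?index_mem// ; apply: sub_sorted srt => ? ?; exact: ltnW.
rewrite ltnS => h; move: ae; rewrite ltr_nat; apply/negP; rewrite -leqNgt /a -(nth_index 0%N es).
by apply: (sorted_leq_nth leq_trans leqnn) => //; rewrite ?inE ?index_mem// ?(ltnW si)//; apply: sub_sorted srt => ? ?; exact: ltnW.
Qed.

Lemma dense_upto_sub y y' n A B : 0 <= y -> y <= y' -> (forall d, (d %| n)%N -> A d -> B d) ->
  dense_upto y n A -> dense_upto y' n B.
Proof.
move=> y0 yy AB [A1 An h]; split; [by apply: AB => //; exact: dvd1n|exact: AB|] => t t1 tn.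
have [e [en Ae te ey]] := h t t1 tn; exists e; split => //; first exact: AB.
by apply: le_trans ey _; rewrite ler_wpM2r//; nlra.
Qed.

Lemma Dset_gt0 y k n : Dset y k n -> (0 < n)%N.
Proof. by case: k => [//|k]; case: n => // /and3P[_]; rewrite mem_filter => /andP[]. Qed.

Lemma Dstar_gt0 y k n : Dstar y k n -> (0 < n)%N.
Proof.
by case: k => [//|k]; rewrite DstarS; case: n => // /forallP/(_ ord0)/and3P[_]; rewrite mem_filter => /andP[].
Qed.

Lemma DsetSP y k n : 0 <= y -> (0 < n)%N -> reflect (dense_upto y n (Dset y k)) (Dset y k.+1 n).
Proof. by move=> y0 n0; exact: dense_from_1_toP. Qed.

Definition Dsplit y j k n : pred nat := fun d => Dstar y j d && Dstar y k (n %/ d)%N.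

Lemma DstarSP y k n : 0 <= y -> (0 < n)%N ->
  reflect (forall j, (j <= k)%N -> dense_upto y n (Dsplit y j (k - j) n)) (Dstar y k.+1 n).
Proof.
move=> y0 n0; rewrite DstarS; apply: (iffP forallP) => [h j jk|h [j jk]].
  by apply/dense_from_1_toP => //; have /= := h (Ordinal (jk : (j < k.+1)%N)).
by apply/dense_from_1_toP => //; apply: h.
Qed.

Lemma Dstar_Dset y k n : 0 <= y -> Dstar y k n -> Dset y k n.
Proof.
move=> y0; elim: k n => [//|k IH] n Dn; have n0 := Dstar_gt0 Dn.
apply/DsetSP => //; have := elimT (DstarSP _ y0 n0) Dn k (leqnn k).
by apply: dense_upto_sub => // d _ /andP[/IH].
Qed.

Lemma Dstar_mono y y' k n : 0 <= y -> y <= y' -> Dstar y k n -> Dstar y' k n.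
Proof.
move=> y0 yy; have y0' : 0 <= y' by nlra.
elim/ltn_ind: k n => -[//|k] IH n Dn; have n0 := Dstar_gt0 Dn; apply/DstarSP => // j jk.
have := elimT (DstarSP _ y0 n0) Dn j jk; apply: dense_upto_sub => // d _ /andP[h1 h2].
by rewrite /Dsplit !IH// ltnS leq_subr.
Qed.

Lemma Dstar1 y k : 0 <= y -> Dstar y k 1.
Proof.
move=> y0; elim/ltn_ind: k => -[//|k] IH; apply/DstarSP => // j jk.
by split; rewrite ?/Dsplit ?divn1 ?IH// ?ltnS ?leq_subr// => t t1 t2; nlra.
Qed.

Lemma Dstar_mulS y k m p : 1 <= y -> (0 < p)%N -> p%:R <= y -> Dstar y k m -> Dstar y k (p * m)%N.
Proof.
move=> y1 p0 py; have y0 : 0 <= y by nlra.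
elim/ltn_ind: k m => -[|k] IH m Dm; have m0 := Dstar_gt0 Dm.
  by rewrite Dstar0 muln_gt0 p0.
have pm0 : (0 < p * m)%N by rewrite muln_gt0 p0.
apply/DstarSP => // j jk; have [/andP[_ d1] /andP[dm _] h] := elimT (DstarSP _ y0 m0) Dm j jk.
rewrite divn1 in d1; have kj : (k - j < k.+1)%N by rewrite ltnS leq_subr.
split; rewrite ?/Dsplit ?divn1 ?divnn ?pm0 ?Dstar1//= ?IH// => t t1 tn.
have [tm|mt] := ltP t m%:R.
  have [e [em /andP[e1 e2] te ey]] := h t t1 tm; exists e; split => //; first exact: dvdn_mull.
  by rewrite /Dsplit e1 -muln_divA// IH.
exists (p * m)%N; split => //; first by rewrite /Dsplit divnn pm0 Dstar1//= andbT IH.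
by rewrite natrM ler_pM.
Qed.

(** At each scale t one of two factors is large enough for the induction. If t / p < (p y)^j, the
    divisor e of m just above t has a cofactor of size at least (p y)^(k - j), and p joins the
    cofactor. Otherwise the divisor of m just above t / p exceeds (p y)^j, and p joins it. *)
Lemma Dstar_mul_small y k m p : 1 <= y -> (0 < p)%N -> (p%:R * y) ^+ k <= m%:R ->
  Dstar y k m -> Dstar y k (p * m)%N.
Proof.
move=> y1 p0; have y0 : 0 <= y by nlra.
have p1 : (1 : R) <= p%:R by rewrite ler1n.
have py1 : 1 <= p%:R * y by rewrite mulr_ege1.
elim/ltn_ind: k m => -[|k] IH m pm Dm; have m0 := Dstar_gt0 Dm.
  by rewrite Dstar0 muln_gt0 p0.
have pm0 : (0 < p * m)%N by rewrite muln_gt0 p0.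
have p0' : (0 : R) < p%:R by nlra.
apply/DstarSP => // j jk; have [/andP[_ d1] /andP[dm _] h] := elimT (DstarSP _ y0 m0) Dm j jk.
have le_pow a b : (a <= b)%N -> (p%:R * y) ^+ a <= (p%:R * y) ^+ b.
  by move=> ab; exact: ler_weXn2l.
rewrite divn1 in d1; have kj : (k - j < k.+1)%N by rewrite ltnS leq_subr.
split; rewrite ?/Dsplit ?divn1 ?divnn ?pm0 ?Dstar1//= ?andbT.
- by apply: IH => //; apply: le_trans pm; apply: le_pow; rewrite ltnW.
- by apply: IH => //; apply: le_trans pm; apply: le_pow; rewrite ltnW.
move=> t t1 tn; have [tb|tb] := ltP (t / p%:R) ((p%:R * y) ^+ j).
  have key : (p%:R * y) ^+ (k - j) * (y * t) < m%:R.
    apply: lt_le_trans pm; rewrite -{2}(subnK jk) -addnS exprD ltr_pM2l; last by rewrite exprn_gt0//; nlra.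
    rewrite exprSr mulrA [ltRHS]mulrC ltr_pM2l -?ltr_pdivrMr//; nlra.
  have tm : t < m%:R.
    apply: le_lt_trans key; rewrite -[leLHS]mul1r ler_pM// ?exprn_ege1//; first nlra.
    by rewrite ler_peMl//; nlra.
  have [e [em /andP[e1 e2] te ey]] := h t t1 tm; exists e; split => //; first exact: dvdn_mull.
  rewrite /Dsplit e1 -muln_divA// IH//.
  have e0 : (0 : R) < e%:R by nlra.
  have -> : (m %/ e)%:R = m%:R / e%:R :> R.
    by rewrite -{2}(divnK em) natrM mulfK// gt_eqF.
  rewrite ler_pdivlMr//; apply: le_trans (ltW key); rewrite ler_wpM2l// exprn_ge0//; nlra.
have tp : t / p%:R < m%:R by rewrite ltr_pdivrMr// mulrC -natrM.
have [e [em /andP[e1 e2] te ey]] := h (t / p%:R) (le_trans (exprn_ege1 j py1) tb) tp.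
exists (p * e)%N; split.
- exact: dvdn_mul.
- rewrite /Dsplit divnMl// e2 andbT IH//; nlra.
- by rewrite natrM mulrC -ltr_pdivrMr.
- by rewrite natrM mulrC -ler_pdivlMr// -mulrA.
Qed.

End Density.

(** * The part of an integer below a bound; squarefree integers *)

Section Parts.
Implicit Types (n m p q z e b : nat).

Definition part_lt z n := partn n [pred p | (p < z)%N].

Lemma part_lt_gt0 z n : (0 < part_lt z n)%N.
Proof. exact: part_gt0. Qed.

Lemma part_lt_dvd z n : (part_lt z n %| n)%N.
Proof. exact: dvdn_part. Qed.

Lemma part_lt_prime z n p : prime p -> (p %| part_lt z n)%N -> (p < z)%N.
Proof.
move=> pr pd; have := part_pnat [pred p | (p < z)%N] n.
by move/(pnatP _ (part_gt0 _ _))/(_ p pr pd).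
Qed.

Lemma part_lt_id z n : (0 < n)%N -> (forall p, prime p -> (p %| n)%N -> (p < z)%N) -> part_lt z n = n.
Proof. by move=> n0 h; apply: part_pnat_id; apply/pnatP => // p pr /(h p pr). Qed.

Lemma part_lt_sub z n e : (0 < n)%N -> (e %| n)%N -> (forall p, prime p -> (p %| e)%N -> (p < z)%N) ->
  (e %| part_lt z n)%N.
Proof.
move=> n0 en h; rewrite -(part_lt_id (dvdn_gt0 n0 en) h).
exact: partn_dvd.
Qed.

Lemma part_lt_comp z z' n : (z <= z')%N -> part_lt z (part_lt z' n) = part_lt z n.
Proof. by move=> zz; apply: partn_part => p; rewrite !inE => /leq_trans; apply. Qed.

Lemma squarefreeP n : reflect ((0 < n)%N /\ forall p, prime p -> ~~ (p ^ 2 %| n)%N) (squarefree n).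
Proof.
apply: (iffP andP) => [[n0 /allP h]|[n0 h]]; split => //.
  move=> p pr; apply/negP => pn; have : p \in primes n.
    by rewrite mem_primes pr n0 (dvdn_trans _ pn)// dvdn_exp.
  by move/h; rewrite pn.
by apply/allP => p; rewrite mem_primes => /andP[/h].
Qed.

Lemma squarefree_gt0 n : squarefree n -> (0 < n)%N.
Proof. by case/squarefreeP. Qed.

Lemma squarefree_dvd m n : (m %| n)%N -> squarefree n -> squarefree m.
Proof.
move=> mn /squarefreeP[n0 h]; apply/squarefreeP; split; first exact: dvdn_gt0 mn.
by move=> p /h; apply: contra => /dvdn_trans; apply.
Qed.

Lemma squarefree_mul_prime m p : squarefree m -> prime p -> ~~ (p %| m)%N -> squarefree (m * p)%N.
Proof.
move=> /squarefreeP[m0 h] pr pm; apply/squarefreeP; split; first by rewrite muln_gt0 m0 prime_gt0.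
move=> q qr; have [->|qp] := eqVneq q p.
  by rewrite expnSr expn1 dvdn_pmul2r ?prime_gt0.
rewrite Gauss_dvdl; first exact: h.
by rewrite coprimeXl// prime_coprime// dvdn_prime2.
Qed.

Lemma squarefree_logn n p : squarefree n -> (logn p n <= 1)%N.
Proof.
move=> /squarefreeP[n0 h]; have [pr|npr] := boolP (prime p); last by rewrite lognE (negPf npr).
by rewrite leqNgt -pfactor_dvdn//; exact: h.
Qed.

Lemma part_lt_succ z n : squarefree n ->
  part_lt z.+1 n = (part_lt z n * (if prime z && (z %| n)%N then z else 1))%N.
Proof.
move=> sf; have n0 := squarefree_gt0 sf.
rewrite -(partnC [pred p | (p < z)%N] (part_lt_gt0 z.+1 n)) -/(part_lt z _) part_lt_comp//.
congr (_ * _)%N; rewrite -partnI (@eq_in_partn _ z); last first.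
  move=> p _; rewrite !inE ltnS andbC -leqNgt; by rewrite eqn_leq andbC.
have [pr|npr] := boolP (prime z); last by rewrite p_part lognE (negPf npr) expn0.
rewrite p_part; case: ifPn => /= zn.
  have : (0 < logn z n)%N by rewrite logn_gt0 mem_primes pr n0.
  by case: (logn z n) (squarefree_logn z sf) => [|[|k]].
by rewrite lognE (negPf zn) andbF andbF.
Qed.

Lemma part_lt_le z n : squarefree n -> (part_lt z n <= z ^ z)%N.
Proof.
move=> sf; elim: z => [|z IH].
  by rewrite /part_lt /partn big_pred0.
rewrite part_lt_succ// expnSr leq_mul//; last by case: ifP.
by apply: leq_trans IH _; case: (z) => // k; rewrite leq_exp2r.
Qed.

Lemma squarefree_decomp n : (0 < n)%N -> exists s t, [/\ squarefree s, (0 < t)%N & n = (s * t ^ 2)%N].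
Proof.
elim/ltn_ind: n => n IH n0; have [sf|nsf] := boolP (squarefree n).
  by exists n, 1%N; rewrite muln1.
have /allPn[p] : ~~ all (fun p => ~~ (p ^ 2 %| n)%N) (primes n) by move: nsf; rewrite /squarefree n0.
rewrite mem_primes => /andP[pr _].
rewrite negbK => /dvdnP[k nk]; have p1 := prime_gt1 pr.
have k0 : (0 < k)%N by move: n0; rewrite nk muln_gt0 => /andP[].
have [|s [t [sf t0 kE]]] := IH k _ k0.
  by rewrite nk -{1}[k]muln1 ltn_pmul2l// -(exp1n 2) ltn_exp2r.
by exists s, (t * p)%N; rewrite muln_gt0 t0 prime_gt0// nk kE expnMn mulnA.
Qed.

End Parts.

Section DsetPrime.
Variable R : realType.

(** Let t be the part of d below z. The divisor e in (t, y t] supplied by density cannot divide t,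
    so it has a prime factor >= z and the induction hypothesis applies to it; moreover z times the
    part of e below z is at most e, hence at most y t. *)
Lemma Dset_prime_factor (y : R) k d z p : 1 <= y -> Dset y k d -> prime p -> (p %| d)%N -> (z <= p)%N ->
  z%:R ^+ k <= y ^+ k * (part_lt z d)%:R.
Proof.
move=> y1; have y0 : 0 <= y by nlra.
elim: k d p => [|k IH] d p Dd pr pd zp.
  by rewrite !expr0 mul1r ler1n part_lt_gt0.
have d0 := Dset_gt0 Dd; have [_ _ h] := elimT (DsetSP _ y0 d0) Dd.
have t0 := part_lt_gt0 z d; set t := part_lt z d in t0 *.
have td : (t%:R : R) < d%:R.
  rewrite ltr_nat ltn_neqAle dvdn_leq ?part_lt_dvd// andbT; apply/eqP => E.
  by have := part_lt_prime pr (_ : p %| part_lt z d)%N; rewrite -/t E ltnNge zp => /(_ pd).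
have [|e [ed De te ey]] := h t%:R _ td; first by rewrite ler1n.
have e0 : (0 < e)%N := dvdn_gt0 d0 ed.
have [q [qr qe zq]] : exists q, [/\ prime q, (q %| e)%N & (z <= q)%N].
  apply: contrapT => H; move: te; rewrite ltr_nat; apply/negP; rewrite -leqNgt dvdn_leq//.
  apply: part_lt_sub => // q qr qe; rewrite ltnNge; apply/negP => zq; apply: H; by exists q.
have := IH e q De qr qe zq; set te' := part_lt z e => h1.
have qt : (z * te' <= e)%N.
  rewrite -[leqRHS](partnC [pred p | (p < z)%N] e0) mulnC leq_mul//.
  rewrite (leq_trans zq)// dvdn_leq ?part_gt0//.
  move: qe; rewrite -{1}(partnC [pred p | (p < z)%N] e0) Euclid_dvdM// => /orP[|//].
  by move/(part_lt_prime qr); rewrite ltnNge zq.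
have yk : 0 <= y ^+ k by rewrite exprn_ge0.
rewrite exprS [y ^+ k.+1]exprSr -mulrA; apply: le_trans (ler_wpM2l yk ey).
apply: (@le_trans _ _ (z%:R * (y ^+ k * te'%:R))); first by rewrite ler_wpM2l.
by rewrite mulrCA ler_wpM2l// -natrM ler_nat.
Qed.

(** The only trace of density that the upper bound keeps. The slack eta collects i ln y and twice
    the logarithm of t, when t^2 has been split off. *)
Definition admissible (a eta : R) n : bool :=
  all (fun p => a * ln p%:R <= eta + ln (part_lt p n)%:R) (primes n).

Lemma admissibleP a eta n : (0 < n)%N -> reflect
  (forall p, prime p -> (p %| n)%N -> a * ln p%:R <= eta + ln (part_lt p n)%:R) (admissible a eta n).
Proof.
move=> n0; apply: (iffP allP) => h p.
  by move=> pr pn; apply: h; rewrite mem_primes pr n0.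
by rewrite mem_primes => /and3P[]; auto.
Qed.

Lemma Dset_admissible (y : R) i s t : 1 <= y -> squarefree s -> (0 < t)%N -> Dset y i (s * t ^ 2)%N ->
  admissible i%:R (i%:R * ln y + 2 * ln t%:R) s.
Proof.
move=> y1 sf t0 D; have s0 := squarefree_gt0 sf; apply/admissibleP => // p pr ps.
have n0 : (0 < s * t ^ 2)%N by rewrite muln_gt0 s0 expn_gt0 t0.
have p0 : (0 : R) < p%:R by rewrite ltr0n prime_gt0.
have pn : (p %| s * t ^ 2)%N by rewrite dvdn_mulr.
have := Dset_prime_factor y1 D pr pn (leqnn p).
have t20 : (0 < t ^ 2)%N by rewrite expn_gt0 t0.
have le : (part_lt p (s * t ^ 2) <= part_lt p s * t ^ 2)%N.
  by rewrite /part_lt partnM// leq_mul// dvdn_leq// dvdn_part.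
move=> h; have {}h : p%:R ^+ i <= y ^+ i * (part_lt p s * t ^ 2)%:R.
  by apply: le_trans h _; rewrite ler_wpM2l ?exprn_ge0 ?ler_nat//; nlra.
have y0 : 0 < y by nlra.
have yi : 0 < y ^+ i by rewrite exprn_gt0.
have q0 := part_lt_gt0 p s.
have {}h : ln (p%:R ^+ i) <= ln (y ^+ i * (part_lt p s * t ^ 2)%:R).
  by rewrite ler_ln// posrE ?exprn_gt0// mulr_gt0// ltr0n muln_gt0 q0.
have e1 : ln (y ^+ i * (part_lt p s * t ^ 2)%:R) = i%:R * ln y + (ln (part_lt p s)%:R + 2 * ln t%:R) :> R.
  have q0' : (part_lt p s)%:R \is @Num.pos R by exact: natr_pos.
  have t2' : (t ^ 2)%:R \is @Num.pos R by exact: natr_pos.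
  have y' : y ^+ i \is Num.pos by rewrite posrE.
  have qt' : (part_lt p s * t ^ 2)%:R \is @Num.pos R by rewrite natr_pos// muln_gt0 q0.
  rewrite (lnM y' qt') natrM (lnM q0' t2') natrX !lnXn ?ltr0n//.
  by rewrite !mulr_natl.
move: h; rewrite e1 lnXn// -mulr_natl; nlra.
Qed.

End DsetPrime.

(** * Sums over the stopped leaves of a tree of prime-by-prime decisions *)

Section TreeSum.
Variable R : realType.
Variables (V : nat -> nat -> R) (alive : nat -> nat -> bool) (f : nat -> R).
Variables (S : seq nat) (t : nat -> nat) (z0 : nat).
Hypothesis uS : uniq S.
Hypothesis sfS : forall m, m \in S -> squarefree m.
Hypothesis tS : forall m p, m \in S -> prime p -> (p %| m)%N -> (p < t m)%N.
Hypothesis antichain : forall m m', m \in S -> m' \in S -> (t m <= t m')%N -> part_lt (t m) m' = m -> m' = m.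
Hypothesis fV : forall m, m \in S -> 0 <= f m <= V (t m) m.
Hypothesis aliveS : forall m z, m \in S -> (z <= t m)%N -> alive z (part_lt z m).
Hypothesis V0 : forall z b, (z0 <= z)%N -> (0 < b)%N -> alive z b ->
  [/\ 0 <= V z b, 0 <= V z.+1 b & 0 <= V z.+1 (b * z)%N].
Hypothesis Vstep : forall z b, (z0 <= z)%N -> (0 < b)%N -> alive z b ->
  V z.+1 b + (if prime z then V z.+1 (b * z)%N else 0) <= V z b.

Let T z b := \sum_(m <- S | (z <= t m)%N && (part_lt z m == b)) f m.

(** A node (z, b) stands for the numbers whose part below z is b, and [t m] is the time at which m
    is stopped. Induction runs down from beyond the last stopping time. Either a leaf stops at the
    node, and then by the antichain condition it is the only one below, or the sum splits according
    to whether z divides m. *)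
Lemma tree_sum z b : (z0 <= z)%N -> (0 < b)%N -> alive z b -> T z b <= V z b.
Proof.
pose M := \max_(m <- S) t m.
have tM m : m \in S -> (t m <= M)%N by move=> mS; exact: leq_bigmax_seq.
move: {2}(M.+1 - z)%N (leqnn (M.+1 - z)) => d.
elim: d z b => [|d IH] z b dz hz b0 al.
  rewrite /T big_seq_cond big1; first by case: (V0 hz b0 al).
  move=> m /and3P[mS zt _]; have := tM m mS; move: dz zt; lia.
have Tle z' b' : (M.+1 - z' <= d)%N -> (z0 <= z')%N -> (0 < b')%N -> 0 <= V z' b' -> T z' b' <= V z' b'.
  move=> dz' hz' b'0 v0; have [al'|dead] := boolP (alive z' b'); first exact: IH.
  rewrite /T big_seq_cond big1// => m /and3P[mS zt /eqP E].
  by move: dead; rewrite -E aliveS.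
have [v1 v2 v3] := V0 hz b0 al.
have [/hasP[m mS /andP[/eqP tm /eqP pm]]|nh] := boolP (has (fun m => (t m == z) && (part_lt z m == b)) S).
  have mb : m = b.
    by rewrite -pm part_lt_id ?squarefree_gt0 ?sfS// => p pr pd; rewrite -tm; exact: tS.
  rewrite /T big_mkcond (bigD1_seq m)//= tm leqnn pm eqxx/=.
  rewrite big_seq_cond big1 ?addr0; first by have /andP[_] := fV mS; rewrite tm mb.
  move=> m' /andP[m'S /eqP ne]; case: ifP => // /andP[zt /eqP pm']; case: ne.
  by apply: antichain => //; rewrite tm// pm' mb.
apply: le_trans (Vstep hz b0 al).
have hb : T z.+1 b <= V z.+1 b by apply: Tle => //; lia.
have split : T z b <= T z.+1 b + (if prime z then T z.+1 (b * z)%N else 0).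
  have -> : (if prime z then T z.+1 (b * z)%N else 0) =
      \sum_(m <- S | [&& prime z, z.+1 <= t m & part_lt z.+1 m == b * z]%N) f m.
    by case: (prime z); rewrite ?big_pred0_eq.
  rewrite /T big_mkcond [X in _ <= X + _]big_mkcond [X in _ <= _ + X]big_mkcond -big_split/= big_seq [leRHS]big_seq.
  apply: ler_sum => m mS; have /andP[f0 _] := fV mS.
  have g0 (c : bool) : 0 <= (if c then f m else 0) by case: c.
  case: ifPn => [/andP[zt /eqP pm]|_]; last by rewrite addr_ge0.
  have zt1 : (z.+1 <= t m)%N.
    rewrite ltn_neqAle zt andbT; apply/eqP => E; move/negP: nh; apply.
    by apply/hasP; exists m => //; rewrite -E pm !eqxx.
  rewrite zt1 (part_lt_succ z (sfS mS)) pm.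
  case: (prime z) => /=; last by rewrite muln1 eqxx addr0.
  by case: (z %| m)%N; rewrite ?muln1 eqxx ?lerDr ?lerDl.
apply: le_trans split (lerD hb _); case: ifPn => pr//.
by apply: Tle => //; [lia|exact: leqW|rewrite muln_gt0 b0 prime_gt0].
Qed.

Lemma tree_sum_start B : (forall m, m \in S -> (z0 <= t m)%N /\ (part_lt z0 m <= B)%N) ->
  \sum_(m <- S) f m <= \sum_(1 <= b < B.+1 | alive z0 b) V z0 b.
Proof.
move=> hS; have -> : \sum_(m <- S) f m = \sum_(1 <= b < B.+1) T z0 b.
  rewrite /T; under [RHS]eq_bigr do rewrite big_mkcond.
  rewrite exchange_big/= big_seq [RHS]big_seq; apply: eq_bigr => m mS.
  have [zt pB] := hS m mS; rewrite zt/=.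
  rewrite (bigD1_seq (part_lt z0 m))/= ?iota_uniq ?mem_index_iota ?part_lt_gt0 ?ltnS//.
  by rewrite eqxx big1 ?addr0// => b /negPf; rewrite eq_sym => ->.
rewrite [leRHS]big_mkcond; rewrite big_seq_cond [leRHS]big_seq_cond.
apply: ler_sum => b; rewrite mem_index_iota andbT => /andP[b0 _].
case: ifPn => al; first exact: tree_sum.
rewrite /T big_seq_cond big1// => m /and3P[mS zt /eqP E].
by move: al; rewrite -E aliveS.
Qed.

End TreeSum.

(** * The weight *)

Section Homogeneous.
Variable R : realType.
Implicit Types (u l L x mu n b : R).

Definition homG mu n l L : R := L `^ n * G mu (l / L).

#[local] Opaque powR ln.

Lemma homG_derive_l mu n l L : 0 < l -> 0 < L ->
  is_derive l 1 (fun t => homG mu n t L) (L `^ n * (mu * G (mu - 1) (l / L)) / L).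
Proof.
move=> l0 L0; have u0 : 0 < l / L by rewrite divr_gt0.
have D1 := is_derive_affine L^-1 0 l.
have D2 : is_derive (L^-1 * l + 0) 1 (G mu) (mu * G (mu - 1) (l / L)).
  by rewrite addr0 (mulrC L^-1); exact: G_is_derive.
have := is_deriveZ' (L `^ n) (is_derive_comp' (g := fun t => L^-1 * t + 0) D2 D1).
rewrite mulrA (_ : (fun t => _) = (fun t => homG mu n t L))//.
by apply/funext => t; rewrite /homG addr0 (mulrC L^-1).
Qed.

(** The delay equation in homogeneous form: an increase of L removes a multiple of the value at l +
    L, just what adjoining a prime with ln p close to L adds. The remaining term vanishes for n = mu
    - 1. *)
Lemma homG_derive_L mu n l L : 0 < l -> 0 < L ->
  is_derive L 1 (homG mu n l) (((n - mu + 1) * homG mu n l L - homG mu n (l + L) L) / L).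
Proof.
move=> l0 L0; have u0 : 0 < l / L by rewrite divr_gt0.
have Ln : L != 0 by rewrite gt_eqF.
have D0 : 0 < L + 0 by rewrite addr0.
have D1 := is_deriveZ' l (is_derive_invr Ln).
have D2 := is_derive_comp' (g := fun t => l * t^-1) (G_is_derive mu u0) D1.
have := is_deriveM' (is_derive_powR n D0) D2.
rewrite addr0 (_ : (fun t => (t + 0) `^ n * _) = homG mu n l); last first.
  by apply/funext => t; rewrite /homG addr0.
move=> D; apply: (is_derive_eq D); rewrite /homG.
have -> : (l + L) / L = l / L + 1 by field.
have := G_shift mu u0; set g := G (mu - 1) _; set g1 := G mu _; set g2 := G mu _ => S.
rewrite (powRS n L0); set P := L `^ (n - 1).
have -> : L * P * (mu * g * (l * - L ^- 2)) = - (l / L * (mu * g)) * P by field.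
by rewrite S; field.
Qed.

Lemma powR_comparable (q s : R) : 1 <= q -> exists2 C : R, 1 <= C &
  forall v x : R, 0 < v -> v / q <= x -> x <= q * v -> x `^ s <= C * v `^ s.
Proof.
move=> q1; have q0 : 0 < q by nlra.
have [k1 hk1] := natr_ge_norm s; have [k2 hk2] := natr_ge_norm (q ^+ 2).
pose k := (maxn k1 k2).+1.
have kk (r : R) j : `|r| <= j%:R -> (j <= maxn k1 k2)%N -> `|r| <= k%:R.
  by move=> rj jk; apply: le_trans rj _; rewrite ler_nat ltnW.
have sk : `|s| <= k%:R by apply: kk hk1 _; exact: leq_maxl.
have qk : q ^+ 2 <= k%:R.
  by rewrite -[leLHS]ger0_norm ?sqr_ge0//; apply: kk hk2 _; exact: leq_maxr.
have k1' : (1 : R) <= k%:R by rewrite ler1n.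
have c0 : 0 < (q^-1) `^ s by rewrite powR_gt0// invr_gt0.
exists (1 + k%:R ^+ k * (q^-1) `^ s); first by rewrite lerDl mulr_ge0// ?exprn_ge0// ltW.
move=> v x v0 vx xv; have vq : 0 < v / q by rewrite divr_gt0.
apply: le_trans (powR_ratio_le vq vx _ sk _) _ => //.
  apply: le_trans xv _; have -> : q * v = v / q * q ^+ 2 by field; rewrite gt_eqF.
  by rewrite ler_pM2l.
rewrite powRM ?invr_ge0 ?(ltW v0) ?(ltW q0)// [_ * q^-1 `^ s]mulrC mulrA ler_wpM2r ?powR_ge0//.
by rewrite lerDr.
Qed.

(** Covers the points met in one step, with room for the further shift of l that the derivative in L
    introduces. *)
Definition nearby l L l1 L1 := [/\ l <= l1, l1 <= l + 4 * L, L <= L1 & L1 <= 3 / 2 * L].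

Lemma nearby_ratio l L l1 L1 : 1 <= L -> 3 / 4 * L <= l -> nearby l L l1 L1 ->
  [/\ 0 < l / L, 2^-1 <= l1 / L1, l / L / 8 <= l1 / L1 & l1 / L1 <= 8 * (l / L)].
Proof.
move=> L1' lL [h1 h2 h3 h4]; have L0 : 0 < L by nlra.
have L10 : 0 < L1 by nlra.
split; first by rewrite divr_gt0//; nlra.
- by rewrite ler_pdivlMr//; nlra.
- rewrite -!mulrA -invfM ler_pdivlMr// mulrAC ler_pdivrMr ?mulr_gt0//; nra.
- rewrite ler_pdivrMr// mulrAC mulrA ler_pdivlMr//; nra.
Qed.

Lemma homG_le mu n : exists2 C : R, 1 <= C & forall l L l1 L1, 1 <= L -> 3 / 4 * L <= l ->
  nearby l L l1 L1 -> `|homG mu n l1 L1| <= C * (L `^ n * (l / L) `^ mu).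
Proof.
have [C1 C10 H1] := G_le mu.
have q8 : (1 : R) <= 8 by nlra.
have [C2 C20 H2] := powR_comparable mu q8; have [C3 C30 H3] := powR_comparable n q8.
have P : 0 <= C3 * (C1 * C2) by rewrite !mulr_ge0//; nlra.
exists (1 + C3 * (C1 * C2)); first by nlra.
move=> l L l1 L1 L1' lL nb; have [u0 v1 v2 v3] := nearby_ratio L1' lL nb.
case: nb => [h1 h2 h3 h4].
rewrite /homG normrM (ger0_norm (powR_ge0 _ _)).
have hL : L1 `^ n <= C3 * L `^ n by apply: H3; nlra.
have hG : `|G mu (l1 / L1)| <= C1 * (C2 * (l / L) `^ mu).
  by apply: le_trans (H1 _ v1) _; apply: ler_wpM2l => //; apply: H2.
apply: le_trans (ler_pM (powR_ge0 _ _) (normr_ge0 _) hL hG) _.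
have B0 : 0 <= L `^ n * (l / L) `^ mu by rewrite mulr_ge0 ?powR_ge0.
by rewrite mulrDl mul1r [leLHS](_ : _ = C3 * (C1 * C2) * (L `^ n * (l / L) `^ mu)) ?lerDr//; ring.
Qed.

Lemma lip_of_derive (f df : R -> R) x1 x2 K : 0 <= K ->
  (forall x, Num.min x1 x2 <= x <= Num.max x1 x2 -> is_derive x 1 f (df x) /\ `|df x| <= K) ->
  `|f x1 - f x2| <= K * `|x1 - x2|.
Proof.
move=> K0; wlog h : x1 x2 / x1 < x2.
  move=> W H; have [h|h|->] := ltgtP x1 x2; first exact: W.
    by rewrite distrC (distrC x1); apply: W => // x hx; apply: H; rewrite minC maxC.
  by rewrite !subrr normr0 mulr0.
rewrite (min_idPl (ltW h)) (max_idPr (ltW h)) => H.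
have [z /andP[z1 z2] E] := mean_value_cc h (fun x hx => (H x hx).1).
rewrite distrC E normrM (distrC x1); apply: ler_wpM2r => //.
by apply: (H z _).2; rewrite !ltW.
Qed.

(** The limit 5/2 on the shift in l leaves 3/2 for the value at l + L that occurs in the derivative
    in L. *)
Lemma homG_lip mu n : exists2 C : R, 1 <= C & forall l L l1 L1 l2 L2, 1 <= L -> 3 / 4 * L <= l ->
  nearby l L l1 L1 -> nearby l L l2 L2 -> l1 <= l + 5 / 2 * L -> l2 <= l + 5 / 2 * L ->
  `|homG mu n l1 L1 - homG mu n l2 L2| <=
    C * (L `^ n * (l / L) `^ mu) / L * (`|l1 - l2| + `|L1 - L2|).
Proof.
have [C1 C11 H1] := homG_le mu n; have [C2 C21 H2] := homG_le (mu - 1) n.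
pose b : R := n - mu + 1.
have mn0 : 0 <= `|mu| by []. have bn0 : 0 <= `|b| by [].
pose C : R := `|mu| * C2 * 2 + (`|b| + 1) * C1.
have C0 : 1 <= C by rewrite /C; nra.
have C0' : 0 <= C by nlra.
exists C => // l L l1 L1 l2 L2 L1' lL nb1 nb2 hl1 hl2.
have L0 : 0 < L by nlra. have l0 : 0 < l by nlra.
set B := L `^ n * _; have B0 : 0 <= B by rewrite mulr_ge0 ?powR_ge0.
have u0 : 0 < l / L by rewrite divr_gt0.
have B2 : L `^ n * (l / L) `^ (mu - 1) <= 2 * B.
  rewrite /B mulrCA ler_wpM2l ?powR_ge0//; apply: powRB1_le.
  by rewrite ler_pdivlMr//; nlra.
have K0 : 0 <= C * B / L by exact: divr_ge0 (mulr_ge0 C0' B0) (ltW L0).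
case: (nb1) => a1 a2 a3 a4; case: (nb2) => b1 b2 b3 b4.
have step1 : `|homG mu n l1 L1 - homG mu n l2 L1| <= C * B / L * `|l1 - l2|.
  apply: (@lip_of_derive (fun t => homG mu n t L1) (fun t => L1 `^ n * (mu * G (mu - 1) (t / L1)) / L1)) => // x.
  rewrite ge_min le_max => /andP[x1 x2].
  have xl : l <= x by case/orP: x1; nlra.
  have xu : x <= l + 4 * L by case/orP: x2; nlra.
  split; first by apply: homG_derive_l; nlra.
  have -> : L1 `^ n * (mu * G (mu - 1) (x / L1)) / L1 = mu * homG (mu - 1) n x L1 / L1.
    by rewrite /homG mulrCA.
  have nb : nearby l L x L1 by split.
  rewrite normrM normfV (ger0_norm (_ : 0 <= L1)); last nlra.
  apply: ler_pM => //; [by rewrite invr_ge0; nlra| |by rewrite lef_pV2 ?posrE; nlra].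
  rewrite normrM; apply: le_trans (ler_wpM2l mn0 (H2 _ _ _ _ L1' lL nb)) _.
  apply: le_trans (ler_wpM2l mn0 (ler_wpM2l (le_trans ler01 C21) B2)) _.
  rewrite /C; have h : 0 <= (`|b| + 1) * C1 * B by apply: mulr_ge0 => //; apply: mulr_ge0; nlra.
  by rewrite mulrDl; nlra.
have step2 : `|homG mu n l2 L1 - homG mu n l2 L2| <= C * B / L * `|L1 - L2|.
  apply: (@lip_of_derive (homG mu n l2) (fun t => (b * homG mu n l2 t - homG mu n (l2 + t) t) / t)) => // x.
  rewrite ge_min le_max => /andP[x1 x2].
  have xl : L <= x by case/orP: x1; nlra.
  have xu : x <= 3 / 2 * L by case/orP: x2; nlra.
  split; first by apply: homG_derive_L; nlra.
  rewrite normrM normfV (ger0_norm (_ : 0 <= x)); last nlra.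
  apply: ler_pM => //; [by rewrite invr_ge0; nlra| |by rewrite lef_pV2 ?posrE; nlra].
  apply: le_trans (ler_normB _ _) _; rewrite normrM.
  have n1 : nearby l L l2 x by split.
  have n2 : nearby l L (l2 + x) x by split; nlra.
  apply: le_trans (lerD (ler_wpM2l bn0 (H1 _ _ _ _ L1' lL n1)) (H1 _ _ _ _ L1' lL n2)) _.
  rewrite -/B /C; have h : 0 <= `|mu| * C2 * 2 * B by apply: mulr_ge0 => //; apply: mulr_ge0 => //; apply: mulr_ge0 => //; nlra.
  by rewrite !mulrDl mul1r; nlra.
rewrite mulrDr; apply: le_trans (lerD step1 step2); exact: ler_distD.
Qed.

(* [L'] is the next value of a sum of [ln p / p] over primes; the derivative in
   [L] cancels the increment in [l] up to the factor [1 + b / p]. *)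
Lemma homG_step mu n C0 : 1 <= C0 -> exists2 C : R, 1 <= C & forall l L p, C0 + 4 <= L ->
  3 / 4 * L <= l -> 1 <= p -> `|ln p - L| <= C0 ->
  `|homG mu n l (L + ln p / p) + homG mu n (l + ln p) (L + ln p / p) / p
    - (1 + (n - mu + 1) / p) * homG mu n l L|
  <= C / (p * L) * (L `^ n * (l / L) `^ mu).
Proof.
move=> C01; have [C1 C11 H1] := homG_le mu n; have [C2 C21 H2] := homG_lip mu n.
pose b : R := n - mu + 1; have bn0 : 0 <= `|b| by [].
pose C : R := `|b| * C2 + (`|b| + 1) * (C0 + 1) * C1 + C2 * (C0 + 2).
have CC : 1 <= C.
  have g1 : 0 <= `|b| * C2 by rewrite mulr_ge0//; nlra.
  have g2 : 0 <= (`|b| + 1) * (C0 + 1) * C1 by rewrite !mulr_ge0//; nlra.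
  have g3 : C2 * 1 <= C2 * (C0 + 2) by rewrite ler_wpM2l//; nlra.
  by rewrite /C; nlra.
exists C => // l L p hL lL p1 hp.
have L1' : 1 <= L by nlra. have L0 : 0 < L by nlra. have l0 : 0 < l by nlra.
have p0 : 0 < p by nlra.
move: (hp); rewrite ler_norml => /andP[hp1 hp2].
set B := L `^ n * _; have B0 : 0 <= B by rewrite mulr_ge0 ?powR_ge0.
have d0 : 0 < ln p / p by rewrite divr_gt0//; nlra.
have d1 : ln p / p <= 1 by rewrite ler_pdivrMr// mul1r ltW// ln_sublinear.
set d := ln p / p in d0 d1 *; have lt : L < L + d by nlra.
have [|t /andP[t1 t2] E] := mean_value_cc (f := homG mu n l) (df := fun t => (b * homG mu n l t - homG mu n (l + t) t) / t) lt.
  by move=> x /andP[x1 x2]; apply: homG_derive_L; nlra.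
have t0 : 0 < t by nlra.
set T := homG mu n l t; set S := homG mu n (l + t) t.
set S' := homG mu n (l + ln p) (L + d); set F := homG mu n l L.
have nt : nearby l L l t by split; nlra.
have nS : nearby l L (l + t) t by split; nlra.
have nS' : nearby l L (l + ln p) (L + d) by split; nlra.
have nF : nearby l L l L by split; nlra.
have hT : `|T| <= C1 * B by exact: H1.
have hS : `|S| <= C1 * B by exact: H1.
have C20 : 0 <= C2 by nlra.
have K0 : 0 <= C2 * B / L by exact: divr_ge0 (mulr_ge0 C20 B0) (ltW L0).
have hTF : `|T - F| <= C2 * B / L * 1.
  apply: le_trans (H2 _ _ _ _ _ _ L1' lL nt nF _ _) _; try nlra.
  by apply: ler_wpM2l => //; rewrite subrr normr0 add0r ger0_norm; nlra.
have hSS : `|S' - S| <= C2 * B / L * (C0 + 2).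
  apply: le_trans (H2 _ _ _ _ _ _ L1' lL nS' nS _ _) _; try nlra.
  apply: ler_wpM2l => //; rewrite addrAC opprD addrA subrr add0r.
  have h1 : `|ln p - t| <= C0 + 1 by rewrite ler_norml; nlra.
  have h2 : `|L + d - t| <= 1 by rewrite ler_norml; nlra.
  by rewrite addrC in h1; nlra.
pose th := ln p / t - 1.
have hth : `|th| <= (C0 + 1) / L.
  have -> : th = (ln p - t) / t by rewrite /th; field; rewrite gt_eqF.
  rewrite normrM normfV (ger0_norm (ltW t0)); apply: ler_pM => //; first by rewrite invr_ge0 ltW.
    by rewrite ler_norml; nlra.
  by rewrite lef_pV2 ?posrE//; nlra.
have key : homG mu n l (L + d) + S' / p - (1 + b / p) * F =
   (b * (T - F) + th * (b * T - S) + (S' - S)) / p.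
  have -> : homG mu n l (L + d) = F + (b * T - S) / t * d.
    by rewrite (_ : L + d - L = d) in E; [rewrite -E /F; ring|ring].
  by rewrite /th /d; field; rewrite !gt_eqF.
rewrite key normrM normfV (ger0_norm (ltW p0)).
have -> : C / (p * L) * B = C * B / L / p by field; rewrite !gt_eqF.
rewrite ler_wpM2r ?invr_ge0 ?(ltW p0)//.
have g1 : `|b * (T - F)| <= `|b| * (C2 * B / L * 1) by rewrite normrM ler_wpM2l.
have g2 : `|th * (b * T - S)| <= (C0 + 1) / L * ((`|b| + 1) * (C1 * B)).
  rewrite normrM ler_pM//; apply: le_trans (ler_normB _ _) _; rewrite normrM.
  by have := ler_wpM2l bn0 hT; rewrite mulrDl mul1r; nlra.
apply: le_trans (ler_normD _ _) _; apply: le_trans (lerD (ler_normD _ _) (lexx _)) _.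
apply: le_trans (lerD (lerD g1 g2) hSS) _.
rewrite le_eqVlt; apply/orP; left; apply/eqP; rewrite /C; field.
by rewrite gt_eqF.
Qed.

End Homogeneous.

Section Weights.
Variables (R : realType) (a : R).
Hypothesis a1 : 1 <= a.
Implicit Types (u h L p s e : R).

#[local] Opaque powR ln.

Notation lam := (lambda a^-1).
Notation mu := (lam - 4^-1).

Lemma lam_gt0 : 0 < lam. Proof. by have [] := lambda_spec a1. Qed.
Lemma G_lam0 : G lam a = 0. Proof. by have [] := lambda_spec a1. Qed.
Lemma G_lam_gt0 u : a < u -> 0 < G lam u.
Proof. by have [_ _ _] := lambda_spec a1; apply. Qed.
Lemma G_mu_gt0 u : a <= u -> 0 < G mu u.
Proof. have [_ _ h _] := lambda_spec a1; apply: h; nlra. Qed.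

Lemma powRD_pos (x r s : R) : 0 < x -> x `^ (r + s) = x `^ r * x `^ s.
Proof. by move=> x0; rewrite powRD// (gt_eqF x0) implybT. Qed.

Lemma powR_split32 L : 0 < L -> L `^ (lam - 3 / 2) = L `^ (lam - 1) * L `^ (- 2^-1).
Proof. by move=> L0; rewrite -powRD_pos//; congr (_ `^ _); field. Qed.

Lemma pos_min (f df : R -> R) (x1 x2 : R) : x1 <= x2 ->
  (forall x, x1 <= x <= x2 -> is_derive x 1 f (df x)) -> (forall x, x1 <= x <= x2 -> 0 < f x) ->
  exists2 c : R, 0 < c & forall x, x1 <= x <= x2 -> c <= f x.
Proof.
move=> x12 D pf; have [c cI H] := EVT_min x12 (is_derive_within D).
move: cI; rewrite in_itv/= => cI.
by exists (f c); [exact: pf|move=> x xI; apply: H; rewrite in_itv/=].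
Qed.

Lemma G_lip nu : exists2 C : R, 1 <= C & forall u, 2^-1 <= u <= a + 1 ->
  `|G nu u - G nu a| <= C * `|u - a|.
Proof.
have [C1 C10 H1] := G_le (nu - 1).
have q1 : 1 <= a + 2 by have ? := a1; nlra.
have [C2 C20 H2] := powR_comparable (nu - 1) q1.
have K0 : 0 <= `|nu| * (C1 * C2) by rewrite !mulr_ge0//; nlra.
exists (1 + `|nu| * (C1 * C2)); first by nlra.
have ? := a1; move=> u /andP[u1 u2].
apply: le_trans (_ : `|nu| * (C1 * C2) * `|u - a| <= _); last by rewrite ler_wpM2r//; nlra.
apply: (lip_of_derive (df := fun t => nu * G (nu - 1) t)) => // x.
rewrite ge_min le_max => /andP[x1 x2].
have xl : 2^-1 <= x by case/orP: x1; nlra.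
have xu : x <= a + 1 by case/orP: x2; nlra.
split; first by apply: G_is_derive; nlra.
rewrite normrM ler_wpM2l//; apply: le_trans (H1 _ xl) _; rewrite ler_wpM2l//.
have := H2 1 x ltr01; rewrite powR1 !mulr1 div1r; apply; last nlra.
by apply: le_trans xl; rewrite lef_pV2 ?posrE; nlra.
Qed.

Lemma G_lam_lip : exists2 C : R, 1 <= C & forall u, 2^-1 <= u <= a + 1 -> `|G lam u| <= C * `|u - a|.
Proof. by have [C C1 H] := G_lip lam; exists C => // u /H; rewrite G_lam0 subr0. Qed.

(** Since mu < lambda, [G mu] is positive at a itself, hence also slightly below a, where the error
    in Mertens' estimate may push the argument. *)
Lemma G_mu_ge : exists c e : R, [/\ 0 < c, 0 < e, e <= 4^-1 &
  forall u, a - e <= u <= a + 4^-1 -> c <= G mu u].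
Proof.
have ? := a1; have aa : a <= a + 4^-1 by nlra.
have [||c c0 H] := @pos_min (G mu) (fun t => mu * G (mu - 1) t) a (a + 4^-1) aa.
- by move=> x /andP[x1 x2]; apply: G_is_derive; nlra.
- by move=> x /andP[x1 x2]; apply: G_mu_gt0.
have [C C1 HC] := G_lip mu.
have C20 : 0 < 2 * C by nlra.
pose e : R := Num.min 4^-1 (c / (2 * C)).
have ee : e <= c / (2 * C) by rewrite ge_min lexx orbT.
have e4 : e <= 4^-1 by rewrite ge_min lexx.
have e0 : 0 < e by rewrite lt_min divr_gt0// andbT invr_gt0.
exists (c / 2), e; split=> //; first by nlra.
move=> u /andP[u1 u2]; have [au|ua] := leP a u.
  by have := H u; rewrite au u2 => /(_ isT); nlra.
have := HC u; have -> : 2^-1 <= u <= a + 1 by apply/andP; split; nlra.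
move=> /(_ isT); rewrite (distrC u) (ger0_norm (_ : 0 <= a - u)); last nlra.
have := H a; rewrite lexx aa => /(_ isT) h1.
have h2 : C * (a - u) <= c / 2.
  have -> : c / 2 = C * (c / (2 * C)) by field; rewrite gt_eqF//; nlra.
  by rewrite ler_wpM2l//; nlra.
rewrite ler_norml => /andP[h3 _]; nlra.
Qed.

Lemma powR_le1n (s : R) (x b : R) : 1 <= x -> x <= b -> 0 <= s -> x `^ s <= b `^ s.
Proof. by move=> x1 xb s0; apply: ge0_ler_powR; rewrite ?nnegrE//; nlra. Qed.

Lemma G_lam_ge : exists2 c : R, 0 < c & forall u, a + 4^-1 <= u -> c * u `^ lam <= G lam u.
Proof.
have ? := a1; have l0 := lam_gt0.
have [V V1 HV] := G_ge (ltW l0).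
pose W : R := V + a + 1.
have aW : a + 4^-1 <= W by rewrite /W; nlra.
have [||c c0 H] := @pos_min (G lam) (fun t => lam * G (lam - 1) t) (a + 4^-1) W aW.
- by move=> x /andP[x1 x2]; apply: G_is_derive; nlra.
- by move=> x /andP[x1 x2]; apply: G_lam_gt0; nlra.
have W0 : 0 < W `^ lam by apply: powR_gt0; rewrite /W; nlra.
have ge0 : 0 < egam R by have [/andP[h _] _] := buchstab_facts R; nlra.
pose k : R := Num.min (egam R / 2) (c / W `^ lam).
have k1 : k <= egam R / 2 by rewrite ge_min lexx.
have k2 : k <= c / W `^ lam by rewrite ge_min lexx orbT.
exists k; first by rewrite lt_min !divr_gt0.
move=> u au; have [uV|Vu] := leP V u.
  by apply: le_trans (HV _ uV); rewrite ler_wpM2r ?powR_ge0.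
apply: le_trans (H u _); last by rewrite au /W; nlra.
apply: (@le_trans _ _ (c / W `^ lam * u `^ lam)); first by rewrite ler_wpM2r ?powR_ge0.
rewrite mulrAC ler_pdivrMr// ler_wpM2l ?(ltW c0)//; apply: powR_le1n; rewrite ?(ltW l0)// /W; nlra.
Qed.

Lemma G_lam_le : exists2 C : R, 1 <= C & forall u, 2^-1 <= u -> `|G lam u| <= C * u `^ lam.
Proof.
have [C C0 H] := G_le lam; exists (1 + C); first by nlra.
by move=> u /H h; apply: le_trans h _; rewrite ler_wpM2r ?powR_ge0//; nlra.
Qed.

Lemma powR_mu_le u : 2^-1 <= u -> u `^ mu <= 2 * u `^ lam.
Proof.
move=> u1; have u0 : 0 < u by nlra.
have -> : u `^ mu = (u `^ 4^-1)^-1 * u `^ lam by rewrite powRD_pos// mulrC powRN.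
apply: ler_wpM2r; first exact: powR_ge0.
have h : (2^-1) `^ 4^-1 <= u `^ 4^-1 by apply: ge0_ler_powR; rewrite ?nnegrE//; nlra.
have p0 : (0 : R) < (2^-1) `^ 4^-1 by apply: powR_gt0; rewrite invr_gt0.
apply: (@le_trans _ _ (((2^-1) `^ 4^-1)^-1)); first by rewrite lef_pV2 ?posrE// (lt_le_trans p0).
rewrite -[leRHS]invrK lef_pV2 ?posrE ?invr_gt0//.
rewrite -[leLHS]powRr1; last by rewrite invr_ge0.
by apply: ger_powR; nlra.
Qed.

(** For u >= a + 1/4 the function [G lam] has the order u^lam, and a large K wins. Closer to a it
    may vanish or be slightly negative, and there the positive [G mu], divided by the small h,
    wins. *)
Lemma core_inequality C : 1 <= C -> exists K e : R, [/\ 1 <= K, 0 < e, e <= 4^-1 &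
  forall h u (th : R), 0 < h -> h <= e -> a - e <= u -> 2^-1 <= th -> th <= 2 ->
    C * u `^ lam <= K * th * G lam u + G mu u / (4 * h)].
Proof.
have ? := a1; move=> C1; have l0 := lam_gt0.
have [c c0 Hc] := G_lam_ge; have [c' [e' [c'0 e'0 e'4 Hc']]] := G_mu_ge.
have [C5 C51 H5] := G_lam_lip.
pose K : R := 1 + 2 * C / c.
have Cc : 0 <= 2 * C / c by apply: divr_ge0; nlra.
pose M : R := C * (a + 1) `^ lam + 2 * K * C5.
have p0 : 0 <= C * (a + 1) `^ lam by rewrite mulr_ge0 ?powR_ge0//; nlra.
have K1 : 1 <= K by rewrite /K; nlra.
have q0 : 0 < 2 * K * C5 by rewrite !mulr_gt0//; nlra.
have M0 : 0 < M by rewrite /M; nlra.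
have M40 : 0 < c' / (4 * M) by rewrite divr_gt0//; nlra.
pose e : R := Num.min e' (c' / (4 * M)).
have ee : e <= c' / (4 * M) by rewrite ge_min lexx orbT.
have ee' : e <= e' by rewrite ge_min lexx.
exists K, e; split=> //; [by rewrite lt_min e'0|by nlra|].
move=> h u th h0 he ue t1 t2; have K0 : 0 <= K by nlra.
have h40 : 0 < 4 * h by nlra.
have [u4|u4] := leP (a + 4^-1) u.
  have g0 : 0 <= G mu u / (4 * h) by rewrite divr_ge0 ?(ltW h40)// ltW// G_mu_gt0; nlra.
  have h1 : 2 * C / c * 2^-1 <= K * th by apply: ler_pM => //; rewrite /K; nlra.
  have cu0 : 0 <= c * u `^ lam by rewrite mulr_ge0 ?powR_ge0 ?ltW.
  have := ler_pM (_ : 0 <= 2 * C / c * 2^-1) cu0 h1 (Hc u u4).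
  have -> : 2 * C / c * 2^-1 * (c * u `^ lam) = C * u `^ lam by field; rewrite gt_eqF.
  have Cc2 : 0 <= 2 * C / c * 2^-1 by nlra.
  by move=> /(_ Cc2); nlra.
have ur : 2^-1 <= u <= a + 1 by apply/andP; split; nlra.
have g1 : `|G lam u| <= C5.
  apply: le_trans (H5 _ ur) _; rewrite -[leRHS]mulr1; apply: ler_wpM2l; first nlra.
  by rewrite ler_norml; nlra.
have g2 : c' <= G mu u by apply: Hc'; apply/andP; split; nlra.
have g3 : M <= G mu u / (4 * h).
  rewrite ler_pdivlMr//; apply: le_trans g2.
  have : M * (4 * h) <= M * (4 * (c' / (4 * M))) by rewrite ler_wpM2l ?(ltW M0)//; nlra.
  by have -> : M * (4 * (c' / (4 * M))) = c' by field; rewrite gt_eqF.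
have g4 : u `^ lam <= (a + 1) `^ lam by apply: ge0_ler_powR; rewrite ?nnegrE; nlra.
have g5 : C * u `^ lam <= C * (a + 1) `^ lam by rewrite ler_wpM2l//; nlra.
have g6 : - (2 * K * C5) <= K * th * G lam u.
  rewrite lerNl; apply: le_trans (ler_norm _) _; rewrite normrN normrM ger0_norm; last by rewrite mulr_ge0//; nlra.
  by apply: ler_pM => //; [rewrite mulr_ge0//; nlra|rewrite mulrC ler_wpM2r].
by move: g3; rewrite /M; nlra.
Qed.

(** Superinvariant for s = 1, subinvariant for s = -1. The drift coefficient n - mu + 1 of
    [homG_step] is 0 for the main term and -1/4 for the second one, whose degree makes it smaller by
    L^(-1/2). The factor with K / L drifts because L grows along the tree. *)
Definition weight s K (l : R) L : R :=
  (1 + s * K / L) * homG lam (lam - 1) l L + s * homG mu (lam - 3 / 2) l L.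

Lemma weightE s K l L : 0 < L -> weight s K l L =
  L `^ (lam - 1) * ((1 + s * K / L) * G lam (l / L) + s * (L `^ (- 2^-1) * G mu (l / L))).
Proof.
move=> L0; by rewrite /weight /homG powR_split32//; ring.
Qed.

Lemma powRN2_sqr L : 0 < L -> L `^ (- 2^-1) * L `^ (- 2^-1) = L^-1.
Proof.
move=> L0; have E : - 2^-1 + - 2^-1 = - 1 :> R by field.
by rewrite -powRD_pos// E powR_inv1// ltW.
Qed.

Lemma powRN2_small e : 0 < e -> exists2 L0 : R, 1 <= L0 & forall L, L0 <= L -> L `^ (- 2^-1) <= e.
Proof.
move=> e0; have h2 : (0 : R) < 2^-1 by rewrite invr_gt0.
have [x x1 H] := powR_neg_small h2 e0; exists x => // L xL.
apply: le_trans H; rewrite !powRN lef_pV2 ?posrE ?powR_gt0//; [|nlra|nlra].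
by apply: ge0_ler_powR; rewrite ?nnegrE//; nlra.
Qed.

Lemma weight_step C0 : 1 <= C0 -> exists K L0 : R, [/\ 1 <= K, 1 <= L0 &
  forall s l L p, s = 1 \/ s = -1 -> L0 <= L -> 1 <= p -> `|ln p - L| <= C0 -> a * ln p <= l ->
  s * (weight s K l (L + ln p / p) + weight s K (l + ln p) (L + ln p / p) / p - weight s K l L) <= 0].
Proof.
have ? := a1; move=> C01.
have [C1 C11 H1] := homG_step lam (lam - 1) C01.
have [C2 C21 H2] := homG_step mu (lam - 3 / 2) C01.
pose C : R := 2 * C1 + 2 * C2.
have CC : 1 <= C by rewrite /C; nlra.
have [K [e [K1 e0 e4 core]]] := core_inequality CC.
have [L1 L11 small] := powRN2_small e0.
pose L0 : R := L1 + 8 * C0 + K + a * C0 / e + a * 4 * C0.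
have q0 : 0 <= a * C0 / e by rewrite !mulr_ge0 ?invr_ge0//; nlra.
have q1 : 0 <= a * 4 * C0 by rewrite !mulr_ge0//; nlra.
exists K, L0; split => //; first by rewrite /L0; nlra.
move=> s l L p hs hL p1 hp hl.
have [g1 g2 g3 g4] : [/\ L1 <= L, 8 * C0 + K + 4 <= L + 4, a * C0 / e <= L & a * 4 * C0 <= L].
  by split; move: hL; rewrite /L0; nlra.
clear hL; have Lp : 1 <= L by nlra.
have L0' : 0 < L by nlra. have p0 : 0 < p by nlra.
move: (hp); rewrite ler_norml => /andP[hp1 hp2].
have aL : a * (L - C0) <= l by apply: le_trans hl; rewrite ler_wpM2l//; nlra.
have lL : 3 / 4 * L <= l.
  apply: le_trans aL; have : 1 * (L - C0) <= a * (L - C0) by rewrite ler_wpM2r//; nlra.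
  by nlra.
have hC : C0 + 4 <= L by nlra.
have u1 : 2^-1 <= l / L by rewrite ler_pdivlMr//; nlra.
have ue : a - e <= l / L.
  rewrite ler_pdivlMr// mulrBl; apply: le_trans aL.
  have : a * C0 / e * e <= L * e by rewrite ler_wpM2r ?(ltW e0)//; nlra.
  by rewrite divfK ?gt_eqF//; nlra.
have E1 := H1 _ _ _ hC lL p1 hp; have E2 := H2 _ _ _ hC lL p1 hp.
set u := l / L in u1 ue E1 E2.
have d0 : 0 <= ln p / p by apply: divr_ge0; [|exact: ltW]; clear -a1 hp1 hp2 g2 K1 C01; lra.
have d1 : ln p / p <= 1 by rewrite ler_pdivrMr// mul1r ltW// ln_sublinear.
set L' := L + ln p / p in E1 E2 *.
have L'0 : 0 < L' by rewrite /L'; nlra.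
have LL' : L <= L' by rewrite /L'; nlra.
pose th : R := ln p / L'.
have t1 : 2^-1 <= th by rewrite ler_pdivlMr// /L'; clear -a1 hp1 hp2 d1 g2 K1 C01; lra.
have t2 : th <= 2 by rewrite ler_pdivrMr// /L'; clear -a1 hp1 hp2 d0 g2 K1 C01; lra.
pose h : R := L `^ (- 2^-1).
have h0 : 0 < h by apply: powR_gt0.
have he : h <= e by apply: small; nlra.
have hh : h * h = L^-1 by apply: powRN2_sqr.
have cr := core h u th h0 he ue t1 t2.
rewrite (_ : lam - 1 - lam + 1 = 0) in E1; last by ring.
rewrite (_ : lam - 3 / 2 - mu + 1 = - 4^-1) in E2; last by field.
rewrite /weight; move: E1 E2.
set A1 := homG lam (lam - 1) l L; set A2 := homG mu (lam - 3 / 2) l L.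
have A1E : A1 = L `^ (lam - 1) * G lam u by [].
have A2E : A2 = L `^ (lam - 1) * h * G mu u.
  by rewrite /A2 /homG powR_split32.
set A1' := homG lam _ l L'; set A1'' := homG lam _ (l + _) L'.
set A2' := homG mu _ l L'; set A2'' := homG mu _ (l + _) L'.
have -> : L `^ (lam - 3 / 2) = L `^ (lam - 1) * h by rewrite powR_split32.
set P := L `^ (lam - 1) in A1E A2E *.
have P0 : 0 < P by apply: powR_gt0.
rewrite mul0r addr0 mul1r.
set E1 := A1' + A1'' / p - A1; set E2 := A2' + A2'' / p - _ => b1 b2.
have um := powR_mu_le u1.
have -> : s * ((1 + s * K / L') * A1' + s * A2' + ((1 + s * K / L') * A1'' + s * A2'') / p - ((1 + s * K / L) * A1 + s * A2))
   = s * E1 + K / L' * E1 - K * (L^-1 - L'^-1) * A1 + E2 - A2 / (4 * p).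
  rewrite /E1 /E2; case: hs => ->; field; rewrite !gt_eqF//.
have LE : L^-1 - L'^-1 = th / (p * L).
  have -> : L^-1 - L'^-1 = (L' - L) / (L * L') by field; rewrite !gt_eqF.
  have -> : L' - L = ln p / p by rewrite /L'; ring.
  by rewrite /th; field; rewrite !gt_eqF.
have K2 : K / L' <= 1 by rewrite ler_pdivrMr// mul1r /L'; clear -a1 g2 C01 d0; lra.
have K20 : 0 <= K / L' by apply: divr_ge0; [exact: le_trans ler01 K1|exact: ltW].
have s1 : s * E1 <= `|E1|.
  by case: hs => ->; rewrite ?mul1r ?mulN1r ?ler_norm// -normrN ler_norm.
have s2 : K / L' * E1 <= `|E1|.
  apply: le_trans (ler_norm _) _; rewrite normrM (ger0_norm K20) -[leRHS]mul1r.
  by rewrite ler_wpM2r.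
have s3 : E2 <= `|E2| by exact: ler_norm.
have pL : 0 < p * L by rewrite mulr_gt0.
have ul0 : 0 <= u `^ lam by exact: powR_ge0.
have h1 : h <= 1 by apply: le_trans he _; clear -a1 e4; lra.
have b2' : `|E2| <= C2 / (p * L) * (P * (2 * u `^ lam)).
  apply: le_trans b2 _; apply: ler_wpM2l; first by rewrite divr_ge0 ?ltW//; nlra.
  rewrite -mulrA; apply: ler_wpM2l; first exact: ltW.
  rewrite -[leRHS]mul1r; apply: ler_pM => //; [exact: ltW|exact: powR_ge0].
have fin : (p * L) / P * (2 * (C1 / (p * L) * (P * u `^ lam)) + C2 / (p * L) * (P * (2 * u `^ lam)) -
    K * (th / (p * L)) * A1 - A2 / (4 * p)) <= 0.
  have -> : (p * L) / P * (2 * (C1 / (p * L) * (P * u `^ lam)) + C2 / (p * L) * (P * (2 * u `^ lam)) -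
     K * (th / (p * L)) * A1 - A2 / (4 * p)) = C * u `^ lam - (K * th * G lam u + L * h * G mu u / 4).
    by rewrite A1E A2E /C; field; rewrite !gt_eqF.
  have -> : L * h * G mu u / 4 = G mu u / (4 * h).
    have -> : L = (h * h)^-1 by rewrite hh invrK.
    by field; rewrite gt_eqF.
  by rewrite subr_le0.
rewrite pmulr_rle0 in fin; last by rewrite divr_gt0.
clear -a1 fin s1 s2 s3 b1 b2' LE; rewrite LE; lra.
Qed.

End Weights.

Section WeightBounds.
Variables (R : realType) (a : R).
Hypothesis a1 : 1 <= a.
Implicit Types (u h l L p s e : R).

#[local] Opaque powR ln.

Notation lam := (lambda a^-1).
Notation mu := (lam - 4^-1).
Notation weight := (weight a).

Lemma homog_split l L : 0 < L -> 0 <= l -> L `^ (lam - 1) * (l / L) `^ lam = l `^ lam / L.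
Proof.
move=> L0 l0; have E : (l / L) `^ lam = l `^ lam * L `^ (- lam).
  rewrite powRM ?invr_ge0 ?(ltW L0)//; congr (_ * _).
  by rewrite -[L^-1]powR_inv1 ?(ltW L0)// -powRrM mulN1r.
have E1 : lam - 1 + - lam = -1 by ring.
by rewrite E mulrCA -powRD_pos// E1 powR_inv1// ltW.
Qed.

Lemma mu_small e : 0 < e -> exists2 L0 : R, 1 <= L0 & forall u L, L0 <= L -> a - 4^-1 <= u ->
  `|L `^ (- 2^-1) * G mu u| <= e * u `^ lam.
Proof.
have ? := a1; move=> e0; have [C C0 H] := G_le mu.
have d0 : 0 < e / (2 * C + 1) by apply: divr_gt0 => //; nlra.
have [L0 L01 HL] := powRN2_small d0; exists L0 => // u L hL ua.
have u1 : 2^-1 <= u by nlra.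
have um := powR_mu_le a u1.
rewrite normrM (ger0_norm (powR_ge0 _ _)).
apply: le_trans (ler_pM (powR_ge0 _ _) (normr_ge0 _) (HL _ hL) (le_trans (H _ u1) (ler_wpM2l C0 um))) _.
rewrite (_ : e / (2 * C + 1) * (C * (2 * u `^ lam)) = e * u `^ lam * ((2 * C) / (2 * C + 1))); last by ring.
have eu : 0 <= e * u `^ lam by rewrite mulr_ge0 ?powR_ge0// ltW.
by apply: ler_piMr => //; rewrite ler_pdivrMr; nlra.
Qed.

(** Up to the common factor L^(lam - 1), the main term is O(1/L) there, as [G lam] vanishes at a,
    while the second has sign s and at least a constant times L^(-1/2). *)
Lemma weight_near_boundary K s C0 : 1 <= K -> 1 <= C0 -> s = 1 \/ s = -1 ->
  exists2 L0 : R, 1 <= L0 & forall l L, L0 <= L -> a * (L - C0) <= l -> l <= a * (L + C0) ->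
  0 <= s * weight s K l L.
Proof.
have ? := a1; move=> K1 C01 hs.
have [c [e [c0 e0 e4 Hc]]] := G_mu_ge a1; have [C C1 HC] := G_lam_lip a1.
have p0 : 0 < 2 * C * a * C0 by rewrite !mulr_gt0//; nlra.
have d0 : 0 < c / (2 * C * a * C0) by rewrite divr_gt0.
have [L1 L11 HL] := powRN2_small d0.
have q0 : 0 <= a * C0 / e by rewrite divr_ge0 ?mulr_ge0//; nlra.
exists (L1 + K + a * C0 / e) => [|l L hL h1 h2]; first nlra.
have L0 : 0 < L by nlra.
have h2L : L `^ (- 2^-1) <= c / (2 * C * a * C0) by apply: HL; nlra.
have eL : a * C0 / L <= e.
  rewrite ler_pdivrMr// [leRHS]mulrC -ler_pdivrMr//; nlra.
have u1 : a - a * C0 / L <= l / L.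
  rewrite ler_pdivlMr// mulrBl divfK ?gt_eqF//; nlra.
have u2 : l / L <= a + a * C0 / L.
  rewrite ler_pdivrMr// mulrDl divfK ?gt_eqF//; nlra.
rewrite weightE//; set u := l / L in u1 u2 *; set h := L `^ (- 2^-1) in h2L *.
have h0 : 0 < h by apply: powR_gt0.
have P0 : 0 < L `^ (lam - 1) by apply: powR_gt0.
have gm : c <= G mu u by apply: Hc; apply/andP; split; nlra.
have gl : `|G lam u| <= C * (a * C0 / L).
  apply: le_trans (HC u _) _; first by apply/andP; split; nlra.
  by rewrite ler_wpM2l//; [nlra|rewrite ler_norml; apply/andP; split; nlra].
have hh : h * h = L^-1 by apply: powRN2_sqr.
have kL : `|1 + s * K / L| <= 2.
  have KL : K / L <= 1 by rewrite ler_pdivrMr//; nlra.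
  have KL0 : 0 <= K / L by rewrite divr_ge0//; nlra.
  by rewrite -mulrA; case: hs => ->; rewrite ?mul1r ?mulN1r ler_norml; nlra.
have key : `|(1 + s * K / L) * G lam u| <= h * c.
  rewrite normrM; apply: le_trans (ler_pM (normr_ge0 _) (normr_ge0 _) kL gl) _.
  rewrite -hh (_ : 2 * (C * (a * C0 * (h * h))) = h * (h * (2 * C * a * C0))); last by ring.
  by rewrite ler_wpM2l ?(ltW h0)// -ler_pdivlMr.
have hg : h * c <= h * G mu u by rewrite ler_wpM2l// ltW.
have [k1 k2] : - (h * c) <= (1 + s * K / L) * G lam u /\ (1 + s * K / L) * G lam u <= h * c.
  by move: key; rewrite ler_norml => /andP[].
rewrite mulrCA; apply: mulr_ge0; first exact: ltW.
move: (_ * G lam u) k1 k2 => X k1 k2; case: hs => ->; nlra.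
Qed.

Lemma weight_lower K s : 1 <= K -> s = 1 \/ s = -1 ->
  exists L0 c : R, [/\ 1 <= L0, 0 < c & forall l L, L0 <= L -> (a + 4^-1) * L <= l ->
  c * (l `^ lam / L) <= weight s K l L].
Proof.
have ? := a1; move=> K1 hs; have [c c0 Hc] := G_lam_ge a1.
have e0 : 0 < c / 4 by nlra.
have [L1 L11 HL] := mu_small e0.
exists (L1 + 2 * K), (c / 4); split; [nlra|nlra|] => l L hL lL.
have L0 : 0 < L by nlra.
have ua : a + 4^-1 <= l / L by rewrite ler_pdivlMr.
have l0 : 0 <= l by apply: le_trans lL; rewrite mulr_ge0//; nlra.
have hm : `|L `^ (- 2^-1) * G mu (l / L)| <= c / 4 * (l / L) `^ lam by apply: HL; nlra.
have hl := Hc _ ua.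
rewrite weightE// -homog_split// mulrCA ler_wpM2l ?powR_ge0//.
have cu0 : 0 <= c * (l / L) `^ lam by rewrite mulr_ge0 ?powR_ge0// ltW.
have kL : 2^-1 <= 1 + s * K / L.
  have KL : K / L <= 2^-1 by rewrite ler_pdivrMr//; nlra.
  have KL0 : 0 <= K / L by rewrite divr_ge0//; nlra.
  by rewrite -mulrA; case: hs => ->; rewrite ?mul1r ?mulN1r; nlra.
have g1 : 2^-1 * (c * (l / L) `^ lam) <= (1 + s * K / L) * G lam (l / L).
  by apply: ler_pM => //; rewrite invr_ge0.
move: hm; rewrite ler_norml => /andP[m1 m2].
by case: hs => E; rewrite E in g1 *; nlra.
Qed.

Lemma weight_upper K s : 1 <= K -> s = 1 \/ s = -1 ->
  exists L0 C : R, [/\ 1 <= L0, 1 <= C & forall l L, L0 <= L -> (a - 4^-1) * L <= l ->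
  weight s K l L <= C * (l `^ lam / L)].
Proof.
have ? := a1; move=> K1 hs; have [C C1 HC] := G_lam_le a.
have [L1 L11 HL] := mu_small ltr01.
exists (L1 + K), (2 * C + 1); split; [nlra|nlra|] => l L hL lL.
have L0 : 0 < L by nlra.
have ua : a - 4^-1 <= l / L by rewrite ler_pdivlMr.
have l0 : 0 <= l by apply: le_trans lL; rewrite mulr_ge0//; nlra.
have hm : `|L `^ (- 2^-1) * G mu (l / L)| <= 1 * (l / L) `^ lam by apply: HL; nlra.
have hl : `|G lam (l / L)| <= C * (l / L) `^ lam by apply: HC; nlra.
rewrite weightE// -homog_split// [leRHS]mulrCA ler_wpM2l ?powR_ge0//.
have kL : `|1 + s * K / L| <= 2.
  have KL : K / L <= 1 by rewrite ler_pdivrMr//; nlra.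
  have KL0 : 0 <= K / L by rewrite divr_ge0//; nlra.
  by rewrite -mulrA; case: hs => ->; rewrite ?mul1r ?mulN1r ler_norml; nlra.
have g1 : (1 + s * K / L) * G lam (l / L) <= 2 * (C * (l / L) `^ lam).
  by apply: le_trans (ler_norm _) _; rewrite normrM; apply: ler_pM.
move: hm; rewrite ler_norml => /andP[m1 m2].
by case: hs => E; rewrite E in g1 *; nlra.
Qed.

(** For s = -1 the second term only helps and the main one vanishes linearly at l = a L. This factor
    is needed because the direct count of [fill_first] vanishes in the same way. *)
Lemma weight_upper_boundary K : 1 <= K ->
  exists L0 C : R, [/\ 1 <= L0, 1 <= C & forall l L, L0 <= L -> a * L <= l ->
  weight (- 1) K l L <= C * (l `^ lam / L) * (l / L - a)].
Proof.
have ? := a1; move=> K1; have [C C1 HC] := G_lam_le a; have [C2 C21 HC2] := G_lam_lip a1.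
exists (1 + K), (C + C2); split; [nlra|nlra|] => l L hL lL.
have L0 : 0 < L by nlra.
have ua : a <= l / L by rewrite ler_pdivlMr.
have l0 : 0 <= l by apply: le_trans lL; rewrite mulr_ge0//; nlra.
rewrite weightE// -homog_split//; set u := l / L in ua *.
rewrite [leRHS](_ : _ = L `^ (lam - 1) * ((C + C2) * u `^ lam * (u - a))); last by ring.
rewrite ler_wpM2l ?powR_ge0//.
have gm : 0 <= L `^ (- 2^-1) * G mu u by rewrite mulr_ge0 ?powR_ge0// ltW// G_mu_gt0.
have gl0 : 0 <= G lam u.
  move: ua; rewrite le_eqVlt => /predU1P[<-|/(G_lam_gt0 a1)/ltW//].
  by rewrite G_lam0.
have kL : 1 + -1 * K / L <= 1.
  have K0 : 0 <= K / L by rewrite divr_ge0//; nlra.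
  by rewrite mulN1r mulNr; nlra.
have g1 : (1 + -1 * K / L) * G lam u <= 1 * G lam u by rewrite ler_wpM2r.
have ul1 : 1 <= u `^ lam.
  by rewrite -(powRr0 u); apply: ler_powR; [nlra|exact/ltW/lam_gt0].
suff : G lam u <= (C + C2) * u `^ lam * (u - a) by nlra.
have [ua1|ua1] := leP u (a + 1).
  apply: le_trans (ler_norm _) _; apply: le_trans (HC2 u _) _; first by apply/andP; split; nlra.
  rewrite ger0_norm; last nlra.
  rewrite ler_wpM2r//; first nlra.
  by rewrite -[leLHS]mulr1; apply: ler_pM; nlra.
apply: le_trans (ler_norm _) _; apply: le_trans (HC u _) _; first nlra.
have p1 : C * u `^ lam <= (C + C2) * u `^ lam by rewrite ler_wpM2r ?powR_ge0//; nlra.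
by apply: le_trans p1 _; apply: ler_peMr; [rewrite mulr_ge0 ?powR_ge0//|]; nlra.
Qed.

Lemma weight_nonneg K C0 : 1 <= K -> 1 <= C0 ->
  exists2 L0 : R, 1 <= L0 & forall l L, L0 <= L -> a * (L - C0) <= l -> 0 <= weight 1 K l L.
Proof.
have ? := a1; move=> K1 C01; have s1 : (1 : R) = 1 \/ (1 : R) = -1 by left.
have [L2 L21 H2] := weight_near_boundary K1 C01 s1.
exists L2 => // l L hL h; have [al|al] := leP l (a * (L + C0)).
  by have := H2 l L hL h al; rewrite mul1r.
have L0 : 0 < L by nlra.
rewrite weightE//.
have ua : a < l / L.
  rewrite ltr_pdivlMr//; apply: le_lt_trans al; rewrite ler_wpM2l//; nlra.
have K0 : 0 <= 1 * K / L by rewrite mul1r divr_ge0//; nlra.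
have K1' : 0 <= 1 + 1 * K / L by nlra.
have g1 := ltW (G_lam_gt0 a1 ua); have g2 := ltW (G_mu_gt0 a1 (ltW ua)).
apply: mulr_ge0 (powR_ge0 _ _) (addr_ge0 (mulr_ge0 K1' g1) (mulr_ge0 ler01 (mulr_ge0 (powR_ge0 _ _) g2))).
Qed.

(** All that the count needs, with K and the thresholds merged; [G] itself no longer appears. *)
Lemma upper_weight (C0 : R) : 1 <= C0 -> exists (w : R -> R -> R) (L0 c C : R),
  [/\ 1 <= L0, 0 < c & 1 <= C] /\
  [/\ forall l L p, L0 <= L -> 1 <= p -> `|ln p - L| <= C0 -> a * ln p <= l ->
        w l (L + ln p / p) + w (l + ln p) (L + ln p / p) / p <= w l L,
      forall l L, L0 <= L -> a * (L - C0) <= l -> 0 <= w l L,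
      forall l L, L0 <= L -> (a + 4^-1) * L <= l -> c * (l `^ lam / L) <= w l L
    & forall l L, L0 <= L -> a * (L - C0) <= l -> w l L <= C * (l `^ lam / L)].
Proof.
have ? := a1; move=> C01; have [K [L1 [K1 L11 H1]]] := weight_step a1 C01.
have s1 : (1 : R) = 1 \/ (1 : R) = -1 by left.
have [L2 L21 H2] := weight_nonneg K1 C01.
have [L3 [c [L31 c0 H3]]] := weight_lower K1 s1.
have [L4 [C [L41 CC H4]]] := weight_upper K1 s1.
have aC : 0 <= 4 * a * C0 by rewrite !mulr_ge0//; nlra.
have {}H1 l L p := H1 1 l L p s1.
move: (weight 1 K) H1 H2 H3 H4 => w H1 H2 H3 H4.
pose M : R := L1 + L2 + L3 + L4 + 4 * a * C0.
have [M1 M2 M3 M4] : [/\ L1 <= M, L2 <= M, L3 <= M & L4 <= M] by rewrite /M; split; nlra.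
have M5 : 4 * a * C0 <= M by rewrite /M; nlra.
have M0 : 1 <= M by nlra.
exists w, M, c, C; split=> //; clearbody M; split.
- move=> l L p hL p1 hp al; have := H1 l L p (le_trans M1 hL) p1 hp al.
  by rewrite mul1r subr_le0.
- by move=> l L hL; apply: H2; exact: le_trans hL.
- by move=> l L hL; apply: H3; exact: le_trans hL.
- move=> l L hL h; apply: H4; first exact: le_trans hL.
  by clear -h hL M5; rewrite mulrBl; move: h; rewrite mulrBr; nlra.
Qed.

Lemma lower_weight (C0 : R) : 1 <= C0 -> exists (w : R -> R -> R) (L0 c C : R),
  [/\ 1 <= L0, 0 < c & 1 <= C] /\
  [/\ forall l L p, L0 <= L -> 1 <= p -> `|ln p - L| <= C0 -> a * ln p <= l ->
        w l L <= w l (L + ln p / p) + w (l + ln p) (L + ln p / p) / p,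
      forall l L, L0 <= L -> a * (L - C0) <= l -> l <= a * (L + C0) -> w l L <= 0,
      forall l L, L0 <= L -> (a + 4^-1) * L <= l -> c * (l `^ lam / L) <= w l L,
      forall l L, L0 <= L -> a * (L - C0) <= l -> w l L <= C * (l `^ lam / L)
    & forall l L, L0 <= L -> a * L <= l -> w l L <= C * (l `^ lam / L) * (l / L - a)].
Proof.
have ? := a1; move=> C01; have [K [L1 [K1 L11 H1]]] := weight_step a1 C01.
have s1 : (-1 : R) = 1 \/ (-1 : R) = -1 by right.
have [L2 L21 H2] := weight_near_boundary K1 C01 s1.
have [L3 [c [L31 c0 H3]]] := weight_lower K1 s1.
have [L4 [C [L41 CC H4]]] := weight_upper K1 s1.
have [L5 [C' [L51 CC' H5]]] := weight_upper_boundary K1.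
have aC : 0 <= 4 * a * C0 by rewrite !mulr_ge0//; nlra.
have {}H1 l L p := H1 (-1) l L p s1.
move: (weight (-1) K) H1 H2 H3 H4 H5 => w H1 H2 H3 H4 H5.
pose M : R := L1 + L2 + L3 + L4 + L5 + 4 * a * C0.
have [M1 M2 M3 M4] : [/\ L1 <= M, L2 <= M, L3 <= M & L4 <= M] by rewrite /M; split; nlra.
have [M5 M6] : 4 * a * C0 <= M /\ L5 <= M by rewrite /M; split; nlra.
have M0 : 1 <= M by nlra.
have pos l L : 1 <= L -> 0 <= l `^ lam / L by move=> h; rewrite divr_ge0 ?powR_ge0//; nlra.
exists w, M, c, (C + C'); split; first by split=> //; nlra.
clearbody M; split.
- move=> l L p hL p1 hp al; have := H1 l L p (le_trans M1 hL) p1 hp al.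
  by rewrite mulN1r oppr_le0 subr_ge0.
- by move=> l L hL h h'; have := H2 l L (le_trans M2 hL) h h'; rewrite mulN1r oppr_ge0.
- by move=> l L hL; apply: H3; exact: le_trans hL.
- move=> l L hL h; apply: le_trans (H4 l L (le_trans M4 hL) _) _.
    by clear -h hL M5; rewrite mulrBl; move: h; rewrite mulrBr; nlra.
  by apply: ler_wpM2r; [apply: pos|]; nlra.
- move=> l L hL h; apply: le_trans (H5 l L (le_trans M6 hL) h) _.
  apply: ler_wpM2r; first by rewrite subr_ge0 ler_pdivlMr//; nlra.
  by apply: ler_wpM2r; [apply: pos|]; nlra.
Qed.

End WeightBounds.

(** * The upper bound *)

Section MertensBounds.
Variable R : realType.
Implicit Types (w x : R) (n m p q z : nat).

Lemma mert_succ z : mert R z.+1 = mert R z + (if prime z then ln z%:R / z%:R else 0).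
Proof. by rewrite /mert big_mkcond big_nat_recr//= -big_mkcond. Qed.

Lemma ln2_gt0 : 0 < ln 2 :> R. Proof. by rewrite ln_gt0// ltr1n. Qed.
Lemma ln2_le1 : ln 2 <= 1 :> R.
Proof. by have := @le_ln1Dx R 1; rewrite (_ : 1 + 1 = 2)//; apply; rewrite ltrN10 || nlra. Qed.

Lemma ln_truncnS x : 1 <= x -> ln x < ln (Num.truncn x).+1%:R <= ln x + ln 2.
Proof.
move=> x1; have x0 : 0 < x by nlra.
have h1 : x < (Num.truncn x).+1%:R by exact: truncnS_gt.
have h2 : (Num.truncn x)%:R <= x by rewrite truncn_le; nlra.
rewrite ltr_ln ?posrE ?ltr0n// h1 -lnM ?posrE// ler_ln ?posrE ?ltr0n ?mulr_gt0//.
by rewrite -natr1; nlra.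
Qed.

Lemma sum_prime_subrange (g : nat -> R) (Q : pred nat) N z1 z2 : (forall q, 0 <= g q) ->
  (forall q, Q q -> [/\ prime q, (z1 <= q)%N & (q < z2)%N]) ->
  \sum_(0 <= q < N | Q q) g q <= \sum_(z1 <= q < z2 | prime q) g q.
Proof.
move=> g0 hQ; rewrite (big_nat_widen 0 _ (N + z2)); last exact: leq_addr.
rewrite (big_nat_widen z1 _ (N + z2)); last exact: leq_addl.
rewrite (big_nat_widenl z1 0)//=.
rewrite big_mkcond/= [leRHS]big_mkcond/=; apply: ler_sum => q _.
case: ifPn => [/andP[/hQ[pr h1 h2] _]|_]; last by case: ifP.
by rewrite pr h1 h2.
Qed.

Lemma mert_range C0 z1 z2 : (forall n, (0 < n)%N -> `|mert R n - ln n%:R| <= C0) ->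
  (0 < z1)%N -> (z1 <= z2)%N ->
  `|\sum_(z1 <= q < z2 | prime q) ln q%:R / q%:R - (ln z2%:R - ln z1%:R)| <= 2 * C0 :> R.
Proof.
move=> H z10 zz; have z20 : (0 < z2)%N by exact: leq_trans zz.
have E : mert R z2 = mert R z1 + \sum_(z1 <= q < z2 | prime q) ln q%:R / q%:R.
  by rewrite /mert (@big_cat_nat _ _ _ z1 _ _ _ _ (leq0n _) zz).
have := H _ z10; have := H _ z20; rewrite E !ler_norml.
move: (mert R z1) (\sum_(_ <= q < _ | _) _) (ln z1%:R) (ln z2%:R) => A B C D; nlra.
Qed.

(** Chebyshev's bound drawn from Mertens' estimate: each prime q of the window contributes at least
    ln w / (2 w) to the sum of ln q / q, which is bounded over the window. *)
Lemma prime_window_le : exists2 C1 : R, 1 <= C1 & forall w N, 2 <= w ->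
  (count (fun q => [&& prime q, w / 2 < q%:R & q%:R <= w]) (iota 0 N))%:R <= C1 * (w / ln w).
Proof.
have [C0 C01 H] := mertens R.
have l3 : 0 <= ln 3 :> R by rewrite ln_ge0// ler1n.
exists (2 * (ln 3 + 2 * C0)) => [|w N w2]; first nlra.
have w0 : 0 < w by nlra.
have lw : 0 < ln w by rewrite ln_gt0//; nlra.
set Q := fun q => _.
pose z1 := (Num.truncn (w / 2)).+1; pose z2 := (Num.truncn w).+1.
have w20 : 0 <= w / 2 by nlra.
have hQ q : Q q -> [/\ prime q, (z1 <= q)%N & (q < z2)%N].
  case/and3P => pr q1 q2; split => //.
    by rewrite /z1 truncn_lt_nat.
  by rewrite ltnS truncn_ge_nat//; nlra.
have g0 q : 0 <= ln q%:R / q%:R :> R by rewrite divr_ge0 ?ln_nat_ge0.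
have step1 : (count Q (iota 0 N))%:R <= \sum_(0 <= q < N | Q q) (2 * w / ln w) * (ln q%:R / q%:R).
  rewrite -sum1_count natr_sum /index_iota subn0; apply: ler_sum => q /and3P[pr q1 q2].
  have q0 : (0 : R) < q%:R by rewrite ltr0n prime_gt0.
  have q22 : (2 : R) <= q%:R by rewrite ler_nat prime_gt1.
  have sq : ln w <= 2 * ln q%:R.
    rewrite mulr_natl -lnXn// ler_ln ?posrE ?exprn_gt0//.
    have [w4|w4] := leP 4 w; first by nra.
    by apply: le_trans (ltW w4) _; nra.
  rewrite mulrACA -invfM ler_pdivlMr ?mulr_gt0// mul1r mulrC [leRHS]mulrAC [leRHS]mulrC.
  by apply: ler_pM => //; exact: ltW.
apply: le_trans step1 _; rewrite -mulr_sumr.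
have zz : (z1 <= z2)%N.
  by rewrite ltnS truncn_ge_nat; [|nlra]; apply: le_trans (_ : w / 2 <= _); [rewrite truncn_le|]; nlra.
have := mert_range H (isT : (0 < z1)%N) zz; rewrite ler_norml => /andP[_ h].
have lz2 : ln z2%:R <= ln (w + 1) :> R.
  rewrite ler_ln ?posrE ?ltr0n//; last nlra.
  have : (Num.truncn w)%:R <= w by rewrite truncn_le; nlra.
  by rewrite /z2 -natr1; nlra.
have lz1 : ln (w / 2) <= ln z1%:R :> R.
  by rewrite ler_ln ?posrE ?ltr0n//; [apply/ltW; exact: truncnS_gt|nlra].
have l3' : ln (w + 1) <= ln 3 + ln (w / 2).
  rewrite -lnM ?posrE//; last nlra.
  by rewrite ler_ln ?posrE//; nlra.
have sB := sum_prime_subrange N g0 hQ.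
rewrite [leRHS](_ : _ = 2 * w / ln w * (ln 3 + 2 * C0)); last by field; rewrite gt_eqF.
by apply: ler_wpM2l; [rewrite divr_ge0//; nlra|nlra].
Qed.

End MertensBounds.

Section LeafBound.
Variables (R : realType) (a : R).
Hypothesis a1 : 1 <= a.

Notation lam := (lambda a^-1).
Local Notation mert := (mert R).
Local Notation lnr n := (ln (n%:R : R)).

(** [tree_sum] with the superinvariant weight at (eta + ln b, mert z), divided by b. A node is alive
    when the prime z would still be admissible. Leaves above the boundary zone have weight at least
    a multiple of the summand, and at z0 only the b <= z0^z0 occur, each of weight O(eta^lam). *)
Lemma leaf_bound : exists (z0 : nat) (K : R), [/\ (0 < z0)%N, 0 < K,
  forall z, (z0 <= z)%N -> 1 <= mert z &
  forall (eta : R) (S : seq nat) (t : nat -> nat), ln 2 <= eta -> uniq S ->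
  (forall m, m \in S -> squarefree m && admissible a eta m) ->
  (forall m p, m \in S -> prime p -> (p %| m)%N -> (p < t m)%N) ->
  (forall m m', m \in S -> m' \in S -> (t m <= t m')%N -> part_lt (t m) m' = m -> m' = m) ->
  (forall m, m \in S -> [/\ (z0 <= t m)%N, a * lnr (t m) <= eta + lnr m &
     (a + 4^-1) * mert (t m) <= eta + lnr m]) ->
  \sum_(m <- S) (eta + lnr m) `^ lam / mert (t m) / m%:R <= K * eta `^ lam].
Proof.
have ? := a1; have [C0 C01 HM] := mertens R.
have C01' : 1 <= C0 + 1 by nlra.
have [w [L0 [c [C [[L01 c0 C1] [Wstep Wge0 Wlow Wup]]]]]] := upper_weight a1 C01'.
pose z0 := (Num.truncn (expR (L0 + C0))).+1.
have lz0 z : (z0 <= z)%N -> [/\ (0 < z)%N, L0 <= mert z & L0 + C0 <= lnr z].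
  move=> hz; have z_gt0 : (0 < z)%N by exact: leq_trans hz.
  have h : L0 + C0 <= lnr z.
    rewrite -[leLHS]expRK ler_ln ?posrE ?expR_gt0 ?ltr0n//.
    by apply: le_trans (ltW (truncnS_gt _)) _; rewrite ler_nat.
  split=> //; have := HM _ z_gt0; rewrite ler_norml => /andP[+ _]; nlra.
pose B := (z0 ^ z0)%N.
have l2 := ln2_gt0 R.
have lB := ln_nat_ge0 R B.
(* As eta >= ln 2, the bound ln b <= ln B gives eta + ln b <= k eta at the roots. *)
pose k : R := 1 + lnr B / ln 2.
have k1 : 1 <= k by rewrite /k lerDl divr_ge0// ltW.
pose X : R := C * k `^ lam.
have X0 : 0 <= X by rewrite mulr_ge0 ?powR_ge0//; nlra.
exists z0, ((1 + X * B%:R) / c); split=> //.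
  by rewrite divr_gt0//; have := mulr_ge0 X0 (ler0n R B); nlra.
  by move=> z /lz0[_ h _]; nlra.
move=> eta S t eta2 uS hS tS anti ht.
have sfS m : m \in S -> squarefree m by move/hS => /andP[].
pose ell b := eta + lnr b.
pose alive z b := a * lnr z <= ell b.
pose V z b := w (ell b) (mert z) / b%:R.
pose f m := c * ((eta + lnr m) `^ lam / mert (t m)) / m%:R.
have aliveL z b : (z0 <= z)%N -> alive z b -> a * (mert z - C0) <= ell b.
  move=> hz; apply: le_trans; rewrite ler_wpM2l//; first nlra.
  have [z_gt0 _ _] := lz0 z hz.
  by have := HM _ z_gt0; rewrite ler_norml => /andP[_]; nlra.
have d1 z : 0 <= (if prime z then lnr z / z%:R else 0) <= 1.
  case: ifP => pr; last by rewrite lexx ler01.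
  have z_gt0 : (0 : R) < z%:R by rewrite ltr0n prime_gt0.
  by rewrite divr_ge0 ?ln_nat_ge0// ler_pdivrMr// mul1r ltW// ln_sublinear.
have fV m : m \in S -> 0 <= f m <= V (t m) m.
  move=> mS; have [h1 h2 h3] := ht m mS; have [t0 hL _] := lz0 _ h1.
  have m0 : (0 : R) < m%:R by rewrite ltr0n squarefree_gt0// sfS.
  have M0 : 0 <= (mert (t m))^-1 by rewrite invr_ge0; nlra.
  apply/andP; split; first by rewrite /f divr_ge0 ?(ltW m0)// mulr_ge0 ?(ltW c0)// mulr_ge0 ?powR_ge0.
  by rewrite /f /V ler_wpM2r ?invr_ge0 ?(ltW m0)//; exact: Wlow.
have aliveS m z : m \in S -> (z <= t m)%N -> alive z (part_lt z m).
  move=> mS zt; have [h1 h2 h3] := ht m mS.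
  have m0 := squarefree_gt0 (sfS m mS).
  rewrite /alive /ell; case: (posnP z) => [->|z_gt0].
    rewrite ln0// mulr0 addr_ge0 ?ln_nat_ge0//; nlra.
  have E := partnC [pred p | (p < z)%N] m0; rewrite -/(part_lt z m) in E.
  set cof := partn m _ in E.
  have [c1|c1] := leqP cof 1.
    have cof1 : cof = 1%N by apply/eqP; rewrite eqn_leq c1 part_gt0.
    move: E; rewrite cof1 muln1 => ->; apply: le_trans h2; rewrite ler_wpM2l//; first nlra.
    exact: ler_ln_nat.
  (* For the least prime p of m not below z, the parts of m below p and below z coincide;
     admissibility at p shows that the node was alive at z. *)
  have pr := pdiv_prime c1; set p := pdiv cof in pr.
  have pc : (p %| cof)%N by exact: pdiv_dvd.
  have pm : (p %| m)%N by rewrite -E dvdn_mull.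
  have zp : (z <= p)%N.
    have := part_pnat (negn [pred p | (p < z)%N]) m; move=> /(pnatP _ (part_gt0 _ _))/(_ p pr pc).
    by rewrite !inE -leqNgt.
  have Ep : part_lt p m = part_lt z m.
    apply: eq_in_partn => q; rewrite mem_primes !inE => /and3P[qr _ qm].
    have [qz|zq] := ltnP q z; first by rewrite (leq_trans qz).
    apply/negP => qp; move: qm; rewrite -E Euclid_dvdM// => /orP[/(part_lt_prime qr)|qc].
      by rewrite ltnNge zq.
    by have := pdiv_min_dvd (prime_gt1 qr) qc; rewrite leqNgt qp.
  have /andP[_ adm] := hS m mS.
  rewrite -Ep; apply: le_trans (elimT (admissibleP _ _ m0) adm p pr pm).
  by rewrite ler_wpM2l ?ler_ln_nat//; nlra.
have V0 z b : (z0 <= z)%N -> (0 < b)%N -> alive z b ->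
    [/\ 0 <= V z b, 0 <= V z.+1 b & 0 <= V z.+1 (b * z)%N].
  move=> hz b0 al; have [z_gt0 hL lz] := lz0 z hz; have [_ hL' _] := lz0 z.+1 (leqW hz).
  have aL := aliveL z b hz al.
  have m1 : mert z.+1 <= mert z + 1 by rewrite mert_succ lerD2l; have /andP[] := d1 z.
  have aL' : a * (mert z.+1 - (C0 + 1)) <= ell b by apply: le_trans aL; rewrite ler_wpM2l//; nlra.
  have aL'' : a * (mert z - (C0 + 1)) <= ell b by apply: le_trans aL; rewrite ler_wpM2l//; nlra.
  have eb : ell b <= ell (b * z)%N by rewrite /ell ln_natM// addrA lerDl ln_nat_ge0.
  split; rewrite /V divr_ge0//; apply: Wge0 => //; exact: le_trans eb.
have Vstep z b : (z0 <= z)%N -> (0 < b)%N -> alive z b ->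
    V z.+1 b + (if prime z then V z.+1 (b * z)%N else 0) <= V z b.
  move=> hz b0 al; have [z_gt0 hL lz] := lz0 z hz.
  rewrite /V mert_succ; case: ifPn => pr; last by rewrite !addr0.
  have z1 : (1 : R) <= z%:R by rewrite ler1n.
  have b0' : (0 : R) < b%:R by rewrite ltr0n.
  have hz' : `|lnr z - mert z| <= C0 + 1.
    by rewrite distrC; apply: le_trans (HM _ z_gt0) _; nlra.
  have := Wstep (ell b) (mert z) z%:R hL z1 hz' al.
  have -> : ell (b * z)%N = ell b + lnr z by rewrite /ell ln_natM// addrA.
  rewrite natrM => h; have {}h := ler_wpM2r (ltW (_ : 0 < b%:R^-1)) h.
  apply: le_trans (h _); last by rewrite invr_gt0.
  by rewrite mulrDl lerD2l invfM mulrA mulrAC.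
have key : \sum_(m <- S) f m <= \sum_(1 <= b < B.+1 | alive z0 b) V z0 b.
  apply: (tree_sum_start uS sfS tS anti fV aliveS V0 Vstep) => m mS.
  by have [h _ _] := ht m mS; split => //; apply: part_lt_le; exact: sfS.
have Vb b : (1 <= b < B.+1)%N -> (if alive z0 b then V z0 b else 0) <= X * eta `^ lam.
  move=> /andP[b0 bB]; case: ifPn => al; last by rewrite mulr_ge0 ?powR_ge0.
  have [z_gt0 hL lz] := lz0 z0 (leqnn _).
  have aL := aliveL z0 b (leqnn _) al.
  have aL'' : a * (mert z0 - (C0 + 1)) <= ell b by apply: le_trans aL; rewrite ler_wpM2l//; nlra.
  have b1 : (1 : R) <= b%:R by rewrite ler1n.
  have eb : 0 <= ell b <= k * eta.
    rewrite addr_ge0 ?ln_nat_ge0//=; last nlra.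
    rewrite /ell /k mulrDl mul1r lerD2l; apply: (@le_trans _ _ (lnr B)); first exact: ler_ln_nat.
    by rewrite mulrAC ler_pdivlMr// ler_wpM2l.
  case/andP: eb => eb0 ebk.
  have pw : ell b `^ lam <= k `^ lam * eta `^ lam.
    rewrite -powRM; [|nlra|nlra]; apply: ge0_ler_powR; rewrite ?nnegrE//.
      exact/ltW/lam_gt0.
    by rewrite mulr_ge0; nlra.
  have W := Wup _ _ hL aL''.
  have M1 : 1 <= mert z0 by nlra.
  have pM : ell b `^ lam / mert z0 <= ell b `^ lam.
    by rewrite ler_pdivrMr; [rewrite ler_peMr ?powR_ge0|nlra].
  apply: (@le_trans _ _ (w (ell b) (mert z0))).
    rewrite /V ler_pdivrMr; last nlra.
    by rewrite ler_peMr//; apply: Wge0.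
  apply: le_trans W _; rewrite /X -mulrA ler_wpM2l//; first nlra.
  exact: le_trans pM pw.
have sumV : \sum_(1 <= b < B.+1 | alive z0 b) V z0 b <= X * eta `^ lam * B%:R.
  rewrite big_mkcond; apply: le_trans (ler_sum_nat Vb) _.
  by rewrite sumr_const_nat subn1/= mulr_natr.
have fE : \sum_(m <- S) f m = c * \sum_(m <- S) (eta + lnr m) `^ lam / mert (t m) / m%:R.
  by rewrite mulr_sumr; apply: eq_bigr => m _; rewrite /f !mulrA.
rewrite mulrAC ler_pdivlMr// mulrC -fE; apply: le_trans key (le_trans sumV _).
by rewrite mulrDl mul1r mulrAC lerDr powR_ge0.
Qed.

(** One stopping time, about e^tau with tau = T / (a + 1/2), serves all m. Admissibility gives (a +
    1) ln p <= eta + ln m for every prime factor p, so ln p <= tau, while eta + ln m >= T keeps m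
    above the boundary zone. With a common stopping time the antichain condition is immediate. *)
Lemma window_bound : exists (T0 K : R), [/\ 1 <= T0, 0 < K & forall (eta T : R) (S : seq nat),
  ln 2 <= eta -> T0 <= T -> uniq S ->
  (forall m, m \in S -> [/\ squarefree m, admissible a eta m, T <= eta + lnr m &
     eta + lnr m <= (a + 1) / (a + 2^-1) * T]) ->
  \sum_(m <- S) m%:R^-1 <= K * (T * (eta / T) `^ lam)].
Proof.
have ? := a1; have [C0 C01 HM] := mertens R.
have [z0 [K [z00 K0 _ H]]] := leaf_bound.
have l2 := ln2_gt0 R; have l21 := ln2_le1 R.
have lz0 := ln_nat_ge0 R z0.
pose tau0 : R := 1 + lnr z0 + 4 * (a + 4^-1) * (C0 + 1) + 2 * a.
have q1 : 0 <= 4 * (a + 4^-1) * (C0 + 1) by rewrite !mulr_ge0//; nlra.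
have ah : 0 < a + 2^-1 by nlra.
exists (tau0 * (a + 2^-1)), K; split=> //.
  by apply: mulr_ege1; rewrite /tau0; nlra.
move=> eta T S eta2 T0 uS hS.
pose tau : R := T / (a + 2^-1).
have htau : tau0 <= tau by rewrite ler_pdivlMr.
have TE : T = tau * (a + 2^-1) by rewrite divfK// gt_eqF.
have tau1 : 1 <= expR tau by rewrite -[leLHS]expR0 ler_expR; move: htau; rewrite /tau0; nlra.
pose t := (Num.truncn (expR tau)).+1.
have /andP[t1 t2] := ln_truncnS tau1; rewrite expRK -/t in t1 t2.
have t0 : (0 < t)%N by [].
have z0t : (z0 <= t)%N.
  rewrite -(ler_nat R) -ler_ln ?posrE ?ltr0n//; move: htau; rewrite /tau0; nlra.
have mt : mert t <= tau + ln 2 + C0.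
  by have := HM _ t0; rewrite ler_norml => /andP[_]; nlra.
have mt0 : 0 < mert t.
  have := HM _ t0; rewrite ler_norml => /andP[+ _].
  have : 4 * 1 * C0 <= 4 * (a + 4^-1) * (C0 + 1) by apply: ler_pM; nlra.
  by move: htau; rewrite /tau0; nlra.
have mtT : mert t <= T.
  have : tau * 1 <= tau * (a - 2^-1 + 2^-1) by rewrite ler_wpM2l//; move: htau; rewrite /tau0; nlra.
  have : 4 * 1 * (C0 + 1) <= 4 * (a + 4^-1) * (C0 + 1) by rewrite !ler_wpM2r//; nlra.
  by rewrite TE; move: htau; rewrite /tau0; nlra.
have c1 : (a + 4^-1) * mert t <= T.
  apply: le_trans (ler_wpM2l _ mt) _; first nlra.
  have : 4 * (a + 4^-1) * (C0 + ln 2) <= 4 * (a + 4^-1) * (C0 + 1) by apply: ler_wpM2l; nlra.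
  by rewrite TE; move: htau; rewrite /tau0; nlra.
have c2 : a * lnr t <= T.
  apply: le_trans (ler_wpM2l _ t2) _; first nlra.
  have : a * ln 2 <= a * 1 by apply: ler_wpM2l; nlra.
  by rewrite TE; move: htau; rewrite /tau0; nlra.
have Tp : 0 < T by rewrite TE mulr_gt0//; move: htau; rewrite /tau0; nlra.
have tS m p : m \in S -> prime p -> (p %| m)%N -> (p < t)%N.
  move=> mS pr pm.
  have [sf adm _ h4] := hS m mS; have m0 := squarefree_gt0 sf.
  have := elimT (admissibleP _ _ m0) adm p pr pm.
  have le : (part_lt p m * p <= m)%N.
    rewrite -[leqRHS](partnC [pred q | (q < p)%N] m0) leq_mul// dvdn_leq ?part_gt0//.
    move: pm; rewrite -{1}(partnC [pred q | (q < p)%N] m0) Euclid_dvdM// => /orP[|//].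
    by move/(part_lt_prime pr); rewrite ltnn.
  have p0 := prime_gt0 pr; have q0 := part_lt_gt0 p m.
  have := ler_ln_nat R (_ : 0 < part_lt p m * p)%N le; rewrite muln_gt0 q0 p0 => /(_ isT).
  rewrite ln_natM// => g1 g2.
  have g3 : (a + 1) * lnr p <= (a + 1) * tau.
    by move: h4; rewrite /tau -mulrA (mulrC _ T) => h4; nlra.
  have g4 : lnr p <= tau by move: g3; rewrite ler_pM2l//; nlra.
  rewrite /t ltnS truncn_ge_nat ?expR_ge0//.
  by rewrite -[leLHS](lnK (natr_pos R p0)) ler_expR.
have h : \sum_(m <- S) (eta + lnr m) `^ lam / mert t / m%:R <= K * eta `^ lam.
  apply: (H eta S (fun=> t) eta2 uS) => [m mS|||m mS].
  - by have [h1 h2 _ _] := hS m mS; rewrite h1 h2.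
  - exact: tS.
  - move=> m m' _ m'S _ <-; rewrite part_lt_id//; first by have [/squarefree_gt0] := hS _ m'S.
    by move=> p; exact: tS.
  - have [_ _ h3 _] := hS m mS; split => //; exact: le_trans h3.
have lb : T `^ lam / T * \sum_(m <- S) m%:R^-1 <= \sum_(m <- S) (eta + lnr m) `^ lam / mert t / m%:R.
  rewrite mulr_sumr !big_seq; apply: ler_sum => m mS; have [_ _ h3 _] := hS m mS.
  rewrite ler_wpM2r ?invr_ge0//; apply: ler_pM; rewrite ?powR_ge0 ?invr_ge0 ?(ltW Tp)//.
    by apply: ge0_ler_powR; rewrite ?nnegrE; [exact/ltW/lam_gt0|nlra|nlra|].
  by rewrite lef_pV2 ?posrE.
have Tl : 0 < T `^ lam by rewrite powR_gt0.
have := le_trans lb h; rewrite mulrAC ler_pdivrMr// mulrC -ler_pdivlMr// => h5.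
apply: le_trans h5 _; rewrite powRM ?invr_ge0; [|nlra|nlra].
rewrite le_eqVlt; apply/orP; left; apply/eqP.
have -> : T^-1 `^ lam = (T `^ lam)^-1.
  by rewrite -powR_inv1 ?(ltW Tp)// -powRrM mulN1r powRN.
by field; rewrite gt_eqF.
Qed.

End LeafBound.

Section PairCount.
Variable R : realType.

Lemma count_pairs_le (P : pred nat) (Q : nat -> pred nat) (g : nat -> nat -> nat) (s : seq nat) : uniq s ->
  (forall n, n \in s -> P n -> exists m q, [/\ m \in s, q \in s, Q m q & n = g m q]) ->
  (count P s)%:R <= \sum_(m <- s) (count (Q m) s)%:R :> R.
Proof.
move=> us H.
have h : (size [seq n <- s | P n] <= size [seq g m q | m <- s, q <- [seq q <- s | Q m q]])%N.
  apply: uniq_leq_size; first exact: filter_uniq.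
  move=> n; rewrite mem_filter => /andP[Pn ns]; have [m [q [ms qs mq ->]]] := H n ns Pn.
  by apply/allpairsPdep; exists m, q; rewrite mem_filter mq.
move: h; rewrite size_filter size_allpairs_dep -(ler_nat R) => /le_trans; apply.
rewrite sumnE big_map natr_sum le_eqVlt; apply/orP; left; apply/eqP.
by apply: eq_bigr => m _; rewrite size_filter.
Qed.

Lemma powR_div (u v l : R) : 0 <= u -> 0 < v -> (u / v) `^ l = u `^ l / v `^ l.
Proof.
move=> u0 v0; have v0' : 0 <= v by exact: ltW.
rewrite powRM// ?invr_ge0//; congr (_ * _).
by rewrite -[v^-1](powR_inv1 v0') -powRrM mulN1r powRN.
Qed.

Lemma part_lt_prime1 z q : prime q -> (z <= q)%N -> part_lt z q = 1%N.
Proof.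
move=> pr zq; have := part_lt_dvd z q; have /primeP[_ h] := pr.
move/h => /predU1P[//|/eqP E].
by have := part_lt_prime (z := z) (n := q) pr; rewrite E => /(_ (dvdnn _)); rewrite ltnNge zq.
Qed.

End PairCount.

Section UpperCount.
Variables (R : realType) (a : R).
Hypothesis a1 : 1 <= a.

Notation lam := (lambda a^-1).
Local Notation mert := (mert R).
Local Notation lnr n := (ln (n%:R : R)).

(** The quotient ell / W lies roughly between a and a + 1/4, and ell + W = X'; so ell lies roughly
    between a X' / (a + 1) and (a + 1/4) X' / (a + 5/4), a ratio smaller than (a + 1) / (a + 1/2).
    Largeness of X' absorbs the constants. *)
Lemma critical_window (C0 ell W X' : R) : 1 <= C0 -> a * (W - 1) <= ell -> ell < (a + 4^-1) * (W + C0) ->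
  ell + W = X' -> 3 * (a + 2) ^+ 2 * (C0 + 1) <= X' ->
  let T := a * X' / (a + 1) - 1 in
  [/\ T <= ell, ell <= (a + 1) / (a + 2^-1) * T & X' <= 2 * (a + 5 / 4) * W].
Proof.
move=> C01 h1 h2 E hX T; have ? := a1.
have a10 : 0 < a + 1 by nlra.
have TE : (a + 1) * T = a * X' - (a + 1) by rewrite /T; field; rewrite gt_eqF.
have q0 : 0 <= a * C0 by rewrite mulr_ge0//; nlra.
have q1 : 0 <= a ^+ 2 * C0 by rewrite mulr_ge0 ?sqr_ge0//; nlra.
have q2 : 0 <= a ^+ 2 by exact: sqr_ge0.
have e1 : (a + 5 / 4) * ell <= (a + 4^-1) * (X' + C0) by rewrite -E; nlra.
have X'0 : 0 <= X' by apply: le_trans hX; rewrite !mulr_ge0 ?exprn_ge0//; nlra.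
split.
- by rewrite -(ler_pM2l a10) TE -E; nlra.
- have -> : (a + 1) / (a + 2^-1) * T = (a + 1) * T / (a + 2^-1) by rewrite mulrAC.
  rewrite TE ler_pdivlMr; last nlra.
  have a54 : 0 < a + 5 / 4 by nlra.
  rewrite -(ler_pM2l a54).
  have e2 : (a + 2^-1) * ((a + 5 / 4) * ell) <= (a + 2^-1) * ((a + 4^-1) * (X' + C0)) by rewrite ler_wpM2l//; nlra.
  have f1 : X' * (3 / 8) <= X' * (a / 2 - 8^-1) by rewrite ler_wpM2l//; nlra.
  have f2 : (a + 2^-1) * (a + 4^-1) * C0 <= (a + 2) ^+ 2 * C0 by nlra.
  have f3 : (a + 5 / 4) * (a + 1) <= (a + 2) ^+ 2 by nlra.
  have f4 : 0 <= (a + 2) ^+ 2 * C0 by nlra.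
  nlra.
- by rewrite (_ : W = X' - ell); nlra.
Qed.

Lemma critical_range (C0 X' : R) : 1 <= C0 -> 3 * (a + 2) ^+ 2 * (C0 + 1) <= X' ->
  X' / 4 <= a * X' / (a + 1) - 1 <= X'.
Proof.
move=> C01 hX; have ? := a1.
have a10 : 0 < a + 1 by nlra.
have TE : (a + 1) * (a * X' / (a + 1) - 1) = a * X' - (a + 1) by field; rewrite gt_eqF.
have q0 : 0 <= a * C0 by rewrite mulr_ge0//; nlra.
have q1 : 0 <= a ^+ 2 * C0 by rewrite mulr_ge0 ?sqr_ge0//; nlra.
have q2 : 0 <= a ^+ 2 by exact: sqr_ge0.
have X'0 : 4 <= X' by nlra.
have aX : 4 * a <= X' * a by rewrite ler_wpM2r//; nlra.
have aX' : X' * 1 <= X' * a by rewrite ler_wpM2l//; nlra.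
by apply/andP; split; rewrite -(ler_pM2l a10) TE; nlra.
Qed.

Lemma quarter_bound (X W lm lq e b l2 : R) : 4 <= X -> W + lm = X -> W - l2 <= lq -> l2 <= 1 ->
  lq <= b -> b <= e + lm -> 0 <= e -> X / 4 <= e + lm.
Proof. by nlra. Qed.

(** Write n = m q with q the largest prime factor and count q by [prime_window_le]; a sum of x / (m
    ln(x/m)) over m remains. Leaves above the boundary zone are summed by [leaf_bound]. For the
    others eta + ln m is nearly proportional to ln(x/m), [critical_window] confines them, and
    [window_bound] applies. *)
Lemma dyadic_count : exists X0 K : R, [/\ 1 <= X0, 0 < K & forall eta x : R,
  ln 2 <= eta -> eta <= ln x -> X0 <= ln x ->
  (count (fun n => [&& squarefree n, admissible a eta n & x / 2 < n%:R]) (iota 1 (Num.truncn x)))%:R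
   <= K * (x * (eta / ln x) `^ lam)].
Proof.
have ? := a1; have [C0 C01 HM] := mertens R.
have [z0 [K1 [z00 K10 Hz0 HL]]] := leaf_bound a1.
have [T0 [K2 [T01 K20 HW]]] := window_bound a1.
have [C1 C11 HP] := prime_window_le R.
have l2 := ln2_gt0 R; have l21 := ln2_le1 R.
have l0 := lam_gt0 a1.
pose B := (z0 ^ z0)%N; have lB := ln_nat_ge0 R B.
pose k : R := 1 + C0 / ln 2.
have k1 : 1 <= k by rewrite /k lerDl divr_ge0//; nlra.
pose Xc : R := 3 * (a + 2) ^+ 2 * (C0 + 1).
have Xc0 : 0 <= Xc by rewrite !mulr_ge0 ?exprn_ge0//; nlra.
pose X0 : R := 4 + 4 * T0 + lnr B + 2 + Xc.
pose K : R := C1 * (k * K1 + 2 * (a + 5 / 4) * K2) * 4 `^ lam.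
have p4 : (0 : R) < 4 `^ lam by apply: powR_gt0.
have kK : 0 < k * K1 by rewrite mulr_gt0//; nlra.
have aK : 0 < 2 * (a + 5 / 4) * K2 by rewrite !mulr_gt0//; nlra.
exists X0, K; split; first by rewrite /X0; nlra.
  by rewrite /K !mulr_gt0//; nlra.
move=> eta x eta2 etaX hX; have a0 : 0 <= a by nlra.
have C00 : 0 <= C0 by nlra.
have k0 : 0 <= k by nlra.
set X := ln x in etaX hX *.
have [x4 xT xB xc] : [/\ 4 <= X, 4 * T0 <= X, lnr B + 2 <= X & Xc <= X] by split; move: hX; rewrite /X0; nlra.
have x0 : 0 < x by rewrite ltNge; apply/negP => h; move: x4; rewrite /X ln0//; nlra.
have xE : x = expR X by rewrite lnK// posrE.
have x5 : 5 <= x by rewrite xE; apply: le_trans (expR_ge1Dx X); nlra.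
set N := Num.truncn x; set s := iota 1 N.
set P := fun n => _.
pose Q m q := [&& prime q, x / 2 < (m * q)%:R, (m * q)%:R <= x, squarefree m, admissible a eta m,
  part_lt q m == m & a * lnr q <= eta + lnr m].
have us : uniq s by exact: iota_uniq.
have sP n : (n \in s) = (0 < n)%N && (n%:R <= x).
  by rewrite mem_iota add1n ltnS truncn_ge_nat// ltW.
have pairs : (count P s)%:R <= \sum_(m <- s) (count (Q m) s)%:R :> R.
  apply: (@count_pairs_le R P Q muln s us) => n; rewrite sP => /andP[n0 nx] /and3P[sf adm nx2].
  have n1 : (1 < n)%N by rewrite -(ltr_nat R); nlra.
  have pr := max_pdiv_prime n1; set q := max_pdiv n in pr.
  have qn : (q %| n)%N by exact: max_pdiv_dvd.
  have q0 := prime_gt0 pr; have q1 := prime_gt1 pr.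
  pose m := (n %/ q)%N; have nE : n = (m * q)%N by rewrite divnK.
  have mn : (m %| n)%N by rewrite nE dvdn_mulr.
  have m0 : (0 < m)%N := dvdn_gt0 n0 mn.
  have qm : ~~ (q %| m)%N.
    apply/negP => h; have /squarefreeP[_ /(_ q pr)/negP] := sf; apply.
    by rewrite nE -mulnn dvdn_pmul2r.
  have lt p : prime p -> (p %| m)%N -> (p < q)%N.
    move=> pp pm; rewrite ltn_neqAle; apply/andP; split.
      by apply/eqP => E; move: qm; rewrite -E pm.
    by apply: max_pdiv_max; rewrite mem_primes pp n0 (dvdn_trans pm mn).
  have pl p : (p <= q)%N -> part_lt p n = part_lt p m.
    by move=> pq; rewrite {1}/part_lt nE partnM// -/(part_lt p q) part_lt_prime1// muln1.
  have le b : (b %| n)%N -> (b \in s).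
    move=> bn; rewrite sP (dvdn_gt0 n0 bn)/=; apply: le_trans nx; rewrite ler_nat; exact: dvdn_leq.
  exists m, q; split => //; rewrite ?le//.
  rewrite /Q pr -nE nx2 nx (squarefree_dvd mn sf)/= part_lt_id// eqxx/=; apply/andP; split.
    apply/(admissibleP _ _ m0) => p pp pm; rewrite -(pl _ (ltnW (lt p pp pm))).
    exact: (elimT (admissibleP _ _ n0) adm p pp (dvdn_trans pm mn)).
  have := elimT (admissibleP _ _ n0) adm q pr qn.
  by rewrite pl// part_lt_id.
pose S := [seq m <- s | has (Q m) s].
have SQ m : m \in S -> exists q, Q m q by rewrite mem_filter => /andP[/hasP[q _ h] _]; exists q.
pose W m := ln (x / m%:R).
have sumS : \sum_(m <- s) (count (Q m) s)%:R <= \sum_(m <- S) C1 * (x / m%:R / W m).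
  rewrite /S big_filter [leRHS]big_mkcond; apply: ler_sum => m _.
  case: ifPn => [/hasP[q _ /and5P[pr h1 h2 sf _]]|]; last by rewrite has_count lt0n negbK => /eqP->.
  have m0 : (0 : R) < m%:R by rewrite ltr0n squarefree_gt0.
  have w2 : 2 <= x / m%:R.
    rewrite ler_pdivlMr//; apply: le_trans h2; rewrite natrM mulrC.
    by apply: ler_wpM2l; [exact: ltW|rewrite ler_nat prime_gt1].
  apply: le_trans (HP _ N.+1 w2).
  rewrite ler_nat; apply: (@leq_trans (count (fun q => [&& prime q, x / m%:R / 2 < q%:R & q%:R <= x / m%:R]) s)).
    apply: sub_count => q' /and5P[pr' h1' h2' _ _]; rewrite pr'/=.
    by rewrite [x / m%:R / 2]mulrAC ltr_pdivrMr// ler_pdivlMr// -natrM mulnC h1' h2'.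
  by rewrite /= leq_addl.
have uS : uniq S by exact: filter_uniq.
(* Beyond the primes of m and beyond x / (2 m), yet at most q. A proper extension of m by primes
   this large would exceed x / 2, whereas every m in [S] is at most x / 2: hence the antichain
   condition. *)
pose t m := maxn z0 (maxn (max_pdiv m).+1 (Num.truncn (x / 2 / m%:R)).+1).
have facts m : m \in S -> [/\ (0 < m)%N, squarefree m && admissible a eta m,
    [/\ (z0 <= t m)%N, a * lnr (t m) <= eta + lnr m & mert (t m) <= W m + C0],
    [/\ ln 2 <= W m, X / 4 <= eta + lnr m & W m + lnr m = X] & a * (W m - 1) <= eta + lnr m].
  move=> /SQ[q /and5P[pr h1 h2 sf /and3P[adm /eqP pq hq]]].
  have m0 := squarefree_gt0 sf; have m0' : (0 : R) < m%:R by rewrite ltr0n.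
  have q0 := prime_gt0 pr; have q0' : (0 : R) < q%:R by rewrite ltr0n.
  have ltq p : prime p -> (p %| m)%N -> (p < q)%N by move=> pp; rewrite -pq; exact: part_lt_prime.
  have mq : ~~ (q %| m)%N by apply/negP => /(ltq q pr); rewrite ltnn.
  have qz : (z0 <= q)%N.
    rewrite leqNgt; apply/negP => qz0.
    have sfn := squarefree_mul_prime sf pr mq.
    have : (m * q <= B)%N.
      rewrite -(part_lt_id (z := z0) (squarefree_gt0 sfn)) ?part_lt_le// => p pp.
      rewrite Euclid_dvdM// => /orP[/(ltq p pp)/ltn_trans|]; first by apply.
      by rewrite dvdn_prime2// => /eqP->.
    rewrite -(ler_nat R) => hB.
    have xB2 : x <= 2 * B%:R by move: h1; move: (m * q)%:R B%:R hB => u v hB; rewrite ltr_pdivrMr//; nlra.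
    have B0 : (0 : R) < B%:R by rewrite ltr0n expn_gt0 z00.
    have : X <= ln (2 * B%:R) by rewrite ler_ln ?posrE// mulr_gt0.
    by rewrite lnM ?posrE// => h; clear -h xB l21; lra.
  have tq : (t m <= q)%N.
    rewrite !geq_max qz/=; apply/andP; split.
      have [m1|m1] := leqP m 1; last by apply: ltq; [exact: max_pdiv_prime|exact: max_pdiv_dvd].
      have -> : m = 1%N by apply/eqP; rewrite eqn_leq m1.
      by rewrite (_ : max_pdiv 1 = 1%N)// prime_gt1.
    rewrite truncn_lt_nat; last by rewrite !divr_ge0// ltW.
    by rewrite ltr_pdivrMr// -natrM mulnC.
  have t0 : (0 < t m)%N by rewrite leq_max z00.
  have qW : lnr q <= W m.
    by rewrite /W ler_ln ?posrE ?divr_gt0// ler_pdivlMr// -natrM mulnC.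
  have tqL : lnr (t m) <= lnr q by exact: ler_ln_nat.
  have WE : W m + lnr m = X by rewrite /W ln_div ?posrE// subrK.
  have Wq : W m - ln 2 <= lnr q.
    rewrite lerBlDr -lnM ?posrE// /W ler_ln ?posrE ?divr_gt0 ?mulr_gt0//.
    rewrite ler_pdivrMr//; have := h1; rewrite natrM => h; clear -h; lra.
  have q2 : ln 2 <= lnr q :> R by apply: ler_ln_nat => //; exact: prime_gt1.
  have lm := ln_nat_ge0 R m; have lq := ln_nat_ge0 R q.
  have al : lnr q <= a * lnr q by rewrite ler_peMl.
  split => //.
  - by rewrite sf.
  - split; first by rewrite leq_max leqnn.
      exact: le_trans (ler_wpM2l a0 tqL) hq.
    by have := HM _ t0; rewrite ler_norml => /andP[_] h; clear -h tqL qW; lra.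
  - split=> //; first exact: le_trans q2 qW.
    apply: (quarter_bound x4 WE Wq l21 al hq); exact: le_trans (ltW l2) eta2.
  - apply: le_trans (ler_wpM2l a0 _) hq; clear -Wq l21; lra.
have anti m m' : m \in S -> m' \in S -> (t m <= t m')%N -> part_lt (t m) m' = m -> m' = m.
  move=> mS m'S _ pm; have [m0 _ _ _ _] := facts m mS.
  have [q /and5P[pr h1 h2 sf _]] := SQ _ m'S; have m'0 := squarefree_gt0 sf.
  have m0' : (0 : R) < m%:R by rewrite ltr0n.
  have E := partnC [pred p | (p < t m)%N] m'0; rewrite -/(part_lt _ m') pm in E.
  set cof := partn m' _ in E.
  have [c1|c1] := leqP cof 1.
    have cof1 : cof = 1%N by apply/eqP; rewrite eqn_leq c1 part_gt0.
    by rewrite -E cof1 muln1.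
  have pp := pdiv_prime c1; set p := pdiv cof in pp.
  have pc : (p %| cof)%N by exact: pdiv_dvd.
  have tp : (t m <= p)%N.
    have := part_pnat (negn [pred p | (p < t m)%N]) m'; move=> /(pnatP _ (part_gt0 _ _))/(_ p pp pc).
    by rewrite !inE -leqNgt.
  have tx : x / 2 / m%:R < (t m)%:R.
    apply: lt_le_trans (truncnS_gt _) _; rewrite ler_nat.
    by rewrite /t !leq_max leqnn !orbT.
  have : x / 2 < m'%:R.
    rewrite -E natrM; rewrite ltr_pdivrMr// [_ * m%:R]mulrC in tx; apply: lt_le_trans tx _.
    by rewrite ler_wpM2l ?ler_nat// (leq_trans tp)// dvdn_leq// ltnW.
  have : m'%:R * 2 <= x.
    by apply: le_trans h2; rewrite natrM ler_wpM2l// ler_nat prime_gt1.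
  by move=> u1 u2; exfalso; clear -u1 u2; lra.
pose c1 m := (a + 4^-1) * mert (t m) <= eta + lnr m.
pose S1 := [seq m <- S | c1 m]; pose S2 := [seq m <- S | ~~ c1 m].
have splitS (g : nat -> R) : \sum_(m <- S) g m = \sum_(m <- S1) g m + \sum_(m <- S2) g m.
  by rewrite (bigID c1)/=; congr (_ + _); rewrite [RHS]big_filter.
have eta0 : 0 < eta by exact: lt_le_trans eta2.
have X00 : 0 < X by exact: lt_le_trans x4.
have X40 : 0 < X / 4 by exact: divr_gt0.
pose Y : R := (X / 4) `^ lam.
have Y0 : 0 < Y by exact: powR_gt0.
have YE : eta `^ lam / Y = 4 `^ lam * (eta / X) `^ lam.
  have -> : Y = X `^ lam / 4 `^ lam.
    by rewrite /Y powR_div// ltW.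
  have -> : (eta / X) `^ lam = eta `^ lam / X `^ lam.
    by rewrite powR_div// ltW.
  have X0' : X `^ lam != 0 by rewrite gt_eqF// powR_gt0.
  by field; rewrite X0' gt_eqF.
have bound1 : \sum_(m <- S1) x / m%:R / W m <= x * k * K1 * (eta `^ lam / Y).
  have hS1 m : m \in S1 -> m \in S by rewrite mem_filter => /andP[].
  have h := HL eta S1 t eta2 (filter_uniq _ uS).
  have {}h : \sum_(m <- S1) (eta + lnr m) `^ lam / mert (t m) / m%:R <= K1 * eta `^ lam.
    apply: h.
    - by move=> m /hS1/facts[].
    - move=> m p /hS1/facts[m0 _ _ _ _] pp pm; rewrite /t !leq_max ltnS; apply/orP; right; apply/orP; left.
      by apply: max_pdiv_max; rewrite mem_primes pp m0.
    - by move=> m m' /hS1 mS /hS1 m'S; exact: anti.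
    - by move=> m mS1; have [_ _ [g1 g2 _] _ _] := facts m (hS1 m mS1); split => //; move: mS1; rewrite mem_filter => /andP[].
  have -> : x * k * K1 * (eta `^ lam / Y) = x * k / Y * (K1 * eta `^ lam) by field; rewrite gt_eqF.
  have xk : 0 <= x * k / Y := divr_ge0 (mulr_ge0 (ltW x0) k0) (ltW Y0).
  apply: le_trans (ler_wpM2l xk h).
  rewrite mulr_sumr !big_seq; apply: ler_sum => m mS1.
  have [m0 _ [_ _ g3] [g4 g5 g6] _] := facts m (hS1 m mS1).
  have m0' : (0 : R) < m%:R by rewrite ltr0n.
  have W0 : 0 < W m by exact: lt_le_trans g4.
  have t0 : (0 < t m)%N by rewrite leq_max z00.
  have M0 : 0 < mert (t m).
    by apply: lt_le_trans ltr01 (Hz0 _ _); rewrite leq_max leqnn.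
  have kW : mert (t m) <= k * W m.
    apply: le_trans g3 _; rewrite /k mulrDl mul1r lerD2l mulrAC ler_pdivlMr//.
    exact: ler_wpM2l.
  have Yle : Y <= (eta + lnr m) `^ lam.
    apply: ge0_ler_powR; rewrite ?nnegrE ?(ltW l0) ?(ltW X40)//.
    exact: le_trans (ltW X40) g5.
  have -> : x * k / Y * ((eta + lnr m) `^ lam / mert (t m) / m%:R) =
     x / m%:R * ((eta + lnr m) `^ lam / Y * (k / mert (t m))) by field; rewrite !gt_eqF.
  apply: ler_wpM2l; first exact: divr_ge0 (ltW x0) (ltW m0').
  rewrite -[leLHS]mul1r; apply: ler_pM => //; rewrite ?invr_ge0 ?(ltW W0)//.
    by rewrite ler_pdivlMr// mul1r.
  by rewrite ler_pdivlMr// mulrC ler_pdivrMr.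
have bound2 : \sum_(m <- S2) x / m%:R / W m <= x * (2 * (a + 5 / 4)) * K2 * (eta `^ lam / Y).
  have hS2 m : m \in S2 -> m \in S /\ eta + lnr m < (a + 4^-1) * mert (t m).
    by rewrite mem_filter /= /c1 -ltNge => /andP[].
  (* The sum of eta + ln m and ln(x/m), the same for every m. *)
  pose X' : R := X + eta; have hX' : 3 * (a + 2) ^+ 2 * (C0 + 1) <= X' by rewrite -/Xc /X' (le_trans xc)// lerDl ltW.
  pose T : R := a * X' / (a + 1) - 1.
  have /andP[T1 T2] := critical_range C01 hX'; rewrite -/T in T1 T2.
  have XX : X <= X' by rewrite lerDl ltW.
  have crit m : m \in S2 -> [/\ T <= eta + lnr m, eta + lnr m <= (a + 1) / (a + 2^-1) * T & X' <= 2 * (a + 5 / 4) * W m].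
    move=> /hS2[mS lt]; have [m0 _ [_ _ g3] [g4 g5 g6] g7] := facts m mS.
    have a4 : 0 <= a + 4^-1 by rewrite addr_ge0// invr_ge0.
    have E : eta + lnr m + W m = X' by rewrite /X' -g6; ring.
    exact: (critical_window C01 g7 (lt_le_trans lt (ler_wpM2l a4 g3)) E hX').
  have T0T : T0 <= T by clear -T1 XX xT; lra.
  have Tp : 0 < T by exact: lt_le_trans (lt_le_trans ltr01 T01) T0T.
  have h := HW eta T S2 eta2 T0T (filter_uniq _ uS).
  have {}h : \sum_(m <- S2) m%:R^-1 <= K2 * (T * (eta / T) `^ lam).
    apply: h => m mS2; have [g1 g2 _] := crit m mS2; have [mS _] := hS2 m mS2.
    by have [_ /andP[sf adm] _ _ _] := facts m mS.
  have X'0 : 0 < X' by exact: lt_le_trans XX.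
  have a54 : 0 <= 2 * (a + 5 / 4) by clear -a0; lra.
  have xX : 0 <= x * (2 * (a + 5 / 4)) / X' by exact: divr_ge0 (mulr_ge0 (ltW x0) a54) (ltW X'0).
  apply: (@le_trans _ _ (x * (2 * (a + 5 / 4)) / X' * \sum_(m <- S2) m%:R^-1)).
    rewrite mulr_sumr !big_seq; apply: ler_sum => m mS2; have [_ _ g3] := crit m mS2.
    have [mS _] := hS2 m mS2; have [m0 _ _ [g4 _ _] _] := facts m mS.
    have m0' : (0 : R) < m%:R by rewrite ltr0n.
    have W0 : 0 < W m by exact: lt_le_trans g4.
    have -> : x * (2 * (a + 5 / 4)) / X' / m%:R = x / m%:R * (2 * (a + 5 / 4) / X') by field; rewrite !gt_eqF.
    apply: ler_wpM2l; first exact: divr_ge0 (ltW x0) (ltW m0').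
    by rewrite ler_pdivlMr// mulrC ler_pdivrMr.
  apply: le_trans (ler_wpM2l xX h) _.
  have pw : (eta / T) `^ lam <= eta `^ lam / Y.
    have -> : eta `^ lam / Y = (eta / (X / 4)) `^ lam.
      by rewrite powR_div// ltW.
    have T3 : X / 4 <= T by clear -T1 XX; lra.
    apply: ge0_ler_powR; rewrite ?nnegrE; [exact: ltW|exact: divr_ge0 (ltW eta0) (ltW Tp)|exact: divr_ge0 (ltW eta0) (ltW X40)|].
    by rewrite ler_wpM2l ?(ltW eta0)// lef_pV2 ?posrE.
  have TX : T / X' <= 1 by rewrite ler_pdivrMr// mul1r.
  have TX0 : 0 <= T / X' by exact: divr_ge0 (ltW Tp) (ltW X'0).
  have -> : x * (2 * (a + 5 / 4)) / X' * (K2 * (T * (eta / T) `^ lam)) =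
     x * (2 * (a + 5 / 4)) * K2 * (T / X' * (eta / T) `^ lam) by field; rewrite !gt_eqF.
  apply: ler_wpM2l; first exact: mulr_ge0 (mulr_ge0 (ltW x0) a54) (ltW K20).
  by rewrite -[leRHS]mul1r; apply: ler_pM => //; exact: powR_ge0.
apply: le_trans pairs (le_trans sumS _); rewrite -mulr_sumr splitS.
apply: le_trans (ler_wpM2l (le_trans ler01 C11) (lerD bound1 bound2)) _.
rewrite YE /K le_eqVlt; apply/orP; left; apply/eqP; ring.
Qed.


End UpperCount.

Section UpperTotal.
Variables (R : realType) (a : R).
Hypothesis a1 : 1 <= a.

Notation lam := (lambda a^-1).

Lemma ln_gt0_gt1 (x : R) : 0 < ln x -> 1 < x.
Proof. by move=> h; rewrite ltNge; apply/negP => /ln_le0; rewrite leNgt h. Qed.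

Lemma count_iota_le (P : pred nat) (x : R) : 0 <= x -> (count P (iota 1 (Num.truncn x)))%:R <= x.
Proof.
move=> x0; apply: le_trans (_ : (Num.truncn x)%:R <= _); last by rewrite truncn_le.
by rewrite ler_nat; apply: leq_trans (count_size _ _) _; rewrite size_iota.
Qed.

Lemma upper_squarefree : exists2 K : R, 0 < K & forall eta x : R, ln 2 <= eta -> 1 < x ->
  (count (fun n => squarefree n && admissible a eta n) (iota 1 (Num.truncn x)))%:R
   <= K * (x * (eta / ln x) `^ lam).
Proof.
have ? := a1; have [X0 [K1 [X01 K10 H]]] := dyadic_count a1.
have l2 := ln2_gt0 R; have l21 := ln2_le1 R.
have l0 := lam_gt0 a1.
(* Replacing ln x by th ln x costs exactly the factor 3/2. Halving x therefore leaves 3/4 of the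
   bound, and the dyadic count fits into the remaining quarter, whence [4 * K1] below. *)
pose th : R := (2 / 3) `^ lam^-1.
have th0 : 0 < th by apply: powR_gt0; nlra.
have th1 : th < 1.
  rewrite /th /powR gt_eqF; last nlra.
  rewrite -[ltRHS]expR0 ltr_expR pmulr_rlt0 ?invr_gt0//.
  by apply: ln_lt0; apply/andP; split; nlra.
have thE : th `^ lam = 2 / 3 by rewrite -powRrM mulVf ?gt_eqF// powRr1//; nlra.
pose X1 : R := X0 + ln 2 / (1 - th) + 1.
have q0 : 0 <= ln 2 / (1 - th) by rewrite divr_ge0//; nlra.
have X10 : 2 <= X1 by rewrite /X1; nlra.
pose K : R := 4 * K1 + (X1 / ln 2) `^ lam + 1.
have p0 : 0 <= (X1 / ln 2) `^ lam by exact: powR_ge0.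
have K0 : 0 < K by rewrite /K; nlra.
exists K => // eta x eta2 x1.
set P := fun n => _.
have [k xk] : exists k : nat, x <= 2 ^+ k.
  exists (Num.truncn x).+1; apply: le_trans (ltW (truncnS_gt x)) _.
  by rewrite -natrX ler_nat ltnW// ltn_expl.
elim: k x x1 xk => [|k IH] x x1 xk; first by move: xk; rewrite expr0; nlra.
have x0 : 0 < x by nlra.
have X00 : 0 < ln x by rewrite ln_gt0.
have eta0 : 0 < eta by nlra.
have triv c : 1 <= c * (eta / ln x) `^ lam -> c <= K -> (count P (iota 1 (Num.truncn x)))%:R <= K * (x * (eta / ln x) `^ lam).
  move=> hc cK; apply: le_trans (count_iota_le P (ltW x0)) _.
  rewrite mulrCA -[leLHS]mulr1 ler_wpM2l ?(ltW x0)//; apply: le_trans hc _.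
  by rewrite ler_wpM2r ?powR_ge0.
have [etaX|Xeta] := leP (ln x) eta.
  apply: (triv 1); last by rewrite /K; nlra.
  rewrite mul1r -[leLHS](powRr0 (eta / ln x)); apply: ler_powR; last exact: ltW.
  by rewrite ler_pdivlMr// mul1r.
have [hX|hX] := leP (ln x) X1.
  apply: (triv ((X1 / ln 2) `^ lam)); last by rewrite /K; nlra.
  rewrite -powRM; [|by rewrite divr_ge0//; nlra|by rewrite divr_ge0//; nlra].
  rewrite -[leLHS](powRr0 (X1 / ln 2 * (eta / ln x))); apply: ler_powR; last exact: ltW.
  have -> : X1 / ln 2 * (eta / ln x) = (X1 / ln x) * (eta / ln 2) by field; rewrite !gt_eqF.
  by apply: mulr_ege1; rewrite ler_pdivlMr// mul1r.
have XX : X0 <= ln x by move: hX; rewrite /X1; nlra.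
have lx2 : ln (x / 2) = ln x - ln 2 by rewrite ln_div ?posrE.
have x2 : 1 < x / 2.
  by apply: ln_gt0_gt1; rewrite lx2; nlra.
have thX : th * ln x <= ln (x / 2).
  have : ln 2 / (1 - th) <= ln x by move: hX; rewrite /X1; nlra.
  by rewrite ler_pdivrMr ?lx2; nlra.
have IHx : (count P (iota 1 (Num.truncn (x / 2))))%:R <= K * (x / 2 * (eta / ln (x / 2)) `^ lam).
  by apply: IH => //; rewrite ler_pdivrMr// -exprSr.
set y := (eta / ln x) `^ lam; have y0 : 0 <= y by exact: powR_ge0.
have step : (eta / ln (x / 2)) `^ lam <= 3 / 2 * y.
  have -> : 3 / 2 * y = (eta / (th * ln x)) `^ lam.
    have -> : eta / (th * ln x) = eta / ln x / th by field; rewrite !gt_eqF.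
    have e0 : 0 <= eta / ln x by rewrite divr_ge0// ltW.
    by rewrite powR_div// thE -/y; field.
  have tx0 : 0 < th * ln x by rewrite mulr_gt0.
  apply: ge0_ler_powR; rewrite ?nnegrE; [exact: ltW|by rewrite divr_ge0//; nlra|by rewrite divr_ge0//; nlra|].
  by rewrite ler_wpM2l ?(ltW eta0)// lef_pV2 ?posrE//; nlra.
have D := H eta x eta2 (ltW Xeta) XX.
have split : (count P (iota 1 (Num.truncn x)) <= count P (iota 1 (Num.truncn (x / 2)%R)) +
    count (fun n => [&& squarefree n, admissible a eta n & (x / 2 < n%:R)%R]) (iota 1 (Num.truncn x)))%N.
  have le2 : (Num.truncn (x / 2) <= Num.truncn x)%N.
    rewrite truncn_ge_nat ?(ltW x0)//; apply: le_trans (_ : x / 2 <= _); last nlra.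
    by rewrite truncn_le; nlra.
  rewrite -(subnKC le2) iotaD !count_cat leq_add2l; apply: (leq_trans _ (leq_addl _ _)).
  rewrite -!size_filter; apply: eq_leq; congr size; apply: eq_in_filter => n.
  rewrite mem_iota => /andP[n1 _].
  have -> : x / 2 < n%:R by rewrite -truncn_lt_nat; [move: n1; rewrite ?addn1 ?add1n|nlra].
  by rewrite andbT.
apply: le_trans (_ : (count P (iota 1 (Num.truncn (x / 2))) + _)%:R <= _); first by rewrite ler_nat; exact: split.
rewrite natrD; apply: le_trans (lerD IHx D) _; rewrite -/y.
have xy0 : 0 <= x * y by rewrite mulr_ge0// ltW.
have h1 : K * (x / 2 * (eta / ln (x / 2)) `^ lam) <= K * (x / 2 * (3 / 2 * y)).
  by rewrite ler_wpM2l ?(ltW K0)// ler_wpM2l//; nlra.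
have h2 : 4 * K1 * (x * y) <= K * (x * y) by rewrite ler_wpM2r// /K; nlra.
nlra.
Qed.

End UpperTotal.

Section UpperDset.
Variable R : realType.

Lemma sum_inv32 n : \sum_(1 <= t < n.+2) (t%:R * Num.sqrt t%:R)^-1 <= 3 - 2 / Num.sqrt n.+1%:R :> R.
Proof.
elim: n => [|n IH]; first by rewrite big_nat1 sqrtr1 !mulr1 !invr1; nlra.
rewrite big_nat_recr//=.
pose u : R := Num.sqrt n.+1%:R; pose v : R := Num.sqrt n.+2%:R.
have u0 : 0 < u by rewrite sqrtr_gt0. have v0 : 0 < v by rewrite sqrtr_gt0.
have vE : v ^+ 2 = n.+2%:R by rewrite sqr_sqrtr.
have uE : v ^+ 2 = u ^+ 2 + 1 by rewrite !sqr_sqrtr// natr1.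
apply: le_trans (lerD IH (_ : _ <= 2 / u - 2 / v)) _; last by rewrite -/u -/v; nlra.
rewrite -/v -vE; clear IH vE; clearbody u v.
have -> : 2 / u - 2 / v = 2 * (v - u) / (u * v) by field; rewrite !gt_eqF.
rewrite ler_pdivlMr ?mulr_gt0// mulrC ler_pdivrMr ?mulr_gt0//.
have h : (v - u) * (v + u) = 1 by nlra.
have uv : u <= v by nra.
have h2 : u * (u + v) <= 2 * v ^+ 2 by nra.
have -> : 2 * (v - u) * (v ^+ 2 * v) = (2 * v ^+ 2) * (v - u) * v by ring.
have -> : u * v = u * ((v - u) * (v + u)) * v by rewrite h mulr1.
rewrite ler_wpM2r ?(ltW v0)//.
have -> : u * ((v - u) * (v + u)) = u * (u + v) * (v - u) by ring.
by rewrite ler_wpM2r// subr_ge0.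
Qed.

Lemma ln_powR_le (l t : R) : 0 < l -> 1 <= t -> (1 + ln t) `^ l <= (1 + 2 * l) `^ l * Num.sqrt t.
Proof.
move=> l0 t1; have lt : 0 <= ln t by exact: ln_ge0.
pose e : R := (2 * l)^-1.
have e0 : 0 < e by rewrite invr_gt0; nlra.
have te1 : 1 <= t `^ e by rewrite -(powRr0 t); apply: ler_powR => //; exact: ltW.
have h : 1 + ln t <= (1 + 2 * l) * t `^ e.
  have : ln (t `^ e) <= t `^ e by apply/ltW/ln_sublinear; nlra.
  rewrite ln_powR /e => h1.
  have : (2 * l) * ((2 * l)^-1 * ln t) <= (2 * l) * t `^ e by rewrite ler_wpM2l//; nlra.
  by rewrite mulrA mulfV ?mul1r; [nlra|rewrite gt_eqF//; nlra].
apply: (@le_trans _ _ (((1 + 2 * l) * t `^ e) `^ l)).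
  by apply: ge0_ler_powR; rewrite ?nnegrE; [exact: ltW|nlra|rewrite mulr_ge0//; nlra|].
rewrite powRM; [|nlra|exact: powR_ge0].
rewrite -powRrM (_ : e * l = 2^-1); last by rewrite /e; field; rewrite gt_eqF.
by rewrite powR12_sqrt//; nlra.
Qed.

(** With n = b t^2 and b squarefree, each t contributes x / t^2 times a power of (i ln y + 2 ln t) /
    ln x. The power of ln t costs at most a constant times sqrt t, so the sum over t converges like
    that of t^(-3/2). *)
Lemma upper_Dset (i : nat) : (0 < i)%N -> exists2 K : R, 0 < K & forall y x : R, 2 <= y -> y <= x ->
  (count (Dset y i) (iota 1 (Num.truncn x)))%:R <= K * (x * (ln y / ln x) `^ lambda (i%:R^-1 : R)).
Proof.
move=> i0; have a1 : (1 : R) <= i%:R by rewrite ler1n.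
have [K1 K10 H] := upper_squarefree a1.
have l0 := lam_gt0 a1; set lam := lambda _ in H l0 *.
have l2 := ln2_gt0 R; have l21 := ln2_le1 R.
pose c : R := 2 * (i%:R + 2 / ln 2).
have ic : 0 < i%:R + 2 / ln 2 :> R by rewrite addr_gt0 ?divr_gt0//; nlra.
have c0 : 0 < c by rewrite /c mulr_gt0.
have cE : c = 2 * (i%:R + 2 / ln 2) by []; clearbody c.
pose K2 : R := (K1 + 1) * (c `^ lam * (1 + 2 * lam) `^ lam).
have K20 : 0 < K2.
  apply: mulr_gt0; first exact: addr_gt0.
  by apply: mulr_gt0; apply: powR_gt0 => //; rewrite addr_gt0// mulr_gt0.
have K2E : K2 = (K1 + 1) * (c `^ lam * (1 + 2 * lam) `^ lam) by []; clearbody K2.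
exists (K2 * 3); first by rewrite mulr_gt0.
move=> y x y2 yx; have y0 : 0 < y by apply: lt_le_trans y2.
have x0 : 0 < x by exact: lt_le_trans yx.
set N := Num.truncn x; set s := iota 1 N.
pose Q (t n : nat) := [&& n%:R <= x / (t ^ 2)%:R, squarefree n & admissible i%:R (i%:R * ln y + 2 * ln t%:R : R) n].
have sP n : (n \in s) = (0 < n)%N && (n%:R <= x).
  by rewrite mem_iota add1n ltnS truncn_ge_nat// ltW.
have pairs : (count (Dset y i) s)%:R <= \sum_(t <- s) (count (Q t) s)%:R :> R.
  apply: (@count_pairs_le R (Dset y i) Q (fun t n => n * t ^ 2)%N s (iota_uniq _ _)) => n.
  rewrite sP => /andP[n0 nx] Dn; have [b [t [sf t0 nE]]] := squarefree_decomp n0.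
  have b0 := squarefree_gt0 sf.
  have le m : (m %| n)%N -> (m \in s).
    move=> mn; rewrite sP (dvdn_gt0 n0 mn)/=; apply: le_trans nx; rewrite ler_nat; exact: dvdn_leq.
  have tn : (t %| n)%N by rewrite nE dvdn_mull// dvdn_exp.
  have bn : (b %| n)%N by rewrite nE dvdn_mulr.
  exists t, b; split; [exact: le|exact: le| |exact: nE].
  have t20 : (0 : R) < (t ^ 2)%:R by rewrite ltr0n expn_gt0 t0.
  rewrite /Q sf ler_pdivlMr// -natrM -nE nx/=.
  by apply: Dset_admissible => //; [nlra|rewrite -nE].
have ly : ln 2 <= ln y by rewrite ler_ln ?posrE//; nlra.
have lx : ln y <= ln x by rewrite ler_ln ?posrE//; nlra.
set z := (ln y / ln x) `^ lam; have z0 : 0 <= z by exact: powR_ge0.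
have term t : (1 <= t < N.+1)%N -> (count (Q t) s)%:R <= K2 * (x * z) * (t%:R * Num.sqrt t%:R)^-1.
  move=> /andP[t1 tN]; have t1' : (1 : R) <= t%:R by rewrite ler1n.
  have t0 : (0 : R) < t%:R by nlra.
  have lt := ln_nat_ge0 R t.
  pose X : R := x / (t ^ 2)%:R.
  have t20 : (0 : R) < (t ^ 2)%:R by rewrite ltr0n expn_gt0 t1.
  have X0 : 0 < X by rewrite divr_gt0.
  have XE : ln X = ln x - 2 * ln t%:R by rewrite /X ln_div ?posrE// natrX lnXn// mulr_natl.
  pose A : R := i%:R * ln y + 2 * ln t%:R.
  have iy : ln y <= i%:R * ln y by rewrite ler_peMl//; nlra.
  have A2 : ln 2 <= A by rewrite /A; nlra.
  have cnt : (count (Q t) s <= count (fun n => squarefree n && admissible i%:R A n) (iota 1 (Num.truncn X)))%N.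
    rewrite -!size_filter; apply: uniq_leq_size; first exact/filter_uniq/iota_uniq.
    move=> n; rewrite !mem_filter => /andP[/and3P[nX sf adm] _]; rewrite sf adm/= mem_iota.
    by rewrite squarefree_gt0// add1n ltnS truncn_ge_nat ?(ltW X0).
  have cmp : (count (Q t) s)%:R <= (K1 + 1) * (X * (2 * A / ln x) `^ lam).
    apply: le_trans (_ : (count (fun n => squarefree n && admissible i%:R A n) (iota 1 (Num.truncn X)))%:R <= _).
      by rewrite ler_nat.
    have p0 : 0 <= (2 * A / ln x) `^ lam by exact: powR_ge0.
    (* As 2 ln t <= A, the first case gives ln x <= 2 A and the trivial bound X suffices; in the
       second ln x <= 2 ln X, whence the factor 2 in [2 * A / ln x]. *)
    have [hA|hA] := leP (ln X) A.
      apply: le_trans (count_iota_le _ (ltW X0)) _.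
      rewrite mulrCA -[leLHS]mulr1 ler_wpM2l ?(ltW X0)//.
      rewrite -[leLHS]mul1r; apply: ler_pM => //; first nlra.
      rewrite -[leLHS](powRr0 (2 * A / ln x)); apply: ler_powR; last exact: ltW.
      by rewrite ler_pdivlMr; rewrite /A in hA *; nlra.
    have X1 : 1 < X by apply: ln_gt0_gt1; nlra.
    apply: le_trans (H A X A2 X1) _.
    apply: ler_pM => //; [exact: ltW|by rewrite mulr_ge0 ?powR_ge0// ltW|nlra|].
    rewrite ler_wpM2l ?(ltW X0)//; apply: ge0_ler_powR; rewrite ?nnegrE.
    - exact: ltW.
    - by rewrite divr_ge0//; nlra.
    - by rewrite divr_ge0//; nlra.
    - by rewrite ler_pdivrMr; [rewrite mulrAC ler_pdivlMr; [rewrite /A in hA *; nra|nlra]|nlra].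
  apply: le_trans cmp _.
  have A3 : 2 * A / ln x <= c * (ln y / ln x) * (1 + ln t%:R).
    have -> : c * (ln y / ln x) * (1 + ln t%:R) = c * ln y * (1 + ln t%:R) / ln x by ring.
    apply: ler_wpM2r; first by rewrite invr_ge0 (le_trans _ lx)// (le_trans (ltW l2)).
    have h1 : 2 * ln t%:R <= ln y * (2 / ln 2) * ln t%:R :> R.
      rewrite ler_wpM2r// mulrCA ler_peMr// ler_pdivlMr//; nlra.
    have h2 : 0 <= i%:R * ln y * ln t%:R :> R by rewrite !mulr_ge0//; nlra.
    have h3 : 0 <= ln y * (2 / ln 2) by rewrite mulr_ge0// ?divr_ge0//; nlra.
    by rewrite /A cE; nlra.
  have A4 : (2 * A / ln x) `^ lam <= c `^ lam * z * ((1 + 2 * lam) `^ lam * Num.sqrt t%:R).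
    have lyx : 0 <= ln y / ln x by rewrite divr_ge0//; nlra.
    apply: (@le_trans _ _ ((c * (ln y / ln x) * (1 + ln t%:R)) `^ lam)).
      have lx0 : 0 <= ln x by exact: le_trans (le_trans (ltW l2) ly) lx.
      have A0 : 0 <= 2 * A by rewrite mulr_ge0// (le_trans (ltW l2)).
      apply: ge0_ler_powR; rewrite ?nnegrE ?(ltW l0)//; first exact: divr_ge0.
        exact: mulr_ge0 (mulr_ge0 (ltW c0) lyx) (addr_ge0 ler01 lt).
    rewrite powRM; [|by rewrite mulr_ge0//; nlra|nlra].
    rewrite powRM; [|nlra|by []].
    by rewrite -/z ler_wpM2l ?mulr_ge0 ?powR_ge0// ln_powR_le.
  have -> : K2 * (x * z) * (t%:R * Num.sqrt t%:R)^-1 =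
     (K1 + 1) * (X * (c `^ lam * z * ((1 + 2 * lam) `^ lam * Num.sqrt t%:R))).
    have sq : Num.sqrt t%:R * Num.sqrt t%:R = t%:R :> R by rewrite -expr2 sqr_sqrtr// ltW.
    have s0 : 0 < Num.sqrt t%:R :> R by rewrite sqrtr_gt0.
    rewrite K2E /X natrX; pose r : R := Num.sqrt t%:R; rewrite -/r in s0 sq *; clearbody r.
    by rewrite -sq; field; rewrite gt_eqF.
  by rewrite ler_wpM2l//; [nlra|rewrite ler_wpM2l// ltW].
apply: le_trans pairs _.
have -> : \sum_(t <- s) (count (Q t) s)%:R = \sum_(1 <= t < N.+1) (count (Q t) s)%:R :> R.
  by rewrite /index_iota subSS subn0.
apply: le_trans (ler_sum_nat term) _; rewrite -mulr_sumr.
have -> : K2 * 3 * (x * z) = K2 * (x * z) * 3 by ring.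
apply: ler_wpM2l; first exact: mulr_ge0 (ltW K20) (mulr_ge0 (ltW x0) z0).
case: (N) => [|n]; first by rewrite big_geq.
by apply: le_trans (sum_inv32 n) _; rewrite lerBlDr lerDl divr_ge0// sqrtr_ge0.
Qed.

End UpperDset.


(** * The lower bound *)

Section Fill.
Variables (R : realType) (i : nat).
Hypothesis i0 : (0 < i)%N.

Local Notation a := (i%:R : R).
Local Notation lnr n := (ln (n%:R : R)).
Local Notation mert := (mert R).

(* [Cnt z b] bounds from below the number of admissible multiples of [b] up to
   [x] whose cofactor is squarefree with prime factors at least [z]; [D z b]
   says that [b] may be so extended. *)
Definition ext_count (Cnt : nat -> nat -> R) (D : nat -> nat -> Prop) (x eta : R) : Prop :=
  [/\ forall z b, 0 <= Cnt z b,
      forall z b, (0 < b)%N -> Cnt z.+1 b + (if prime z then Cnt z.+1 (b * z)%N else 0) <= Cnt z b,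
      forall z b, D z b -> b%:R <= x -> 1 <= Cnt z b,
      forall z z' b, D z b -> (z <= z')%N -> D z' b /\ (0 < b)%N
    & forall z b p, D z b -> prime p -> (z <= p)%N -> a * lnr p <= lnr b - eta -> D p.+1 (b * p)%N].

Variable C0 : R.
Hypothesis C01 : 1 <= C0.
Hypothesis HM : forall n, (0 < n)%N -> `|mert n - lnr n| <= C0.

Let a1 : 1 <= a. Proof. by rewrite ler1n. Qed.
Let l2 := ln2_gt0 R.
Let l21 := ln2_le1 R.

Lemma inv_prime_sum z1 z2 : (0 < z1)%N -> (z1 <= z2)%N -> (1 < z2)%N ->
  (lnr z2 - lnr z1 - 2 * C0) / lnr z2 <= \sum_(z1 <= p < z2 | prime p) p%:R^-1.
Proof.
have [l2x l21x C01x] := And3 l2 l21 C01.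
move=> z10 zz z21; have lz : 0 < lnr z2 by rewrite ln_gt0// ltr1n.
rewrite ler_pdivrMr// mulr_suml.
have := mert_range HM z10 zz; rewrite ler_norml => /andP[h _].
apply: (@le_trans _ _ (\sum_(z1 <= q < z2 | prime q) lnr q / q%:R)); first by clear -i0 HM C01 a1 l2 l21 h; lra.
rewrite big_nat_cond [leRHS]big_nat_cond; apply: ler_sum => p /andP[/andP[p1 p2] pr].
by rewrite mulrC ler_wpM2l ?invr_ge0// ler_ln_nat ?prime_gt0// ltnW.
Qed.

Lemma ln_div_natM (x : R) b p : 0 < x -> (0 < b)%N -> (0 < p)%N ->
  ln (x / (b * p)%N%:R) = ln (x / b%:R) - lnr p.
Proof.
move=> x0 b0 p0; have [bR pR] : (0 : R) < b%:R /\ (0 : R) < p%:R by rewrite !ltr0n.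
rewrite natrM [in LHS](_ : x / _ = x / b%:R / p%:R); last by field; rewrite !gt_eqF.
by rewrite [LHS]ln_div ?posrE ?divr_gt0.
Qed.

Lemma count_mono Cnt D x eta z z' b : ext_count Cnt D x eta -> (0 < b)%N -> (z <= z')%N ->
  Cnt z' b <= Cnt z b.
Proof.
case=> C0' Cs _ _ _ b0; elim: z' => [|z' IH]; first by rewrite leqn0 => /eqP->.
rewrite leq_eqVlt => /predU1P[->//|]; rewrite ltnS => /IH; apply: le_trans.
by apply: le_trans (Cs z' b b0); rewrite lerDl; case: ifP.
Qed.

(** Classification of the extensions by the least prime adjoined. *)
Lemma count_window Cnt D x eta z z2 b : ext_count Cnt D x eta -> (0 < b)%N -> (z <= z2)%N ->
  Cnt z2 b + \sum_(z <= p < z2 | prime p) Cnt p.+1 (b * p)%N <= Cnt z b.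
Proof.
move=> [C0' Cs _ _ _] b0; elim: z2 => [|z2 IH].
  by rewrite leqn0 => /eqP->; rewrite big_geq// addr0.
rewrite leq_eqVlt => /predU1P[->|]; first by rewrite big_geq// addr0.
rewrite ltnS => zz; apply: le_trans (IH zz).
rewrite big_mkcond big_nat_recr//= -big_mkcond/= addrCA addrC lerD2r.
exact: Cs.
Qed.

Lemma count_window_le Cnt D x eta z z2 z3 b : ext_count Cnt D x eta -> (0 < b)%N -> (z <= z2)%N -> (z2 <= z3)%N ->
  \sum_(z <= p < z2 | prime p) Cnt z3 (b * p)%N <= Cnt z b.
Proof.
move=> H b0 zz zz3; apply: le_trans (count_window H b0 zz).
have [C0' _ _ _ _] := H; apply: le_trans (_ : \sum_(z <= p < z2 | prime p) Cnt p.+1 (b * p)%N <= _); last by rewrite lerDr.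
rewrite big_nat_cond [leRHS]big_nat_cond; apply: ler_sum => p /andP[/andP[p1 p2] pr].
by apply: (count_mono H); rewrite ?muln_gt0 ?b0 ?prime_gt0// (leq_trans p2).
Qed.

(** One last prime q near the top of [w / A, w], w = x / b. With ln A = 1 + ln 2 + 2 C0, Mertens'
    estimate makes the sum of ln q / q over this window at least 1, and each b q is itself
    counted. *)
Lemma fill_last : exists2 A : R, 1 <= A & forall Cnt D x eta z b, ext_count Cnt D x eta ->
  D z b -> A <= x / b%:R -> z%:R <= x / b%:R / A -> a * ln (x / b%:R) <= lnr b - eta ->
  x / b%:R / (A * ln (x / b%:R)) <= Cnt z b.
Proof.
have [l2x l21x C01x] := And3 l2 l21 C01.
pose A : R := expR (1 + ln 2 + 2 * C0).
have A1 : 1 < A by rewrite -[ltLHS]expR0 ltr_expR; nlra.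
have A0 : 0 < A by nlra.
have lA : ln A = 1 + ln 2 + 2 * C0 by rewrite expRK.
exists A => [|Cnt D x eta z b H Dzb Aw zw aw]; first exact: ltW.
have [_ b0] : D z b /\ (0 < b)%N by have [_ _ _ Dm _] := H; exact: Dm Dzb (leqnn z).
have b0' : (0 : R) < b%:R by rewrite ltr0n.
set w := x / b%:R in Aw zw aw *.
have w0 : 0 < w by exact: lt_le_trans Aw.
have w1 : 1 < w by exact: lt_le_trans Aw.
have lw : 0 < ln w by exact: ln_gt0.
have wA1 : 1 <= w / A by rewrite ler_pdivlMr// mul1r.
have wA0 : 0 < w / A by exact: lt_le_trans wA1.
pose z1 := (Num.truncn (w / A)).+1; pose z2 := (Num.truncn w).+1.
have zz1 : (z <= z1)%N by rewrite ltnW// ltnS truncn_ge_nat// ltW.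
have wAw : w / A <= w by rewrite ler_pdivrMr// ler_peMr// ltW.
have z12 : (z1 <= z2)%N.
  rewrite ltnS truncn_ge_nat ?(ltW w0)//; apply: le_trans wAw.
  by rewrite truncn_le ltW.
apply: le_trans (count_mono H b0 zz1); apply: le_trans (count_window_le H b0 z12 (leqnn z2)).
have [C0' _ Ce Dm Dmul] := H; have [Dz1 _] := Dm _ _ _ Dzb zz1.
have := mert_range HM (isT : (0 < z1)%N) z12; rewrite ler_norml => /andP[h _].
have /andP[_ hz1] := ln_truncnS wA1; rewrite -/z1 in hz1.
have /andP[hz2 _] := ln_truncnS (ltW w1); rewrite -/z2 in hz2.
have lwA : ln (w / A) = ln w - ln A by rewrite ln_div ?posrE.
have s1 : 1 <= \sum_(z1 <= q < z2 | prime q) lnr q / q%:R.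
  by clear -i0 HM C01 a1 l2 l21 h hz1 hz2 lwA lA; lra.
have -> : w / (A * ln w) = w / (A * ln w) * 1 by rewrite mulr1.
have k0 : 0 <= w / (A * ln w) by apply: divr_ge0; [exact: ltW|exact: mulr_ge0 (ltW A0) (ltW lw)].
apply: le_trans (ler_wpM2l k0 s1) _; rewrite mulr_sumr.
rewrite big_nat_cond [leRHS]big_nat_cond; apply: ler_sum => q /andP[/andP[q1 q2] pr].
have q0 : (0 : R) < q%:R by rewrite ltr0n prime_gt0.
have qw : q%:R <= w by rewrite -truncn_ge_nat ?(ltW w0)// -ltnS.
have lq : lnr q <= ln w by rewrite ler_ln ?posrE.
have wq : w / A <= q%:R.
  by apply: le_trans (ltW (truncnS_gt _)) _; rewrite ler_nat.
have Dq : D q.+1 (b * q)%N.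
  apply: Dmul Dz1 pr q1 _; apply: le_trans aw; rewrite ler_wpM2l//; exact: ltW (lt_le_trans ltr01 a1).
have bqx : (b * q)%N%:R <= x by rewrite natrM mulrC -ler_pdivlMr.
have [Dz2 _] := Dm _ z2 _ Dq q2.
apply: le_trans (Ce _ _ Dz2 bqx).
have -> : w / (A * ln w) * (lnr q / q%:R) = (w / A / q%:R) * (lnr q / ln w) by field; rewrite !gt_eqF.
rewrite -[leRHS]mulr1; apply: ler_pM.
- by apply: divr_ge0; exact: ltW.
- by apply: divr_ge0; [exact: ln_nat_ge0|exact: ltW].
- by rewrite ler_pdivrMr// mul1r.
- by rewrite ler_pdivrMr// mul1r.
Qed.

(** A node may have ln b - eta hardly above a ln z, too little for the last prime. Primes from N
    successive levels just above La enlarge b first: N e = eps keeps their logarithms below (1 +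
    eps) La, and a eps = 1/8 fits into the margins of the constraints. *)
Let N := (2 * i)%N.
Let e : R := (16 * a ^+ 2)^-1.
Let eps : R := (8 * a)^-1.
Let s : R := e / 4.

Lemma fill_consts : [/\ 0 < e, e <= 1, N%:R * e = eps, 0 < eps & eps <= 8^-1 /\ a * eps = 8^-1].
Proof.
have a0 : 0 < a by exact: lt_le_trans a1.
have NE : N%:R = 2 * a by rewrite natrM.
split.
- by rewrite invr_gt0 mulr_gt0// exprn_gt0.
- rewrite invf_le1 ?mulr_gt0 ?exprn_gt0//; apply: (@le_trans _ _ (16 * 1)); first nlra.
  by rewrite ler_wpM2l// exprn_ege1.
- by rewrite NE /e /eps; field; rewrite gt_eqF.
- by rewrite invr_gt0 mulr_gt0.
split; last by rewrite /eps; field; rewrite gt_eqF.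
by rewrite lef_pV2 ?posrE ?mulr_gt0// ler_peMr.
Qed.

Definition level (La : R) (j : nat) : nat := (Num.truncn (expR ((1 + j%:R * e) * La))).+1.

Lemma levelP La j : 0 <= La -> [/\ (1 + j%:R * e) * La <= lnr (level La j),
   lnr (level La j) <= (1 + j%:R * e) * La + ln 2 &
   forall p, (0 < p)%N -> (p < level La j)%N -> lnr p <= (1 + j%:R * e) * La].
Proof.
move=> La0; have [e0 _ _ _ _] := fill_consts.
have h : 0 <= (1 + j%:R * e) * La.
  by apply: mulr_ge0 => //; apply: addr_ge0 => //; apply: mulr_ge0 => //; exact: ltW.
have h1 : 1 <= expR ((1 + j%:R * e) * La) by rewrite -[leLHS]expR0 ler_expR.
have /andP[g1 g2] := ln_truncnS h1; rewrite expRK in g1 g2.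
split; [exact: ltW|exact: g2|] => p p0; rewrite ltnS truncn_ge_nat ?expR_ge0// => hp.
by rewrite -[leRHS]expRK ler_ln ?posrE ?expR_gt0// ltr0n.
Qed.

Lemma level_le La j j' : 0 <= La -> (j <= j')%N -> (level La j <= level La j')%N.
Proof.
move=> La0 jj; have [e0 _ _ _ _] := fill_consts.
rewrite ltnS truncn_ge_nat ?expR_ge0//; apply: le_trans (_ : expR ((1 + j%:R * e) * La) <= _).
  by rewrite truncn_le expR_ge0.
by rewrite ler_expR; apply: ler_wpM2r => //; rewrite lerD2l; apply: ler_wpM2r; [exact: ltW|rewrite ler_nat].
Qed.

(** A level has width e La in ln p, of which the errors take at most half; dividing by ln p <= 2 La
    leaves e / 4. *)
Lemma level_window La j : 8 <= La -> 2 * (1 + 2 * C0) / e <= La -> lnr (level La j.+1) <= 2 * La ->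
  s <= \sum_(level La j <= p < level La j.+1 | prime p) p%:R^-1.
Proof.
have [l2x l21x C01x] := And3 l2 l21 C01.
have [e0 _ _ _ _] := fill_consts; have s0 : 0 < s by rewrite divr_gt0.
move=> La8 Lae l5; have La0 : 0 < La by exact: lt_le_trans La8.
have [l1 l2' _] := levelP j (ltW La0); have [l3 _ _] := levelP j.+1 (ltW La0).
have je : 0 <= j%:R * e by apply: mulr_ge0 => //; exact: ltW.
have lev : (level La j <= level La j.+1)%N by exact: level_le (ltW La0) (leqnSn j).
have z21 : (1 < level La j.+1)%N.
  rewrite -(ltr_nat R) -ltr_ln ?posrE// ln1; apply: lt_le_trans l3; rewrite mulr_gt0//.
  by apply: ltr_pwDl => //; apply: mulr_ge0 => //; exact: ltW.
apply: le_trans (inv_prime_sum (isT : (0 < level La j)%N) lev z21).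
have lz : 0 < lnr (level La j.+1) by rewrite ln_gt0// ltr1n.
rewrite ler_pdivlMr//; apply: (@le_trans _ _ (s * (2 * La))); first by rewrite ler_wpM2l// ltW.
have eLa : 2 * (1 + 2 * C0) <= La * e by rewrite -ler_pdivrMr.
rewrite /s; move: l3 l2'; rewrite -[j.+1%:R]natr1; clear -i0 HM C01 a1 l2 l21 N eps s eLa l21x; move=> l3 l2'; nlra.
Qed.

Lemma level_bound La j : 8 <= La -> (j <= N)%N ->
  lnr (level La j) <= 2 * La /\ (1 + j%:R * e) * La <= (1 + eps) * La.
Proof.
have [l2x l21x C01x] := And3 l2 l21 C01.
move=> La8 jN; have [e0 e1 NE ep0 [ep8 _]] := fill_consts.
have La0 : 0 <= La by nlra.
have je : j%:R * e <= eps by rewrite -NE; apply: ler_wpM2r; [exact: ltW|rewrite ler_nat].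
have h : (1 + j%:R * e) * La <= (1 + eps) * La by apply: ler_wpM2r => //; rewrite lerD2l.
split => //; have [_ h2 _] := levelP j La0; apply: le_trans h2 _.
have : (1 + eps) * La <= (1 + 8^-1) * La by apply: ler_wpM2r => //; rewrite lerD2l.
by clear -i0 HM C01 a1 l2 l21 N eps s h La8 l21x; lra.
Qed.

(** Induction on the number k of primes still to insert, one from each of the last k levels, so that
    they increase. Each has logarithm at least La, so in the end ln b - eta >= 3 a La, while ln(x/b)
    has come down into [6/5 La, 3 La]: the situation of [fill_last]. *)
Lemma fill_mid : exists La1 c0 : R, [/\ 8 <= La1, 0 < c0 & forall Cnt D x eta La k b, ext_count Cnt D x eta ->
  La1 <= La -> (k < N)%N -> D (level La (N - k)) b -> (3 * a - k%:R) * La <= lnr b - eta -> 0 < x ->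
  (k%:R * (1 + eps) + 6 / 5) * La <= ln (x / b%:R) -> ln (x / b%:R) <= (k%:R + 3) * La ->
  c0 * s ^+ k * (x / b%:R / La) <= Cnt (level La (N - k)) b].
Proof.
have [l2x l21x C01x] := And3 l2 l21 C01.
have [A A1 HA] := fill_last.
have [e0 e1 NE ep0 [ep8 aep]] := fill_consts.
have lA0 : 0 <= ln A by exact: ln_ge0.
have C00 : 0 <= C0 by exact: le_trans C01.
have A0 : 0 < A by exact: lt_le_trans A1.
pose La1 : R := 8 + 20 * (ln A + 1) + 2 * (1 + 2 * C0) / e.
have q0 : 0 <= 2 * (1 + 2 * C0) / e by apply: divr_ge0; [nlra|exact: ltW].
have s0 : 0 < s by rewrite divr_gt0.
exists La1, (3 * A)^-1; split; [by rewrite /La1; nlra|by rewrite invr_gt0 mulr_gt0|].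
move=> Cnt D x eta La k b H hLa kN; have [C0' _ Ce Dm Dmul] := H.
have [La8 LaA Lae] : [/\ 8 <= La, 20 * (ln A + 1) <= La & 2 * (1 + 2 * C0) / e <= La].
  by clear -i0 HM C01 a1 l2 l21 N eps s hLa q0 lA0; rewrite /La1 in hLa; split; nlra.
have La0 : 0 < La by exact: lt_le_trans La8.
elim: k b kN => [|k IH] b kN Db ell x0 r1 r2; have [_ b0] := Dm _ _ _ Db (leqnn _);
  have b0' : (0 : R) < b%:R by rewrite ltr0n.
  rewrite expr0 mulr1 subn0 in Db *.
  rewrite subr0 in ell; rewrite mul0r !add0r in r1 r2.
  set w := x / b%:R in r1 r2 *; have w0 : 0 < w by rewrite divr_gt0.
  have lw : 0 < ln w by apply: lt_le_trans r1; rewrite mulr_gt0.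
  have [_ hl _] := levelP N (ltW La0); have [_ hb] := level_bound La8 (leqnn N).
  have wA : A <= w by rewrite -ler_ln ?posrE//; clear -i0 HM C01 a1 l2 l21 N eps s r1 LaA La8 lA0; lra.
  have zw : (level La N)%:R <= w / A.
    rewrite -ler_ln ?posrE ?divr_gt0// ln_div ?posrE//.
    have ep : eps * La <= 8^-1 * La by apply: ler_wpM2r => //; exact: ltW.
    by clear -i0 HM C01 a1 l2 l21 N eps s hl hb r1 LaA l21x ep lA0; lra.
  have aw : a * ln w <= lnr b - eta.
    apply: le_trans ell; have := ler_wpM2l (le_trans ler01 a1) r2.
    by rewrite mulrCA mulrA (mulrC a).
  apply: le_trans (HA _ _ _ _ _ _ H Db wA zw aw); rewrite -/w.
  have -> : (3 * A)^-1 * (w / La) = w / A * (3 * La)^-1 by field; rewrite !gt_eqF.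
  have -> : w / (A * ln w) = w / A * (ln w)^-1 by field; rewrite !gt_eqF.
  apply: ler_wpM2l; first by apply: divr_ge0; exact: ltW.
  by rewrite lef_pV2 ?posrE ?mulr_gt0.
pose j := (N - k.+1)%N; have jE : (N - k)%N = j.+1 by rewrite /j subnSK// ltnW.
have kN' : (k < N)%N by exact: ltnW.
rewrite -/j in Db *.
have jN : (j.+1 <= N)%N by rewrite -jE leq_subr.
have lev : (level La j <= level La j.+1)%N by exact: level_le (ltW La0) (leqnSn j).
apply: le_trans (count_window_le H b0 lev (leqnn _)).
have [l1 l2' _] := levelP j (ltW La0); have [l3 _ l4] := levelP j.+1 (ltW La0).
have [l5 l6] := level_bound La8 jN.
have je : 0 <= j%:R * e by apply: mulr_ge0 => //; exact: ltW.
have sum_ge := level_window La8 Lae l5.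
have ck : 0 <= (3 * A)^-1 * s ^+ k * (x / b%:R / La).
  apply: mulr_ge0; first by apply: mulr_ge0; [rewrite invr_ge0 mulr_ge0// ltW|exact/exprn_ge0/ltW].
  by apply: divr_ge0; [apply: divr_ge0|]; exact: ltW.
have -> : (3 * A)^-1 * s ^+ k.+1 * (x / b%:R / La) = (3 * A)^-1 * s ^+ k * (x / b%:R / La) * s.
  by rewrite exprSr; ring.
apply: le_trans (ler_wpM2l ck sum_ge) _; rewrite mulr_sumr.
rewrite big_nat_cond [leRHS]big_nat_cond; apply: ler_sum => p /andP[/andP[p1 p2] pr].
have p0 := prime_gt0 pr; have p0' : (0 : R) < p%:R by rewrite ltr0n.
have lp1 : La <= lnr p.
  apply: le_trans (_ : lnr (level La j) <= _); last exact: ler_ln_nat.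
  by apply: le_trans l1; rewrite ler_peMl ?(ltW La0)// lerDl.
have lp2 : lnr p <= (1 + eps) * La by apply: le_trans l6; exact: l4.
have kR : k.+2%:R <= 2 * a by rewrite -natrM ler_nat.
have allowed : a * lnr p <= lnr b - eta.
  apply: le_trans ell; apply: le_trans (ler_wpM2l (le_trans ler01 a1) lp2) _.
  rewrite mulrA; apply: ler_wpM2r; first exact: ltW.
  by rewrite mulrDr aep; move: kR; rewrite -[k.+2%:R]natr1; clear -i0 HM C01 a1 l2 l21 N eps s; lra.
have Dp : D (level La j.+1) (b * p)%N.
  by have [] := Dm _ (level La j.+1) _ (Dmul _ _ _ Db pr p1 allowed) p2.
have bp : (b * p)%N%:R = b%:R * p%:R :> R by rewrite natrM.
have lbp : lnr (b * p)%N = lnr b + lnr p by exact: ln_natM.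
have rE : ln (x / (b * p)%N%:R) = ln (x / b%:R) - lnr p.
  exact: ln_div_natM.
have kS : (k.+1%:R : R) = k%:R + 1 by rewrite natr1.
have := IH (b * p)%N kN'; rewrite jE => /(_ Dp).
have e1' : (3 * a - k%:R) * La <= lnr (b * p)%N - eta.
  by rewrite lbp; move: ell; rewrite kS; clear -i0 HM C01 a1 l2 l21 N eps s lp1; lra.
have e2 : (k%:R * (1 + eps) + 6 / 5) * La <= ln (x / (b * p)%N%:R).
  by rewrite rE; move: r1; rewrite kS; clear -i0 HM C01 a1 l2 l21 N eps s lp2; lra.
have e3 : ln (x / (b * p)%N%:R) <= (k%:R + 3) * La.
  by rewrite rE; move: r2; rewrite kS; clear -i0 HM C01 a1 l2 l21 N eps s lp1; lra.
move=> /(_ e1' x0 e2 e3); apply: le_trans.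
rewrite bp le_eqVlt; apply/orP; left; apply/eqP; field.
by rewrite !gt_eqF.
Qed.

(** Close to the boundary the first prime must satisfy a ln p <= ln b - eta, which leaves a window
    in ln p above ln z of width proportional to the gap; its sum of 1 / p produces the minimum in
    the conclusion. [fill_mid] inserts the remaining primes. *)
Lemma fill_first : exists La1 c : R, [/\ 8 <= La1, 0 < c & forall Cnt D x eta z b, ext_count Cnt D x eta ->
  La1 <= lnr z -> D z b -> 4 * a * C0 <= lnr b - eta - a * lnr z -> 0 < x ->
  (2 * a + 3 / 2) * lnr z <= ln (x / b%:R) -> ln (x / b%:R) <= (2 * a + 3) * lnr z ->
  c * (x / b%:R / lnr z) * Num.min 1 ((lnr b - eta - a * lnr z) / lnr z) <= Cnt z b].
Proof.
have [l2x l21x C01x] := And3 l2 l21 C01.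
have [La1 [c0 [La18 c00 HF]]] := fill_mid.
have [e0 e1 NE ep0 [ep8 aep]] := fill_consts.
have C00 : 0 <= C0 by exact: le_trans C01.
have a0 : 0 < a by exact: lt_le_trans a1.
pose La2 : R := La1 + 4 * C0 / e.
have q0 : 0 <= 4 * C0 / e by apply: divr_ge0; [nlra|exact: ltW].
have s0 : 0 < s by rewrite divr_gt0.
have cs0 : 0 < c0 * s ^+ N.-1 by rewrite mulr_gt0// exprn_gt0.
exists La2, (c0 * s ^+ N.-1 * (e / (4 * a))); split.
- by rewrite /La2; clear -i0 HM C01 a1 l2 l21 N eps s La18 q0; lra.
- by rewrite mulr_gt0// divr_gt0// mulr_gt0.
move=> Cnt D x eta z b H; set La := lnr z => hLa Db gap x0 r1 r2.
have [C0' _ Ce Dm Dmul] := H; have [_ b0] := Dm _ _ _ Db (leqnn _).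
have b0' : (0 : R) < b%:R by rewrite ltr0n.
have [hLa1 hLae] : La1 <= La /\ 4 * C0 / e <= La by clear -i0 HM C01 a1 l2 l21 N eps s hLa q0 La18 C01x; rewrite /La2 in hLa; split; nlra.
have La8 : 8 <= La by exact: le_trans hLa1.
have La0 : 0 < La by exact: lt_le_trans La8.
have z_gt0 : (0 < z)%N.
  by rewrite lt0n; apply/eqP => z0; move: La0; rewrite /La z0 ln0// ltxx.
set ell := lnr b - eta in gap *; set d := ell - a * La in gap *.
have d0 : 0 < d.
  by apply: lt_le_trans gap; rewrite !mulr_gt0//; exact: lt_le_trans C01.
have ellE : ell / a = La + d / a by rewrite /d; field; rewrite gt_eqF.
have da0 : 0 < d / a by rewrite divr_gt0.
have el1 : 1 <= expR (ell / a).
  by rewrite -[leLHS]expR0 ler_expR ellE addr_ge0// ltW.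
pose zc := (Num.truncn (expR (ell / a))).+1.
have /andP[zc1 zc2] := ln_truncnS el1; rewrite expRK -/zc in zc1 zc2.
pose z1 := minn (level La 1) zc.
have [l3 _ l4] := levelP 1 (ltW La0).
have N1 : (1 <= N)%N by rewrite /N muln_gt0.
have [l5 l6] := level_bound La8 N1.
rewrite mul1r in l3 l4 l6.
have zl1 : lnr z1 <= lnr (level La 1) by apply: ler_ln_nat; rewrite ?leq_min ?geq_minl.
have lz1 : La + Num.min (e * La) (d / a) <= lnr z1.
  rewrite /z1; case: (leqP (level La 1) zc) => _.
    apply: le_trans l3; by rewrite [leRHS]mulrDl mul1r lerD2l ge_min lexx.
  by apply: le_trans (ltW zc1); rewrite ellE lerD2l ge_min lexx orbT.
have mn : 4 * C0 <= Num.min (e * La) (d / a).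
  rewrite le_min; apply/andP; split; first by rewrite [leRHS]mulrC -ler_pdivrMr.
  by rewrite ler_pdivlMr// mulrAC.
set mm := Num.min (e * La) (d / a) in lz1 mn.
have zz1 : (z <= z1)%N.
  rewrite leqNgt; apply/negP => lt.
  have := ler_ln_nat R (_ : 0 < z1)%N (ltnW lt); rewrite leq_min/= => /(_ isT).
  by rewrite -/La; clear -i0 HM C01 a1 l2 l21 N eps s lz1 mn C01x; lra.
have z1l : (z1 <= level La 1)%N by exact: geq_minl.
have z11 : (1 < z1)%N.
  rewrite -(ltr_nat R) -ltr_ln ?posrE ?ltr0n ?leq_min// ln1.
  by apply: lt_le_trans lz1; clear -i0 HM C01 a1 l2 l21 N eps s La0 mn C01x; lra.
have k1 : (N.-1 < N)%N by rewrite prednK.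
have kE : (N - N.-1)%N = 1%N by rewrite -{1}(prednK N1) subSnn.
have kR : (N.-1%:R : R) = 2 * a - 1 by rewrite -natrM -[X in X = _](addrK 1) natr1 prednK.
apply: le_trans (count_window_le H b0 zz1 z1l).
have sum_ge : e / (4 * a) * Num.min 1 (d / La) <= \sum_(z <= p < z1 | prime p) p%:R^-1.
  apply: le_trans (inv_prime_sum z_gt0 zz1 z11).
  have lz0 : 0 < lnr z1 by rewrite ln_gt0// ltr1n.
  rewrite ler_pdivlMr//.
  have m0 : 0 <= Num.min 1 (d / La) by rewrite le_min ler01 divr_ge0 ?ltW.
  have ea : 0 <= e / (4 * a) by apply: divr_ge0; [exact: ltW|rewrite mulr_ge0// ltW].
  apply: (@le_trans _ _ (e / (4 * a) * Num.min 1 (d / La) * (2 * La))).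
    by apply: ler_wpM2l; [exact: mulr_ge0|exact: le_trans zl1 l5].
  have mmE : e / a * Num.min 1 (d / La) * La <= mm.
    rewrite /mm le_min; apply/andP; split.
      apply: ler_wpM2r; first exact: ltW.
      rewrite -[leRHS]mulr1; apply: ler_pM => //; first by rewrite divr_ge0 ?ltW.
        by rewrite ler_pdivrMr// ler_peMr// ltW.
      by rewrite ge_min lexx.
    apply: (@le_trans _ _ (1 / a * (d / La) * La)).
      apply: ler_wpM2r; first exact: ltW.
      apply: ler_pM => //; first by rewrite divr_ge0 ?ltW.
        by apply: ler_wpM2r; [rewrite invr_ge0 ltW|].
      by rewrite ge_min lexx orbT.
    by rewrite le_eqVlt; apply/orP; left; apply/eqP; field; rewrite !gt_eqF.
  have -> : e / (4 * a) * Num.min 1 (d / La) * (2 * La) = (e / a * Num.min 1 (d / La) * La) / 2.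
    by field; rewrite gt_eqF.
  by rewrite -/La; clear -i0 HM C01 a1 l2 l21 N eps s mmE lz1 mn; lra.
have ck : 0 <= c0 * s ^+ N.-1 * (x / b%:R / La).
  apply: mulr_ge0; first exact: ltW.
  by apply: divr_ge0; [apply: divr_ge0|]; exact: ltW.
have -> : c0 * s ^+ N.-1 * (e / (4 * a)) * (x / b%:R / La) * Num.min 1 (d / La) =
   c0 * s ^+ N.-1 * (x / b%:R / La) * (e / (4 * a) * Num.min 1 (d / La)) by ring.
apply: le_trans (ler_wpM2l ck sum_ge) _; rewrite mulr_sumr.
rewrite big_nat_cond [leRHS]big_nat_cond; apply: ler_sum => p /andP[/andP[p1 p2] pr].
have p0 := prime_gt0 pr; have p0' : (0 : R) < p%:R by rewrite ltr0n.
have lp1 : La <= lnr p by exact: ler_ln_nat.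
have lp2 : lnr p <= (1 + eps) * La by apply: le_trans l6; apply: l4 => //; exact: leq_trans p2 z1l.
have allowed : a * lnr p <= ell.
  have : lnr p <= ell / a.
    have pz : (p < zc)%N by apply: leq_trans p2 _; exact: geq_minr.
    rewrite -[leRHS]expRK ler_ln ?posrE ?expR_gt0//.
    by rewrite -truncn_ge_nat ?expR_ge0// -ltnS.
  by rewrite ler_pdivlMr// mulrC.
have Dp : D (level La 1) (b * p)%N.
  by have [] := Dm _ (level La 1) _ (Dmul _ _ _ Db pr p1 allowed) (leq_trans p2 z1l).
have bp : (b * p)%N%:R = b%:R * p%:R :> R by rewrite natrM.
have lbp : lnr (b * p)%N = lnr b + lnr p by exact: ln_natM.
have rE : ln (x / (b * p)%N%:R) = ln (x / b%:R) - lnr p.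
  exact: ln_div_natM.
have := HF Cnt D x eta La N.-1 (b * p)%N H hLa1 k1; rewrite kE => /(_ Dp).
rewrite kR rE lbp.
have e1' : (3 * a - (2 * a - 1)) * La <= lnr b + lnr p - eta.
  by have : 0 < d := d0; rewrite /d /ell; clear -i0 HM C01 a1 l2 l21 N eps s lp1; lra.
have e2 : ((2 * a - 1) * (1 + eps) + 6 / 5) * La <= ln (x / b%:R) - lnr p.
  have : (2 * a * eps) * La = 4^-1 * La by rewrite -(mulrA 2 a) aep; field.
  by clear -i0 HM C01 a1 l2 l21 N eps s r1 lp2 La0; lra.
have e3 : ln (x / b%:R) - lnr p <= (2 * a - 1 + 3) * La by clear -i0 HM C01 a1 l2 l21 N eps s r2 lp1; lra.
move=> /(_ e1' x0 e2 e3); apply: le_trans.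
rewrite bp le_eqVlt; apply/orP; left; apply/eqP; field.
by rewrite !gt_eqF.
Qed.

End Fill.

Lemma ln_succ_le (R : realType) z : (0 < z)%N -> ln (z.+1%:R : R) <= ln z%:R + z%:R^-1.
Proof.
move=> z0; have zR : (0 : R) < z%:R by rewrite ltr0n.
have -> : (z.+1%:R : R) = z%:R * (1 + z%:R^-1) by rewrite mulrDr mulr1 divff ?gt_eqF// natr1.
rewrite lnM ?posrE ?addr_gt0 ?invr_gt0// lerD2l.
by apply: le_ln1Dx; rewrite (lt_trans _ (_ : 0 < _)) ?invr_gt0// ltrN10.
Qed.

Section TreeLower.
Variables (R : realType) (i : nat).
Hypothesis i0 : (0 < i)%N.

Local Notation a := (i%:R : R).
Local Notation lnr n := (ln (n%:R : R)).
Local Notation mert := (mert R).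
Local Notation lam := (lambda (a^-1 : R)).

(** Subinvariance gives, by induction from large z downwards, that the count dominates x / b times
    the weight over (ln x)^lam. The direct construction takes over once ln(x/b) <= kap ln z. Where
    the weight is nonpositive there is nothing to prove; this covers the boundary zone, so a
    positive weight guarantees the gap that [fill_first] requires. *)
Lemma tree_lower : exists c Z0 : R, [/\ 0 < c, 1 <= Z0 & forall Cnt D x eta z b, ext_count i Cnt D x eta ->
  Z0 <= lnr z -> D z b -> 0 < x -> 0 <= eta -> (a + 2^-1) * lnr z <= lnr b - eta ->
  (2 * a + 3) * lnr z <= ln (x / b%:R) ->
  c * (x / b%:R) * (((lnr b - eta) / ln x) `^ lam / lnr z) <= Cnt z b].
Proof.
have a1 : 1 <= a by rewrite ler1n.
have [C0 C01 HM] := mertens R.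
have C0' : 1 <= 5 * C0 + 1 by nlra.
have [w [L0 [c [C [[L01 c0 C1] [wstep wbd wlow wup wupb]]]]]] := lower_weight a1 C0'.
have [La1 [cf [La18 cf0 HF]]] := fill_first i0 C01 HM.
have lam0 : 0 < lam by exact: lam_gt0.
have [a0 CC] : 0 < a /\ 0 < C by split; nlra.
(* A step lowers ln(x/b) by at most ln z, so on arrival below kap ln z it is still about (kap - 1)
   ln z; this range lies within [2 a + 3/2, 2 a + 3], as required by [fill_first]. *)
pose kap : R := 2 * a + 11 / 4.
pose Z0 : R := La1 + L0 + 4 * kap + 4 * a * C0 + 4 * C0 + a.
have aC : 0 <= a * C0 by apply: mulr_ge0; nlra.
have [Z1 Z2 Z3 Z4] : [/\ La1 <= Z0, L0 + C0 <= Z0, 4 * kap <= Z0 & 2 * C0 <= Z0] by rewrite /Z0 /kap; split; nlra.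
have [Z5 Z6 Z7] : [/\ a <= Z0, 1 <= Z0 & 4 * (a * C0) + C0 <= Z0] by rewrite /Z0 /kap; split; nlra.
have kap1 : 1 <= kap by rewrite /kap; nlra.
have kapE : kap = 2 * a + 11 / 4 by [].
clearbody kap Z0.
pose c6 := cf / (8 * C).
have c60 : 0 < c6 by rewrite divr_gt0// mulr_gt0.
have lnS z : (0 < z)%N -> lnr z.+1 <= lnr z + 1.
  by move=> z0; apply: le_trans (ln_succ_le R z0) _; rewrite lerD2l invf_le1 ?ler1n ?ltr0n.
have setup Cnt D x eta z b : ext_count i Cnt D x eta -> Z0 <= lnr z -> D z b -> 0 < x -> 0 <= eta ->
    (2 * a + 3 / 2) * lnr z <= ln (x / b%:R) ->
    [/\ (0 < z)%N, (0 < b)%N, 0 < lnr z, 0 <= lnr b & ln (x / b%:R) = ln x - lnr b /\ 0 < ln (x / b%:R)].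
  move=> H hz Dz x0 eta0 r2; have [_ _ _ Dm _] := H; have [_ b0] := Dm _ _ _ Dz (leqnn z).
  have z0 : (0 < z)%N by rewrite lt0n; apply/eqP => z0; move: hz; rewrite z0 ln0//; clear -i0 Z6; lra.
  have lz0 : 0 < lnr z by clear -i0 hz Z6; lra.
  split => //; first exact: ln_nat_ge0.
  split; first by rewrite ln_div ?posrE// ltr0n.
  by apply: lt_le_trans r2; apply: mulr_gt0 => //; clear -i0 a0; lra.
have fillcase Cnt D x eta z b : ext_count i Cnt D x eta -> Z0 <= lnr z -> D z b -> 0 < x -> 0 <= eta ->
    a * lnr z <= lnr b - eta -> (2 * a + 3 / 2) * lnr z <= ln (x / b%:R) -> ln (x / b%:R) <= kap * lnr z ->
    c6 * (x / b%:R) * ((ln x) `^ (- lam) * w (lnr b - eta) (mert z)) <= Cnt z b.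
  move=> H hz Dz x0 eta0 al r2 hk; have [z0 b0 lz0 lb0 [lxE r0]] := setup _ _ _ _ _ _ H hz Dz x0 eta0 r2.
  have [Cn0 _ _ _ _] := H; have bR : (0 : R) < b%:R by rewrite ltr0n.
  have xc : 0 <= c6 * (x / b%:R) by apply: mulr_ge0; [exact: ltW|apply: divr_ge0; exact: ltW].
  have /ler_normlP[M1 M2] := HM z z0.
  set ell := lnr b - eta in al *.
  have [w0|w0] := leP (w ell (mert z)) 0.
    apply: le_trans (Cn0 z b); rewrite mulrA; apply: mulr_ge0_le0 => //.
    by apply: mulr_ge0 => //; exact: powR_ge0.
  have mz : lnr z / 2 <= mert z by clear -i0 M1 hz Z4; lra.
  have m0 : 0 < mert z by clear -i0 mz lz0; lra.
  have L0m : L0 <= mert z by clear -i0 M1 Z2 hz; lra.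
  have gap : 4 * a * C0 <= ell - a * lnr z.
    have h1 : a * (mert z - (5 * C0 + 1)) <= ell.
      by apply: le_trans al; apply: ler_wpM2l; [exact: ltW|clear -i0 M2 C01; lra].
    rewrite leNgt; apply/negP => lt; have := wbd ell (mert z) L0m h1.
    suff h2 : ell <= a * (mert z + (5 * C0 + 1)) by move=> /(_ h2); rewrite leNgt w0.
    by have := ler_wpM2l (ltW a0) M1; clear -i0 lt a0; lra.
  have hkap : ln (x / b%:R) <= (2 * a + 3) * lnr z.
    by apply: le_trans hk _; apply: ler_wpM2r; [exact: ltW|rewrite kapE; clear -i0; lra].
  apply: le_trans (HF _ _ _ _ _ _ H (le_trans Z1 hz) Dz gap x0 r2 hkap).
  have am : a * mert z <= ell by have := ler_wpM2l (ltW a0) M2; clear -i0 gap aC; lra.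
  have am' : a * (mert z - (5 * C0 + 1)) <= ell.
    by apply: le_trans am; apply: ler_wpM2l; [exact: ltW|clear -i0 C01; lra].
  have ellx : ell <= ln x by rewrite /ell; clear -i0 eta0 r0 lxE; lra.
  have ell0 : 0 < ell by apply: lt_le_trans al; exact: mulr_gt0.
  have lx0 : 0 < ln x by exact: lt_le_trans ellx.
  have pw : (ln x) `^ (- lam) * ell `^ lam <= 1.
    by rewrite powRN mulrC ler_pdivrMr ?powR_gt0// mul1r; apply: ge0_ler_powR => //; rewrite ?nnegrE; exact: ltW.
  have lm : (mert z)^-1 <= 2 / lnr z by rewrite -[leRHS]invf_div lef_pV2 ?posrE ?divr_gt0.
  have q0 : 0 <= 2 / lnr z by apply: divr_ge0 => //; exact: ltW.
  have CQ : 0 <= C * (2 / lnr z) by apply: mulr_ge0 => //; exact: ltW.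
  have W1 : (ln x) `^ (- lam) * (C * (ell `^ lam / mert z)) <= C * (2 / lnr z).
    rewrite mulrCA; apply: ler_wpM2l; first exact: ltW.
    rewrite mulrA -[leRHS]mul1r; apply: ler_pM => //; first exact: mulr_ge0 (powR_ge0 _ _) (powR_ge0 _ _).
    by rewrite invr_ge0 ltW.
  have key : (ln x) `^ (- lam) * w ell (mert z) <=
      C * (2 / lnr z) * (4 * Num.min 1 ((ell - a * lnr z) / lnr z)).
    have [m1|m1] := leP 1 ((ell - a * lnr z) / lnr z).
      rewrite mulr1; apply: le_trans (ler_wpM2l (powR_ge0 _ _) (wup _ _ L0m am')) _.
      by apply: le_trans W1 _; rewrite ler_peMr// ler1n.
    apply: le_trans (ler_wpM2l (powR_ge0 _ _) (wupb _ _ L0m am)) _; rewrite [leLHS]mulrA.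
    have e0 : 0 <= ell / mert z - a by rewrite subr_ge0 ler_pdivlMr.
    apply: le_trans (ler_wpM2r e0 W1) _; apply: ler_wpM2l => //.
    have -> : ell / mert z - a = (ell - a * mert z) / mert z by field; rewrite gt_eqF.
    have -> : 4 * ((ell - a * lnr z) / lnr z) = (2 * (ell - a * lnr z)) * (2 / lnr z) by field; rewrite gt_eqF.
    apply: ler_pM => //; [by rewrite subr_ge0|by rewrite invr_ge0 ltW|].
    by have := ler_wpM2l (ltW a0) M1; clear -i0 gap aC; lra.
  apply: le_trans (ler_wpM2l xc key) _.
  by rewrite le_eqVlt; apply/orP; left; apply/eqP; rewrite /c6; field; rewrite !gt_eqF.
have main Cnt D x eta z b : ext_count i Cnt D x eta -> Z0 <= lnr z -> D z b -> 0 < x -> 0 <= eta ->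
    a * lnr z <= lnr b - eta -> (kap - 1) * lnr z - kap <= ln (x / b%:R) ->
    c6 * (x / b%:R) * ((ln x) `^ (- lam) * w (lnr b - eta) (mert z)) <= Cnt z b.
  move=> H + + x0 eta0; have [Cn0 Cs Ce Dm Dmul] := H.
  set Z := (Num.truncn x).+1.
  move: {2}(Z - z)%N (leqnn (Z - z)) => n; elim: n z b => [|n IH] z b nz hz Dz al hr.
    have r2 : (2 * a + 3 / 2) * lnr z <= ln (x / b%:R).
      by rewrite kapE in hr Z3; clear -i0 hr hz Z3; lra.
    have [z0 b0 lz0 lb0 [lxE r0]] := setup _ _ _ _ _ _ H hz Dz x0 eta0 r2.
    apply: (fillcase _ _ _ _ _ _ H) => //; apply: le_trans (_ : lnr z <= _); last by rewrite ler_peMl// ltW.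
    have zx : x < z%:R.
      by apply: lt_le_trans (truncnS_gt _) _; rewrite ler_nat -/Z -subn_eq0 -leqn0.
    apply: le_trans (_ : ln x <= _); first by rewrite lxE; clear -i0 lb0; lra.
    by rewrite ler_ln ?posrE// ?ltr0n// ltW.
  have r2 : (2 * a + 3 / 2) * lnr z <= ln (x / b%:R).
    by rewrite kapE in hr Z3; clear -i0 hr hz Z3; lra.
  have [z0 b0 lz0 lb0 [lxE r0]] := setup _ _ _ _ _ _ H hz Dz x0 eta0 r2.
  have [hk|hk] := leP (ln (x / b%:R)) (kap * lnr z); first exact: (fillcase _ _ _ _ _ _ H).
  have [zR bR] : (0 : R) < z%:R /\ (0 : R) < b%:R by rewrite !ltr0n.
  have P0 : 0 <= c6 * (x / b%:R) * (ln x) `^ (- lam).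
    by apply: mulr_ge0; [apply: mulr_ge0; [|apply: divr_ge0]; exact: ltW|exact: powR_ge0].
  have /ler_normlP[M1 M2] := HM z z0.
  set ell := lnr b - eta in al *.
  have nz' : (Z - z.+1 <= n)%N by rewrite subnS; move: nz; case: (Z - z)%N.
  have lzS := lnS z z0; have hzS : Z0 <= lnr z.+1 by apply: le_trans hz _; exact: ler_ln_nat.
  have rS : (kap - 1) * lnr z.+1 - kap <= (kap - 1) * lnr z - 1.
    have k1 : 0 <= kap - 1 by clear -i0 kap1; lra.
    by have := ler_wpM2l k1 lzS; clear -i0; lra.
  (* If z + 1 is already out of reach for b, then ell is within a bounded distance of a L and the
     weight there is nonpositive. *)
  have child1 : c6 * (x / b%:R) * ((ln x) `^ (- lam) * w ell (mert z.+1)) <= Cnt z.+1 b.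
    have [alS|deadS] := leP (a * lnr z.+1) ell.
      by apply: IH => //; [have [] := Dm _ z.+1 _ Dz (leqnSn z)|apply: le_trans rS _; clear -i0 hk lz0; lra].
    have /ler_normlP[N1 N2] := HM z.+1 isT.
    apply: le_trans (Cn0 z.+1 b); rewrite mulrA; apply: mulr_ge0_le0 => //; apply: wbd; first by clear -i0 N1 Z2 hzS; lra.
      apply: le_trans al; apply: ler_wpM2l; first exact: ltW.
      by clear -i0 N2 lzS C01; lra.
    apply: le_trans (ltW deadS) _; apply: ler_wpM2l; first exact: ltW.
    by clear -i0 N1 C01; lra.
  apply: le_trans (Cs z b b0); have L0m : L0 <= mert z by clear -i0 M1 Z2 hz; lra.
  have nM : `|lnr z - mert z| <= 5 * C0 + 1 by rewrite distrC; apply: le_trans (HM z z0) _; clear -i0 C01; lra.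
  have z1R : (1 : R) <= z%:R by rewrite ler1n.
  move: child1; rewrite mert_succ; case: ifP => pr; last by rewrite !addr0.
  move=> child1; have st := wstep ell (mert z) z%:R L0m z1R nM al.
  have lbz : lnr (b * z)%N = lnr b + lnr z by exact: ln_natM.
  have child2 : c6 * (x / (b * z)%N%:R) * ((ln x) `^ (- lam) * w (ell + lnr z) (mert z + lnr z / z%:R)) <= Cnt z.+1 (b * z)%N.
    have ezE : ell + lnr z = lnr (b * z)%N - eta by rewrite lbz /ell; clear -i0; lra.
    have := mert_succ R z; rewrite pr ezE => <-; apply: IH => //.
    - exact: Dmul Dz pr (leqnn z) al.
    - rewrite -ezE; have := ler_wpM2l (ltW a0) lzS; clear -i0 al hz Z5; lra.
    - rewrite ln_div_natM//; apply: le_trans rS _; clear -i0 hk lz0; lra.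
  apply: le_trans (lerD child1 child2).
  have -> : c6 * (x / (b * z)%N%:R) = c6 * (x / b%:R) / z%:R.
    by rewrite natrM; field; rewrite !gt_eqF.
  have := ler_wpM2l P0 st; rewrite mulrDr !mulrA; move/le_trans; apply.
  by rewrite le_eqVlt; apply/orP; left; apply/eqP; field; rewrite !gt_eqF.
exists (c6 * c / 2), Z0; split => //; first by rewrite divr_gt0// mulr_gt0.
move=> Cnt D x eta z b H hz Dz x0 eta0 hl hr.
have [z0 b0 lz0 lb0 [lxE r0]] : [/\ (0 < z)%N, (0 < b)%N, 0 < lnr z, 0 <= lnr b & ln (x / b%:R) = ln x - lnr b /\ 0 < ln (x / b%:R)].
  apply: (setup _ _ _ _ _ _ H) => //; apply: le_trans hr; apply: ler_wpM2r; last by clear -i0; lra.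
  by clear -i0 hz Z6; lra.
have lx0 : 0 < ln x by clear -i0 r0 lb0 lxE; lra.
have bR : (0 : R) < b%:R by rewrite ltr0n.
have /ler_normlP[M1 M2] := HM z z0.
have L0m : L0 <= mert z by clear -i0 M1 Z2 hz; lra.
have m0 : 0 < mert z by clear -i0 L0m L01; lra.
have al : a * lnr z <= lnr b - eta by apply: le_trans hl; clear -i0 lz0; lra.
have hr' : (kap - 1) * lnr z - kap <= ln (x / b%:R).
  by apply: le_trans hr; rewrite kapE; clear -i0 lz0 a0; lra.
apply: le_trans (main _ _ _ _ _ _ H hz Dz x0 eta0 al hr').
set ell := lnr b - eta in hl al *.
have ell0 : 0 < ell by apply: lt_le_trans al; exact: mulr_gt0.
have hl' : (a + 4^-1) * mert z <= ell.
  apply: le_trans hl; apply: (@le_trans _ _ ((a + 4^-1) * (lnr z + C0))).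
    by apply: ler_wpM2l; [clear -i0 a0; lra|clear -i0 M2; lra].
  by clear -i0 hz Z7; lra.
have xc : 0 <= c6 * (x / b%:R) by apply: mulr_ge0; [exact: ltW|apply: divr_ge0; exact: ltW].
have := ler_wpM2l xc (ler_wpM2l (powR_ge0 (ln x) (- lam)) (wlow _ _ L0m hl')); apply: le_trans.
have mz : (2 * lnr z)^-1 <= (mert z)^-1.
  by rewrite lef_pV2 ?posrE ?mulr_gt0//; clear -i0 M2 hz Z4 lz0; lra.
rewrite powR_div ?(ltW ell0)// powRN.
have E1 : c6 * c / 2 * (x / b%:R) * (ell `^ lam / ln x `^ lam / lnr z) =
  c6 * (x / b%:R) * (c * (ell `^ lam / ln x `^ lam)) * (2 * lnr z)^-1.
  by field; rewrite !gt_eqF ?powR_gt0.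
have E2 : c6 * (x / b%:R) * ((ln x `^ lam)^-1 * (c * (ell `^ lam / mert z))) =
  c6 * (x / b%:R) * (c * (ell `^ lam / ln x `^ lam)) * (mert z)^-1.
  by field; rewrite !gt_eqF ?powR_gt0.
rewrite E1 E2; apply: ler_wpM2l => //; apply: mulr_ge0 => //; apply: mulr_ge0; first exact: ltW.
by apply: divr_ge0; exact: powR_ge0.
Qed.

End TreeLower.

(** * Counting multiples with a squarefree cofactor; squarefree harmonic sums *)

Section Extensions.
Variable R : realType.
Implicit Types (A : pred nat) (x y : R).

Local Notation lnr n := (ln (n%:R : R)).

Definition extends z b n : bool :=
  [&& (b %| n)%N, squarefree (n %/ b)%N & all (fun p => z <= p)%N (primes (n %/ b)%N)].

Definition ext_number A x z b : R :=
  (count (fun n => A n && extends z b n) (iota 1 (Num.truncn x)))%:R.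

Lemma extendsP z b n : (0 < b)%N -> reflect
  (exists2 m, n = (b * m)%N & squarefree m /\ forall p, prime p -> (p %| m)%N -> (z <= p)%N) (extends z b n).
Proof.
move=> b0; apply: (iffP and3P) => [[/dvdnP[m ->]]|[m -> [sf h]]].
  rewrite mulnK// => sf /allP h; exists m; rewrite 1?mulnC//; split=> // p pr pm.
  by apply: h; rewrite mem_primes pr squarefree_gt0.
rewrite dvdn_mulr// mulKn//; split => //; apply/allP => p.
by rewrite mem_primes => /and3P[pr _ /(h _ pr)].
Qed.

Lemma count_two_le (T : Type) (P1 P2 P : pred T) s : (forall n, P1 n -> P n) -> (forall n, P2 n -> P n) ->
  (forall n, P1 n -> ~~ P2 n) -> (count P1 s + count P2 s <= count P s)%N.
Proof.
move=> h1 h2 h3; rewrite -count_predUI (@eq_count _ (predI P1 P2) pred0); last first.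
  by move=> n /=; apply/andP => -[/h3/negP].
by rewrite count_pred0 addn0; apply: sub_count => n /orP[/h1|/h2].
Qed.

Lemma ext_count_number i A (D : nat -> nat -> Prop) x eta :
  (forall z b, D z b -> A b /\ (0 < b)%N) -> (forall z z' b, D z b -> (z <= z')%N -> D z' b) ->
  (forall z b p, D z b -> prime p -> (z <= p)%N -> i%:R * lnr p <= lnr b - eta -> D p.+1 (b * p)%N) ->
  ext_count i (ext_number A x) D x eta.
Proof.
move=> HA Hm Hp; split => [z b|z b b0|z b Dz bx|z z' b Dz zz|]; last exact: Hp.
- exact: ler0n.
- have E1 n : A n && extends z.+1 b n -> A n && extends z b n.
    case/andP => -> /(extendsP _ _ b0)[m nE [sf h]]; apply/(extendsP _ _ b0); exists m => //.
    by split => // p pr /(h p pr)/ltnW.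
  case: ifP => pr; last by rewrite addr0 /ext_number ler_nat; apply: sub_count => n; exact: E1.
  have bz0 : (0 < b * z)%N by rewrite muln_gt0 b0 prime_gt0.
  rewrite /ext_number -natrD ler_nat; apply: count_two_le => [//|n|n].
    case/andP => -> /(extendsP _ _ bz0)[m nE [sf h]]; apply/(extendsP _ _ b0).
    exists (m * z)%N; first by rewrite nE -mulnA (mulnC z).
    split; first by apply: squarefree_mul_prime => //; apply/negP => /(h _ pr); rewrite ltnn.
    move=> p pp; rewrite Euclid_dvdM// => /orP[/(h p pp)/ltnW//|].
    by rewrite dvdn_prime2// => /eqP->.
  case/andP => An /(extendsP _ _ b0)[m nE [_ h]]; rewrite An/=.
  apply/negP => /(extendsP _ _ bz0)[m' nE' _].
  have mE : m = (z * m')%N by apply/eqP; rewrite -(eqn_pmul2l b0) -nE nE' mulnA.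
  by have := h z pr; rewrite mE dvdn_mulr// ltnn => /(_ isT).
- have [Ab b0] := HA _ _ Dz; rewrite ler1n -has_count; apply/hasP; exists b.
    by rewrite mem_iota b0/= add1n ltnS truncn_ge_nat// (le_trans _ bx).
  by rewrite Ab/=; apply/(extendsP _ _ b0); exists 1%N; rewrite ?muln1//; split => // p pr; rewrite dvdn1 => /eqP pE; rewrite pE in pr.
- by have [_ b0] := HA _ _ Dz; split => //; exact: Hm zz.
Qed.

Lemma ext_number_le A x z b : ext_number A x z b <= (count A (iota 1 (Num.truncn x)))%:R.
Proof. by rewrite ler_nat; apply: sub_count => n /andP[]. Qed.

Lemma part_lt_extends z t n : (0 < t)%N -> (t < z)%N -> extends z t n -> part_lt z n = t.
Proof.
move=> t0 tz /(extendsP _ _ t0)[m -> [sf h]]; have m0 := squarefree_gt0 sf.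
have tE : part_lt z t = t by apply: part_lt_id => // p _ /(dvdn_leq t0)/leq_ltn_trans; apply.
have mE : part_lt z m = 1%N.
  by apply: part_p'nat; apply/pnatP => // p pr pm; rewrite !inE -leqNgt; exact: h.
by rewrite /part_lt partnM// -!/(part_lt _ _) tE mE muln1.
Qed.

(** Every extension of t has t as its part below z, so different t count disjoint sets. *)
Lemma ext_number_sum A x z T : (T < z)%N ->
  \sum_(1 <= t < T.+1 | squarefree t) ext_number A x z t <= (count A (iota 1 (Num.truncn x)))%:R.
Proof.
move=> Tz; rewrite /ext_number -natr_sum ler_nat -sum1_count [leqRHS]big_mkcond/=.
under eq_bigr do rewrite -sum1_count big_mkcond/=.
rewrite exchange_big/=; apply: leq_sum => n _; case: (A n) => /=; last by rewrite big1.
rewrite -big_mkcondr/= sum1_count; apply: leq_trans (_ : count_mem (part_lt z n) (index_iota 1 T.+1) <= 1)%N; last first.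
  by rewrite count_uniq_mem ?iota_uniq// leq_b1.
have E t : t \in index_iota 1 T.+1 -> squarefree t && extends z t n -> pred1 (part_lt z n) t.
  rewrite mem_index_iota ltnS => /andP[t0 tT] /andP[_ /part_lt_extends-> //]; first exact/eqP.
  exact: leq_ltn_trans Tz.
elim: (index_iota 1 T.+1) E => //= t s IH E; apply: leq_add.
  by have := E t (mem_head _ _); case: (_ && _) => // /(_ isT) ->.
by apply: IH => u us; apply: E; rewrite in_cons us orbT.
Qed.

Lemma sum_inv_sq n : \sum_(1 <= d < n.+2) (d%:R ^+ 2 : R)^-1 <= 2 - n.+1%:R^-1.
Proof.
elim: n => [|n IH]; first by rewrite big_nat1 expr1n invr1; nlra.
rewrite big_nat_recr//=; have n0 : (0 : R) < n.+1%:R by [].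
have n2 : (n.+2%:R : R) = n.+1%:R + 1 by rewrite natr1.
apply: le_trans (lerD IH (lexx _)) _; rewrite n2; move: (n.+1%:R : R) n0 => u u0.
have [u1 u2 u3] : [/\ 0 < u + 1, 0 < u * (u + 1) & 0 < (u + 1) ^+ 2].
  by rewrite mulr_gt0 ?exprn_gt0 ?addr_gt0.
have -> : 2 - (u + 1)^-1 = 2 - u^-1 + (u * (u + 1))^-1 by field; rewrite !gt_eqF.
by rewrite lerD2l lef_pV2 ?posrE// expr2 ler_wpM2r ?(ltW u1)// lerDl.
Qed.

Lemma ln_le_harmonic n : (0 < n)%N -> lnr n <= \sum_(1 <= k < n) (k%:R : R)^-1.
Proof.
elim: n => [//|[|n] IH] _; first by rewrite ln1 big_geq.
by rewrite big_nat_recr//=; apply: le_trans (ln_succ_le R (isT : (0 < n.+1)%N)) _; rewrite lerD2r; exact: IH.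
Qed.

Lemma term_le_sum (F : nat -> R) (P : pred nat) m n j : (forall k, 0 <= F k) -> (m <= j < n)%N -> P j ->
  F j <= \sum_(m <= k < n | P k) F k.
Proof.
move=> F0 jmn Pj; rewrite big_mkcond (bigD1_seq j) ?mem_index_iota ?iota_uniq//= Pj lerDl.
by apply: sumr_ge0 => k _; case: ifP.
Qed.

(** Writing k = s d^2 bounds the harmonic sum by the squarefree one times the sum of d^-2, which is
    at most 2. *)
Lemma squarefree_harmonic n : (0 < n)%N ->
  lnr n / 2 <= \sum_(1 <= s < n | squarefree s) (s%:R : R)^-1.
Proof.
move=> n0; rewrite ler_pdivrMr//; apply: le_trans (ln_le_harmonic n0) _.
pose F k s d : R := if k == (s * d ^ 2)%N then (k%:R)^-1 else 0.
have F0 k s d : 0 <= F k s d by rewrite /F; case: ifP.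
apply: (@le_trans _ _ (\sum_(1 <= k < n) \sum_(1 <= s < n | squarefree s) \sum_(1 <= d < n) F k s d)).
  rewrite big_nat_cond [leRHS]big_nat_cond; apply: ler_sum => k /andP[/andP[k0 kn] _].
  have [s [d [sf d0 kE]]] := squarefree_decomp k0; have s0 := squarefree_gt0 sf.
  have [sk dk] : (s <= k)%N /\ (d <= k)%N.
    by split; apply: dvdn_leq => //; rewrite kE; [exact: dvdn_mulr|rewrite dvdn_mull// dvdn_exp].
  have -> : k%:R^-1 = F k s d by rewrite /F -kE eqxx.
  apply: le_trans (_ : \sum_(1 <= d < n) F k s d <= _).
    by apply: term_le_sum => //; rewrite d0 (leq_ltn_trans dk).
  apply: (@term_le_sum (fun s => \sum_(1 <= d < n) F k s d)) => //.
    by move=> s'; apply: sumr_ge0.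
  by rewrite s0 (leq_ltn_trans sk).
rewrite exchange_big/= mulr_suml; apply: ler_sum => s _; rewrite exchange_big/=.
apply: (@le_trans _ _ (\sum_(1 <= d < n) (s%:R)^-1 * (d%:R ^+ 2)^-1)).
  apply: ler_sum => d _; rewrite /F -big_mkcond/= big_nat1_eq.
  have -> : ((s * d ^ 2)%N%:R : R)^-1 = s%:R^-1 * (d%:R ^+ 2)^-1 by rewrite natrM natrX invfM.
  by case: ifP => // _; rewrite mulr_ge0// invr_ge0// exprn_ge0.
rewrite -mulr_sumr; apply: ler_wpM2l; first by rewrite invr_ge0.
case: n {n0 F F0} => [|[|n]]; [by rewrite big_geq|by rewrite big_geq|].
by apply: le_trans (sum_inv_sq n) _; rewrite lerBlDr lerDl invr_ge0.
Qed.

End Extensions.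

(** * Lower bounds for the starred sets and their squarefree members *)

Section LowerBounds.
Variables (R : realType) (i : nat).
Hypothesis i0 : (0 < i)%N.

Local Notation a := (i%:R : R).
Local Notation lnr n := (ln (n%:R : R)).
Local Notation lam := (lambda (a^-1 : R)).

Let ln_ge2 (u : R) : 2 <= u -> 0 < ln u.
Proof. by move=> h; apply: ln_gt0; apply: lt_le_trans h; rewrite ltr1n. Qed.

Let powR_le1 (u : R) : 0 <= u -> u <= 1 -> u `^ lam <= 1.
Proof.
move=> u0 u1; have l0 : 0 <= lam by apply: ltW; apply: lam_gt0; rewrite ler1n.
have := ge0_ler_powR l0 (_ : u \is Num.nneg) (_ : 1 \is Num.nneg) u1.
by rewrite powR1; apply; rewrite nnegrE.
Qed.

Lemma expr_le_nat (u : R) k b : 0 < u -> (0 < b)%N -> k%:R * ln u <= lnr b -> u ^+ k <= b%:R.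
Proof.
move=> u0 b0 h; rewrite -ler_ln ?posrE ?exprn_gt0 ?ltr0n//.
by rewrite [leLHS]lnXn// -[leLHS]mulr_natl.
Qed.

(** [Dstar_mul_small] in logarithms, with eta = a ln y: the rule by which the tree grows. *)
Lemma Dstar_ext y z b p : 1 <= y -> Dstar y i b -> prime p -> (z <= p)%N ->
  a * lnr p <= lnr b - a * ln y -> Dstar y i (b * p)%N.
Proof.
move=> y1 Db pr zp h; have y0 : 0 < y by exact: lt_le_trans y1.
have pR : (0 : R) < p%:R by rewrite ltr0n prime_gt0.
rewrite mulnC; apply: Dstar_mul_small; rewrite ?prime_gt0//.
apply: expr_le_nat; [exact: mulr_gt0|exact: Dstar_gt0 Db|].
by rewrite lnM ?posrE// mulrDr -lerBrDr.
Qed.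

(* Powers of 2 belong to every starred set, so a large one starts the tree. *)
Lemma Dstar_lower_fixed (Y0 : R) : 2 <= Y0 -> exists2 c : R, 0 < c & forall y x : R, 2 <= y -> y <= Y0 -> y <= x ->
  c * (x * (ln y / ln x) `^ lam) <= (count (Dstar y i) (iota 1 (Num.truncn x)))%:R.
Proof.
move=> Y2; have [c [Z0 [c0 Z01 H]]] := tree_lower R i0.
have a1 : 1 <= a by rewrite ler1n.
have a0 : 0 < a by exact: lt_le_trans a1.
have l20 := ln2_gt0 R; have lam0 : 0 < lam by exact: lam_gt0.
pose z := (Num.truncn (expR Z0)).+1.
have eZ : 1 <= expR Z0 by rewrite -[leLHS]expR0 ler_expR; exact: le_trans Z01.
have /andP[lz _] := ln_truncnS eZ; rewrite expRK -/z in lz.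
have lz0 : 0 < lnr z by apply: le_lt_trans lz; exact: le_trans Z01.
pose k := ((Num.truncn ((a + 2^-1) * lnr z / ln 2)).+1 + i)%N.
pose b := (2 ^ k)%N.
have b0 : (0 < b)%N by rewrite expn_gt0.
have bR : (0 : R) < b%:R by rewrite ltr0n.
have lb : lnr b = k%:R * ln 2 by rewrite /b natrX lnXn// mulr_natl.
have hb : (a + 2^-1) * lnr z <= lnr b - a * ln 2.
  rewrite lb /k natrD [X in _ <= X - _]mulrDl addrK -ler_pdivrMr//; exact: ltW (truncnS_gt _).
have Db : Dstar (2 : R) i b.
  rewrite /b; elim: (k) => [|k' IH]; first by rewrite expn0; exact: Dstar1.
  by rewrite expnS; apply: Dstar_mulS => //; rewrite ler1n.
set E := lnr b - a * ln 2 in hb.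
have E0 : 0 < E by apply: lt_le_trans hb; rewrite mulr_gt0// addr_gt0// invr_gt0.
pose x0 := expR (lnr b + (2 * a + 3) * lnr z).
have lY : 0 < ln Y0 by exact: ln_ge2.
pose q := (ln Y0 / E) `^ lam.
have q0 : 0 < q by rewrite powR_gt0// divr_gt0.
pose c1 := c / b%:R / lnr z / q.
have c10 : 0 < c1 by rewrite !divr_gt0.
have x00 : 0 < x0 by exact: expR_gt0.
exists (Num.min c1 x0^-1) => [|y x y2 yY yx]; first by rewrite lt_min c10 invr_gt0.
have x2 : 2 <= x by exact: le_trans yx.
have [xR yR] : 0 < x /\ 0 < y by split; [exact: lt_le_trans x2|exact: lt_le_trans y2].
have lx0 : 0 < ln x by exact: ln_ge2.
have ly0 : 0 < ln y by exact: ln_ge2.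
have lyx : ln y <= ln x by rewrite ler_ln ?posrE.
have lyY : ln y <= ln Y0 by rewrite ler_ln ?posrE// (lt_le_trans yR).
have xp : 0 <= x * (ln y / ln x) `^ lam by apply: mulr_ge0; [exact: ltW|exact: powR_ge0].
have [xx0|xx0] := leP x x0.
  apply: (@le_trans _ _ (x0^-1 * (x * (ln y / ln x) `^ lam))); first by rewrite ler_wpM2r// ge_min lexx orbT.
  apply: (@le_trans _ _ 1); last first.
    rewrite ler1n -has_count; apply/hasP; exists 1%N; last exact: Dstar1 (ltW yR).
    by rewrite mem_iota/= add1n ltnS truncn_ge_nat ?(ltW xR)//; apply: le_trans x2; rewrite ler1n.
  rewrite mulrA -[leRHS]mulr1; apply: ler_pM => //; first by apply: mulr_ge0; rewrite ?invr_ge0; exact: ltW.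
    exact: powR_ge0.
    by rewrite mulrC ler_pdivrMr// mul1r.
  by apply: powR_le1; [apply: divr_ge0; exact: ltW|rewrite ler_pdivrMr// mul1r].
apply: (@le_trans _ _ (c1 * (x * (ln y / ln x) `^ lam))); first by rewrite ler_wpM2r// ge_min lexx.
pose D (z : nat) b := Dstar (2 : R) i b.
have HC : ext_count i (ext_number (Dstar (2 : R) i) x) D x (a * ln 2).
  apply: ext_count_number => [z' b' Db'|//|z' b' p Db' pr zp h].
    by split => //; exact: Dstar_gt0 Db'.
  by apply: Dstar_ext Db' pr zp h; rewrite ler1n.
have lxx0 : lnr b + (2 * a + 3) * lnr z <= ln x.
  by rewrite -[leLHS]expRK ler_ln ?posrE// ltW.
have r : (2 * a + 3) * lnr z <= ln (x / b%:R) by rewrite ln_div ?posrE// lerBrDl.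
have eta0 : 0 <= a * ln 2 by apply: mulr_ge0; exact: ltW.
have := H _ _ _ _ z b HC (ltW lz) Db xR eta0 hb r; rewrite -/E => h.
apply: le_trans (_ : (count (Dstar (2 : R) i) (iota 1 (Num.truncn x)))%:R <= _); last first.
  by rewrite ler_nat; apply: sub_count => n; apply: Dstar_mono.
apply: le_trans (ext_number_le _ _ z b); apply: le_trans h.
have ratio : (ln y / ln x) `^ lam <= q * (E / ln x) `^ lam.
  have [Y0' Ex] : 0 <= ln Y0 / E /\ 0 <= E / ln x by split; apply: divr_ge0; exact: ltW.
  rewrite /q -powRM//; apply: ge0_ler_powR; rewrite ?nnegrE; [exact: ltW|by apply: divr_ge0; exact: ltW|exact: mulr_ge0|].
  rewrite [leRHS](_ : _ = ln Y0 / ln x); last by field; rewrite !gt_eqF.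
  by rewrite ler_pM2r// invr_gt0.
apply: (@le_trans _ _ (c1 * (x * (q * (E / ln x) `^ lam)))).
  by rewrite ler_pM2l// ler_pM2l.
by rewrite le_eqVlt; apply/orP; left; apply/eqP; rewrite /c1; field; rewrite !gt_eqF.
Qed.

(** Primes up to y may be adjoined freely by [Dstar_mulS]. From each squarefree t <= sqrt y, insert
    M primes between sqrt y and y, then apply [tree_lower] with z close to y. The sum of 1 / t over
    the starting points is of order ln y and cancels the factor 1 / ln z of [tree_lower]. *)
Lemma Dstar_sqf_lower_far : exists c Y0 : R, [/\ 0 < c, 2 <= Y0 & forall y x : R, Y0 <= y -> 0 < x ->
  (7 * a + 9) * ln y <= ln x ->
  c * (x * (ln y / ln x) `^ lam) <=
    (count [pred n | Dstar y i n && squarefree n] (iota 1 (Num.truncn x)))%:R].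
Proof.
have [C0 C01 HM] := mertens R; have [c [Z0 [c0 Z01 H]]] := tree_lower R i0.
have a1 : 1 <= a by rewrite ler1n.
have a0 : 0 < a by exact: lt_le_trans a1.
have lam0 : 0 < lam by exact: lam_gt0.
(* M primes above sqrt y give ln b >= (2 a + 2) ln y, so (a + 2) ln y is left after subtracting eta
   = a ln y; M e <= 1/2 keeps all M levels below y. *)
pose e : R := (16 * a ^+ 2)^-1; pose s := e / 4; pose M := (4 * i + 4)%N.
have e0 : 0 < e by rewrite invr_gt0 mulr_gt0// exprn_gt0.
have s0 : 0 < s by rewrite divr_gt0.
have ME : M%:R = 4 * a + 4 by rewrite natrD natrM.
have Me : M%:R * e <= 2^-1.
  rewrite ME /e ler_pdivrMr ?mulr_gt0 ?exprn_gt0//; have : 1 * a <= a * a by rewrite ler_pM2r.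
  by rewrite expr2; clear -i0 a1; move: (a * a) => aa h; nlra.
have q0 : 0 <= 2 * (1 + 2 * C0) / e by apply: divr_ge0; [clear -i0 C01; lra|exact: ltW].
pose La0 := 8 + Z0 + a + 2 * (1 + 2 * C0) / e.
have [h1 h2 h3 h4] : [/\ 8 <= La0, Z0 <= La0, a <= La0 & 2 * (1 + 2 * C0) / e <= La0].
  by rewrite /La0; clear -i0 q0 a0 Z01; split; nlra.
clearbody La0.
have l21 := ln2_le1 R; have l20 := ln2_gt0 R.
exists (s ^+ M * (c / 6)), (expR (2 * La0)); split.
- by rewrite mulr_gt0 ?exprn_gt0// divr_gt0.
- by apply: le_trans (expR_ge1Dx _); clear -i0 h1; lra.
(* The chain ends with ln b <= (2 M + 1) La = (8 a + 9) ln y / 2, and [tree_lower] asks for another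
   (2 a + 3) ln z; the factor 7 a + 9 covers both with a margin. *)
move=> y x Yy x0 hx; pose La := ln y / 2.
have y0 : 0 < y by apply: lt_le_trans Yy; exact: expR_gt0.
have lyE : ln y = 2 * La by rewrite /La; field.
have hLa : La0 <= La by rewrite /La ler_pdivlMr// mulrC -[leLHS]expRK ler_ln ?posrE// expR_gt0.
have La8 : 8 <= La by exact: le_trans hLa.
have La_gt0 : 0 < La by exact: lt_le_trans La8.
have La_ge0 := ltW La_gt0.
have ly0 : 0 < ln y by rewrite lyE mulr_gt0.
have y1 : 1 <= y by rewrite -ler_ln ?posrE// ln1 ltW.
have lx0 : 0 < ln x by apply: lt_le_trans hx; rewrite mulr_gt0// addr_gt0// mulr_gt0.
pose D z b := [/\ Dstar y i b, squarefree b & forall p, prime p -> (p %| b)%N -> (p < z)%N].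
pose A := [pred n | Dstar y i n && squarefree n].
have Dmono z z' b : D z b -> (z <= z')%N -> D z' b.
  by case=> Db sf h zz; split => // p pr /(h p pr)/leq_trans; apply.
have Dmul z b p : D z b -> prime p -> (z <= p)%N -> Dstar y i (b * p)%N -> D p.+1 (b * p)%N.
  case=> Db sf h pr zp Dbp; split => //.
    apply: squarefree_mul_prime => //; apply/negP => /(h p pr); rewrite ltnNge zp//.
  move=> p' pr'; rewrite Euclid_dvdM// => /orP[/(h p' pr') p'z|].
    by rewrite ltnS ltnW// (leq_trans p'z).
  by rewrite dvdn_prime2// => /eqP->.
have HC : ext_count i (ext_number A x) D x (a * ln y).
  apply: ext_count_number => [z b [Db sf _]|//|z b p Db pr zp h].
    by split; [rewrite /A/= Db|exact: Dstar_gt0 Db].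
  apply: (Dmul _ _ _ Db pr zp); have [Db' _ _] := Db; exact: Dstar_ext y1 Db' pr zp h.
pose zy := (Num.truncn y).+1.
have /andP[zy1 zy2] := ln_truncnS y1; rewrite -/zy in zy1 zy2.
have lzy0 : 0 < lnr zy by exact: lt_trans zy1.
pose F := c * x * ((ln y / ln x) `^ lam / (3 * La)).
have F0 : 0 <= F.
  apply: mulr_ge0; first by apply: mulr_ge0; exact: ltW.
  by apply: divr_ge0; [exact: powR_ge0|exact: mulr_ge0].
have base b : D zy b -> M%:R * La <= lnr b -> lnr b <= (2 * M%:R + 1) * La -> F / b%:R <= ext_number A x zy b.
  move=> Db; rewrite ME => b1 b2; have [/Dstar_gt0 b0 _ _] := Db.
  have bR : (0 : R) < b%:R by rewrite ltr0n.
  have g1 : Z0 <= lnr zy.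
    by apply: le_trans (ltW zy1); rewrite lyE; clear -i0 hLa h2 La_gt0; lra.
  have g2 : 0 <= a * ln y by apply: mulr_ge0; exact: ltW.
  have ell : 2 * a * La + 4 * La <= lnr b - a * ln y by rewrite lyE; clear -i0 b1; lra.
  have g5 : lnr zy <= 2 * La + 1 by rewrite lyE in zy2; clear -i0 zy2 l21; lra.
  have g3 : (a + 2^-1) * lnr zy <= lnr b - a * ln y.
    apply: le_trans ell; apply: le_trans (ler_wpM2l (_ : 0 <= a + 2^-1) g5) _.
      by clear -i0 a0; lra.
    by clear -i0 h3 hLa La8; lra.
  have aLa : 8 * a <= a * La by rewrite mulrC ler_pM2l.
  have g4 : (2 * a + 3) * lnr zy <= ln (x / b%:R).
    rewrite ln_div ?posrE//; apply: le_trans (ler_wpM2l (_ : 0 <= 2 * a + 3) g5) _.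
      by clear -i0 a0; lra.
    by move: hx; rewrite lyE; clear -i0 b2 aLa La8 a0; lra.
  apply: le_trans (H _ _ _ _ _ _ HC g1 Db x0 g2 g3 g4).
  have -> : F / b%:R = c * (x / b%:R) * ((ln y / ln x) `^ lam / (3 * La)) by rewrite /F; ring.
  apply: ler_wpM2l; first by apply: mulr_ge0; [|apply: divr_ge0]; exact: ltW.
  have yb : ln y <= lnr b - a * ln y.
    by apply: le_trans ell; rewrite lyE; have := mulr_ge0 (ltW a0) La_ge0; clear -i0 La_gt0; lra.
  have b3 : 0 < lnr b - a * ln y by exact: lt_le_trans yb.
  apply: ler_pM; [exact: powR_ge0|by rewrite invr_ge0 mulr_ge0| |].
    apply: ge0_ler_powR; rewrite ?nnegrE; [exact: ltW|by apply: divr_ge0; exact: ltW|by apply: divr_ge0; exact: ltW|].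
    by rewrite ler_pM2r// invr_gt0.
  by rewrite lef_pV2 ?posrE ?mulr_gt0//; clear -i0 g5 La8; lra.
have levM j : (j <= M)%N -> (1 + j%:R * e) * La <= ln y /\ lnr (level i La j) <= 2 * La.
  move=> jM; have je : j%:R * e <= 2^-1.
    by apply: le_trans Me; rewrite ler_pM2r// ler_nat.
  have hle := ler_wpM2r La_ge0 je.
  have [_ g _] := levelP i0 j La_ge0; split; first by rewrite lyE; clear -i0 hle La_gt0; lra.
  by apply: le_trans g _; rewrite -/e; clear -i0 hle La8 l21; lra.
have chain k b : (k <= M)%N -> D (level i La (M - k)) b -> (M - k)%:R * La <= lnr b ->
    lnr b <= (2 * (M - k)%:R + 1) * La -> s ^+ k * (F / b%:R) <= ext_number A x (level i La (M - k)) b.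
  elim: k b => [|k IH] b kM Db b1 b2; have [/Dstar_gt0 b0 _ _] := Db.
    rewrite subn0 in Db b1 b2 *; have [g _] := levM M (leqnn M).
    have lz : (level i La M <= zy)%N.
      rewrite ltnS truncn_ge_nat ?(ltW y0)//; apply: le_trans (_ : expR ((1 + M%:R * e) * La) <= _).
        by rewrite truncn_le expR_ge0.
      by rewrite -[leRHS](lnK y0) ler_expR.
    rewrite expr0 mul1r; apply: le_trans (count_mono HC b0 lz); apply: base => //; exact: Dmono lz.
  have bR : (0 : R) < b%:R by rewrite ltr0n.
  set j := (M - k.+1)%N in Db b1 b2 *; have jE : (M - k)%N = j.+1 by rewrite /j subnSK.
  have jM : (j.+1 <= M)%N by rewrite -jE leq_subr.
  have [w1 w2] := levM _ jM.
  have lev : (level i La j <= level i La j.+1)%N by exact: level_le.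
  apply: le_trans (count_window_le HC b0 lev (leqnn _)).
  have := level_window i0 C01 HM La8 (le_trans h4 hLa) w2; rewrite -/e -/s => sum_ge.
  have ck : 0 <= s ^+ k * (F / b%:R).
    by apply: mulr_ge0; [exact/exprn_ge0/ltW|exact: divr_ge0].
  rewrite exprSr -mulrA (mulrC s) mulrA; apply: le_trans (ler_wpM2l ck sum_ge) _.
  rewrite mulr_sumr big_nat_cond [leRHS]big_nat_cond; apply: ler_sum => p /andP[/andP[p1 p2] pr].
  have p0 := prime_gt0 pr; have pR : (0 : R) < p%:R by rewrite ltr0n.
  have [l1 _ _] := levelP i0 j La_ge0; have [_ _ l4] := levelP i0 j.+1 La_ge0.
  have lp1 : La <= lnr p.
    apply: le_trans (_ : lnr (level i La j) <= _); last exact: ler_ln_nat.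
    by apply: le_trans l1; rewrite ler_peMl// lerDl; apply: mulr_ge0 => //; exact: ltW.
  have lp2 : lnr p <= ln y by apply: le_trans w1; exact: l4.
  have py : p%:R <= y by rewrite -ler_ln ?posrE.
  have Dp : D (level i La j.+1) (b * p)%N.
    apply: Dmono p2; apply: (Dmul _ _ _ Db pr p1); rewrite mulnC.
    by apply: Dstar_mulS => //; have [] := Db.
  have := IH (b * p)%N (ltnW kM); rewrite jE => /(_ Dp).
  have lbp : lnr (b * p)%N = lnr b + lnr p by exact: ln_natM.
  have jS : (j.+1%:R : R) = j%:R + 1 by rewrite natr1.
  rewrite lbp jS lyE in lp2 *; move=> IHp; apply: le_trans (IHp _ _).
  - by rewrite natrM invfM mulrA -!mulrA.
  - by clear -i0 b1 lp1; lra.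
  - by clear -i0 b2 lp2; lra.
pose T := Num.truncn (expR ((1 + 0%:R * e) * La)).
have TE : level i La 0 = T.+1 by [].
have [l1 _ l3] := levelP i0 0 La_ge0.
apply: le_trans (ext_number_sum A x (ltnSn T)).
apply: (@le_trans _ _ (\sum_(1 <= t < T.+1 | squarefree t) s ^+ M * F * t%:R^-1)); last first.
  rewrite big_nat_cond [leRHS]big_nat_cond; apply: ler_sum => t /andP[/andP[t0 tT] sf].
  have lt := l3 t t0 tT; rewrite mul0r addr0 mul1r in lt.
  have tR : (0 : R) < t%:R by rewrite ltr0n.
  have := chain M t (leqnn M); rewrite subnn TE mul0r mulr0 add0r mul1r -mulrA; apply => //; last exact: ln_nat_ge0.
  split => // [|p pr /(dvdn_leq t0) pt]; last exact: leq_ltn_trans tT.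
  have := @Dstar_mulS R y i 1 t y1 t0; rewrite muln1; apply; last by apply: Dstar1; exact: ltW.
  by rewrite -ler_ln ?posrE// lyE; clear -i0 lt La_gt0; lra.
rewrite -mulr_sumr; have sF : 0 <= s ^+ M * F by apply: mulr_ge0 => //; exact/exprn_ge0/ltW.
apply: le_trans (ler_wpM2l sF (squarefree_harmonic R (isT : (0 < T.+1)%N))).
apply: (@le_trans _ _ (s ^+ M * F * (La / 2))).
  by rewrite le_eqVlt; apply/orP; left; apply/eqP; rewrite /F; field; rewrite !gt_eqF.
apply: ler_wpM2l => //; apply: ler_wpM2r; first by rewrite invr_ge0.
by rewrite mul0r addr0 mul1r TE in l1.
Qed.

(** When y is too close to x it is lowered to y' with (7 a + 9) ln y' = ln x: the sets shrink with
    y, and the expected order changes only by a constant factor. *)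
Lemma Dstar_sqf_lower : exists c Y0 : R, [/\ 0 < c, 2 <= Y0 & forall y x : R, Y0 <= y -> y <= x ->
  c * (x * (ln y / ln x) `^ lam) <=
    (count [pred n | Dstar y i n && squarefree n] (iota 1 (Num.truncn x)))%:R].
Proof.
have [c [Y0 [c0 Y02 H]]] := Dstar_sqf_lower_far.
have a1 : 1 <= a by rewrite ler1n.
have lam0 : 0 < lam by exact: lam_gt0.
pose K : R := 7 * a + 9; have K1 : 1 <= K by rewrite /K; clear -i0 a1; lra.
have K0 : 0 < K by exact: lt_le_trans K1.
have Y0R : 0 < Y0 by exact: lt_le_trans Y02.
have lY0 : 0 < ln Y0 by exact: ln_ge2.
have YY : Y0 <= expR (K * ln Y0).
  by rewrite -[leLHS](lnK Y0R) ler_expR ler_peMl// ltW.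
exists (c * K^-1 `^ lam), (expR (K * ln Y0)); split; [by rewrite mulr_gt0// powR_gt0// invr_gt0|exact: le_trans YY|].
move=> y x Yy yx; have y0 : 0 < y by apply: lt_le_trans Yy; exact: expR_gt0.
have x0 : 0 < x by exact: lt_le_trans yx.
have KlY : K * ln Y0 <= ln y by rewrite -[leLHS]expRK ler_ln ?posrE// expR_gt0.
have ly0 : 0 < ln y by apply: lt_le_trans KlY; exact: mulr_gt0.
have lyx : ln y <= ln x by rewrite ler_ln ?posrE.
have lx0 : 0 < ln x by exact: lt_le_trans lyx.
have Y0y : Y0 <= y by exact: le_trans Yy.
have Ki0 : 0 <= K^-1 by rewrite invr_ge0 ltW.
have P1 : 0 <= (ln y / ln x) `^ lam by exact: powR_ge0.
have P2 : 0 <= K^-1 `^ lam by exact: powR_ge0.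
have [far|near] := leP (K * ln y) (ln x).
  apply: le_trans (H y x Y0y x0 far); rewrite -mulrA ler_pM2l// ler_piMl//.
    by apply: mulr_ge0 => //; exact: ltW.
  by apply: powR_le1 => //; rewrite invf_le1.
pose y' := expR (ln x / K).
have ly' : ln y' = ln x / K by rewrite expRK.
have y'y : y' <= y by rewrite -[leRHS](lnK y0) ler_expR ler_pdivrMr// mulrC ltW.
have Yy' : Y0 <= y'.
  by rewrite -[leLHS](lnK Y0R) ler_expR ler_pdivlMr// mulrC; exact: le_trans lyx.
have far : K * ln y' <= ln x by rewrite ly' mulrC divfK// gt_eqF.
apply: (@le_trans _ _ (count [pred n | Dstar y' i n && squarefree n] (iota 1 (Num.truncn x)))%:R); last first.
  rewrite ler_nat; apply: sub_count => n /andP[/= Dn ->]; rewrite andbT.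
  by apply: Dstar_mono Dn => //; exact: expR_ge0.
apply: le_trans (H y' x Yy' x0 far); rewrite ly' (_ : ln x / K / ln x = K^-1); last by field; rewrite !gt_eqF.
rewrite -mulrA ler_pM2l// mulrCA ler_pM2l// ler_piMr//.
apply: powR_le1; first by apply: divr_ge0; exact: ltW.
by rewrite ler_pdivrMr// mul1r.
Qed.

End LowerBounds.

(** A lower bound for the smaller family and an upper bound for the larger one settle both
    equivalences. *)
Lemma asymp_sandwich (R : realType) (y0 c1 c2 : R) (f h g : R -> R -> R) : 0 < c1 -> 0 < c2 ->
  (forall x y, y0 <= y -> y <= x -> c1 * h x y <= f x y) ->
  (forall x y, y0 <= y -> y <= x -> f x y <= g x y) ->
  (forall x y, y0 <= y -> y <= x -> g x y <= c2 * h x y) ->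
  asymp_from y0 g f /\ asymp_from y0 f h.
Proof.
move=> c10 c20 low fg up; have c120 : 0 < c2 / c1 by rewrite divr_gt0.
split; last first.
  exists c1, c2; split => // x y y0y yx; rewrite low//.
  by apply: le_trans (fg _ _ y0y yx) (up _ _ y0y yx).
exists 1, (c2 / c1); split => // x y y0y yx; rewrite mul1r fg//=.
apply: le_trans (up _ _ y0y yx) _; rewrite -mulrA ler_pM2l//.
by rewrite mulrC ler_pdivlMr// mulrC low.
Qed.

Theorem theorem1 (R : realType) :
  (forall i : nat, (0 < i)%N ->
     let D := fun x y : R => count_upto (Dset y i) x in
     let Ds := fun x y : R => count_upto (Dstar y i) x in
     let Dsf := fun x y : R =>
       count_upto [pred n | Dset y i n && squarefree n] x in
     let Dssf := fun x y : R =>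
       count_upto [pred n | Dstar y i n && squarefree n] x in
     let M := fun x y : R => x * (ln y / ln x) `^ lambda (i%:R^-1 : R) in
     (asymp_from 2 D Ds /\ asymp_from 2 Ds M) /\
     (exists y0 : R, 2 <= y0 /\
        asymp_from y0 Dsf Dssf /\ asymp_from y0 Dssf M)) /\
  (lambda (1 : R) = 1 /\
   forall (i m : nat) (ds : seq nat), (i, m, ds) \in lambda_table ->
     truncates_to (lambda (i%:R^-1 : R)) m ds) /\
  (exists e : nat -> R, e @ \oo --> (0 : R) /\
     forall i : nat, (0 < i)%N ->
       lambda (i%:R^-1 : R) = i%:R * (ln (i%:R : R) - 1 + e i)).
Proof.
split; last first.
  split; last exact: lambda_asymptotic.
  by split; [exact: lambda1|exact: lambda_table_ok].
move=> i i0; have [K K0 up] := upper_Dset R i0.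
have [c [Y0 [c0 Y02 lowsf]]] := Dstar_sqf_lower R i0.
have [c' c'0 low2] := Dstar_lower_fixed i0 Y02.
have pos (y : R) : 2 <= y -> 0 <= y by apply: le_trans.
split; last first.
  exists Y0; split => //; apply: (asymp_sandwich c0 K0) => x y Yy yx; first exact: lowsf.
    rewrite ler_nat; apply: sub_count => n /andP[/= Dn ->]; rewrite andbT.
    by apply: Dstar_Dset => //; apply: pos; exact: le_trans Yy.
  apply: le_trans (up y x (le_trans Y02 Yy) yx).
  by rewrite ler_nat; apply: sub_count => n /andP[].
(* For y <= Y0 the bound with fixed starting point is used, and above Y0 the count of squarefree
   members alone is large enough. *)
have m0 : 0 < Num.min c c' by rewrite lt_min c0.
apply: (asymp_sandwich m0 K0) => x y y2 yx; last exact: up.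
  have xp : 0 <= x * (ln y / ln x) `^ lambda (i%:R^-1 : R).
    by apply: mulr_ge0; [apply: pos; exact: le_trans yx|exact: powR_ge0].
  have [yY|Yy] := leP y Y0.
    apply: le_trans (low2 y x y2 yY yx).
    by apply: ler_wpM2r => //; rewrite ge_min lexx orbT.
  apply: le_trans (_ : c * (x * (ln y / ln x) `^ lambda (i%:R^-1 : R)) <= _).
    by apply: ler_wpM2r => //; rewrite ge_min lexx.
  apply: le_trans (lowsf y x (ltW Yy) yx) _.
  by rewrite ler_nat; apply: sub_count => n /andP[].
by rewrite ler_nat; apply: sub_count => n; apply: Dstar_Dset; exact: pos.
Qed.
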